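(* Let $y:S^2\to S^6$ be a conformally immersed Willmore two-sphere with isotropic Hopf differential, i.e. $\langle\kappa,\kappa\rangle\equiv 0$. If $y$ is not S-Willmore, then $y$ is totally isotropic (and hence full) in $S^6$. Moreover, locally there exist sections $E_1,E_2$ of the complexified normal bundle $V^{\perp}_{\mathbb C}$ of $y$ (an isotropic frame) such that, for $i,j=1,2$, $$\kappa,\ D_z\kappa,\ D_{\bar z}\kappa\in \mathrm{Span}_{\mathbb C}\{E_1,E_2\},$$ $$\langle E_i,E_j\rangle=0,\qquad \langle E_i,\bar E_j\rangle=\delta_{ij},$$ $$D_zE_i\in \mathrm{Span}_{\mathbb C}\{E_1,E_2\},\qquad D_{\bar z}E_i\in \mathrm{Span}_{\mathbb C}\{E_1,E_2\}.$$ That is, the normal connection is block diagonal with respect to the frame $\{E_1,E_2,\bar E_1,\bar E_2\}$.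
   Context: Let $\mathbb R^{8}_1$ be $\mathbb R^8$ with the Lorentzian metric $\langle x,y\rangle=-x_0y_0+\sum_{j=1}^{7}x_jy_j$, extended complex bilinearly to $\mathbb C^8$. Let $y:M\to S^6$ be a conformal immersion of a Riemann surface $M$, and $z$ a local complex coordinate. The canonical lift with respect to $z$ is $Y=e^{-\omega}(1,y)$, where $e^{2\omega}=2\langle y_z,y_{\bar z}\rangle$; it takes values in the forward light cone. One has the global orthogonal bundle decomposition $M\times\mathbb R^8_1=V\oplus V^\perp$ with $V=\mathrm{Span}\{Y,\mathrm{Re}\,Y_z,\mathrm{Im}\,Y_z,Y_{z\bar z}\}$ (a bundle of 4-dimensional Lorentzian subspaces); $V^\perp$ is the (conformal) normal bundle (rank 4, positive definite), $V_{\mathbb C},V^\perp_{\mathbb C}$ are complexifications, and $D$ is the normal connection on $V^\perp_{\mathbb C}$ (differentiate in $\mathbb C^8$ and project orthogonally to $V^\perp_{\mathbb C}$). The conformal Hopf differential $\kappa\in\Gamma(V^\perp_{\mathbb C})$ and the Schwarzian $s$ (complex-valued) are defined by $Y_{zz}=-\frac s2Y+\kappa$. The surface $y$ is Willmore iff $D_{\bar z}D_{\bar z}\kappa+\frac{\bar s}{2}\kappa=0$. A Willmore surface is called S-Willmore if $D_{\bar z}\kappa$ is everywhere parallel to $\kappa$ (i.e. $\kappa$ and $D_{\bar z}\kappa$ are linearly dependent at every point). The surface $y$ is totally isotropic if $\langle Y_z^{(m)},Y_z^{(n)}\rangle=0$ for all positive integers $m,n$, where $Y_z^{(m)}$ is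 the $m$-th derivative of $Y$ with respect to $z$. Full means not contained in a proper lower-dimensional round subsphere of $S^6$. *)

(* Defs.v *)
From HB Require Import structures.
From mathcomp Require Import all_boot all_order all_algebra.
From mathcomp Require Import all_classical all_reals all_analysis.
From mathcomp Require Import complex.

Set Implicit Arguments.
Unset Strict Implicit.
Unset Printing Implicit Defensive.

Import Order.TTheory GRing.Theory Num.Theory.
Import numFieldNormedType.Exports.

Local Open Scope classical_set_scope.
Local Open Scope complex_scope.
Local Open Scope ring_scope.

Section Calculus.
Variable R : realType.

(* The point p = (u, v) stands for the complex number z = u + i v. *)
Definition plane := (R * R)%type.

Definition eu : plane := (1, 0).
Definition ev : plane := (0, 1).

Fixpoint Ck_on (k : nat) (U : set plane) (f : plane -> R) : Prop :=
  (forall p, U p -> {for p, continuous f}) /\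
  match k with
  | 0 => True
  | k'.+1 =>
      (forall p, U p -> derivable f p eu /\ derivable f p ev) /\
      Ck_on k' U (fun p => 'D_eu f p) /\ Ck_on k' U (fun p => 'D_ev f p)
  end.

Definition smooth_on (U : set plane) (f : plane -> R) : Prop :=
  forall k, Ck_on k U f.

Definition smooth_row_on n (U : set plane) (F : plane -> 'rV[R]_n) : Prop :=
  forall j, smooth_on U (fun p => F p 0 j).

Definition smooth_crow_on n (U : set plane) (F : plane -> 'rV[R[i]]_n) : Prop :=
  forall j, smooth_on U (fun p => complex.Re (F p 0 j)) /\
            smooth_on U (fun p => complex.Im (F p 0 j)).

Definition rowD n (v : plane) (F : plane -> 'rV[R]_n) (p : plane) : 'rV[R]_n :=
  \row_j 'D_v (fun q => F q 0 j) p.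

Definition crowD n (v : plane) (F : plane -> 'rV[R[i]]_n) (p : plane) :
    'rV[R[i]]_n :=
  \row_j ('D_v (fun q => complex.Re (F q 0 j)) p +i*
          'D_v (fun q => complex.Im (F q 0 j)) p).

Definition dz n (F : plane -> 'rV[R[i]]_n) (p : plane) : 'rV[R[i]]_n :=
  2^-1 *: (crowD eu F p - 'i%C *: crowD ev F p).

Definition dzbar n (F : plane -> 'rV[R[i]]_n) (p : plane) : 'rV[R[i]]_n :=
  2^-1 *: (crowD eu F p + 'i%C *: crowD ev F p).

Definition cplx m n (A : 'M[R]_(m, n)) : 'M[R[i]]_(m, n) :=
  map_mx (fun x => x%:C) A.

Definition conj_cmx m n (A : 'M[R[i]]_(m, n)) : 'M[R[i]]_(m, n) :=
  map_mx (@conjc R) A.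

Definition re_row n (x : 'rV[R[i]]_n) : 'rV[R]_n := map_mx (@complex.Re R) x.
Definition im_row n (x : 'rV[R[i]]_n) : 'rV[R]_n := map_mx (@complex.Im R) x.

End Calculus.

Definition dot (K : comPzRingType) n (x y : 'rV[K]_n) : K := (x *m y^T) 0 0.

Definition lorentz_metric (K : comPzRingType) : 'M[K]_8 :=
  diag_mx (\row_j (if j == 0 then -1 else 1)).

Definition lorentz (K : comPzRingType) (x y : 'rV[K]_8) : K :=
  (x *m lorentz_metric K *m y^T) 0 0.

Definition unit_sphere (R : realType) n : set 'rV[R]_n := [set x | dot x x = 1].

Definition conformal_immersion_on (R : realType) n
    (U : set (plane R)) (f : plane R -> 'rV[R]_n) : Prop :=
  forall p, U p ->
    let fu := rowD (eu R) f p in let fv := rowD (ev R) f p in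
    [/\ dot fu fv = 0, dot fu fu = dot fv fv & 0 < dot fu fu].

(* The quantities below are attached to a map f : U -> S^6, where U is the
   image of a local complex coordinate. *)
Section Lift.
Variable R : realType.
Local Notation C := R[i].
Local Notation plane := (plane R).
Variable f : plane -> 'rV[R]_7.

(* 2 <f_z, f_zbar> is real, so that taking its real part loses nothing. *)
Definition omega (p : plane) : R :=
  let F := fun q => cplx (f q) in
  ln (complex.Re (2 * dot (dz F p) (dzbar F p))) / 2.

Definition real_lift (p : plane) : 'rV[R]_8 :=
  expR (- omega p) *: row_mx (1 : 'rV[R]_1) (f p).

Definition lift_Y (p : plane) : 'rV[C]_8 := cplx (real_lift p).

(* The rows span V_C. *)
Definition V_frame (p : plane) : 'M[C]_(4, 8) :=
  \matrix_(i < 4)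
    [:: lift_Y p; cplx (re_row (dz lift_Y p)); cplx (im_row (dz lift_Y p));
        dzbar (dz lift_Y) p]`_i.

(* Row spaces: v <= V_perp p means that v is a vector of V_C^perp at p. *)
Definition V_perp (p : plane) : 'M[C]_8 :=
  kermx (lorentz_metric C *m (V_frame p)^T).

Definition normal_part (p : plane) (v : 'rV[C]_8) : 'rV[C]_8 :=
  v *m proj_mx (V_perp p) <<V_frame p>>%MS.

Definition Dz (xi : plane -> 'rV[C]_8) (p : plane) : 'rV[C]_8 :=
  normal_part p (dz xi p).

Definition Dzbar (xi : plane -> 'rV[C]_8) (p : plane) : 'rV[C]_8 :=
  normal_part p (dzbar xi p).

(* The pair (kappa, s); it is uniquely determined when f is a smooth conformal
   immersion, and (0, 0) is only a default value. *)
Definition hopf_schwarzian (p : plane) : 'rV[C]_8 * C :=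
  xget (0, 0) [set ks : 'rV[C]_8 * C |
    (ks.1 <= V_perp p)%MS /\
    dz (dz lift_Y) p = - (ks.2 / 2) *: lift_Y p + ks.1].

Definition kappa (p : plane) : 'rV[C]_8 := (hopf_schwarzian p).1.
Definition schwarzian (p : plane) : C := (hopf_schwarzian p).2.

Definition willmore_on (U : set plane) : Prop :=
  forall p, U p ->
    Dzbar (Dzbar kappa) p + (conjc (schwarzian p) / 2) *: kappa p = 0.

Definition isotropic_hopf_on (U : set plane) : Prop :=
  forall p, U p -> lorentz (kappa p) (kappa p) = 0.

Definition kappa_parallel_on (U : set plane) : Prop :=
  forall p, U p -> ~~ row_free (col_mx (kappa p) (Dzbar kappa p)).

Definition totally_isotropic_on (U : set plane) : Prop :=
  forall (m n : nat) p, (0 < m)%N -> (0 < n)%N -> U p ->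
    lorentz (iter m (@dz R 8) lift_Y p) (iter n (@dz R 8) lift_Y p) = 0.

Definition span2 (E : 'I_2 -> plane -> 'rV[C]_8) (p : plane) : 'M[C]_(2, 8) :=
  \matrix_(i < 2) E i p.

Definition isotropic_frame_on (W : set plane)
    (E : 'I_2 -> plane -> 'rV[C]_8) : Prop :=
  let Ebar := fun i q => conj_cmx (E i q) in
  (forall i, smooth_crow_on W (E i)) /\
  forall p, W p ->
  [/\ forall i, (E i p <= V_perp p)%MS,
      [/\ (kappa p <= span2 E p)%MS, (Dz kappa p <= span2 E p)%MS
        & (Dzbar kappa p <= span2 E p)%MS],
      (forall i j, lorentz (E i p) (E j p) = 0) /\
      (forall i j, lorentz (E i p) (Ebar j p) = (i == j)%:R),
      forall i, (Dz (E i) p <= span2 E p)%MS /\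
                (Dzbar (E i) p <= span2 E p)%MS
    & (* the normal connection is block diagonal in {E1, E2, Ebar1, Ebar2} *)
      (V_perp p :=: col_mx (span2 E p) (span2 Ebar p))%MS /\
      forall i, (Dz (Ebar i) p <= span2 Ebar p)%MS /\
                (Dzbar (Ebar i) p <= span2 Ebar p)%MS].

End Lift.

(* S^2 is the unit sphere of R^3 with its standard complex structure.  A local
   complex coordinate z : phi(U) -> U is given by its inverse phi : U -> S^2,
   an injective conformal immersion compatible with the orientation by the
   outward normal. *)
Definition local_coordinate (R : realType) (U : set (plane R))
    (phi : plane R -> 'rV[R]_3) : Prop :=
  [/\ open U, smooth_row_on U phi,
      (forall p, U p -> unit_sphere (phi p)) /\
      (forall p q, U p -> U q -> phi p = phi q -> p = q),
      conformal_immersion_on U phi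
    & forall p, U p ->
        0 < \det (col_mx (phi p)
                   (col_mx (rowD (eu R) phi p) (rowD (ev R) phi p)) : 'M[R]_3)].

(* A surface y : S^2 -> S^6 is a map on R^3 of which only the values on the
   unit sphere matter. *)
Section Surface.
Variables (R : realType) (y : 'rV[R]_3 -> 'rV[R]_7).

Definition conformally_immersed_sphere : Prop :=
  (forall x, unit_sphere x -> unit_sphere (y x)) /\
  forall U phi, local_coordinate U phi ->
    smooth_row_on U (y \o phi) /\ conformal_immersion_on U (y \o phi).

Definition willmore : Prop :=
  forall U phi, local_coordinate U phi -> willmore_on (y \o phi) U.

Definition isotropic_hopf : Prop :=
  forall U phi, local_coordinate U phi -> isotropic_hopf_on (y \o phi) U.

Definition s_willmore : Prop :=
  willmore /\
  forall U phi, local_coordinate U phi -> kappa_parallel_on (y \o phi) U.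

Definition totally_isotropic : Prop :=
  forall U phi, local_coordinate U phi -> totally_isotropic_on (y \o phi) U.

(* A round sphere with center c, radius r, in the affine subspace through c
   spanned by the orthonormal rows of W; its dimension is k - 1. *)
Definition round_sphere n k (c : 'rV[R]_n) (r : R) (W : 'M[R]_(k, n)) :
    set 'rV[R]_n :=
  [set c + r *: (v *m W) | v in @unit_sphere R k].

Definition full : Prop :=
  ~ exists (k : nat) (c : 'rV[R]_7) (r : R) (W : 'M[R]_(k, 7)),
      [/\ (k < 7)%N, 0 < r, W *m W^T = 1%:M,
          round_sphere c r W `<=` @unit_sphere R 7
        & forall x, unit_sphere x -> round_sphere c r W (y x)].

Definition has_local_isotropic_frames : Prop :=
  forall U phi, local_coordinate U phi -> forall p, U p ->
    exists (W : set (plane R)) (E : 'I_2 -> plane R -> 'rV[R[i]]_8),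
      [/\ open W, W p, W `<=` U & isotropic_frame_on (y \o phi) W E].

End Surface.

(* Main.v *)
(* Write [kap] for the Hopf differential and [eta] for its normal [zbar]-derivative. Isotropy of [kap] and the
   Willmore equation give [<kap, eta> = <eta, eta> = 0] and make [<D_z kap, eta> dz^4] holomorphic, so it vanishes on
   the sphere: in a stereographic chart its square norm decays at infinity, and the maximum principle applies. Hence,
   where [kap ^ eta != 0], the null plane spanned by [kap] and [eta] is parallel for the normal connection. If the
   surface is not S-Willmore, the zeros of [kap ^ eta] are isolated: this bivector satisfies a first order linear
   equation in [zbar], so a zero of finite order is isolated, while a zero of infinite order is excluded by the
   maximum principle for its Gram determinant [w], since [(log w)_(z zbar)] is a fixed multiple of [<kap, conj kap>].
   The orthogonal projection onto the null plane has first derivatives that are smooth also at these zeros, so it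
   extends smoothly across them. Gram-Schmidt in the extended plane gives the frames [E_1], [E_2]; all [z]-derivatives
   of [Y_z] stay in the isotropic span of [Y], [Y_z] and this plane, which is total isotropy; and a constant vector
   normal to [Y] is normal to a frame of [C^8], which is fullness. *)
From HB Require Import structures.
Require Import Defs.
From mathcomp Require Import all_boot all_order all_algebra.
From mathcomp Require Import all_classical all_reals all_analysis.
From mathcomp Require Import complex.
From mathcomp Require Import ring lra.

Set Implicit Arguments.
Unset Strict Implicit.
Unset Printing Implicit Defensive.

Import Order.TTheory GRing.Theory Num.Theory.
Import numFieldNormedType.Exports.

Local Open Scope classical_set_scope.
Local Open Scope complex_scope.
Local Open Scope ring_scope.

(** * Calculus in the plane *)

(** Two obstacles shape the argument. At the zeros of [w] the bivector [kap ^ eta] degenerates, and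
    dividing out a holomorphic factor there would require solving a d-bar equation. The projection
    avoids this: being parallel for the normal connection, it has only tangential Weingarten terms
    as derivatives, and these are polynomial in [Y], [Y_z], [kap], [eta] and their conjugates,
    without division by [w]. A function whose partial derivatives are smooth through a point extends
    across it by the mean value theorem alone.

    The second obstacle is global: [w] must not vanish to infinite order anywhere as soon as it is
    nonzero somewhere. A stereographic chart is a whole plane, so the comparison can be made at once
    on a box containing both points, without a connectedness argument.

    Both maximum principles use [lapL f = f f_(z zbar) - f_z f_zbar], which is
    [f^2 (log f)_(z zbar)] but makes sense at zeros of [f] too. The weight [1 + |z|^2], with its
    strictly subharmonic logarithm, turns an interior maximum into a strict contradiction. *)

Section RealCalculus.
Variable R : realType.
Local Notation plane := (plane R).
Local Notation eu := (eu R).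
Local Notation ev := (ev R).
Implicit Types (U W : set plane) (f g : plane -> R) (p q v : plane).

(** Restriction to the line [t |-> t v + a] reduces directional derivatives to derivatives in one
    variable, and so gives access to the one-variable mean value theorem and chain rule. *)
Lemma slice_is_derive f (a : plane) v (s : R) :
  derivable f (s *: v + a) v ->
  is_derive s 1 (fun t : R => f (t *: v + a)) ('D_v f (s *: v + a)).
Proof.
move=> df.
have E : (fun h : R => h^-1 *: (((fun t : R => f (t *: v + a)) \o shift s) (h *: 1)
    - f (s *: v + a))) =
  (fun h : R => h^-1 *: ((f \o shift (s *: v + a)) (h *: v) - f (s *: v + a))).
  apply/funext => h /=; congr (_ *: (f _ - _)).
  by rewrite addrA -scalerDl /= /GRing.scale /= mulr1.
split.
  by rewrite /derivable E.
by rewrite /derive E.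
Qed.

Lemma is_derive_of_slice f (a : plane) v (d : R) :
  is_derive (0 : R) 1 (fun t : R => f (t *: v + a)) d -> is_derive a v f d.
Proof.
have E : (fun h : R => h^-1 *: (((fun t : R => f (t *: v + a)) \o shift 0) (h *: 1)
    - f (0 *: v + a))) =
  (fun h : R => h^-1 *: ((f \o shift a) (h *: v) - f a)).
  apply/funext => h /=; congr (_ *: (f _ - f _)); last by rewrite scale0r add0r.
  by congr (_ *: v + a); rewrite addr0 /GRing.scale /= mulr1.
move=> [d1 d2]; split; first by move: d1; rewrite /derivable E.
by rewrite -d2 /derive E.
Qed.

#[local] Opaque derive derivable.

(** Both signs of [h] are allowed, which spares case distinctions later; the price is that the
    intermediate point is only known to satisfy [|c| <= |h|]. *)
Lemma MVT_dir f (a : plane) v (h : R) :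
  (forall s : R, `|s| <= `|h| -> derivable f (s *: v + a) v) ->
  exists2 c : R, `|c| <= `|h| & f (h *: v + a) - f a = h * 'D_v f (c *: v + a).
Proof.
move=> df; pose g := fun t : R => f (t *: v + a).
have dg (s : R) : `|s| <= `|h| -> is_derive s 1 g ('D_v f (s *: v + a)).
  by move=> sh; apply: slice_is_derive; exact: df.
have cg (x : R) : `|x| <= `|h| -> {for x, continuous g}.
  move=> xh; apply/differentiable_continuous/derivable1_diffP.
  by have [] := dg x xh.
have f0 : f a = g 0 by rewrite /g scale0r add0r.
rewrite f0 -/(g h).
have [h0|h0] := leP 0 h.
  have [||c] := @MVT_segment R g (fun s => 'D_v f (s *: v + a)) 0 h h0.
  - move=> x; rewrite in_itv/= => /andP[x0 xh]; apply: dg.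
    by rewrite (ger0_norm (ltW x0)) (ger0_norm h0) ltW.
  - apply: continuous_in_subspaceT => x; rewrite inE /= in_itv/= => /andP[x0 xh].
    by apply: cg; rewrite ger0_norm ?(ger0_norm h0).
  - rewrite in_itv/= => /andP[c0 ch] ->; exists c.
      by rewrite ger0_norm ?(ger0_norm h0).
    by rewrite subr0 mulrC.
have [||c] := @MVT_segment R g (fun s => 'D_v f (s *: v + a)) h 0 (ltW h0).
- move=> x; rewrite in_itv/= => /andP[x0 xh]; apply: dg.
  by rewrite (ltr0_norm xh) (ltr0_norm h0) lerN2 ltW.
- apply: continuous_in_subspaceT => x; rewrite inE /= in_itv/= => /andP[x0 xh].
  by apply: cg; rewrite ler0_norm ?(ltr0_norm h0) ?lerN2.
- rewrite in_itv/= => /andP[c0 ch] e; exists c.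
    by rewrite ler0_norm ?(ltr0_norm h0) ?lerN2.
  by rewrite -opprB e sub0r mulrN opprK mulrC.
Qed.

Definition lin2 (a b : R) : plane -> R := fun v => v.1 * a + v.2 * b.

Lemma lin2_is_linear a b : linear (lin2 a b).
Proof.
move=> k x y; rewrite /lin2 /=.
by rewrite /GRing.scale /= mulrDl mulrDl mulrDr -!mulrA addrACA.
Qed.

HB.instance Definition _ a b :=
  GRing.isLinear.Build R plane R _ (lin2 a b) (lin2_is_linear a b).

Lemma lin2_continuous a b : continuous (lin2 a b).
Proof.
move=> x; apply: cvgD; apply: cvgM; [exact: cvg_fst|exact: cvg_cst|exact: cvg_snd|exact: cvg_cst].
Qed.

Lemma plane_normE (h : plane) : `|h| = Num.max `|h.1| `|h.2|.
Proof. by []. Qed.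

Lemma scale_eu (t : R) (p : plane) : t *: eu + p = (t + p.1, p.2).
Proof. by apply: injective_projections; rewrite /= /GRing.scale /= ?mulr1 ?mulr0 ?add0r. Qed.

Lemma scale_ev (t : R) (p : plane) : t *: ev + p = (p.1, t + p.2).
Proof. by apply: injective_projections; rewrite /= /GRing.scale /= ?mulr1 ?mulr0 ?add0r. Qed.

Lemma lin2_bound (x y h k n e : R) : `|h| <= n -> `|k| <= n ->
  `|x| < e / 2 -> `|y| < e / 2 -> `|h * x + k * y| <= e * n.
Proof.
move=> hn kn xe ye; apply: (le_trans (ler_normD _ _)); rewrite !normrM.
have -> : e * n = n * (e / 2) + n * (e / 2) by field.
by apply: lerD; apply: ler_pM => //; exact: ltW.
Qed.

Lemma C1_diff U f p : open U -> U p ->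
    (forall q, U q -> derivable f q eu /\ derivable f q ev) ->
    {for p, continuous (fun q => 'D_eu f q)} ->
    {for p, continuous (fun q => 'D_ev f q)} ->
  differentiable f p /\ 'd f p = lin2 ('D_eu f p) ('D_ev f p) :> (plane -> R).
Proof.
move=> oU Up df cu cv.
set a := 'D_eu f p; set b := 'D_ev f p.
have H : f \o shift p = cst (f p) + lin2 a b +o_ (0 : plane) id.
  apply/eqaddoE/eqaddoP => e e0.
  have e20 : 0 < e / 2 by rewrite divr_gt0.
  have nU : \forall q \near p, U q by exact: open_nbhs_nbhs.
  have nu : \forall q \near p, `|'D_eu f q - a| < e / 2.
    by have /cvgrPdist_lt /(_ _ e20) := cu; apply: filterS => q; rewrite distrC.
  have nv : \forall q \near p, `|'D_ev f q - b| < e / 2.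
    by have /cvgrPdist_lt /(_ _ e20) := cv; apply: filterS => q; rewrite distrC.
  have [d /= d0 Hd] : nbhs_ball p (fun q => [/\ U q, `|'D_eu f q - a| < e / 2 &
      `|'D_ev f q - b| < e / 2]).
    by apply/nbhs_ballP; apply: filterS (filterI nU (filterI nu nv)) => q [? []].
  have {Hd} Hd q : `|q - p| < d -> [/\ U q, `|'D_eu f q - a| < e / 2 &
      `|'D_ev f q - b| < e / 2].
    by move=> qd; apply: Hd; rewrite -ball_normE /ball_ /= distrC.
  near=> h.
  have hd : `|h| < d.
    near: h; apply/nbhs_ballP; exists d => //= h.
    by rewrite -ball_normE /ball_ /= sub0r normrN.
  suff : `|f (h + p) - (f p + (h.1 * a + h.2 * b))| <= e * `|h| by [].
  have h1 : `|h.1| <= `|h| by rewrite plane_normE le_max lexx.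
  have h2 : `|h.2| <= `|h| by rewrite plane_normE le_max lexx orbT.
  (* The increment is split at the corner [(p.1, h.2 + p.2)] into a horizontal and a vertical step,
     with one mean value point on each. *)
  have [c1 c1h E1] : exists2 c : R, `|c| <= `|h.1| &
    f (h.1 *: eu + (p.1, h.2 + p.2)) - f (p.1, h.2 + p.2) =
     h.1 * 'D_eu f (c *: eu + (p.1, h.2 + p.2)).
    apply: MVT_dir => s sh; rewrite scale_eu /=; apply: (df _ _).1.
    suff /Hd[] : `|(s + p.1, h.2 + p.2) - p| < d by []; apply: le_lt_trans hd; rewrite plane_normE /= !addrK.
    by rewrite ge_max h2 (le_trans sh).
  have [c2 c2h E2] : exists2 c : R, `|c| <= `|h.2| &
    f (h.2 *: ev + p) - f p = h.2 * 'D_ev f (c *: ev + p).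
    apply: MVT_dir => s sh; apply: (df _ _).2.
    rewrite scale_ev; suff /Hd[] : `|(p.1, s + p.2) - p| < d by []; apply: le_lt_trans hd; rewrite plane_normE /= !addrK subrr normr0.
    by rewrite ge_max normr_ge0 (le_trans sh).
  move: E1 E2; rewrite !scale_eu !scale_ev /= => E1 E2.
  have [_ B1 _] : [/\ U (c1 + p.1, h.2 + p.2), `|'D_eu f (c1 + p.1, h.2 + p.2) - a| < e / 2 &
      `|'D_ev f (c1 + p.1, h.2 + p.2) - b| < e / 2].
    apply: Hd; apply: le_lt_trans hd; rewrite plane_normE /= !addrK.
    by rewrite ge_max h2 (le_trans c1h).
  have [_ _ B2] : [/\ U (p.1, c2 + p.2), `|'D_eu f (p.1, c2 + p.2) - a| < e / 2 &
      `|'D_ev f (p.1, c2 + p.2) - b| < e / 2].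
    apply: Hd; apply: le_lt_trans hd; rewrite plane_normE /= !addrK subrr normr0.
    by rewrite ge_max normr_ge0 (le_trans c2h).
  have -> : f (h + p) - (f p + (h.1 * a + h.2 * b)) =
     h.1 * ('D_eu f (c1 + p.1, h.2 + p.2) - a) + h.2 * ('D_ev f (p.1, c2 + p.2) - b).
    rewrite !mulrBr -E1 -E2 -[(h.1 + p.1, h.2 + p.2)]/(h + p).
    by ring.
  exact: (lin2_bound h1 h2 B1 B2).
have dE := diff_unique (@lin2_continuous a b) H.
split => //.
by apply/diff_locallyP; rewrite dE; split => //; exact: lin2_continuous.
Unshelve. all: by end_near. Qed.

Lemma eq_on_near (T : Type) U (f g : plane -> T) p : open U -> U p -> (forall q, U q -> f q = g q) ->
  \forall q \near p, f q = g q.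
Proof. by move=> oU Up fg; apply: filterS (open_nbhs_nbhs (conj oU Up)) => q /fg. Qed.

Lemma eq_on_derive U f g p v : open U -> U p -> (forall q, U q -> f q = g q) ->
  'D_v f p = 'D_v g p.
Proof. by move=> oU Up fg; apply: near_eq_derive; exact: (eq_on_near oU Up fg). Qed.

Lemma eq_on_derivable U f g p v : open U -> U p -> (forall q, U q -> f q = g q) ->
  derivable f p v -> derivable g p v.
Proof. by move=> oU Up fg; apply: near_eq_derivable; exact: (eq_on_near oU Up fg). Qed.

Lemma eq_on_continuous U f g p : open U -> U p -> (forall q, U q -> f q = g q) ->
  {for p, continuous f} -> {for p, continuous g}.
Proof.
move=> oU Up fg cf; rewrite /prop_for /continuous_at -(fg p Up).
by apply: cvg_trans cf; apply: near_eq_cvg; apply: filterS (eq_on_near oU Up fg).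
Qed.

Lemma Ck_onE k U f : Ck_on k.+1 U f = ((forall p, U p -> {for p, continuous f}) /\
  (forall p, U p -> derivable f p eu /\ derivable f p ev) /\
  Ck_on k U ('D_eu f) /\ Ck_on k U ('D_ev f)).
Proof. by []. Qed.

Lemma Ck_on_eq k U f g : open U -> (forall q, U q -> f q = g q) ->
  Ck_on k U f -> Ck_on k U g.
Proof.
move=> oU; elim: k f g => [|k IH] f g fg.
  by move=> [cf _]; split => // p Up; exact: (eq_on_continuous oU Up fg (cf p Up)).
rewrite !Ck_onE => -[cf [df [du dv]]]; split; [|split; [|split]].
- by move=> p Up; exact: (eq_on_continuous oU Up fg (cf p Up)).
- by move=> p Up; have [d1 d2] := df p Up; split; [exact: (eq_on_derivable oU Up fg d1)|exact: (eq_on_derivable oU Up fg d2)].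
- by apply: (IH _ _ _ du) => q Uq; exact: (eq_on_derive _ oU Uq fg).
- by apply: (IH _ _ _ dv) => q Uq; exact: (eq_on_derive _ oU Uq fg).
Qed.

Lemma Ck_onS k U f : Ck_on k.+1 U f -> Ck_on k U f.
Proof.
elim: k f => [|k IH] f; rewrite Ck_onE => -[cf [df [du dv]]]; first by split.
by rewrite Ck_onE; split; [exact: cf|split; [exact: df|split; exact: IH]].
Qed.

Lemma Ck_on_sub k U W f : W `<=` U -> Ck_on k U f -> Ck_on k W f.
Proof.
move=> WU; elim: k f => [|k IH] f.
  by move=> [cf _]; split => // p /WU; exact: cf.
rewrite !Ck_onE => -[cf [df [du dv]]]; split; [|split; [|split]].
- by move=> p /WU; exact: cf.
- by move=> p /WU; exact: df.
- exact: IH.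
- exact: IH.
Qed.

(** [Ck_on] is phrased with the total operators ['D_v f]. Here the derivatives are named functions
    that have to be correct on [U] only, the form in which inductions on [k] produce them. *)
Lemma Ck_on_build k U f du dv : open U -> (forall p, U p -> {for p, continuous f}) ->
  (forall p, U p -> is_derive p eu f (du p)) -> (forall p, U p -> is_derive p ev f (dv p)) ->
  Ck_on k U du -> Ck_on k U dv -> Ck_on k.+1 U f.
Proof.
move=> oU cf dfu dfv cu cv; rewrite Ck_onE; split; [exact: cf|split; [|split]].
- by move=> p Up; split; [exact: (@ex_derive _ _ _ _ _ _ _ (dfu p Up))|exact: (@ex_derive _ _ _ _ _ _ _ (dfv p Up))].
- by apply: (Ck_on_eq oU _ cu) => q Uq; rewrite (@derive_val _ _ _ _ _ _ _ (dfu q Uq)).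
- by apply: (Ck_on_eq oU _ cv) => q Uq; rewrite (@derive_val _ _ _ _ _ _ _ (dfv q Uq)).
Qed.

Lemma Ck_on_cont k U f p : Ck_on k U f -> U p -> {for p, continuous f}.
Proof. by case: k => [|k] [cf _]; exact: cf. Qed.

Lemma Ck_on_deriveu k U f p : Ck_on k.+1 U f -> U p -> is_derive p eu f ('D_eu f p).
Proof. by rewrite Ck_onE => -[_ [df _]] Up; have [d _] := df p Up; exact: derivableP. Qed.

Lemma Ck_on_derivev k U f p : Ck_on k.+1 U f -> U p -> is_derive p ev f ('D_ev f p).
Proof. by rewrite Ck_onE => -[_ [df _]] Up; have [_ d] := df p Up; exact: derivableP. Qed.

Lemma Ck_on_Du k U f : Ck_on k.+1 U f -> Ck_on k U ('D_eu f).
Proof. by rewrite Ck_onE => -[_ [_ []]]. Qed.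

Lemma Ck_on_Dv k U f : Ck_on k.+1 U f -> Ck_on k U ('D_ev f).
Proof. by rewrite Ck_onE => -[_ [_ []]]. Qed.

Lemma Ck_cst k U (c : R) : open U -> Ck_on k U (fun=> c).
Proof.
move=> oU; elim: k c => [|k IH] c; first by split => // p Up; exact: cvg_cst.
apply: (@Ck_on_build _ _ _ (fun=> 0) (fun=> 0) oU _ _ _ (IH 0) (IH 0)).
by move=> p Up; exact: cvg_cst.
Qed.

Lemma Ck_add k U f g : open U -> Ck_on k U f -> Ck_on k U g -> Ck_on k U (fun p => f p + g p).
Proof.
move=> oU; elim: k f g => [|k IH] f g cf cg.
  by split => // p Up; exact: (cvgD (Ck_on_cont cf Up) (Ck_on_cont cg Up)).
apply: (Ck_on_build oU _ _ _ (IH _ _ (Ck_on_Du cf) (Ck_on_Du cg)) (IH _ _ (Ck_on_Dv cf) (Ck_on_Dv cg))) => p Up.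
- exact: (cvgD (Ck_on_cont cf Up) (Ck_on_cont cg Up)).
- exact: (is_deriveD (Ck_on_deriveu cf Up) (Ck_on_deriveu cg Up)).
- exact: (is_deriveD (Ck_on_derivev cf Up) (Ck_on_derivev cg Up)).
Qed.

Lemma Ck_mul k U f g : open U -> Ck_on k U f -> Ck_on k U g -> Ck_on k U (fun p => f p * g p).
Proof.
move=> oU; elim: k f g => [|k IH] f g cf cg.
  by split => // p Up; exact: (cvgM (Ck_on_cont cf Up) (Ck_on_cont cg Up)).
have cf' := Ck_onS cf; have cg' := Ck_onS cg.
apply: (Ck_on_build oU _ _ _ (Ck_add oU (IH _ _ cf' (Ck_on_Du cg)) (IH _ _ cg' (Ck_on_Du cf))) (Ck_add oU (IH _ _ cf' (Ck_on_Dv cg)) (IH _ _ cg' (Ck_on_Dv cf)))) => p Up.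
- exact: (cvgM (Ck_on_cont cf Up) (Ck_on_cont cg Up)).
- exact: (is_deriveM (Ck_on_deriveu cf Up) (Ck_on_deriveu cg Up)).
- exact: (is_deriveM (Ck_on_derivev cf Up) (Ck_on_derivev cg Up)).
Qed.

Lemma Ck_opp k U f : open U -> Ck_on k U f -> Ck_on k U (fun p => - f p).
Proof.
move=> oU cf; have := Ck_mul oU (Ck_cst k (-1) oU) cf.
by apply: Ck_on_eq => // q _; rewrite mulN1r.
Qed.

Lemma is_derive_inv f p v df : f p != 0 -> is_derive p v f df ->
  is_derive p v (fun q => (f q)^-1) (- ((f p)^-1 * (f p)^-1 * df)).
Proof.
move=> f0 [d <-]; apply: DeriveDef; first exact: derivableV.
by rewrite (deriveV f0 d) /GRing.scale /= -exprVn expr2 mulNr.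
Qed.

Lemma Ck_inv k U f : open U -> (forall p, U p -> f p != 0) -> Ck_on k U f -> Ck_on k U (fun p => (f p)^-1).
Proof.
move=> oU f0; elim: k => [|k IH] cf.
  by split => // p Up; exact: (cvgV (f0 p Up) (Ck_on_cont cf Up)).
have c2 := Ck_mul oU (IH (Ck_onS cf)) (IH (Ck_onS cf)).
apply: (Ck_on_build oU _ _ _ (Ck_opp oU (Ck_mul oU c2 (Ck_on_Du cf))) (Ck_opp oU (Ck_mul oU c2 (Ck_on_Dv cf)))) => p Up.
- exact: (cvgV (f0 p Up) (Ck_on_cont cf Up)).
- exact: (is_derive_inv (f0 p Up) (Ck_on_deriveu cf Up)).
- exact: (is_derive_inv (f0 p Up) (Ck_on_derivev cf Up)).
Qed.

Lemma is_derive_of_lin (L : {linear plane -> R}) p v : continuous L -> is_derive p v L (L v).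
Proof.
move=> cL; have dL := linear_differentiable p cL.
apply: DeriveDef; first exact: diff_derivable.
by rewrite deriveE // diff_lin.
Qed.

Lemma Ck_lin2 k U a b : open U -> Ck_on k U (lin2 a b).
Proof.
move=> oU; case: k => [|k]; first by split => // p _; exact: lin2_continuous.
apply: (Ck_on_build oU _ _ _ (Ck_cst k (lin2 a b eu) oU) (Ck_cst k (lin2 a b ev) oU)) => p Up.
- exact: lin2_continuous.
- exact: (is_derive_of_lin _ _ (@lin2_continuous a b)).
- exact: (is_derive_of_lin _ _ (@lin2_continuous a b)).
Qed.

Lemma Ck_fst k U : open U -> Ck_on k U (fun p => p.1).
Proof. by move=> oU; apply: (Ck_on_eq oU _ (Ck_lin2 k 1 0 oU)) => q _; rewrite /lin2 mulr1 mulr0 addr0. Qed.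

Lemma Ck_snd k U : open U -> Ck_on k U (fun p => p.2).
Proof. by move=> oU; apply: (Ck_on_eq oU _ (Ck_lin2 k 0 1 oU)) => q _; rewrite /lin2 mulr1 mulr0 add0r. Qed.

Lemma is_derive_comp1 (g : R -> R) f p v df dg :
  is_derive p v f df -> is_derive (f p) 1 g dg ->
  is_derive p v (fun q => g (f q)) (dg * df).
Proof.
move=> [d <-] Hg; apply: is_derive_of_slice.
have := @slice_is_derive f p v 0; rewrite scale0r add0r => /(_ d) Hf.
have Hg' : is_derive ((fun t : R => f (t *: v + p)) 0) 1 g dg by rewrite scale0r add0r.
by have := is_derive1_comp Hg' Hf; rewrite /GRing.scale /=.
Qed.

Lemma is_derive_sqrt f p v df : 0 < f p -> is_derive p v f df ->
  is_derive p v (fun q => Num.sqrt (f q)) ((2 * Num.sqrt (f p))^-1 * df).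
Proof. by move=> f0 Hf; apply: is_derive_comp1 => //; exact: is_derive1_sqrt. Qed.

Lemma Ck_sqrt k U f : open U -> (forall p, U p -> 0 < f p) -> Ck_on k U f -> Ck_on k U (fun p => Num.sqrt (f p)).
Proof.
move=> oU f0; elim: k => [|k IH] cf.
  split => // p Up; apply: continuous_comp; first exact: (Ck_on_cont cf Up).
  exact: sqrt_continuous.
have ci : Ck_on k U (fun p => (2 * Num.sqrt (f p))^-1).
  apply: Ck_inv => //; last exact: (Ck_mul oU (Ck_cst k 2 oU) (IH (Ck_onS cf))).
  by move=> p Up; rewrite mulf_neq0 // sqrtr_eq0 -ltNge f0.
apply: (Ck_on_build oU _ _ _ (Ck_mul oU ci (Ck_on_Du cf)) (Ck_mul oU ci (Ck_on_Dv cf))) => p Up.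
- apply: continuous_comp; first exact: (Ck_on_cont cf Up).
  exact: sqrt_continuous.
- exact: (is_derive_sqrt (f0 p Up) (Ck_on_deriveu cf Up)).
- exact: (is_derive_sqrt (f0 p Up) (Ck_on_derivev cf Up)).
Qed.

Lemma Ck1_diff k U f p : open U -> U p -> Ck_on k.+1 U f ->
  differentiable f p /\ 'd f p = lin2 ('D_eu f p) ('D_ev f p) :> (plane -> R).
Proof.
rewrite Ck_onE => oU Up [_ [df [cu cv]]].
by apply: (C1_diff oU Up df); [exact: Ck_on_cont cu Up|exact: Ck_on_cont cv Up].
Qed.

Lemma Ck_on_derive k U f p v : open U -> U p -> Ck_on k.+1 U f ->
  is_derive p v f (v.1 * 'D_eu f p + v.2 * 'D_ev f p).
Proof.
move=> oU Up cf; have [d e] := Ck1_diff oU Up cf.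
by apply: DeriveDef; [exact: diff_derivable|rewrite deriveE // e].
Qed.

Lemma chain_rule k U W f (g h : plane -> R) p v : open U -> open W -> W p -> U (g p, h p) ->
  Ck_on k.+1 U f -> Ck_on k.+1 W g -> Ck_on k.+1 W h ->
  is_derive p v (fun q => f (g q, h q))
   ('D_eu f (g p, h p) * 'D_v g p + 'D_ev f (g p, h p) * 'D_v h p).
Proof.
move=> oU oW Wp Up cf cg ch.
have [df ef] := Ck1_diff oU Up cf; have [dg eg] := Ck1_diff oW Wp cg.
have [dh eh] := Ck1_diff oW Wp ch.
have dgh := differentiable_pair dg dh.
have dc : differentiable (f \o (fun q => (g q, h q))) p by exact: differentiable_comp.
apply: DeriveDef; first by apply: diff_derivable; exact: dc.
rewrite -[fun q => f (g q, h q)]/(f \o (fun q => (g q, h q))) deriveE // diff_comp //=.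
have -> : 'd (fun q => (g q, h q)) p v = ('d g p v, 'd h p v).
  exact: (congr1 (fun F : plane -> plane => F v) (diff_pair dg dh)).
have -> : 'D_v g p = 'd g p v by exact: deriveE.
have -> : 'D_v h p = 'd h p v by exact: deriveE.
have L (a b x y : R) : lin2 a b (x, y) = a * x + b * y by rewrite /lin2 /= [x * a]mulrC [y * b]mulrC.
have e3 := congr1 (fun F : plane -> R => F ('d g p v, 'd h p v)) ef.
exact: (etrans e3 (L _ _ _ _)).
Qed.

Lemma Ck_comp k U W f (g h : plane -> R) : open U -> open W -> (forall q, W q -> U (g q, h q)) ->
  Ck_on k U f -> Ck_on k W g -> Ck_on k W h -> Ck_on k W (fun q => f (g q, h q)).
Proof.
move=> oU oW WU; elim: k f => [|k IH] f cf cg ch.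
  split => // p Wp; apply: (@continuous_comp _ _ _ (fun q => (g q, h q)) f).
    exact: (cvg_pair (Ck_on_cont cg Wp) (Ck_on_cont ch Wp)).
  exact: (Ck_on_cont cf (WU p Wp)).
have iu := IH _ (Ck_on_Du cf) (Ck_onS cg) (Ck_onS ch).
have iv := IH _ (Ck_on_Dv cf) (Ck_onS cg) (Ck_onS ch).
apply: (Ck_on_build oW _ _ _ (Ck_add oW (Ck_mul oW iu (Ck_on_Du cg)) (Ck_mul oW iv (Ck_on_Du ch)))
  (Ck_add oW (Ck_mul oW iu (Ck_on_Dv cg)) (Ck_mul oW iv (Ck_on_Dv ch)))) => p Wp.
- apply: (@continuous_comp _ _ _ (fun q => (g q, h q)) f).
    exact: (cvg_pair (Ck_on_cont cg Wp) (Ck_on_cont ch Wp)).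
  exact: (Ck_on_cont cf (WU p Wp)).
- exact: (chain_rule _ oU oW Wp (WU p Wp) cf cg ch).
- exact: (chain_rule _ oU oW Wp (WU p Wp) cf cg ch).
Qed.

End RealCalculus.

(** * Symmetry of second derivatives, local maxima, order of vanishing *)

Section RealCalculus2.
Variable R : realType.
Local Notation plane := (plane R).
Local Notation eu := (eu R).
Local Notation ev := (ev R).
Implicit Types (U W : set plane) (f g : plane -> R) (p q v : plane).
#[local] Opaque derive derivable Defs.eu Defs.ev.

(** The intermediate point is strictly positive, so it can serve as the step length of a second
    application. *)
Lemma MVT_pos f (a : plane) v (h : R) : 0 < h ->
  (forall s : R, `|s| <= h -> derivable f (s *: v + a) v) ->
  exists2 c : R, 0 < c < h & f (h *: v + a) - f a = h * 'D_v f (c *: v + a).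
Proof.
move=> h0 df; pose g := fun t : R => f (t *: v + a).
have dg (s : R) : `|s| <= h -> is_derive s 1 g ('D_v f (s *: v + a)).
  by move=> sh; apply: slice_is_derive; exact: df.
have f0 : f a = g 0 by rewrite /g scale0r add0r.
rewrite f0 -/(g h).
have [||c] := @MVT R g (fun s => 'D_v f (s *: v + a)) 0 h h0.
- move=> x; rewrite in_itv/= => /andP[x0 xh]; apply: dg.
  by rewrite (ger0_norm (ltW x0)) ltW.
- apply: continuous_in_subspaceT => x; rewrite inE /= in_itv/= => /andP[x0 xh].
  have xh' : `|x| <= h by rewrite ger0_norm.
  apply/differentiable_continuous/derivable1_diffP.
  by have [] := dg x xh'.
- by rewrite in_itv/= => c0h ->; exists c => //; rewrite subr0 mulrC.
Qed.

Lemma is_derive_shiftl f (p w v : plane) (d : R) :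
  is_derive (p + w) v f d -> is_derive p v (fun q => f (q + w)) d.
Proof.
move=> [d1 <-]; apply: is_derive_of_slice.
have := @slice_is_derive R f (p + w) v 0; rewrite scale0r add0r => /(_ d1).
by congr (is_derive _ _ _ _); apply/funext => t; rewrite addrA.
Qed.

Lemma plane_ballP p (P : set plane) :
  (\forall q \near p, P q) <-> exists2 d : R, 0 < d & forall q, `|q - p| < d -> P q.
Proof.
split.
  move=> /nbhs_ballP[d /= d0 H]; exists d => // q qd; apply: H.
  by rewrite -ball_normE /ball_ /= distrC.
move=> [d d0 H]; apply/nbhs_ballP; exists d => //= q.
by rewrite -ball_normE /ball_ /= distrC; exact: H.
Qed.

Lemma cont_near f p (e : R) : {for p, continuous f} -> 0 < e ->
  \forall q \near p, `|f q - f p| < e.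
Proof.
move=> /cvgrPdist_lt cf e0; apply: filterS (cf e e0) => q.
by rewrite distrC.
Qed.

Lemma normZ_eu (s : R) : `|s *: eu| = `|s|.
Proof. by rewrite normrZ plane_normE /= normr1 normr0 max_l // mulr1. Qed.

Lemma normZ_ev (s : R) : `|s *: ev| = `|s|.
Proof. by rewrite normrZ plane_normE /= normr1 normr0 max_r // mulr1. Qed.

(** The second difference over a square of side [h] is a difference of horizontal increments as well
    as of vertical ones; two mean value steps turn the two readings into [h^2] times one mixed
    derivative or the other. *)
Lemma schwarz_aux f p (d h : R) : 0 < h -> h + h < d ->
  (forall q, `|q - p| < d -> [/\ derivable f q eu, derivable f q ev,
     derivable ('D_eu f) q ev & derivable ('D_ev f) q eu]) ->
  (exists2 q, `|q - p| < d & f (h *: eu + p + h *: ev) - f (h *: eu + p) - (f (p + h *: ev) - f p) =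
    h * (h * 'D_ev ('D_eu f) q)) /\
  (exists2 q, `|q - p| < d & f (h *: ev + p + h *: eu) - f (h *: ev + p) - (f (p + h *: eu) - f p) =
    h * (h * 'D_eu ('D_ev f) q)).
Proof.
move=> h0 hd H; have nh : `|h| = h by rewrite gtr0_norm.
have tri (a b : plane) : `|a| <= h -> `|b| <= h -> `|(a + p + b) - p| < d.
  move=> ah bh; have -> : a + p + b - p = a + b by rewrite addrAC addrK.
  by apply: le_lt_trans hd; apply: (le_trans (ler_normD _ _)); exact: lerD.
split.
- have dG s : `|s| <= `|h| -> is_derive (s *: eu + p) eu (fun q => f (q + h *: ev) - f q)
      ('D_eu f (s *: eu + p + h *: ev) - 'D_eu f (s *: eu + p)).
    rewrite nh => sh; apply: is_deriveB; last first.
      apply: derivableP; have := tri (s *: eu) 0; rewrite normZ_eu normr0 addr0.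
      move=> /(_ sh (ltW h0))/H[dd _ _ _]; exact: dd.
    apply: is_derive_shiftl; apply: derivableP.
    have := tri (s *: eu) (h *: ev); rewrite normZ_eu normZ_ev nh => /(_ sh (lexx _))/H[dd _ _ _]; exact: dd.
  have [|c cn E] := @MVT_dir R (fun q => f (q + h *: ev) - f q) p eu h.
    by move=> s /dG[].
  rewrite nh in cn; rewrite E; have := dG c; rewrite nh => /(_ cn)[_ ->].
  have [|c2 c2n E2] := @MVT_dir R ('D_eu f) (c *: eu + p) ev h.
    rewrite nh => s sh; have := tri (c *: eu) (s *: ev); rewrite normZ_eu normZ_ev => /(_ cn sh).
    rewrite [s *: ev + _]addrC => /H[_ _ dd _]; exact: dd.
  exists (c2 *: ev + (c *: eu + p)).
    rewrite nh in c2n; have := tri (c *: eu) (c2 *: ev); rewrite normZ_eu normZ_ev => /(_ cn c2n); by rewrite [c2 *: ev + _]addrC.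
  by rewrite -E2 [h *: ev + _]addrC.
- have dG s : `|s| <= `|h| -> is_derive (s *: ev + p) ev (fun q => f (q + h *: eu) - f q)
      ('D_ev f (s *: ev + p + h *: eu) - 'D_ev f (s *: ev + p)).
    rewrite nh => sh; apply: is_deriveB; last first.
      apply: derivableP; have := tri (s *: ev) 0; rewrite normZ_ev normr0 addr0.
      move=> /(_ sh (ltW h0))/H[_ dd _ _]; exact: dd.
    apply: is_derive_shiftl; apply: derivableP.
    have := tri (s *: ev) (h *: eu); rewrite normZ_ev normZ_eu nh => /(_ sh (lexx _))/H[_ dd _ _]; exact: dd.
  have [|c cn E] := @MVT_dir R (fun q => f (q + h *: eu) - f q) p ev h.
    by move=> s /dG[].
  rewrite nh in cn; rewrite E; have := dG c; rewrite nh => /(_ cn)[_ ->].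
  have [|c2 c2n E2] := @MVT_dir R ('D_ev f) (c *: ev + p) eu h.
    rewrite nh => s sh; have := tri (c *: ev) (s *: eu); rewrite normZ_ev normZ_eu => /(_ cn sh).
    rewrite [s *: eu + _]addrC => /H[_ _ _ dd]; exact: dd.
  exists (c2 *: eu + (c *: ev + p)).
    rewrite nh in c2n; have := tri (c *: ev) (c2 *: eu); rewrite normZ_ev normZ_eu => /(_ cn c2n); by rewrite [c2 *: eu + _]addrC.
  by rewrite -E2 [h *: eu + _]addrC.
Qed.

Lemma close_lt (x y a b e : R) : `|x - a| < e -> `|y - b| < e -> x = y -> `|a - b| < e + e.
Proof.
move=> B1 B2 E; apply: le_lt_trans (ltrD B1 B2); rewrite distrC.
have -> : b - a = (x - a) - (y - b) by rewrite E; ring.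
exact: ler_normB.
Qed.

Lemma schwarz U f p : open U -> U p -> Ck_on 2 U f ->
  'D_ev ('D_eu f) p = 'D_eu ('D_ev f) p.
Proof.
move=> oU Up c2; apply/eqP; apply: contraT => ab.
set a := 'D_ev ('D_eu f) p in ab; set b := 'D_eu ('D_ev f) p in ab.
(* Half the gap: the mixed derivatives at [q1] and [q2] coincide, but each lies within [e] of a
   different limit, so the gap would be smaller than [2 e], which is the gap itself. *)
pose e := `|a - b| / 2; have e0 : 0 < e by rewrite divr_gt0 // normr_gt0 subr_eq0.
have nU : \forall q \near p, U q by exact: open_nbhs_nbhs.
have na := cont_near (Ck_on_cont (Ck_on_Dv (Ck_on_Du c2)) Up) e0.
have nb := cont_near (Ck_on_cont (Ck_on_Du (Ck_on_Dv c2)) Up) e0.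
have [d d0 H] := (plane_ballP _ _).1 (filterI nU (filterI na nb)).
have h0 : 0 < d / 3 by rewrite divr_gt0.
have hd : d / 3 + d / 3 < d by lra.
have [|[q1 q1d E1] [q2 q2d E2]] := @schwarz_aux f p d (d / 3) h0 hd.
  move=> q /H[Uq _]; have [_ [d1 [cu cv]]] := c2; have [a1 a2] := d1 q Uq.
  have [_ [d2 _]] := cu; have [_ [d3 _]] := cv.
  have [_ a3] := d2 q Uq; have [a4 _] := d3 q Uq; exact: And4 a1 a2 a3 a4.
have EE : 'D_ev ('D_eu f) q1 = 'D_eu ('D_ev f) q2.
  move: E1 E2; set A := 'D_ev _ q1; set B := 'D_eu _ q2.
  have -> : d / 3 *: ev + p + d / 3 *: eu = d / 3 *: eu + p + d / 3 *: ev.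
    by rewrite addrC addrA addrAC.
  rewrite [d / 3 *: ev + p]addrC [p + d / 3 *: eu]addrC.
  move: (f _) (f _) (f _) (f _) A B h0 => x y z w A B h0 E1 E2.
  apply: (mulfI (lt0r_neq0 h0)); apply: (mulfI (lt0r_neq0 h0)); rewrite -E1 -E2.
  ring.
have [_ [B1 _]] := H _ q1d; have [_ [_ B2]] := H _ q2d.
have := close_lt B1 B2 EE; rewrite -/a -/b /e -splitr ltxx.
exact.
Qed.

Lemma local_max_deriv0 U f p v : open U -> U p ->
  (forall q, U q -> derivable f q v) -> {for p, continuous ('D_v f)} ->
  (\forall q \near p, f q <= f p) -> 'D_v f p = 0.
Proof.
move=> oU Up df cv mx; apply/eqP; apply: contraT => n0.
have e0 : 0 < `|'D_v f p| by rewrite normr_gt0.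
have nU : \forall q \near p, U q by exact: open_nbhs_nbhs.
have [d d0 H] := (plane_ballP _ _).1 (filterI nU (filterI mx (cont_near cv e0))).
(* A step in the direction in which [f] increases, short enough to stay in the ball; the summand 1
   covers the case [v = 0]. *)
pose h := d / (2 * (1 + `|v|)) * Num.sg ('D_v f p).
have v1 : 0 < 1 + `|v| by rewrite ltr_pwDl.
have h0 : h != 0 by rewrite mulf_neq0 ?sgr_eq0 // gt_eqF // divr_gt0 // mulr_gt0.
have hn : `|h| * `|v| < d.
  rewrite normrM normr_sg n0 mulr1 gtr0_norm ?divr_gt0 ?mulr_gt0 //.
  rewrite mulrAC ltr_pdivrMr ?mulr_gt0 // ltr_pM2l //.
  by have := normr_ge0 v; lra.
have inb s : `|s| <= `|h| -> `|s *: v + p - p| < d.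
  by move=> sh; rewrite addrK normrZ; apply: le_lt_trans hn; exact: ler_wpM2r.
have [|c ch E] := @MVT_dir R f p v h.
  by move=> s /inb /H[/df].
have [_ [M _]] := H _ (inb h (lexx _)); have [_ [_ D]] := H _ (inb c ch).
have : h * 'D_v f (c *: v + p) <= 0 by rewrite -E subr_le0.
rewrite leNgt => /negP[]; rewrite /h -mulrA; apply: mulr_gt0; first by rewrite divr_gt0 // mulr_gt0.
move: D n0; set x := 'D_v f p; set y := 'D_v f _ => D n0.
have [x0|x0|x0] := ltrgtP x 0.
- rewrite ltr0_sg // mulN1r oppr_gt0; move: D; rewrite (ltr0_norm x0) ltr_norml => /andP[_].
  by lra.
- rewrite gtr0_sg // mul1r; move: D; rewrite (gtr0_norm x0) ltr_norml => /andP[+ _].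
  by lra.
- by rewrite x0 eqxx in n0.
Qed.

(** With a positive second derivative, two mean value steps starting from the vanishing first
    derivative would make [f] grow in the direction [v]. *)
Lemma local_max_deriv2 U f p v : open U -> U p ->
  (forall q, U q -> derivable f q v /\ derivable ('D_v f) q v) ->
  {for p, continuous ('D_v f)} -> {for p, continuous ('D_v ('D_v f))} ->
  (\forall q \near p, f q <= f p) -> 'D_v ('D_v f) p <= 0.
Proof.
move=> oU Up df cv cvv mx; rewrite leNgt; apply/negP => a0.
have D0 : 'D_v f p = 0 by apply: (local_max_deriv0 oU Up _ cv mx) => q /df[dd _]; exact: dd.
have nU : \forall q \near p, U q by exact: open_nbhs_nbhs.
have [d d0 H] := (plane_ballP _ _).1 (filterI nU (filterI mx (cont_near cvv a0))).
have v1 : 0 < 1 + `|v| by rewrite ltr_pwDl.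
pose h := d / (2 * (1 + `|v|)); have h0 : 0 < h by rewrite divr_gt0 // mulr_gt0.
have hn : h * `|v| < d.
  rewrite mulrAC ltr_pdivrMr ?mulr_gt0 // ltr_pM2l //.
  by have := normr_ge0 v; lra.
have inb s : `|s| <= h -> `|s *: v + p - p| < d.
  by move=> sh; rewrite addrK normrZ; apply: le_lt_trans hn; exact: ler_wpM2r.
have [|c /andP[c0 ch] E] := @MVT_pos f p v h h0.
  move=> s /inb /H[/df[dd _] _]; exact: dd.
have [|c2 /andP[c20 c2c] E2] := @MVT_pos ('D_v f) p v c c0.
  move=> s sc; have /inb /H[/df[_ dd] _] := le_trans sc (ltW ch); exact: dd.
have hh : `|h| <= h by rewrite gtr0_norm.
have c2h : `|c2| <= h by rewrite gtr0_norm // ltW // (lt_trans c2c).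
have [_ [M _]] := H _ (inb h hh); have [_ [_ D]] := H _ (inb c2 c2h).
have y0 : 0 < 'D_v ('D_v f) (c2 *: v + p).
  move: D a0; set x := 'D_v _ p; set y := 'D_v _ _ => D a0.
  by move: D; rewrite ltr_norml => /andP[+ _]; lra.
have : f (h *: v + p) - f p <= 0 by rewrite subr_le0.
rewrite E leNgt => /negP[]; rewrite mulr_gt0 //.
by move: E2; rewrite D0 subr0 => ->; rewrite mulr_gt0.
Qed.

Fixpoint vanish (k : nat) f p : Prop :=
  match k with
  | 0 => True
  | k'.+1 => f p = 0 /\ vanish k' ('D_eu f) p /\ vanish k' ('D_ev f) p
  end.

(** A Taylor estimate obtained without Taylor's formula: by the mean value theorem on the segment
    from [p] to [q], bounds of order [k] for the two partial derivatives add up to one of order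
    [k + 1] for [f]. The index [k] of [vanish] counts derivatives of order less than [k], hence the
    exponent. *)
Lemma vanish_bound k U f p : open U -> U p -> Ck_on k.+1 U f -> vanish k f p ->
  exists C : R, exists d : R, [/\ 0 <= C, 0 < d & forall q, `|q - p| < d -> `|f q| <= C * `|q - p| ^+ k].
Proof.
move=> oU Up; elim: k f => [|k IH] f cf.
  move=> _; have [d d0 H] := (plane_ballP _ _).1 (cont_near (Ck_on_cont cf Up) (@ltr01 R)).
  exists (`|f p| + 1), d; split => //.
  move=> q /H qd; rewrite expr0 mulr1 -[f q](subrK (f p)) addrC.
  by apply: (le_trans (ler_normD _ _)); rewrite lerD2l ltW.
move=> [f0 [vu vv]].
have [Cu [du [Cu0 du0 Hu]]] := IH _ (Ck_on_Du cf) vu.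
have [Cv [dv [Cv0 dv0 Hv]]] := IH _ (Ck_on_Dv cf) vv.
have nU : \forall q \near p, U q by exact: open_nbhs_nbhs.
have [d d0 H] := (plane_ballP _ _).1 nU.
exists (Cu + Cv), (Num.min d (Num.min du dv)); split; first exact: addr_ge0.
  by rewrite !lt_min d0 du0 dv0.
move=> q; rewrite !lt_min => /and3P[qd qdu qdv].
set v := q - p in qd qdu qdv *.
have nb (s : R) : `|s| <= `|1 : R| -> `|s *: v + p - p| <= `|v|.
  by rewrite normr1 => s1; rewrite addrK normrZ; apply: ler_piMl.
have [|c c1 E] := @MVT_dir R f p v 1.
  move=> s /nb sv; have Us := H _ (le_lt_trans sv qd).
  by have [] := Ck_on_derive v oU Us cf.
move: E; rewrite scale1r mul1r f0 subr0 /v subrK => ->; rewrite -/v.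
have cv := nb c c1; have Uc := H _ (le_lt_trans cv qd).
have [_ ->] := Ck_on_derive v oU Uc cf.
have hu := Hu _ (le_lt_trans cv qdu); have hv := Hv _ (le_lt_trans cv qdv).
have v1 : `|v.1| <= `|v| by rewrite plane_normE le_max lexx.
have v2 : `|v.2| <= `|v| by rewrite plane_normE le_max lexx orbT.
have cvk : `|c *: v + p - p| ^+ k <= `|v| ^+ k by apply: lerXn2r; rewrite ?nnegrE.
apply: (le_trans (ler_normD _ _)); rewrite !normrM exprS mulrDl; apply: lerD.
  rewrite mulrCA; apply: ler_pM => //; apply: (le_trans hu); exact: ler_wpM2l.
rewrite mulrCA; apply: ler_pM => //; apply: (le_trans hv); exact: ler_wpM2l.
Qed.

End RealCalculus2.

(** * Extension across a point of a function whose partial derivatives extend *)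

Section Removable.
Variable R : realType.
Local Notation plane := (plane R).
Local Notation eu := (eu R).
Local Notation ev := (ev R).
Implicit Types (U W : set plane) (f g : plane -> R) (p q v : plane).

Lemma is_derive_eps f p v (l : R) :
  (forall e : R, 0 < e -> exists2 d : R, 0 < d & forall h : R, 0 < `|h| < d ->
     `|f (h *: v + p) - f p - h * l| <= e * `|h|) ->
  is_derive p v f l.
Proof.
move=> H.
have cl : (fun h : R => h^-1 *: ((f \o shift p) (h *: v) - f p)) h @[h --> 0^'] --> l.
  apply/cvgrPdist_le => e e0; have [d d0 Hd] := H e e0.
  exists d => //= h; rewrite /ball_ /= sub0r normrN => hd h0.
  have h0' : 0 < `|h| by rewrite normr_gt0.
  have := Hd h; rewrite h0' hd => /(_ isT).
  set x := f (h *: v + p) - f p => xh.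
  have -> : l - h^-1 *: x = - (h^-1 * (x - h * l)).
    by rewrite mulrBr mulKf // opprB.
  by rewrite normrN normrM normfV mulrC ler_pdivrMr.
by apply: DeriveDef; [apply/cvg_ex; exists l|exact: cvg_lim].
Qed.

#[local] Opaque derive derivable Defs.eu Defs.ev.

Lemma MVT_ineq f (a : plane) v (M s t : R) :
  (forall r : R, Num.min s t <= r <= Num.max s t -> derivable f (r *: v + a) v /\ `|'D_v f (r *: v + a)| <= M) ->
  `|f (t *: v + a) - f (s *: v + a)| <= M * `|t - s|.
Proof.
move=> H.
have inb (c : R) : `|c| <= `|t - s| -> True by [].
suff key (s' t' : R) : s' < t' -> (forall r : R, s' <= r <= t' -> derivable f (r *: v + a) v /\ `|'D_v f (r *: v + a)| <= M) ->
   `|f (t' *: v + a) - f (s' *: v + a)| <= M * `|t' - s'|.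
  have [st|ts|->] := ltgtP s t; last by rewrite !subrr normr0 mulr0.
    by apply: key => // r; move: (H r); rewrite min_l ?max_r // ltW.
  rewrite distrC [X in _ * X]distrC.
  by apply: key => // r; move: (H r); rewrite min_r ?max_l // ltW.
move=> st {}H.
pose g := fun r : R => f (r *: v + a).
have dg (r : R) : s' <= r <= t' -> is_derive r 1 g ('D_v f (r *: v + a)).
  by move=> /H[d _]; exact: slice_is_derive.
have [||c] := @MVT R g (fun r => 'D_v f (r *: v + a)) s' t' st.
- by move=> x; rewrite in_itv/= => /andP[x0 xh]; apply: dg; rewrite !ltW.
- apply: continuous_in_subspaceT => x; rewrite inE /= in_itv/= => xh.
  apply/differentiable_continuous/derivable1_diffP.
  by have [] := dg x xh.
- rewrite in_itv/= => /andP[c0 c1]; rewrite /g => ->; rewrite normrM.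
  by apply: ler_wpM2r => //; apply: (H c _).2; rewrite !ltW.
Qed.

Variables (U : set plane) (f a b : plane -> R) (p : plane).
Hypotheses (oU : open U) (Up : U p).
Hypothesis dfu : forall q, U q -> q != p -> is_derive q eu f (a q).
Hypothesis dfv : forall q, U q -> q != p -> is_derive q ev f (b q).
Hypotheses (ca : smooth_on U a) (cb : smooth_on U b).

Lemma removable_box : exists M : R, exists d : R, [/\ 0 < M, 0 < d &
   forall q, `|q - p| < d -> [/\ U q, `|a q| <= M & `|b q| <= M]].
Proof.
have nU : \forall q \near p, U q by exact: open_nbhs_nbhs.
have na := cont_near (Ck_on_cont (ca 0%N) Up) (@ltr01 R).
have nb := cont_near (Ck_on_cont (cb 0%N) Up) (@ltr01 R).
have [d d0 H] := (plane_ballP _ _).1 (filterI nU (filterI na nb)).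
exists (1 + `|a p| + `|b p|), d; split => //.
have bd (x y : R) : `|x - y| < 1 -> `|x| <= 1 + `|y|.
  move=> xy; rewrite -[x](subrK y); apply: (le_trans (ler_normD _ _)).
  by apply: lerD => //; rewrite ltW.
move=> q /H[Uq [/bd aq /bd bq]]; split => //.
  by apply: (le_trans aq); rewrite lerDl.
by apply: (le_trans bq); rewrite addrAC lerDl.
Qed.

(** A horizontal segment avoids [p] if it runs at another height, or at the height of [p] but
    entirely to its right; the disjunction lists these two cases. *)
Lemma hseg (M d y s t : R) : (forall q, `|q - p| < d -> [/\ U q, `|a q| <= M & `|b q| <= M]) ->
  y != p.2 \/ (p.1 < s /\ p.1 < t) ->
  `|y - p.2| < d -> `|s - p.1| < d -> `|t - p.1| < d ->
  `|f (t, y) - f (s, y)| <= M * `|t - s|.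
Proof.
move=> H ne yd sd td.
have e (r : R) : r *: eu + (0, y) = (r, y) by rewrite scale_eu /= addr0.
have := @MVT_ineq f (0, y) eu M s t; rewrite !e; apply => r rst; rewrite e.
have rd : `|(r, y) - p| < d.
  rewrite plane_normE /= gt_max yd andbT.
  move: rst sd td; rewrite !ltr_norml ge_min le_max => /andP[/orP[h1|h1] /orP[h2|h2]] /andP[h3 h4] /andP[h5 h6]; apply/andP; split; lra.
have [Ur ar _] := H _ rd.
have rp : (r, y) != p.
  apply/eqP => rp; case: ne => [|[ps pt]]; first by rewrite -rp eqxx.
  have : p.1 < r by move: rst; rewrite ge_min le_max => /andP[/orP[h1|h1] _]; lra.
  by rewrite -rp ltxx.
by have [d1 ->] := dfu Ur rp.
Qed.

Lemma vseg (M d x s t : R) : (forall q, `|q - p| < d -> [/\ U q, `|a q| <= M & `|b q| <= M]) ->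
  x != p.1 ->
  `|x - p.1| < d -> `|s - p.2| < d -> `|t - p.2| < d ->
  `|f (x, t) - f (x, s)| <= M * `|t - s|.
Proof.
move=> H ne yd sd td.
have e (r : R) : r *: ev + (x, 0) = (x, r) by rewrite scale_ev /= addr0.
have := @MVT_ineq f (x, 0) ev M s t; rewrite !e; apply => r rst; rewrite e.
have rd : `|(x, r) - p| < d.
  rewrite plane_normE /= gt_max yd /=.
  move: rst sd td; rewrite !ltr_norml ge_min le_max => /andP[/orP[h1|h1] /orP[h2|h2]] /andP[h3 h4] /andP[h5 h6]; apply/andP; split; lra.
have [Ur _ ar] := H _ rd.
have rp : (x, r) != p.
  by apply/eqP => rp; move: ne; rewrite -rp eqxx.
by have [d1 ->] := dfv Ur rp.
Qed.

Lemma removable_limit : exists c : R, exists K : R, exists2 d : R, 0 < d & (0 <= K /\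
  forall q, q != p -> `|q - p| < d -> `|f q - c| <= K * `|q - p|).
Proof.
have [M [d [M0 d0 H]]] := removable_box.
pose e (r : R) := f (p.1 + r, p.2).
have E (r s : R) : 0 < r < d -> 0 < s < d -> `|e r - e s| <= M * `|r - s|.
  move=> /andP[r0 rd] /andP[s0 sd].
  have -> : r - s = (p.1 + r) - (p.1 + s) by lra.
  apply: (hseg H); first by right; lra.
  - by rewrite subrr normr0.
  - by have -> : p.1 + s - p.1 = s by [lra]; rewrite gtr0_norm.
  - by have -> : p.1 + r - p.1 = r by [lra]; rewrite gtr0_norm.
(* On the ray to the right of [p] the function is Lipschitz, so any lower end [e r - M r] is below
   any upper end [e s + M s]; the infimum of the upper ends is the limit at [p]. *)
pose A := [set e r + M * r | r in [set r : R | 0 < r < d]].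
have dd : 0 < d / 2 < d by lra.
have A0 : A !=set0 by exists (e (d / 2) + M * (d / 2)); exists (d / 2).
have lb (r : R) : 0 < r < d -> lbound A (e r - M * r).
  move=> rd _ [s sd <-]; have := E r s rd sd; rewrite ler_norml => /andP[h1 h2].
  have [rs|sr] := leP r s.
    move: h2; rewrite ler0_norm ?subr_le0 // => h2.
    have /andP[r0 _] := rd; have : 0 <= M * r by rewrite mulr_ge0 // ltW.
    by nra.
  move: h2; rewrite gtr0_norm ?subr_gt0 // => h2.
  by have /andP[s0 _] := sd; have : 0 <= M * s by [rewrite mulr_ge0 // ltW]; nra.
pose c := inf A.
have ec (r : R) : 0 < r < d -> `|e r - c| <= M * r.
  move=> rd; rewrite ler_norml; apply/andP; split.
    have : c <= e r + M * r.
      by apply: ge_inf; [exists (e r - M * r); exact: lb|exists r].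
    by lra.
  have : e r - M * r <= c by apply: lb_le_inf => //; exact: lb.
  by lra.
(* Off the horizontal line through [p] the path goes horizontally to the abscissa [p.1 + r],
   vertically to the ray and along the ray to its limit. The lengths are at most [2 r], [r] and [r],
   whence the factor 4. *)
have gen (q : plane) : q.2 != p.2 -> `|q - p| < d -> `|f q - c| <= 4 * M * `|q - p|.
  move=> ne qd; set r := `|q - p|.
  have r0 : 0 < r.
    rewrite normr_gt0 subr_eq0; apply/eqP => qp; by rewrite qp eqxx in ne.
  have q1 : `|q.1 - p.1| <= r by rewrite /r plane_normE le_max lexx.
  have q2 : `|q.2 - p.2| <= r by rewrite /r plane_normE le_max lexx orbT.
  have rr : `|p.1 + r - p.1| = r by have -> : p.1 + r - p.1 = r by [lra]; rewrite gtr0_norm.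
  have S1 : `|f (q.1, q.2) - f (p.1 + r, q.2)| <= M * `|q.1 - (p.1 + r)|.
    by apply: (hseg H); [left| | |]; rewrite ?rr // (le_lt_trans _ qd).
  have S2 : `|f (p.1 + r, q.2) - f (p.1 + r, p.2)| <= M * `|q.2 - p.2|.
    apply: (vseg H); rewrite ?rr ?subrr ?normr0 //; last by rewrite (le_lt_trans _ qd).
    by rewrite gt_eqF // ltrDl.
  have S3 := ec r; rewrite r0 qd in S3; have {}S3 := S3 isT.
  have S4 : `|q.1 - (p.1 + r)| <= 2 * r.
    by move: q1; rewrite !ler_norml => /andP[? ?]; apply/andP; split; lra.
  have -> : q = (q.1, q.2) by case: (q).
  have -> : f (q.1, q.2) - c = (f (q.1, q.2) - f (p.1 + r, q.2)) + (f (p.1 + r, q.2) - f (p.1 + r, p.2)) + (e r - c) by rewrite /e; ring.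
  apply: (le_trans (ler_normD _ _)).
  have -> : 4 * M * r = M * (2 * r) + M * r + M * r by ring.
  apply: lerD => //; apply: (le_trans (ler_normD _ _)); apply: lerD.
    by apply: (le_trans S1); rewrite ler_pM2l.
  by apply: (le_trans S2); rewrite ler_pM2l.
exists c, (5 * M), d => //; split; first by rewrite mulr_ge0 // ltW.
move=> q qp qd; have [e2|ne] := eqVneq q.2 p.2; last first.
  apply: (le_trans (gen q ne qd)); rewrite ler_wpM2r //; by rewrite ler_pM2r // ler_nat.
set r := `|q - p|; have r0 : 0 < r by rewrite normr_gt0 subr_eq0.
have q1 : `|q.1 - p.1| = r.
  by rewrite /r plane_normE /= e2 subrr normr0 max_l.
have ne1 : q.1 != p.1 by rewrite -subr_eq0 -normr_gt0 q1.
(* On the horizontal line through [p] the direct way may cross [p]; a vertical detour of length [r]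
   leads to the previous case and raises the factor to 5. *)
pose q' : plane := (q.1, p.2 + r).
have q'p : `|q' - p| = r.
  rewrite plane_normE /= q1; have -> : p.2 + r - p.2 = r by lra.
  by rewrite gtr0_norm // max_l.
have S0 : `|f q' - c| <= 4 * M * r.
  by rewrite -q'p; apply: gen; rewrite ?q'p // /q' /= gt_eqF // ltrDl.
have S1 : `|f (q.1, p.2 + r) - f (q.1, p.2)| <= M * `|p.2 + r - p.2|.
  apply: (vseg H) => //; rewrite ?q1 // ?subrr ?normr0 //.
  by have -> : p.2 + r - p.2 = r by [lra]; rewrite gtr0_norm.
have -> : q = (q.1, p.2) by case: (q) e2 => ? ? /= ->.
have -> : f (q.1, p.2) - c = (f q' - c) - (f (q.1, p.2 + r) - f (q.1, p.2)) by rewrite /q'; ring.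
apply: (le_trans (ler_normB _ _)).
have -> : 5 * M * r = 4 * M * r + M * r by ring.
apply: lerD => //; apply: (le_trans S1).
by have -> : p.2 + r - p.2 = r by [lra]; rewrite gtr0_norm.
Qed.



(** The mean value theorem is applied on a segment that stops short of [p], from [th h v + p] to
    [h v + p], to [f] minus a linear function of slope [dv p]. The remaining piece is controlled by
    the Lipschitz bound and disappears as [th] tends to 0. The form [lin2 x y], equal to 1 on [v],
    serves to write the linear function. *)
Lemma removable_derive (c K d : R) (v : plane) (dv : plane -> R) (x y : R) : lin2 x y v = 1 -> 0 <= K -> 0 < d -> `|v| = 1 ->
  (forall q, q != p -> `|q - p| < d -> `|f q - c| <= K * `|q - p|) ->
  (forall q, U q -> q != p -> is_derive q v f (dv q)) -> {for p, continuous dv} ->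
  forall g, g p = c -> (forall q, q != p -> g q = f q) -> is_derive p v g (dv p).
Proof.
move=> xyv K0 d0 v1 lip dfv' cdv g gp gf; apply: is_derive_eps => e e0.
have nU : \forall q \near p, U q by exact: open_nbhs_nbhs.
have [d1 d10 H] := (plane_ballP _ _).1 (filterI nU (cont_near cdv e0)).
exists (Num.min d d1); first by rewrite lt_min d0.
move=> h /andP[h0]; rewrite lt_min => /andP[hd hd1].
have nz (t : R) : `|t *: v + p - p| = `|t| by rewrite addrK normrZ v1 mulr1.
have nzp (t : R) : t != 0 -> t *: v + p != p.
  by move=> t0; rewrite -subr_eq0 -normr_eq0 nz normr_eq0.
have h0' : h != 0 by rewrite -normr_gt0.
rewrite gp (gf _ (nzp h h0')).
have key (th : R) : 0 < th < 1 -> `|f (h *: v + p) - f ((th * h) *: v + p) - (1 - th) * h * dv p| <= e * `|h|.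
  move=> /andP[t0 t1].
  pose G (q : plane) := f q - dv p * lin2 x y q.
  have LE (t : R) : lin2 x y (t *: v + p) = t + lin2 x y p.
    by rewrite linearD linearZ /= xyv /GRing.scale /= mulr1.
  have := @MVT_ineq G p v e (th * h) h.
  have -> : G (h *: v + p) - G ((th * h) *: v + p) = f (h *: v + p) - f ((th * h) *: v + p) - (1 - th) * h * dv p.
    by rewrite /G !LE; ring.
  move=> /(_ _)/le_trans; apply; last first.
    have -> : h - th * h = (1 - th) * h by ring.
    rewrite normrM mulrA ler_wpM2r // ler_piMr ?ltW // ger0_norm ?subr_ge0 ?ltW //; lra.
  move=> r rr.
  have [r0 rh] : r != 0 /\ `|r| <= `|h|.
    move: rr; rewrite ge_min le_max.
    have [hp|hn|hz] := ltgtP 0 h; last by rewrite -hz eqxx in h0'.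
      have th0 : 0 < th * h by rewrite mulr_gt0.
      have thh : th * h < h by rewrite gtr_pMl.
      move=> /andP[/orP[r1|r1] /orP[r2|r2]]; split; rewrite ?gt_eqF ?(gtr0_norm hp) ?gtr0_norm; lra.
    have th0 : th * h < 0 by rewrite pmulr_rlt0.
    have thh : h < th * h by nra.
    move=> /andP[/orP[r1|r1] /orP[r2|r2]]; split; rewrite ?lt_eqF ?(ltr0_norm hn) ?ltr0_norm; lra.
  have [Ur cr] : (U `&` (fun q : plane => `|dv q - dv p| < e)) (r *: v + p).
    by apply: H; rewrite nz (le_lt_trans rh).
  have dG : is_derive (r *: v + p) v G (dv (r *: v + p) - dv p * 1).
    rewrite -xyv; apply: is_deriveB; first exact: (dfv' _ Ur (nzp r r0)).
    apply: is_deriveZ; exact: (is_derive_of_lin _ _ (@lin2_continuous R x y)).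
  by have [dd ->] := dG; split; [exact: dd|rewrite mulr1 ltW].
have key2 (th : R) : 0 < th < 1 -> `|f (h *: v + p) - c - h * dv p| <= e * `|h| + th * (`|h| * (K + `|dv p|)).
  move=> t01; have /andP[t0 t1] := t01.
  have th0 : th * h != 0 by rewrite mulf_neq0 // gt_eqF.
  have l := lip _ (nzp _ th0); rewrite nz in l.
  have thh : `|th * h| <= `|h| by rewrite normrM ger0_norm ?ler_piMl // ltW.
  have {}l := l (le_lt_trans thh hd).
  have -> : f (h *: v + p) - c - h * dv p = (f (h *: v + p) - f ((th * h) *: v + p) - (1 - th) * h * dv p) + ((f ((th * h) *: v + p) - c) - th * h * dv p) by ring.
  apply: (le_trans (ler_normD _ _)); apply: lerD; first exact: key.
  apply: (le_trans (ler_normB _ _)); rewrite 2!mulrDr; apply: lerD.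
    apply: (le_trans l); rewrite normrM (gtr0_norm t0); lra.
  by rewrite !normrM (gtr0_norm t0) mulrA.
apply/ler_addgt0Pr => e' e'0.
set N := `|h| * (K + `|dv p|) in key2.
have N0 : 0 <= N by rewrite mulr_ge0 // addr_ge0.
(* This choice of [th] makes the error [th N] at most [e'], while the denominator keeps [th] below
   1. *)
have t0 : 0 < e' / (e' + N + 1) < 1.
  have den : 0 < e' + N + 1 by lra.
  by rewrite divr_gt0 // ltr_pdivrMr // mul1r; lra.
apply: (le_trans (key2 _ t0)); rewrite lerD2l.
by rewrite mulrAC ler_pdivrMr; nra.
Qed.

(** Only a value at [p] has to be found: once the partial derivatives of the extension are [a] and
    [b] everywhere, its higher regularity is theirs. *)
Lemma removable : exists c : R, let g := fun q => if q == p then c else f q in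
  smooth_on U g /\ forall q, U q -> is_derive q eu g (a q) /\ is_derive q ev g (b q).
Proof.
have [c [K [d d0 [K0 lip]]]] := removable_limit.
exists c => g.
have gp : g p = c by rewrite /g eqxx.
have gf q : q != p -> g q = f q by rewrite /g => /negbTE ->.
pose W : set plane := U `&` [set q | q != p].
have oW : open W.
  apply: openI => //; rewrite openE => q /= qp; apply/plane_ballP.
  exists `|q - p|; first by rewrite normr_gt0 subr_eq0.
  move=> z zq; apply/eqP => zp; by rewrite zp distrC ltxx in zq.
have gfW q : W q -> f q = g q by move=> [_ /gf ->].
have dgu q : U q -> is_derive q eu g (a q).
  move=> Uq; have [->|qp] := eqVneq q p.
    apply: (@removable_derive c K d eu a 1 0) => //; [|by rewrite -[eu]scale1r normZ_eu normr1|exact: (Ck_on_cont (ca 0%N) Up)].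
    by rewrite /lin2 /= !mulr1 mulr0 addr0.
  have [d1 d2] := dfu Uq qp.
  apply: DeriveDef; first exact: (eq_on_derivable oW (conj Uq qp) gfW d1).
  by rewrite -d2; apply/esym; exact: (eq_on_derive _ oW (conj Uq qp) gfW).
have dgv q : U q -> is_derive q ev g (b q).
  move=> Uq; have [->|qp] := eqVneq q p.
    apply: (@removable_derive c K d ev b 0 1) => //; [|by rewrite -[ev]scale1r normZ_ev normr1|exact: (Ck_on_cont (cb 0%N) Up)].
    by rewrite /lin2 /= !mulr1 mulr0 add0r.
  have [d1 d2] := dfv Uq qp.
  apply: DeriveDef; first exact: (eq_on_derivable oW (conj Uq qp) gfW d1).
  by rewrite -d2; apply/esym; exact: (eq_on_derive _ oW (conj Uq qp) gfW).
split; last by move=> q Uq; split; [exact: dgu|exact: dgv].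
have cg q : U q -> {for q, continuous g}.
  move=> Uq; apply: differentiable_continuous; apply: (C1_diff oU Uq _ _ _).1.
  - by move=> z Uz; have [x1 _] := dgu z Uz; have [x2 _] := dgv z Uz; split; [exact: x1|exact: x2].
  - apply: (eq_on_continuous oU Uq _ (Ck_on_cont (ca 0%N) Uq)) => z Uz.
    by have [_ ->] := dgu z Uz.
  - apply: (eq_on_continuous oU Uq _ (Ck_on_cont (cb 0%N) Uq)) => z Uz.
    by have [_ ->] := dgv z Uz.
case=> [|k]; first by split.
by apply: (Ck_on_build oU cg dgu dgv); [exact: ca|exact: cb].
Qed.

End Removable.

Definition Dc (R : realType) (v : plane R) (f : plane R -> R[i]) (p : plane R) : R[i] :=
  'D_v (fun q => complex.Re (f q)) p +i* 'D_v (fun q => complex.Im (f q)) p.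

(* [c = -i] gives the derivative in [z], [c = i] the one in its conjugate. *)
HB.lock Definition pd (R : realType) (c : R[i]) (f : plane R -> R[i]) (p : plane R) : R[i] :=
  2^-1 * (Dc (eu R) f p + c * Dc (ev R) f p).

HB.lock Definition md (R : realType) (c : R[i]) m n (F : plane R -> 'M[R[i]]_(m, n)) (p : plane R) :
    'M[R[i]]_(m, n) :=
  \matrix_(i, j) pd c (fun q => F q i j) p.

(** * Wirtinger derivatives *)

Section Wirtinger.
Variable R : realType.
Local Notation plane := (plane R).
Local Notation eu := (eu R).
Local Notation ev := (ev R).
Local Notation C := R[i].
Local Notation Re := complex.Re.
Local Notation Im := complex.Im.
Implicit Types (U W : set plane) (f g : plane -> C) (p q v : plane) (c d : C).

#[local] Opaque derive derivable Defs.eu Defs.ev.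

Definition smoothC U f := smooth_on U (fun p => Re (f p)) /\ smooth_on U (fun p => Im (f p)).

Definition derC v f p := derivable (fun q => Re (f q)) p v /\ derivable (fun q => Im (f q)) p v.

Lemma Re_add (x y : C) : Re (x + y) = Re x + Re y. Proof. by case: x; case: y. Qed.
Lemma Im_add (x y : C) : Im (x + y) = Im x + Im y. Proof. by case: x; case: y. Qed.
Lemma Re_opp (x : C) : Re (- x) = - Re x. Proof. by case: x. Qed.
Lemma Im_opp (x : C) : Im (- x) = - Im x. Proof. by case: x. Qed.
Lemma Re_mul (x y : C) : Re (x * y) = Re x * Re y - Im x * Im y. Proof. by case: x; case: y. Qed.
Lemma Im_mul (x y : C) : Im (x * y) = Re x * Im y + Im x * Re y. Proof. by case: x; case: y. Qed.
Lemma Re_conj (x : C) : Re (conjc x) = Re x. Proof. by case: x. Qed.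
Lemma Im_conj (x : C) : Im (conjc x) = - Im x. Proof. by case: x. Qed.

Lemma conjcM (x y : C) : conjc (x * y) = conjc x * conjc y. Proof. exact: rmorphM. Qed.
Lemma conjcD (x y : C) : conjc (x + y) = conjc x + conjc y. Proof. exact: rmorphD. Qed.
Lemma conjcN (x : C) : conjc (- x) = - conjc x. Proof. exact: rmorphN. Qed.

Lemma Dc_cst v c p : Dc v (fun=> c) p = 0.
Proof. by rewrite /Dc !derive_cst. Qed.

Lemma Dc_add v f g p : derC v f p -> derC v g p -> Dc v (fun q => f q + g q) p = Dc v f p + Dc v g p.
Proof.
move=> [f1 f2] [g1 g2]; rewrite /Dc.
have -> : (fun q => Re (f q + g q)) = (fun q => Re (f q)) \+ (fun q => Re (g q)).
  by apply/funext => q; rewrite Re_add.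
have -> : (fun q => Im (f q + g q)) = (fun q => Im (f q)) \+ (fun q => Im (g q)).
  by apply/funext => q; rewrite Im_add.
by rewrite (deriveD f1 g1) (deriveD f2 g2).
Qed.

Lemma Dc_mul v f g p : derC v f p -> derC v g p ->
  Dc v (fun q => f q * g q) p = Dc v f p * g p + f p * Dc v g p.
Proof.
move=> [f1 f2] [g1 g2]; rewrite /Dc.
have -> : (fun q => Re (f q * g q)) = (fun q => Re (f q)) * (fun q => Re (g q)) - (fun q => Im (f q)) * (fun q => Im (g q)).
  by apply/funext => q; rewrite Re_mul.
have -> : (fun q => Im (f q * g q)) = (fun q => Re (f q)) * (fun q => Im (g q)) + (fun q => Im (f q)) * (fun q => Re (g q)).
  by apply/funext => q; rewrite Im_mul.
rewrite (deriveB (derivableM f1 g1) (derivableM f2 g2)) (deriveD (derivableM f1 g2) (derivableM f2 g1)).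
rewrite (deriveM f1 g1) (deriveM f2 g2) (deriveM f1 g2) (deriveM f2 g1).
move: ('D_v _ p) ('D_v _ p) ('D_v _ p) ('D_v _ p) => ? ? ? ?; case: (f p) => a b; case: (g p) => a' b' /=.
rewrite /GRing.scale /=; apply/eqP; rewrite eq_complex /=; apply/andP; split; apply/eqP; ring.
Qed.

Lemma Dc_conj v f p : derC v f p -> Dc v (fun q => conjc (f q)) p = conjc (Dc v f p).
Proof.
move=> [f1 f2]; rewrite /Dc /=.
have -> : (fun q => Re (conjc (f q))) = (fun q => Re (f q)).
  by apply/funext => q; rewrite Re_conj.
have -> : (fun q => Im (conjc (f q))) = - (fun q => Im (f q)).
  by apply/funext => q; rewrite Im_conj.
by rewrite deriveN.
Qed.

Lemma smoothC_derC U f p : smoothC U f -> U p -> derC eu f p /\ derC ev f p.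
Proof.
move=> [f1 f2] Up; have := f1 1%N; have := f2 1%N; rewrite !Ck_onE => -[_ [d1 _]] [_ [d2 _]].
by have [a1 a2] := d1 p Up; have [b1 b2] := d2 p Up; split; split; [exact: b1|exact: a1|exact: b2|exact: a2].
Qed.

Lemma pd_cst c d p : pd c (fun=> d) p = 0.
Proof. by rewrite pd.unlock !Dc_cst mulr0 addr0 mulr0. Qed.

Lemma pd_add U c f g p : U p -> smoothC U f -> smoothC U g ->
  pd c (fun q => f q + g q) p = pd c f p + pd c g p.
Proof.
move=> Up /smoothC_derC/(_ Up)[fu fv] /smoothC_derC/(_ Up)[gu gv].
rewrite !pd.unlock (Dc_add fu gu) (Dc_add fv gv).
move: (Dc _ f p) (Dc _ f p) (Dc _ g p) (Dc _ g p) => ? ? ? ?; ring.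
Qed.

Lemma pd_mul U c f g p : U p -> smoothC U f -> smoothC U g ->
  pd c (fun q => f q * g q) p = pd c f p * g p + f p * pd c g p.
Proof.
move=> Up /smoothC_derC/(_ Up)[fu fv] /smoothC_derC/(_ Up)[gu gv].
rewrite !pd.unlock (Dc_mul fu gu) (Dc_mul fv gv).
move: (Dc _ f p) (Dc _ f p) (Dc _ g p) (Dc _ g p) (f p) (g p) => ? ? ? ? ? ?; ring.
Qed.

Lemma pd_conj U c f p : U p -> smoothC U f ->
  pd c (fun q => conjc (f q)) p = conjc (pd (conjc c) f p).
Proof.
move=> Up /smoothC_derC/(_ Up)[fu fv].
rewrite !pd.unlock (Dc_conj fu) (Dc_conj fv) conjcM conjcD conjcM conjcK.
by rewrite conjc_inv conjc_nat.
Qed.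

Lemma pd_eq U c f g p : open U -> U p -> (forall q, U q -> f q = g q) -> pd c f p = pd c g p.
Proof.
move=> oU Up fg; rewrite !pd.unlock /Dc.
have r q : U q -> Re (f q) = Re (g q) by move=> /fg ->.
have i q : U q -> Im (f q) = Im (g q) by move=> /fg ->.
by rewrite !(eq_on_derive _ oU Up r) !(eq_on_derive _ oU Up i).
Qed.

Lemma smoothC_eq U f g : open U -> (forall q, U q -> f q = g q) -> smoothC U f -> smoothC U g.
Proof.
move=> oU fg [f1 f2]; split=> k.
  by apply: (Ck_on_eq oU _ (f1 k)) => q /fg ->.
by apply: (Ck_on_eq oU _ (f2 k)) => q /fg ->.
Qed.

Lemma smoothC_sub U W f : W `<=` U -> smoothC U f -> smoothC W f.
Proof. by move=> WU [f1 f2]; split=> k; apply: (Ck_on_sub WU). Qed.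

Lemma smoothC_cst U c : open U -> smoothC U (fun=> c).
Proof. by move=> oU; split=> k; exact: Ck_cst. Qed.

Lemma smoothC_real U (r : plane -> R) : open U -> smooth_on U r -> smoothC U (fun p => (r p)%:C).
Proof. by move=> oU sr; split=> k /=; [exact: sr|exact: Ck_cst]. Qed.

Lemma smoothC_add U f g : open U -> smoothC U f -> smoothC U g -> smoothC U (fun p => f p + g p).
Proof.
move=> oU [f1 f2] [g1 g2]; split=> k.
  by apply: (Ck_on_eq oU _ (Ck_add oU (f1 k) (g1 k))) => q _; rewrite Re_add.
by apply: (Ck_on_eq oU _ (Ck_add oU (f2 k) (g2 k))) => q _; rewrite Im_add.
Qed.

Lemma smoothC_opp U f : open U -> smoothC U f -> smoothC U (fun p => - f p).
Proof.
move=> oU [f1 f2]; split=> k.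
  by apply: (Ck_on_eq oU _ (Ck_opp oU (f1 k))) => q _; rewrite Re_opp.
by apply: (Ck_on_eq oU _ (Ck_opp oU (f2 k))) => q _; rewrite Im_opp.
Qed.

Lemma smoothC_mul U f g : open U -> smoothC U f -> smoothC U g -> smoothC U (fun p => f p * g p).
Proof.
move=> oU [f1 f2] [g1 g2]; split=> k.
  by apply: (Ck_on_eq oU _ (Ck_add oU (Ck_mul oU (f1 k) (g1 k)) (Ck_opp oU (Ck_mul oU (f2 k) (g2 k))))) => q _; rewrite Re_mul.
by apply: (Ck_on_eq oU _ (Ck_add oU (Ck_mul oU (f1 k) (g2 k)) (Ck_mul oU (f2 k) (g1 k)))) => q _; rewrite Im_mul.
Qed.

Lemma smoothC_conj U f : open U -> smoothC U f -> smoothC U (fun p => conjc (f p)).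
Proof.
move=> oU [f1 f2]; split=> k.
  by apply: (Ck_on_eq oU _ (f1 k)) => q _; rewrite Re_conj.
by apply: (Ck_on_eq oU _ (Ck_opp oU (f2 k))) => q _; rewrite Im_conj.
Qed.

Lemma smoothC_exp U f n : open U -> smoothC U f -> smoothC U (fun p => f p ^+ n).
Proof.
move=> oU sf; elim: n => [|n IH].
  by apply: (smoothC_eq oU _ (smoothC_cst 1 oU)) => q _; rewrite expr0.
by apply: (smoothC_eq oU _ (smoothC_mul oU sf IH)) => q _; rewrite exprS.
Qed.

Lemma nsq_eq0 (x : C) : (Re x ^+ 2 + Im x ^+ 2 == 0) = (x == 0).
Proof. by case: x => a b; rewrite /= paddr_eq0 ?sqr_ge0 // !sqrf_eq0 eq_complex. Qed.

Lemma smoothC_inv U f : open U -> (forall p, U p -> f p != 0) -> smoothC U f -> smoothC U (fun p => (f p)^-1).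
Proof.
move=> oU f0 [f1 f2].
have n0 p : U p -> Re (f p) * Re (f p) + Im (f p) * Im (f p) != 0.
  by move=> /f0; rewrite -nsq_eq0 !expr2.
have cn k := Ck_inv oU n0 (Ck_add oU (Ck_mul oU (f1 k) (f1 k)) (Ck_mul oU (f2 k) (f2 k))).
split=> k.
  by apply: (Ck_on_eq oU _ (Ck_mul oU (f1 k) (cn k))) => q _; case: (f q) => a b /=; rewrite !expr2.
by apply: (Ck_on_eq oU _ (Ck_opp oU (Ck_mul oU (f2 k) (cn k)))) => q _; case: (f q) => a b /=; rewrite !expr2.
Qed.

Lemma smoothC_Dc U f : open U -> smoothC U f -> smoothC U (Dc eu f) /\ smoothC U (Dc ev f).
Proof.
move=> oU [f1 f2]; split; split=> k /=.
- exact: Ck_on_Du (f1 k.+1).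
- exact: Ck_on_Du (f2 k.+1).
- exact: Ck_on_Dv (f1 k.+1).
- exact: Ck_on_Dv (f2 k.+1).
Qed.

Lemma smoothC_pd U c f : open U -> smoothC U f -> smoothC U (pd c f).
Proof.
move=> oU sf; have [su sv] := smoothC_Dc oU sf; rewrite pd.unlock.
apply: (smoothC_mul oU (smoothC_cst _ oU)).
by apply: (smoothC_add oU su); exact: (smoothC_mul oU (smoothC_cst _ oU)).
Qed.

Lemma Dc_comm U f p : open U -> U p -> smoothC U f -> Dc ev (Dc eu f) p = Dc eu (Dc ev f) p.
Proof.
move=> oU Up [f1 f2]; rewrite /Dc /=.
by rewrite (schwarz oU Up (f1 2%N)) (schwarz oU Up (f2 2%N)).
Qed.

Lemma Dc_scale v c f p : derC v f p -> Dc v (fun q => c * f q) p = c * Dc v f p.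
Proof.
move=> df; have dc : derC v (fun=> c) p by split; exact: derivable_cst.
by rewrite (Dc_mul dc df) Dc_cst mul0r add0r.
Qed.

Lemma pd_comm U c d f p : open U -> U p -> smoothC U f -> pd c (pd d f) p = pd d (pd c f) p.
Proof.
move=> oU Up sf; have [su sv] := smoothC_Dc oU sf.
have [uu uv] := smoothC_derC su Up; have [vu vv] := smoothC_derC sv Up.
have cd e : smoothC U (fun q => e * Dc ev f q) by exact: (smoothC_mul oU (smoothC_cst _ oU)).
have key v e : (v = eu \/ v = ev) -> Dc v (pd e f) p = 2^-1 * (Dc v (Dc eu f) p + e * Dc v (Dc ev f) p).
  have sd := smoothC_add oU su (cd e); rewrite pd.unlock.
  case=> ->.
    rewrite Dc_scale; last exact: (smoothC_derC sd Up).1.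
    by rewrite (Dc_add uu (smoothC_derC (cd e) Up).1) (Dc_scale _ vu).
  rewrite Dc_scale; last exact: (smoothC_derC sd Up).2.
  by rewrite (Dc_add uv (smoothC_derC (cd e) Up).2) (Dc_scale _ vv).
have ku e := key eu e (or_introl erefl); have kv e := key ev e (or_intror erefl).
have E e e' : pd e (pd e' f) p = 2^-1 * (Dc eu (pd e' f) p + e * Dc ev (pd e' f) p) by rewrite {1}pd.unlock.
rewrite !E !ku !kv (Dc_comm oU Up sf).
move: (Dc _ _ p) (Dc _ _ p) (Dc _ _ p) => ? ? ?; ring.
Qed.

Lemma smoothC_sum U (I : Type) (r : seq I) (F : I -> plane -> C) : open U ->
  (forall i, smoothC U (F i)) -> smoothC U (fun p => \sum_(i <- r) F i p).
Proof.
move=> oU sF; elim: r => [|x r IH].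
  by apply: (smoothC_eq oU _ (smoothC_cst 0 oU)) => q _; rewrite big_nil.
by apply: (smoothC_eq oU _ (smoothC_add oU (sF x) IH)) => q _; rewrite big_cons.
Qed.

Lemma pd_sum U c (I : Type) (r : seq I) (F : I -> plane -> C) p : open U -> U p ->
  (forall i, smoothC U (F i)) -> pd c (fun q => \sum_(i <- r) F i q) p = \sum_(i <- r) pd c (F i) p.
Proof.
move=> oU Up sF; elim: r => [|x r IH].
  rewrite [RHS]big_nil; transitivity (pd c (fun=> 0) p); last exact: pd_cst.
  by apply: (pd_eq _ oU Up) => q _; rewrite big_nil.
rewrite big_cons -IH -(pd_add c Up (sF x) (smoothC_sum r oU sF)).
by apply: (pd_eq _ oU Up) => q _; rewrite big_cons.
Qed.

Lemma pd_inv U c f p : open U -> U p -> (forall q, U q -> f q != 0) -> smoothC U f ->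
  pd c (fun q => (f q)^-1) p = - pd c f p / f p ^+ 2.
Proof.
move=> oU Up f0 sf; have := pd_mul c Up sf (smoothC_inv oU f0 sf).
have -> : pd c (fun q => f q / f q) p = 0.
  by rewrite -(pd_cst c 1 p); apply: (pd_eq _ oU Up) => q /f0 /divff.
have := f0 p Up; set x := f p; set y := pd c f p; set z := pd c _ p => x0 E.
apply: (mulfI x0); have -> : x * (- y / x ^+ 2) = - (y / x) by field.
by apply/eqP; rewrite -addr_eq0 addrC -E.
Qed.

Lemma smoothC_cont U f p : smoothC U f -> U p ->
  {for p, continuous (fun q => Re (f q))} /\ {for p, continuous (fun q => Im (f q))}.
Proof. by move=> [f1 f2] Up; split; [exact: (Ck_on_cont (f1 0%N) Up)|exact: (Ck_on_cont (f2 0%N) Up)]. Qed.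


Definition smoothM U m n (F : plane -> 'M[C]_(m, n)) := forall i j, smoothC U (fun p => F p i j).

Lemma mdE c m n (F : plane -> 'M[C]_(m, n)) p i j : md c F p i j = pd c (fun q => F q i j) p.
Proof. by rewrite md.unlock mxE. Qed.

Lemma md_cst c m n (A : 'M[C]_(m, n)) p : md c (fun=> A) p = 0.
Proof. by apply/matrixP => i j; rewrite !(mdE, mxE) pd_cst. Qed.

Lemma md_eq U c m n (F G : plane -> 'M[C]_(m, n)) p : open U -> U p ->
  (forall q, U q -> F q = G q) -> md c F p = md c G p.
Proof.
by move=> oU Up FG; apply/matrixP => i j; rewrite !(mdE, mxE); apply: (pd_eq _ oU Up) => q /FG ->.
Qed.

Lemma md_add U c m n (F G : plane -> 'M[C]_(m, n)) p : U p -> smoothM U F -> smoothM U G ->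
  md c (fun q => F q + G q) p = md c F p + md c G p.
Proof.
move=> Up sF sG; apply/matrixP => i j; rewrite !(mdE, mxE) -(pd_add c Up (sF i j) (sG i j)).
by congr pd; apply/funext => q; rewrite ?mdE ?mxE.
Qed.

Lemma md_mul U c m n k (F : plane -> 'M[C]_(m, n)) (G : plane -> 'M[C]_(n, k)) p :
  open U -> U p -> smoothM U F -> smoothM U G ->
  md c (fun q => F q *m G q) p = md c F p *m G p + F p *m md c G p.
Proof.
move=> oU Up sF sG; apply/matrixP => i j; rewrite !(mdE, mxE).
transitivity (pd c (fun q => \sum_k F q i k * G q k j) p).
  by congr pd; apply/funext => q; rewrite ?mdE ?mxE.
rewrite (pd_sum c _ oU Up); last by move=> l; exact: (smoothC_mul oU (sF i l) (sG l j)).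
rewrite -big_split; apply: eq_bigr => l _ /=.
by rewrite (pd_mul c Up (sF i l) (sG l j)) !mdE.
Qed.

Lemma md_scale U c m n (a : plane -> C) (F : plane -> 'M[C]_(m, n)) p :
  U p -> smoothC U a -> smoothM U F ->
  md c (fun q => a q *: F q) p = pd c a p *: F p + a p *: md c F p.
Proof.
move=> Up sa sF; apply/matrixP => i j; rewrite !(mdE, mxE) -(pd_mul c Up sa (sF i j)).
by congr pd; apply/funext => q; rewrite ?mdE ?mxE.
Qed.

Lemma md_tr c m n (F : plane -> 'M[C]_(m, n)) p : md c (fun q => (F q)^T) p = (md c F p)^T.
Proof. by apply/matrixP => i j; rewrite !(mdE, mxE); congr pd; apply/funext => q; rewrite ?mdE ?mxE. Qed.

Lemma md_conj U c m n (F : plane -> 'M[C]_(m, n)) p : U p -> smoothM U F ->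
  md c (fun q => conj_cmx (F q)) p = conj_cmx (md (conjc c) F p).
Proof.
move=> Up sF; apply/matrixP => i j; rewrite !(mdE, mxE) -(pd_conj c Up (sF i j)).
by congr pd; apply/funext => q; rewrite ?mdE ?mxE.
Qed.

Lemma md_comm U c d m n (F : plane -> 'M[C]_(m, n)) p : open U -> U p -> smoothM U F ->
  md c (md d F) p = md d (md c F) p.
Proof.
move=> oU Up sF; apply/matrixP => i j; rewrite !(mdE, mxE).
transitivity (pd c (pd d (fun q => F q i j)) p).
  by congr pd; apply/funext => q; rewrite ?mdE ?mxE.
rewrite (pd_comm c d oU Up (sF i j)).
by congr pd; apply/funext => q; rewrite ?mdE ?mxE.
Qed.

Lemma smoothM_eq U m n (F G : plane -> 'M[C]_(m, n)) : open U -> (forall q, U q -> F q = G q) ->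
  smoothM U F -> smoothM U G.
Proof. by move=> oU FG sF i j; apply: (smoothC_eq oU _ (sF i j)) => q /FG ->. Qed.

Lemma smoothM_sub U W m n (F : plane -> 'M[C]_(m, n)) : W `<=` U -> smoothM U F -> smoothM W F.
Proof. by move=> WU sF i j; apply: (smoothC_sub WU). Qed.

Lemma smoothM_cst U m n (A : 'M[C]_(m, n)) : open U -> smoothM U (fun=> A).
Proof. by move=> oU i j; exact: smoothC_cst. Qed.

Lemma smoothM_add U m n (F G : plane -> 'M[C]_(m, n)) : open U -> smoothM U F -> smoothM U G ->
  smoothM U (fun q => F q + G q).
Proof.
by move=> oU sF sG i j; apply: (smoothC_eq oU _ (smoothC_add oU (sF i j) (sG i j))) => q _; rewrite ?mdE ?mxE.
Qed.

Lemma smoothM_opp U m n (F : plane -> 'M[C]_(m, n)) : open U -> smoothM U F ->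
  smoothM U (fun q => - F q).
Proof. by move=> oU sF i j; apply: (smoothC_eq oU _ (smoothC_opp oU (sF i j))) => q _; rewrite ?mdE ?mxE. Qed.

Lemma smoothM_scale U m n (a : plane -> C) (F : plane -> 'M[C]_(m, n)) : open U -> smoothC U a ->
  smoothM U F -> smoothM U (fun q => a q *: F q).
Proof.
by move=> oU sa sF i j; apply: (smoothC_eq oU _ (smoothC_mul oU sa (sF i j))) => q _; rewrite ?mdE ?mxE.
Qed.

Lemma smoothM_mul U m n k (F : plane -> 'M[C]_(m, n)) (G : plane -> 'M[C]_(n, k)) : open U ->
  smoothM U F -> smoothM U G -> smoothM U (fun q => F q *m G q).
Proof.
move=> oU sF sG i j.
have := smoothC_sum (index_enum 'I_n) oU (fun l => smoothC_mul oU (sF i l) (sG l j)).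
by apply: (smoothC_eq oU) => q _; rewrite ?mdE ?mxE.
Qed.

Lemma smoothM_tr U m n (F : plane -> 'M[C]_(m, n)) : open U -> smoothM U F -> smoothM U (fun q => (F q)^T).
Proof. by move=> oU sF i j; apply: (smoothC_eq oU _ (sF j i)) => q _; rewrite ?mdE ?mxE. Qed.

Lemma smoothM_conj U m n (F : plane -> 'M[C]_(m, n)) : open U -> smoothM U F ->
  smoothM U (fun q => conj_cmx (F q)).
Proof.
by move=> oU sF i j; apply: (smoothC_eq oU _ (smoothC_conj oU (sF i j))) => q _; rewrite ?mdE ?mxE.
Qed.

Lemma smoothM_md U c m n (F : plane -> 'M[C]_(m, n)) : open U -> smoothM U F -> smoothM U (md c F).
Proof.
by move=> oU sF i j; apply: (smoothC_eq oU _ (smoothC_pd c oU (sF i j))) => q _; rewrite ?mdE ?mxE.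
Qed.

Lemma md_opp U c m n (F : plane -> 'M[C]_(m, n)) p : open U -> U p -> smoothM U F ->
  md c (fun q => - F q) p = - md c F p.
Proof.
move=> oU Up sF; have := md_scale c Up (smoothC_cst (-1) oU) sF.
rewrite pd_cst scale0r add0r scaleN1r => <-.
by congr md; apply/funext => q; rewrite scaleN1r.
Qed.

Lemma dzE n (F : plane -> 'rV[C]_n) : dz F = md (- 'i%C) F.
Proof.
apply/funext => p; apply/matrixP => i j; rewrite !(mdE, mxE) pd.unlock ord1 mulNr.
by [].
Qed.

Lemma dzbarE n (F : plane -> 'rV[C]_n) : dzbar F = md 'i%C F.
Proof. by apply/funext => p; apply/matrixP => i j; rewrite !(mdE, mxE) pd.unlock ord1. Qed.

Lemma smooth_crowE n U (F : plane -> 'rV[C]_n) : smooth_crow_on U F <-> smoothM U F.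
Proof. by split=> [H i j|H j]; [rewrite ord1; exact: H|exact: H]. Qed.

End Wirtinger.

(** * Conformal lifts and their structure equations *)

Section LorentzForm.
Variable R : realType.
Local Notation plane := (plane R).
Local Notation C := R[i].
Implicit Types (x y z : 'rV[C]_8) (a : C).

Lemma lorentz_mx x y : x *m lorentz_metric C *m y^T = (lorentz x y)%:M.
Proof. exact: mx11_scalar. Qed.

Lemma lorentzE x y : lorentz x y = \sum_j (if j == 0 then -1 else 1) * x 0 j * y 0 j.
Proof.
rewrite /lorentz /lorentz_metric mxE; apply: eq_bigr => j _.
by rewrite mul_mx_diag !mxE mulrC [x 0 j * _]mulrC mulrC.
Qed.

Lemma lorentzC x y : lorentz x y = lorentz y x.
Proof. by rewrite !lorentzE; apply: eq_bigr => j _; rewrite mulrAC. Qed.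

Lemma lorentzDl x y z : lorentz (x + y) z = lorentz x z + lorentz y z.
Proof. by rewrite /lorentz !mulmxDl mxE. Qed.

Lemma lorentzDr x y z : lorentz z (x + y) = lorentz z x + lorentz z y.
Proof. by rewrite lorentzC lorentzDl ![lorentz _ z]lorentzC. Qed.

Lemma lorentzZl a x y : lorentz (a *: x) y = a * lorentz x y.
Proof. by rewrite /lorentz -!scalemxAl mxE. Qed.

Lemma lorentzZr a x y : lorentz x (a *: y) = a * lorentz x y.
Proof. by rewrite lorentzC lorentzZl lorentzC. Qed.

Lemma lorentzNl x y : lorentz (- x) y = - lorentz x y.
Proof. by rewrite -scaleN1r lorentzZl mulN1r. Qed.

Lemma lorentzNr x y : lorentz x (- y) = - lorentz x y.
Proof. by rewrite -scaleN1r lorentzZr mulN1r. Qed.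

Lemma lorentz0l y : lorentz 0 y = 0.
Proof. by rewrite /lorentz !mul0mx mxE. Qed.

Lemma lorentz0r y : lorentz y 0 = 0.
Proof. by rewrite lorentzC lorentz0l. Qed.

Definition lorentz_lin := (lorentzDl, lorentzDr, lorentzZl, lorentzZr, lorentzNl, lorentzNr).

Lemma lorentz_conj x y : lorentz (conj_cmx x) (conj_cmx y) = conjc (lorentz x y).
Proof.
rewrite !lorentzE (raddf_sum (@conjc R)); apply: eq_bigr => j _ /=.
by rewrite !mxE conjcM conjcM; case: ifP => _; rewrite ?conjcN conjc1.
Qed.

Lemma conj_cmxK m n (A : 'M[C]_(m, n)) : conj_cmx (conj_cmx A) = A.
Proof. by apply/matrixP => i j; rewrite !mxE conjcK. Qed.

Lemma conj_cmxD m n (A B : 'M[C]_(m, n)) : conj_cmx (A + B) = conj_cmx A + conj_cmx B.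
Proof. by apply/matrixP => i j; rewrite !mxE conjcD. Qed.

Lemma conj_cmxZ m n a (A : 'M[C]_(m, n)) : conj_cmx (a *: A) = conjc a *: conj_cmx A.
Proof. by apply/matrixP => i j; rewrite !mxE conjcM. Qed.

Lemma conj_cmxN m n (A : 'M[C]_(m, n)) : conj_cmx (- A) = - conj_cmx A.
Proof. by apply/matrixP => i j; rewrite !mxE conjcN. Qed.

Lemma conj_cmxM m n k (A : 'M[C]_(m, n)) (B : 'M[C]_(n, k)) : conj_cmx (A *m B) = conj_cmx A *m conj_cmx B.
Proof. exact: map_mxM. Qed.

Lemma conj_cmx_tr m n (A : 'M[C]_(m, n)) : conj_cmx A^T = (conj_cmx A)^T.
Proof. by apply/matrixP => i j; rewrite !mxE. Qed.

Lemma lorentz_conjl x y : lorentz (conj_cmx x) y = conjc (lorentz x (conj_cmx y)).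
Proof. by rewrite -lorentz_conj conj_cmxK. Qed.

Lemma lorentz_conjr x y : lorentz x (conj_cmx y) = conjc (lorentz (conj_cmx x) y).
Proof. by rewrite -lorentz_conj conj_cmxK. Qed.

Lemma lorentz_metricK : lorentz_metric C *m lorentz_metric C = 1%:M.
Proof.
rewrite /lorentz_metric mulmx_diag -diag_const_mx; congr diag_mx.
by apply/rowP => j; rewrite !mxE; case: ifP => _; rewrite ?mulN1r ?opprK ?mulr1.
Qed.

Lemma lorentz_row n x (B : 'M[C]_(n, 8)) i : (x *m lorentz_metric C *m B^T) 0 i = lorentz x (row i B).
Proof. by rewrite /lorentz [LHS]mxE [RHS]mxE; apply: eq_bigr => k _; rewrite !mxE. Qed.

Lemma nondegenerate8 (b : 'I_8 -> 'rV[C]_8) x :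
  (forall c : 'rV[C]_8, \sum_i c 0 i *: b i = 0 -> c = 0) ->
  (forall i, lorentz x (b i) = 0) -> x = 0.
Proof.
move=> free H; pose B := \matrix_i b i.
have Bu : B \in unitmx.
  rewrite -row_free_unit; apply: inj_row_free => c cB; apply: free.
  transitivity (c *m B); last exact: cB.
  by rewrite mulmx_sum_row; apply: eq_bigr => i _; rewrite rowK.
have xB : x *m lorentz_metric C *m B^T = 0.
  by apply/rowP => i; rewrite lorentz_row rowK H mxE.
have : x *m lorentz_metric C = 0.
  have BTu : B^T \in unitmx by rewrite unitmx_tr.
  by rewrite -(mulmxK BTu (x *m lorentz_metric C)) xB mul0mx.
by move=> /(congr1 (mulmx^~ (lorentz_metric C))); rewrite -mulmxA lorentz_metricK mulmx1 mul0mx.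
Qed.

Lemma dyadE (u v : 'rV[C]_8) i j : (u^T *m v) i j = u 0 i * v 0 j.
Proof. by rewrite mxE big_ord1 mxE. Qed.

Lemma wedge_dbar_conj (a b y z : 'rV[C]_8) :
  (conj_cmx (2 *: (y^T *m a - a^T *m y) - 2 *: (z^T *m b - b^T *m z)))^T =
  2 *: ((conj_cmx a)^T *m conj_cmx y - (conj_cmx y)^T *m conj_cmx a)
  - 2 *: ((conj_cmx b)^T *m conj_cmx z - (conj_cmx z)^T *m conj_cmx b).
Proof.
apply/matrixP => i j; rewrite !(dyadE, mxE).
move: (a _ _) (a _ _) (b _ _) (b _ _) (y _ _) (y _ _) (z _ _) (z _ _) => a1 a2 b1 b2 y1 y2 z1 z2.
have c2 : conjc (2 : C) = 2 by exact: conjc_nat.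
rewrite conjcD conjcN !conjcM c2 !conjcD !conjcN !conjcM; ring.
Qed.

Lemma lorentz_comb (x n y v u z : 'rV[C]_8) (a b c d : C) :
  lorentz (x + a *: y + b *: n - c *: v - d *: u) z =
  lorentz x z + a * lorentz y z + b * lorentz n z - c * lorentz v z - d * lorentz u z.
Proof. by rewrite !(lorentzDl, lorentzNl, lorentzZl). Qed.

Lemma conj_cmx_comb (x n y v u : 'rV[C]_8) (a b c d : C) :
  conj_cmx (x + a *: y + b *: n - c *: v - d *: u) =
  conj_cmx x + conjc a *: conj_cmx y + conjc b *: conj_cmx n - conjc c *: conj_cmx v - conjc d *: conj_cmx u.
Proof. by rewrite !(conj_cmxD, conj_cmxN, conj_cmxZ). Qed.

Lemma gram_conj (k e : 'rV[C]_8) :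
  conjc (lorentz k (conj_cmx k) * lorentz e (conj_cmx e) - lorentz k (conj_cmx e) * lorentz e (conj_cmx k)) =
  lorentz k (conj_cmx k) * lorentz e (conj_cmx e) - lorentz k (conj_cmx e) * lorentz e (conj_cmx k).
Proof.
have s (x y : 'rV[C]_8) : conjc (lorentz x (conj_cmx y)) = lorentz y (conj_cmx x).
  by rewrite -lorentz_conj conj_cmxK lorentzC.
have D (a b c d : C) : conjc a = a -> conjc b = b -> conjc c = d -> conjc d = c -> conjc (a * b - c * d) = a * b - c * d.
  by move=> ea eb ec ed; rewrite conjcD conjcN !conjcM ea eb ec ed [d * c]mulrC.
exact: D.
Qed.

Lemma comb8_last (g0 g1 g2 g3 g4 g5 g6 g7 a0 a1 a2 a3 a4 a5 a6 a7 : C) :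
  g0 * a0 + (g1 * a1 + (g2 * a2 + (g3 * a3 + (g4 * a4 + (g5 * a5 + (g6 * a6 + g7 * a7)))))) = 0 ->
  g0 = 0 -> g1 = 0 -> g2 = 0 -> g3 = 0 -> (a6 = 0 -> a7 = 0 -> g4 * a4 + g5 * a5 = 0) /\
  (a4 = 0 -> a5 = 0 -> g6 * a6 + g7 * a7 = 0).
Proof.
move=> E e0 e1 e2 e3; move: E; rewrite e0 e1 e2 e3 !mul0r !add0r => E.
by split=> z1 z2; move: E; rewrite z1 z2 !mulr0 ?addr0 ?add0r.
Qed.

Lemma conj_tr_diff (A B : 'M[C]_8) :
  (conj_cmx (2 *: A - 2 *: B))^T = 2 *: (conj_cmx A)^T - 2 *: (conj_cmx B)^T.
Proof.
apply/matrixP => i j; rewrite !mxE.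
have c2 : conjc (2 : C) = 2 by exact: conjc_nat.
by rewrite conjcD conjcN !conjcM c2.
Qed.

(** In the application [S] is the bivector [kap ^ eta], [y] and [z] are [Y] and [Y_zbar], which [S]
    annihilates, and [a] and [b] are the conjugates of [alphav] and [betav], which [S] sends to
    multiples of [eta] and [kap]. *)
Lemma planeP_dd_aux (L S : 'M[C]_8) (a b y z e k : 'rV[C]_8) (w : C) :
  y *m L *m S = 0 -> z *m L *m S = 0 -> a *m L *m S = - w *: e -> b *m L *m S = - w *: k ->
  L *m (2 *: (a^T *m y - y^T *m a) - 2 *: (b^T *m z - z^T *m b)) *m L *m S =
  w *: (2 *: (L *m y^T *m e) - 2 *: (L *m z^T *m k)).
Proof.
move=> h1 h2 h3 h4.
have M (u v : 'rV[C]_8) : L *m (u^T *m v) *m L *m S = L *m u^T *m (v *m L *m S) by rewrite !mulmxA.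
have D (P Q : 'M[C]_8) : L *m (2 *: P - 2 *: Q) *m L *m S = 2 *: (L *m P *m L *m S) - 2 *: (L *m Q *m L *m S).
  by rewrite mulmxBr -!scalemxAr !mulmxBl -!scalemxAl.
have B (P Q : 'M[C]_8) : L *m (P - Q) *m L *m S = L *m P *m L *m S - L *m Q *m L *m S.
  by rewrite mulmxBr !mulmxBl.
have E1 : L *m (a^T *m y) *m L *m S = 0 by rewrite M h1 mulmx0.
have E2 : L *m (b^T *m z) *m L *m S = 0 by rewrite M h2 mulmx0.
have E3 : L *m (y^T *m a) *m L *m S = - w *: (L *m y^T *m e) by rewrite M h3 -scalemxAr.
have E4 : L *m (z^T *m b) *m L *m S = - w *: (L *m z^T *m k) by rewrite M h4 -scalemxAr.
rewrite D (B (a^T *m y) (y^T *m a)) E1 E3 (B (b^T *m z) (z^T *m b)) E2 E4; move: (L *m y^T *m e) (L *m z^T *m k) => A A'.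
apply/matrixP => i j; rewrite !mxE; move: (A i j) (A' i j) => u v; ring.
Qed.

Lemma planeP_dd_aux1 (k e : 'rV[C]_8) (A B D E : C) :
  (D * B - E * A) *: e - (D * E - E * D) *: k = - (A * E - B * D) *: e.
Proof. apply/rowP => j; rewrite !mxE; move: (k _ _) (e _ _) => k' e'; ring. Qed.

Lemma planeP_dd_aux2 (k e : 'rV[C]_8) (A B D E : C) :
  (A * B - B * A) *: e - (A * E - B * D) *: k = - (A * E - B * D) *: k.
Proof. apply/rowP => j; rewrite !mxE; move: (k _ _) (e _ _) => k' e'; ring. Qed.

Lemma planeP_dd_aux3 (A B : 'M[C]_8) (w l : C) : w != 0 ->
  - (l * w) / w ^+ 2 *: A + w^-1 *: (w *: B + l *: A) = B.
Proof.
move=> w0; rewrite scalerDr !scalerA mulVf // scale1r addrCA -scalerDl.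
have -> : - (l * w) / w ^+ 2 + w^-1 * l = 0 by field.
by rewrite scale0r addr0.
Qed.

(** Algebra behind [wedge_db]: the products [e ^ e] and [k ^ k] cancel, and the rest is regrouped
    around [y] and [v]. *)
Lemma wedge_db_aux (k e y v : 'rV[C]_8) (a b c d t : C) :
  (e + (2 * b) *: y - (2 * a) *: v)^T *m e + k^T *m (- t *: k + (2 * d) *: y - (2 * c) *: v)
  - ((- t *: k + (2 * d) *: y - (2 * c) *: v)^T *m k + e^T *m (e + (2 * b) *: y - (2 * a) *: v)) =
  2 *: (y^T *m (b *: e - d *: k) - (b *: e - d *: k)^T *m y)
  - 2 *: (v^T *m (a *: e - c *: k) - (a *: e - c *: k)^T *m v).
Proof.
apply/matrixP => i j; rewrite !(dyadE, mxE).
move: (k _ _) (k _ _) (e _ _) (e _ _) (y _ _) (y _ _) (v _ _) (v _ _) => k1 k2 e1 e2 y1 y2 v1 v2.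
ring.
Qed.

Variables (U : set plane) (oU : open U).

Lemma smoothC_lorentz (F G : plane -> 'rV[C]_8) : smoothM U F -> smoothM U G ->
  smoothC U (fun q => lorentz (F q) (G q)).
Proof.
move=> sF sG; apply: (smoothM_mul oU (smoothM_mul oU sF (smoothM_cst _ oU)) (smoothM_tr oU sG)).
Qed.

Lemma pd_lorentz c (F G : plane -> 'rV[C]_8) p : U p -> smoothM U F -> smoothM U G ->
  pd c (fun q => lorentz (F q) (G q)) p = lorentz (md c F p) (G p) + lorentz (F p) (md c G p).
Proof.
move=> Up sF sG.
have -> : pd c (fun q => lorentz (F q) (G q)) p =
  md c (fun q => F q *m lorentz_metric C *m (G q)^T) p 0 0 by rewrite mdE.
have sL := smoothM_cst (lorentz_metric C) oU.
rewrite (md_mul c oU Up (smoothM_mul oU sF sL) (smoothM_tr oU sG)).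
by rewrite (md_mul c oU Up sF sL) md_cst mulmx0 addr0 md_tr mxE.
Qed.

Lemma pd_lorentz_cst c (F G : plane -> 'rV[C]_8) (k : C) p : U p -> smoothM U F -> smoothM U G ->
  (forall q, U q -> lorentz (F q) (G q) = k) ->
  lorentz (md c F p) (G p) = - lorentz (F p) (md c G p).
Proof.
move=> Up sF sG FG; apply/eqP; rewrite -addr_eq0 -(pd_lorentz c Up sF sG).
by rewrite (pd_eq c oU Up FG) pd_cst.
Qed.

End LorentzForm.

(** * Moving frame, Hopf differential and normal projection of a lift *)

HB.lock Definition liftW (R : realType) (Y : plane R -> 'rV[R[i]]_8) : plane R -> 'rV[R[i]]_8 :=
  md 'i%C (md (- 'i%C) Y).

(* The null vector field of [V] with [<Y, N> = -1] that is orthogonal to the derivatives of [Y]. *)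
HB.lock Definition liftN (R : realType) (Y : plane R -> 'rV[R[i]]_8) p :=
  2 *: liftW Y p + (2 * lorentz (liftW Y p) (liftW Y p)) *: Y p.

(** Pairing [Y_zz = - (s / 2) Y + kap] with [N], where [<Y, N> = -1] and [<kap, N> = 0], gives
    [s = 2 <Y_zz, N>]. *)
HB.lock Definition lift_schw (R : realType) (Y : plane R -> 'rV[R[i]]_8) p :=
  2 * lorentz (md (- 'i%C) (md (- 'i%C) Y) p) (liftN Y p).

HB.lock Definition lift_kap (R : realType) (Y : plane R -> 'rV[R[i]]_8) p :=
  md (- 'i%C) (md (- 'i%C) Y) p + (lift_schw Y p / 2) *: Y p.

(** Orthogonal projection to the normal bundle, by subtracting components in the frame [Y], [N],
    [Y_z], [Y_zbar], whose only nonzero products are [<Y, N> = -1] and [<Y_z, Y_zbar> = 1/2]. As a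
    right multiplication it is linear and smooth at sight; [nprojE] gives the vector form. *)
HB.lock Definition lift_proj (R : realType) (Y : plane R -> 'rV[R[i]]_8) p (x : 'rV[R[i]]_8) :=
  let L := lorentz_metric R[i] in let Yz := md (- 'i%C) Y p in let Yb := md 'i%C Y p in
  x *m (1%:M + L *m (liftN Y p)^T *m Y p + L *m (Y p)^T *m liftN Y p
    - 2 *: (L *m Yb^T *m Yz) - 2 *: (L *m Yz^T *m Yb)).

HB.lock Definition lift_eta (R : realType) (Y : plane R -> 'rV[R[i]]_8) p :=
  lift_proj Y p (md 'i%C (lift_kap Y) p).

(** The structure equations need only these properties of [Y] itself, so they apply to any chart and
    any restriction. The last clause carries the signature: [Y] and [Y_(z zbar)] span a Lorentzian
    plane, whose complement is therefore positive definite. *)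
Definition conformal_lift (R : realType) (U : set (plane R)) (Y : plane R -> 'rV[R[i]]_8) : Prop :=
  [/\ open U, smoothM U Y, forall p, conj_cmx (Y p) = Y p & forall p, U p ->
  [/\ lorentz (Y p) (Y p) = 0, lorentz (md (- 'i%C) Y p) (md (- 'i%C) Y p) = 0,
     lorentz (md (- 'i%C) Y p) (md 'i%C Y p) = 2^-1 &
     forall x, lorentz x (Y p) = 0 -> lorentz x (liftW Y p) = 0 -> x != 0 -> 0 < lorentz x (conj_cmx x)]].

Definition isotropic_willmore (R : realType) (U : set (plane R)) (Y : plane R -> 'rV[R[i]]_8) : Prop :=
  forall p, U p -> lorentz (lift_kap Y p) (lift_kap Y p) = 0 /\
    lift_proj Y p (md 'i%C (lift_eta Y) p) = - (conjc (lift_schw Y p) / 2) *: lift_kap Y p.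

Section ConformalLift.
Variable R : realType.
Local Notation plane := (plane R).
Local Notation C := R[i].
Local Notation dd := (md (- 'i%C)).
Local Notation db := (md 'i%C).
Variables (U : set plane) (Y : plane -> 'rV[C]_8).
Hypothesis HY : conformal_lift U Y.

Let oU : open U. Proof. by case: HY. Qed.
Let sY : smoothM U Y. Proof. by case: HY. Qed.
Let Y_real : forall p, conj_cmx (Y p) = Y p. Proof. by case: HY. Qed.
Let Y_null : forall p, U p -> lorentz (Y p) (Y p) = 0. Proof. by case: HY => _ _ _ H p /H[]. Qed.
Let Yz_null : forall p, U p -> lorentz (dd Y p) (dd Y p) = 0. Proof. by case: HY => _ _ _ H p /H[]. Qed.
Let Yz_norm : forall p, U p -> lorentz (dd Y p) (db Y p) = 2^-1. Proof. by case: HY => _ _ _ H p /H[]. Qed.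

Local Notation Yzb := (liftW Y).
Local Notation Nv := (liftN Y).
Local Notation schw := (lift_schw Y).
Local Notation kap := (lift_kap Y).
Local Notation nproj := (lift_proj Y).
Local Notation eta := (lift_eta Y).
#[local] Opaque lorentz conj_cmx.

Definition perp p (x : 'rV[C]_8) :=
  [/\ lorentz x (Y p) = 0, lorentz x (dd Y p) = 0, lorentz x (db Y p) = 0 & lorentz x (Yzb p) = 0].

Lemma YzbE : Yzb = db (dd Y). Proof. by rewrite liftW.unlock. Qed.
Lemma NvE p : Nv p = 2 *: Yzb p + (2 * lorentz (Yzb p) (Yzb p)) *: Y p. Proof. by rewrite liftN.unlock. Qed.
Lemma kapE p : kap p = dd (dd Y) p + (schw p / 2) *: Y p. Proof. by rewrite lift_kap.unlock. Qed.
Lemma schwE p : schw p = 2 * lorentz (dd (dd Y) p) (Nv p). Proof. by rewrite lift_schw.unlock. Qed.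
Lemma nprojE p x : nproj p x = x + lorentz x (Nv p) *: Y p + lorentz x (Y p) *: Nv p
  - (2 * lorentz x (db Y p)) *: dd Y p - (2 * lorentz x (dd Y p)) *: db Y p.
Proof.
rewrite lift_proj.unlock /= !mulmxBr !mulmxDr mulmx1 -!scalemxAr !mulmxA !lorentz_mx.
move: (Nv p) (Y p) (dd Y p) (db Y p) => n y v u.
move: (lorentz x n) (lorentz x y) (lorentz x v) (lorentz x u) => a b c d.
by rewrite !mul_scalar_mx !scalerA.
Qed.
Lemma etaE p : eta p = nproj p (db kap p). Proof. by rewrite lift_eta.unlock. Qed.

Lemma conjNi : conjc (- 'i%C) = 'i%C :> C. Proof. by rewrite /= !oppr0 opprK. Qed.
Lemma conj_i : conjc 'i%C = - 'i%C :> C.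
Proof. by apply/eqP; rewrite eq_complex /= oppr0 !eqxx. Qed.

Lemma sYz : smoothM U (dd Y). Proof. exact: smoothM_md. Qed.
Lemma sYb : smoothM U (db Y). Proof. exact: smoothM_md. Qed.
Lemma sYzb : smoothM U Yzb. Proof. rewrite YzbE; apply: smoothM_md => //; exact: sYz. Qed.
Lemma sYzz : smoothM U (dd (dd Y)). Proof. apply: smoothM_md => //; exact: sYz. Qed.
Lemma sNv : smoothM U Nv.
Proof.
apply: (smoothM_eq oU (fun q _ => esym (NvE q))).
apply: (smoothM_add oU (smoothM_scale oU (smoothC_cst _ oU) sYzb)).
apply: (smoothM_scale oU _ sY); apply: (smoothC_mul oU (smoothC_cst _ oU)).
exact: (smoothC_lorentz oU sYzb sYzb).
Qed.
Lemma s_schw : smoothC U schw.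
Proof. apply: (smoothC_eq oU (fun q _ => esym (schwE q))); exact: (smoothC_mul oU (smoothC_cst _ oU) (smoothC_lorentz oU sYzz sNv)). Qed.
Lemma s_kap : smoothM U kap.
Proof.
apply: (smoothM_eq oU (fun q _ => esym (kapE q))).
apply: (smoothM_add oU sYzz); apply: (smoothM_scale oU _ sY).
exact: (smoothC_mul oU s_schw (smoothC_cst _ oU)).
Qed.
Lemma s_nproj (F : plane -> 'rV[C]_8) : smoothM U F -> smoothM U (fun q => nproj q (F q)).
Proof.
move=> sF; apply: (smoothM_eq oU (fun q _ => esym (nprojE q (F q)))); have sl := smoothC_lorentz oU sF; have c2 := smoothC_cst 2 oU.
apply: (smoothM_add oU); last first.
  apply: (smoothM_opp oU); apply: (smoothM_scale oU _ sYb); exact: (smoothC_mul oU c2 (sl _ sYz)).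
apply: (smoothM_add oU); last first.
  apply: (smoothM_opp oU); apply: (smoothM_scale oU _ sYz); exact: (smoothC_mul oU c2 (sl _ sYb)).
apply: (smoothM_add oU); last exact: (smoothM_scale oU (sl _ sY) sNv).
by apply: (smoothM_add oU sF); exact: (smoothM_scale oU (sl _ sNv) sY).
Qed.
Lemma s_eta : smoothM U eta.
Proof. apply: (smoothM_eq oU (fun q _ => esym (etaE q))); apply: s_nproj; apply: (smoothM_md _ oU); exact: s_kap. Qed.

Lemma conj_Yz p : U p -> conj_cmx (dd Y p) = db Y p.
Proof.
move=> Up; have := md_conj 'i%C Up sY; rewrite conj_i => <-.
by congr (md _ _ p); apply/funext => q; rewrite Y_real.
Qed.

Lemma conj_Yb p : U p -> conj_cmx (db Y p) = dd Y p.
Proof. by move=> Up; rewrite -conj_Yz // conj_cmxK. Qed.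

Lemma conj_Yzb p : U p -> conj_cmx (Yzb p) = Yzb p.
Proof.
move=> Up; rewrite YzbE; have := md_conj (- 'i%C) Up sYz; rewrite conjNi => <-.
by rewrite (md_eq _ oU Up conj_Yz) (md_comm _ _ oU Up sY).
Qed.

(** * Scalar products of the moving frame and the Weingarten formula *)

Section AtPoint.
Variables (p : plane) (Up : U p).

Lemma lYYz : lorentz (Y p) (dd Y p) = 0.
Proof.
have := pd_lorentz_cst oU (- 'i%C) Up sY sY Y_null; rewrite lorentzC => /eqP.
by rewrite -addr_eq0 -mulr2n mulrn_eq0 /= => /eqP.
Qed.

Lemma lYYb : lorentz (Y p) (db Y p) = 0.
Proof. by rewrite -conj_Yz // lorentz_conjr Y_real lYYz conjc0. Qed.

Lemma lYbYb : lorentz (db Y p) (db Y p) = 0.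
Proof. by rewrite -conj_Yz // lorentz_conj Yz_null // conjc0. Qed.

Lemma lYYzb : lorentz (Y p) (Yzb p) = - 2^-1.
Proof.
have H q : U q -> lorentz (dd Y q) (Y q) = 0.
  move=> Uq; have := pd_lorentz_cst oU (- 'i%C) Uq sY sY Y_null; rewrite [X in _ = - X]lorentzC => /eqP.
  by rewrite -addr_eq0 -mulr2n mulrn_eq0 /= => /eqP.
have := pd_lorentz_cst oU 'i%C Up sYz sY H.
by rewrite -YzbE lorentzC Yz_norm.
Qed.

Lemma lYzYzb : lorentz (dd Y p) (Yzb p) = 0.
Proof.
have := pd_lorentz_cst oU 'i%C Up sYz sYz Yz_null; rewrite -YzbE lorentzC => /eqP.
by rewrite -addr_eq0 -mulr2n mulrn_eq0 /= => /eqP.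
Qed.

Lemma lYbYzb : lorentz (db Y p) (Yzb p) = 0.
Proof. by rewrite -conj_Yz // -conj_Yzb // lorentz_conj lYzYzb conjc0. Qed.

Lemma lYzzY : lorentz (dd (dd Y) p) (Y p) = 0.
Proof.
have H q : U q -> lorentz (dd Y q) (Y q) = 0.
  move=> Uq; have := pd_lorentz_cst oU (- 'i%C) Uq sY sY Y_null; rewrite [X in _ = - X]lorentzC => /eqP.
  by rewrite -addr_eq0 -mulr2n mulrn_eq0 /= => /eqP.
by rewrite (pd_lorentz_cst oU _ Up sYz sY H) Yz_null ?oppr0.
Qed.

Lemma lYzzYz : lorentz (dd (dd Y) p) (dd Y p) = 0.
Proof.
have := pd_lorentz_cst oU (- 'i%C) Up sYz sYz Yz_null; rewrite [X in _ = - X]lorentzC => /eqP.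
by rewrite -addr_eq0 -mulr2n mulrn_eq0 /= => /eqP.
Qed.

Lemma lYzzYb : lorentz (dd (dd Y) p) (db Y p) = 0.
Proof.
rewrite (pd_lorentz_cst oU _ Up sYz sYb Yz_norm).
by rewrite (md_comm _ _ oU Up sY) -YzbE lYzYzb oppr0.
Qed.

Lemma lYN : lorentz (Y p) (Nv p) = -1.
Proof. by rewrite NvE !lorentz_lin lYYzb Y_null // mulr0 addr0 mulrN divff // pnatr_eq0. Qed.

Lemma lYzN : lorentz (dd Y p) (Nv p) = 0.
Proof. by rewrite NvE !lorentz_lin lYzYzb lorentzC lYYz !mulr0 addr0. Qed.

Lemma lYbN : lorentz (db Y p) (Nv p) = 0.
Proof. by rewrite NvE !lorentz_lin lYbYzb lorentzC lYYb !mulr0 addr0. Qed.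

Lemma lNN : lorentz (Nv p) (Nv p) = 0.
Proof.
rewrite {1}NvE !lorentz_lin lYN NvE !lorentz_lin [lorentz (Yzb p) (Y p)]lorentzC lYYzb.
by set x := lorentz _ _; field.
Qed.

Lemma lYzbN : lorentz (Yzb p) (Nv p) = lorentz (Yzb p) (Yzb p).
Proof.
rewrite NvE !lorentz_lin [lorentz (Yzb p) (Y p)]lorentzC lYYzb.
by set x := lorentz _ _; field.
Qed.

Lemma Yzb_N : Yzb p = 2^-1 *: Nv p - lorentz (Yzb p) (Yzb p) *: Y p.
Proof.
rewrite NvE scalerDr !scalerA mulVf ?pnatr_eq0 // scale1r mulrA mulVf ?pnatr_eq0 // mul1r.
by rewrite addrK.
Qed.

(** Trades [Y_(z zbar)] for the null vector [N], since the frame [Y], [Y_z], [Y_zbar], [N] has the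
    simpler Gram matrix. *)
Lemma perpP x : perp p x <-> [/\ lorentz x (Y p) = 0, lorentz x (dd Y p) = 0, lorentz x (db Y p) = 0 & lorentz x (Nv p) = 0].
Proof.
split=> [[h1 h2 h3 h4]|[h1 h2 h3 h4]]; (split; [exact: h1|exact: h2|exact: h3|]).
  by rewrite NvE !lorentz_lin h1 h4 !mulr0 addr0.
by rewrite Yzb_N !lorentz_lin h1 h4 !mulr0 subr0.
Qed.

Lemma nproj_perp x : perp p (nproj p x).
Proof.
apply/perpP; rewrite nprojE.
have Ybz : lorentz (db Y p) (dd Y p) = 2^-1 by rewrite lorentzC Yz_norm.
have Ny : lorentz (Nv p) (Y p) = -1 by rewrite lorentzC lYN.
have Nz : lorentz (Nv p) (dd Y p) = 0 by rewrite lorentzC lYzN.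
have Nb : lorentz (Nv p) (db Y p) = 0 by rewrite lorentzC lYbN.
have zY : lorentz (dd Y p) (Y p) = 0 by rewrite lorentzC lYYz.
have bY : lorentz (db Y p) (Y p) = 0 by rewrite lorentzC lYYb.
split; rewrite lorentz_comb.
- rewrite (Y_null Up) Ny zY bY; move: (lorentz x _) (lorentz x _) (lorentz x _) (lorentz x _) => a b c d; ring.
- rewrite lYYz Nz (Yz_null Up) Ybz; move: (lorentz x _) (lorentz x _) (lorentz x _) (lorentz x _) => a b c d; by field.
- rewrite lYYb Nb (Yz_norm Up) lYbYb; move: (lorentz x _) (lorentz x _) (lorentz x _) (lorentz x _) => a b c d; by field.
- rewrite lYN lNN lYzN lYbN; move: (lorentz x _) (lorentz x _) (lorentz x _) (lorentz x _) => a b c d; ring.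
Qed.

Lemma nproj_id x : perp p x -> nproj p x = x.
Proof.
move=> /perpP[h1 h2 h3 h4]; rewrite !nprojE h1 h2 h3 h4 !mulr0 !scale0r !subr0 !addr0.
by [].
Qed.

Lemma nprojD x y : nproj p (x + y) = nproj p x + nproj p y.
Proof. by rewrite lift_proj.unlock; exact: mulmxDl. Qed.

Lemma nprojZ a x : nproj p (a *: x) = a *: nproj p x.
Proof. by rewrite lift_proj.unlock; apply/esym; exact: scalemxAl. Qed.

Lemma nproj_Y : nproj p (Y p) = 0.
Proof.
rewrite !nprojE Y_null // lYN lYYz lYYb; by rewrite mulr0 !scale0r scaleN1r !subr0 addr0 subrr.
Qed.

Lemma nproj_Yz : nproj p (dd Y p) = 0.
Proof.
rewrite !nprojE lYzN Yz_norm // Yz_null // [lorentz _ (Y p)]lorentzC lYYz.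
by rewrite mulr0 !scale0r !addr0 subr0 divff ?pnatr_eq0 // scale1r subrr.
Qed.

Lemma nproj_Yb : nproj p (db Y p) = 0.
Proof.
rewrite !nprojE lYbN lYbYb [lorentz _ (dd Y p)]lorentzC Yz_norm // [lorentz _ (Y p)]lorentzC lYYb.
by rewrite mulr0 !scale0r !addr0 subr0 divff ?pnatr_eq0 // scale1r subrr.
Qed.

Lemma lorentz_nproj x y : perp p x -> lorentz x (nproj p y) = lorentz x y.
Proof.
move=> /perpP[h1 h2 h3 h4]; rewrite nprojE lorentzC lorentz_comb [lorentz y x]lorentzC.
have Z (t a b c d a' b' c' d' : C) : a' = 0 -> b' = 0 -> c' = 0 -> d' = 0 -> t + a * a' + b * b' - c * c' - d * d' = t.
  by move=> -> -> -> ->; rewrite !mulr0 !subr0 !addr0.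
by apply: Z; rewrite lorentzC; [exact: h1|exact: h4|exact: h2|exact: h3].
Qed.

Lemma perp_conj x : perp p x -> perp p (conj_cmx x).
Proof.
move=> [h1 h2 h3 h4]; split.
- by rewrite lorentz_conjl Y_real h1 conjc0.
- by rewrite lorentz_conjl conj_Yz // h3 conjc0.
- by rewrite lorentz_conjl conj_Yb // h2 conjc0.
- by rewrite lorentz_conjl conj_Yzb // h4 conjc0.
Qed.

Lemma perpD x y : perp p x -> perp p y -> perp p (x + y).
Proof. by move=> [a1 a2 a3 a4] [b1 b2 b3 b4]; split; rewrite lorentzDl ?a1 ?a2 ?a3 ?a4 ?b1 ?b2 ?b3 ?b4 addr0. Qed.

Lemma perpZ a x : perp p x -> perp p (a *: x).
Proof. by move=> [a1 a2 a3 a4]; split; rewrite lorentzZl ?a1 ?a2 ?a3 ?a4 mulr0. Qed.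

Lemma kap_perp : perp p (kap p).
Proof.
apply/perpP; rewrite kapE schwE; split; rewrite !lorentz_lin.
- by rewrite lYzzY Y_null // mulr0 addr0.
- by rewrite lYzzYz lYYz mulr0 addr0.
- by rewrite lYzzYb lYYb mulr0 addr0.
- rewrite lYN; set a := lorentz _ _; by field.
Qed.

Lemma Yzz_kap : dd (dd Y) p = kap p - (schw p / 2) *: Y p.
Proof. by rewrite kapE addrK. Qed.

Lemma eta_perp : perp p (eta p). Proof. by rewrite etaE; exact: nproj_perp. Qed.

Lemma conj_N : conj_cmx (Nv p) = Nv p.
Proof. by rewrite NvE conj_cmxD !conj_cmxZ conj_Yzb // Y_real conjcM -lorentz_conj conj_Yzb // conjc_nat. Qed.

Lemma nproj_conj x : nproj p (conj_cmx x) = conj_cmx (nproj p x).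
Proof.
rewrite !nprojE conj_cmx_comb conj_N Y_real (conj_Yz Up) (conj_Yb Up).
have lY : lorentz (conj_cmx x) (Y p) = conjc (lorentz x (Y p)) by rewrite lorentz_conjl Y_real.
have lN : lorentz (conj_cmx x) (Nv p) = conjc (lorentz x (Nv p)) by rewrite lorentz_conjl conj_N.
have lb : lorentz (conj_cmx x) (db Y p) = conjc (lorentz x (dd Y p)) by rewrite lorentz_conjl (conj_Yb Up).
have lz : lorentz (conj_cmx x) (dd Y p) = conjc (lorentz x (db Y p)) by rewrite lorentz_conjl (conj_Yz Up).
rewrite lY lN lb lz !conjcM conjc_nat; exact: addrAC.
Qed.

Variable psi : plane -> 'rV[C]_8.
Hypothesis (spsi : smoothM U psi) (ppsi : forall q, U q -> perp q (psi q)).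

(** Modulo [Y] and [Y_z], to which [psi] is orthogonal, [N_z] is [2 Y_(z zbar z)]. Commuting
    derivatives, [Y_(zz zbar)] is [kap_zbar] up to multiples of [Y] and [Y_zbar], and the normal
    part of [kap_zbar] is [eta]. *)
Lemma lpsi_Nz : lorentz (psi p) (dd Nv p) = 2 * lorentz (psi p) (eta p).
Proof.
have sl := smoothC_lorentz oU sYzb sYzb; have c2 := smoothC_cst 2 oU.
have [h1 h2 h3 h4] := ppsi Up.
have E1 : lorentz (psi p) (dd Nv p) = 2 * lorentz (psi p) (dd Yzb p).
  rewrite (md_eq _ oU Up (fun q _ => NvE q)).
  rewrite (md_add _ Up (smoothM_scale oU c2 sYzb) (smoothM_scale oU (smoothC_mul oU c2 sl) sY)).
  rewrite (md_scale _ Up c2 sYzb) (md_scale _ Up (smoothC_mul oU c2 sl) sY) pd_cst.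
  by rewrite !(lorentzDr, lorentzZr) h1 h2 !mulr0 !addr0 mul0r add0r.
have E2 : lorentz (psi p) (dd Yzb p) = lorentz (psi p) (db kap p).
  rewrite YzbE (md_comm _ _ oU Up sYz).
  have E q : U q -> dd (dd Y) q = kap q + (- (schw q / 2)) *: Y q.
    by move=> _; rewrite kapE scaleNr addrK.
  have sa := smoothC_opp oU (smoothC_mul oU s_schw (smoothC_cst 2^-1 oU)).
  rewrite (md_eq _ oU Up E) (md_add _ Up s_kap (smoothM_scale oU sa sY)) (md_scale _ Up sa sY).
  by rewrite !(lorentzDr, lorentzZr) h1 h3 !mulr0 !addr0.
by rewrite E1 E2 etaE (lorentz_nproj _ (ppsi Up)).
Qed.

(* The derivative of a normal field has normal part [D_z psi]; its tangential part is read off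
   from [<psi_z, X> = - <psi, X_z>] for the generators [X] of [V]. *)
Lemma weingarten : dd psi p = nproj p (dd psi p) + (2 * lorentz (psi p) (eta p)) *: Y p
  - (2 * lorentz (psi p) (kap p)) *: db Y p.
Proof.
have p1 q : U q -> lorentz (psi q) (Y q) = 0 by move=> /ppsi[].
have p2 q : U q -> lorentz (psi q) (dd Y q) = 0 by move=> /ppsi[].
have p3 q : U q -> lorentz (psi q) (db Y q) = 0 by move=> /ppsi[].
have p4 q : U q -> lorentz (psi q) (Nv q) = 0 
  by move=> Uq; have [h1 _ _ h4] := ppsi Uq; rewrite NvE !(lorentzDr, lorentzZr) h1 h4 !mulr0 addr0.
have [_ _ h3 h4] := ppsi Up.
rewrite nprojE (pd_lorentz_cst oU _ Up spsi sNv p4) (pd_lorentz_cst oU _ Up spsi sY p1).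
rewrite (pd_lorentz_cst oU _ Up spsi sYz p2) (pd_lorentz_cst oU _ Up spsi sYb p3) lpsi_Nz.
rewrite (p2 _ Up) (md_comm _ _ oU Up sY) -YzbE h4 Yzz_kap !(lorentzDr, lorentzNr, lorentzZr) (p1 _ Up).
rewrite mulr0 !subr0 !oppr0 mulr0 !scale0r !addr0 subr0 scaleNr mulrN scaleNr opprK.
move: (dd psi p) (_ *: Y p) (_ *: db Y p) => x a b.
by rewrite [x - a + b + a]addrAC subrK addrK.
Qed.
End AtPoint.

(** [weingarten] for the conjugate field, conjugated back. *)
Lemma weingartenb psi p : U p -> smoothM U psi -> (forall q, U q -> perp q (psi q)) ->
  db psi p = nproj p (db psi p) + (2 * lorentz (psi p) (conj_cmx (eta p))) *: Y p
  - (2 * lorentz (psi p) (conj_cmx (kap p))) *: dd Y p.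
Proof.
move=> Up sp pp.
have pp' q : U q -> perp q (conj_cmx (psi q)) by move=> Uq; apply: perp_conj => //; exact: pp.
have E : dd (fun q => conj_cmx (psi q)) p = conj_cmx (db psi p).
  by rewrite (md_conj _ Up sp) conjNi.
have := weingarten Up (smoothM_conj oU sp) pp'; rewrite E => /(congr1 (@conj_cmx R _ _)).
rewrite (nproj_conj Up) !(conj_cmxD, conj_cmxN, conj_cmxZ) !conj_cmxK Y_real (conj_Yb Up) !conjcM.
by rewrite conjc_nat -!lorentz_conj !conj_cmxK.
Qed.

Hypothesis HW : isotropic_willmore U Y.

Let kap_iso : forall q, U q -> lorentz (kap q) (kap q) = 0. Proof. by move=> q /HW[]. Qed.
Let kap_willmore : forall q, U q -> nproj q (db eta q) = - (conjc (schw q) / 2) *: kap q.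
Proof. by move=> q /HW[]. Qed.

Local Notation kapb := (fun q => conj_cmx (kap q)).
Local Notation etab := (fun q => conj_cmx (eta q)).

Lemma kap_db p : U p -> db kap p = eta p + (2 * lorentz (kap p) (etab p)) *: Y p
  - (2 * lorentz (kap p) (kapb p)) *: dd Y p.
Proof. by move=> Up; rewrite (weingartenb Up s_kap kap_perp) -etaE. Qed.

Lemma eta_db p : U p -> db eta p = - (conjc (schw p) / 2) *: kap p + (2 * lorentz (eta p) (etab p)) *: Y p
  - (2 * lorentz (eta p) (kapb p)) *: dd Y p.
Proof. by move=> Up; rewrite (weingartenb Up s_eta eta_perp) kap_willmore. Qed.

Lemma lkap_eta p : U p -> lorentz (kap p) (eta p) = 0.
Proof.
move=> Up; have := pd_lorentz_cst oU 'i%C Up s_kap s_kap kap_iso.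
rewrite [X in _ = - X]lorentzC => /eqP; rewrite -addr_eq0 -mulr2n mulrn_eq0 /= => /eqP.
by rewrite lorentzC etaE lorentz_nproj //; exact: kap_perp.
Qed.

(** In the [zbar]-derivative of [<kap, eta> = 0], the Willmore equation makes [D_zbar eta] a
    multiple of [kap], so that [<kap, D_zbar eta>] vanishes by isotropy and [<eta, eta>] alone
    remains. *)
Lemma leta_eta p : U p -> lorentz (eta p) (eta p) = 0.
Proof.
move=> Up; have H q : U q -> lorentz (kap q) (eta q) = 0 by exact: lkap_eta.
have := pd_lorentz_cst oU 'i%C Up s_kap s_eta H.
have kp := kap_perp Up; have ep := eta_perp Up.
rewrite lorentzC -(lorentz_nproj (db eta p) kp) kap_willmore // lorentzZr kap_iso // mulr0 oppr0.
by rewrite [X in _ -> lorentz _ X = _]etaE lorentz_nproj.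
Qed.

(** The tangential terms in [weingarten] are [<kap, eta>] and [<kap, kap>], both zero, so the
    ordinary [z]-derivative of [kap] is already normal. *)
Lemma kap_dd p : U p -> dd kap p = nproj p (dd kap p).
Proof.
move=> Up; rewrite {1}(weingarten Up s_kap kap_perp) lkap_eta // kap_iso //.
by rewrite mulr0 !scale0r addr0 subr0.
Qed.

Lemma eta_dd p : U p -> dd eta p = nproj p (dd eta p).
Proof.
move=> Up; rewrite {1}(weingarten Up s_eta eta_perp) leta_eta // [lorentz (eta p) _]lorentzC lkap_eta //.
by rewrite mulr0 !scale0r addr0 subr0.
Qed.

(** Coefficient of a quartic differential; its transformation law is [hopf4_comp]. By [kap_dd] the
    ordinary derivative stands for [D_z kap]. *)
Definition hopf4 p := lorentz (dd kap p) (eta p).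

Lemma s_hopf4 : smoothC U hopf4.
Proof. by apply: (smoothC_lorentz oU _ s_eta); exact: (smoothM_md _ oU s_kap). Qed.

(** After commuting derivatives, [(kap_zbar)_z] is [eta_z] plus a combination of [Y], [Y_z] and
    [Y_zz], all orthogonal to [eta]; and [eta_zbar] is a combination of [kap], [Y] and [Y_z], all
    orthogonal to [kap_z]. *)
Lemma hopf4_holomorphic p : U p -> pd 'i%C hopf4 p = 0.
Proof.
move=> Up; have skz := smoothM_md (- 'i%C) oU s_kap.
have [ep1 ep2 ep3 ep4] := eta_perp Up; have [kp1 kp2 kp3 kp4] := kap_perp Up.
rewrite (pd_lorentz oU _ Up skz s_eta).
have -> : lorentz (db (dd kap) p) (eta p) = 0.
  rewrite (md_comm _ _ oU Up s_kap).
  pose a q := 2 * lorentz (kap q) (etab q); pose b q := - (2 * lorentz (kap q) (kapb q)).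
  have sa : smoothC U a by exact: (smoothC_mul oU (smoothC_cst _ oU) (smoothC_lorentz oU s_kap (smoothM_conj oU s_eta))).
  have sb : smoothC U b by exact: (smoothC_opp oU (smoothC_mul oU (smoothC_cst _ oU) (smoothC_lorentz oU s_kap (smoothM_conj oU s_kap)))).
  have E q : U q -> db kap q = eta q + a q *: Y q + b q *: dd Y q.
    by move=> Uq; rewrite kap_db // scaleNr.
  rewrite (md_eq _ oU Up E).
  rewrite (md_add _ Up (smoothM_add oU s_eta (smoothM_scale oU sa sY)) (smoothM_scale oU sb sYz)).
  rewrite (md_add _ Up s_eta (smoothM_scale oU sa sY)) (md_scale _ Up sa sY) (md_scale _ Up sb sYz) Yzz_kap.
  rewrite !(lorentzDl, lorentzZl, lorentzNl).
  rewrite lkap_eta // [lorentz (Y p) _]lorentzC ep1 [lorentz (dd Y p) _]lorentzC ep2.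
  have H q : U q -> lorentz (eta q) (eta q) = 0 by exact: leta_eta.
  have := pd_lorentz_cst oU (- 'i%C) Up s_eta s_eta H.
  rewrite [X in _ = - X]lorentzC => /eqP; rewrite -addr_eq0 -mulr2n mulrn_eq0 /= => /eqP ->.
  by rewrite !mulr0 subr0 mulr0 !addr0.
rewrite eta_db // !(lorentzDr, lorentzNr, lorentzZr).
have H1 q : U q -> lorentz (kap q) (Y q) = 0 by move=> /kap_perp[].
have H2 q : U q -> lorentz (kap q) (dd Y q) = 0 by move=> /kap_perp[].
have -> : lorentz (dd kap p) (kap p) = 0.
  have := pd_lorentz_cst oU (- 'i%C) Up s_kap s_kap kap_iso.
  by rewrite [X in _ = - X]lorentzC => /eqP; rewrite -addr_eq0 -mulr2n mulrn_eq0 /= => /eqP ->.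
rewrite (pd_lorentz_cst oU _ Up s_kap sY H1) kp2.
rewrite (pd_lorentz_cst oU _ Up s_kap sYz H2) Yzz_kap !(lorentzDr, lorentzNr, lorentzZr) kap_iso // kp1.
by rewrite !(mulr0, subr0, oppr0, addr0).
Qed.


(** * The null plane of [kap] and [eta]: Gram determinant, bivector, projection *)

Definition gramw p := lorentz (kap p) (kapb p) * lorentz (eta p) (etab p)
  - lorentz (kap p) (etab p) * lorentz (eta p) (kapb p).

(** [coefA] and [coefB] are Cramer's formulas for the coordinates, with respect to [kap] and [eta],
    of the Hermitian projection of [x] to their plane. *)
Definition coefA p x := (lorentz x (kapb p) * lorentz (eta p) (etab p)
  - lorentz x (etab p) * lorentz (eta p) (kapb p)) / gramw p.
Definition coefB p x := (lorentz x (etab p) * lorentz (kap p) (kapb p)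
  - lorentz x (kapb p) * lorentz (kap p) (etab p)) / gramw p.

Section Span.
Variables (p : plane) (Up : U p) (w0 : gramw p != 0).

Lemma coefA_B_kapb x : coefA p x * lorentz (kap p) (kapb p) + coefB p x * lorentz (eta p) (kapb p) = lorentz x (kapb p).
Proof.
move: w0; rewrite /coefA /coefB /gramw; move: (lorentz _ _) (lorentz _ _) (lorentz _ _) (lorentz _ _) (lorentz _ _) (lorentz _ _).
by move=> a b c d e f h; field.
Qed.

Lemma coefA_B_etab x : coefA p x * lorentz (kap p) (etab p) + coefB p x * lorentz (eta p) (etab p) = lorentz x (etab p).
Proof.
move: w0; rewrite /coefA /coefB /gramw; move: (lorentz _ _) (lorentz _ _) (lorentz _ _) (lorentz _ _) (lorentz _ _) (lorentz _ _).
by move=> a b c d e f h; field.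
Qed.

Definition null_frame (i : 'I_8) : 'rV[C]_8 :=
  [:: Y p; dd Y p; db Y p; Nv p; kap p; eta p; kapb p; etab p]`_i.

(** The frame consists of dual pieces: [Y] with [N], [Y_z] with [Y_zbar], and the null plane of
    [kap] and [eta] with its conjugate. Pairing with the partner isolates the coefficients; for the
    two planes there remain two by two systems with the Gram determinant. *)
Lemma null_frame_free (c : 'rV[C]_8) : \sum_i c 0 i *: null_frame i = 0 -> c = 0.
Proof.
pose g (k : nat) := c 0 (inord k).
have cE (i : 'I_8) : c 0 i = g i by rewrite /g inord_val.
have -> : \sum_i c 0 i *: null_frame i = \sum_(i < 8) g i *: null_frame i.
  by apply: eq_bigr => i _; rewrite cE.
rewrite !big_ord_recl big_ord0 /null_frame /= addr0 /bump /= !add1n => E.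
have [k1 k2 k3 k4] := (perpP _ _).1 (kap_perp Up).
have [e1 e2 e3 e4] := (perpP _ _).1 (eta_perp Up).
have [kb1 kb2 kb3 kb4] := (perpP _ _).1 (perp_conj Up (kap_perp Up)).
have [eb1 eb2 eb3 eb4] := (perpP _ _).1 (perp_conj Up (eta_perp Up)).
have P z : g 0 * lorentz (Y p) z + (g 1 * lorentz (dd Y p) z + (g 2 * lorentz (db Y p) z + (g 3 * lorentz (Nv p) z
  + (g 4 * lorentz (kap p) z + (g 5 * lorentz (eta p) z + (g 6 * lorentz (kapb p) z + g 7 * lorentz (etab p) z)))))) = 0.
  by rewrite -(lorentz0l z) -E !(lorentzDl, lorentzZl).
have Ny : lorentz (Nv p) (Y p) = -1 by rewrite lorentzC lYN.
have Nz : lorentz (Nv p) (dd Y p) = 0 by rewrite lorentzC lYzN.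
have Nb : lorentz (Nv p) (db Y p) = 0 by rewrite lorentzC lYbN.
have zy : lorentz (dd Y p) (Y p) = 0 by rewrite lorentzC lYYz.
have by_ : lorentz (db Y p) (Y p) = 0 by rewrite lorentzC lYYb.
have bz : lorentz (db Y p) (dd Y p) = 2^-1 by rewrite lorentzC Yz_norm.
have h2 : (2^-1 : C) != 0 by rewrite invr_eq0 pnatr_eq0.
have g0 : g 0 = 0.
  have := P (Nv p); rewrite lYN // lYzN // lYbN // lNN // k4 e4 kb4 eb4 !mulr0 !addr0 mulrN mulr1.
  by move=> /eqP; rewrite oppr_eq0 => /eqP.
have g3 : g 3 = 0.
  have := P (Y p); rewrite Y_null // zy by_ Ny k1 e1 kb1 eb1 !mulr0 !addr0 !add0r mulrN mulr1.
  by move=> /eqP; rewrite oppr_eq0 => /eqP.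
have g1 : g 1 = 0.
  have := P (db Y p); rewrite lYYb // Yz_norm // lYbYb // Nb k3 e3 kb3 eb3 !mulr0 !addr0 !add0r.
  by move=> /eqP; rewrite mulf_eq0 (negbTE h2) orbF => /eqP.
have g2 : g 2 = 0.
  have := P (dd Y p); rewrite lYYz // Yz_null // bz Nz k2 e2 kb2 eb2 !mulr0 !addr0 !add0r.
  by move=> /eqP; rewrite mulf_eq0 (negbTE h2) orbF => /eqP.
have swap (a b x y z w : C) : z * w - x * y != 0 -> a * z + b * x = 0 -> a * y + b * w = 0 -> a = 0 /\ b = 0.
  move=> d0 E1 E2; split; apply: (mulIf d0); rewrite mul0r.
    have -> : a * (z * w - x * y) = (a * z + b * x) * w - (a * y + b * w) * x by ring.
    by rewrite E1 E2 !mul0r subrr.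
  have -> : b * (z * w - x * y) = (a * y + b * w) * z - (a * z + b * x) * y by ring.
  by rewrite E1 E2 !mul0r subrr.
have kk0 : lorentz (kapb p) (kapb p) = 0 by rewrite lorentz_conj kap_iso // conjc0.
have ke0 : lorentz (kapb p) (etab p) = 0 by rewrite lorentz_conj lkap_eta // conjc0.
have ek0 : lorentz (etab p) (kapb p) = 0 by rewrite lorentzC.
have ee0 : lorentz (etab p) (etab p) = 0 by rewrite lorentz_conj leta_eta // conjc0.
have ek1 : lorentz (eta p) (kap p) = 0 by rewrite lorentzC lkap_eta.
have Pk := (comb8_last (P (kapb p)) g0 g1 g2 g3).1 kk0 ek0.
have Pe := (comb8_last (P (etab p)) g0 g1 g2 g3).1 ke0 ee0.
have Pk' := (comb8_last (P (kap p)) g0 g1 g2 g3).2 (kap_iso Up) ek1.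
have Pe' := (comb8_last (P (eta p)) g0 g1 g2 g3).2 (lkap_eta Up) (leta_eta Up).
have swap' (a b x y z w : C) : z * w - y * x != 0 -> a * z + b * x = 0 -> a * y + b * w = 0 -> a = 0 /\ b = 0.
  by rewrite [y * x]mulrC; exact: swap.
have [g4 g5] : g 4 = 0 /\ g 5 = 0.
  exact: (swap' _ _ _ _ _ _ w0 Pk Pe).
have [g6 g7] : g 6 = 0 /\ g 7 = 0.
  apply: (swap _ _ _ _ _ _ _ Pk' Pe'); move: w0; rewrite /gramw.
  rewrite [lorentz (kapb p) _]lorentzC [lorentz (etab p) (eta p)]lorentzC.
  by rewrite [lorentz (etab p) _]lorentzC [lorentz (kapb p) _]lorentzC.
apply/rowP => i; rewrite mxE cE.
by case: i => [[|[|[|[|[|[|[|[|//]]]]]]]] ilt].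
Qed.

(* A null plane in the rank 4 bundle is its own orthogonal complement. *)
Lemma span_max x : perp p x -> lorentz x (kap p) = 0 -> lorentz x (eta p) = 0 ->
  x = coefA p x *: kap p + coefB p x *: eta p.
Proof.
move=> /perpP[x1 x2 x3 x4] xk xe; apply/eqP; rewrite -subr_eq0; apply/eqP.
have [k1 k2 k3 k4] := (perpP _ _).1 (kap_perp Up).
have [e1 e2 e3 e4] := (perpP _ _).1 (eta_perp Up).
have Z (a b u v w : C) : u = 0 -> v = 0 -> w = 0 -> u - (a * v + b * w) = 0.
  by move=> -> -> ->; rewrite !mulr0 addr0 subrr.
have Z' (a b u v w : C) : a * v + b * w = u -> u - (a * v + b * w) = 0 by move=> ->; rewrite subrr.
have ek : lorentz (eta p) (kap p) = 0 by rewrite lorentzC lkap_eta.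
apply: (nondegenerate8 null_frame_free) => i.
rewrite !(lorentzDl, lorentzNl, lorentzZl).
case: i => [[|[|[|[|[|[|[|[|//]]]]]]]] ilt]; rewrite /null_frame /=.
- exact: Z x1 k1 e1.
- exact: Z x2 k2 e2.
- exact: Z x3 k3 e3.
- exact: Z x4 k4 e4.
- exact: Z xk (kap_iso Up) ek.
- exact: Z xe (lkap_eta Up) (leta_eta Up).
- exact: Z' (coefA_B_kapb x).
- exact: Z' (coefA_B_etab x).
Qed.
End Span.

Hypothesis hopf4_0 : forall q, U q -> hopf4 q = 0.
Variables (W : set plane) (oW : open W) (WU : W `<=` U).
Hypothesis W_indep : forall q, W q -> gramw q != 0.

Local Notation L := (lorentz_metric C).

Definition wedge p : 'M[C]_8 := (kap p)^T *m eta p - (eta p)^T *m kap p.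

Lemma s_wedge : smoothM U wedge.
Proof.
apply: (smoothM_add oU); last apply: (smoothM_opp oU).
  exact: (smoothM_mul oU (smoothM_tr oU s_kap) s_eta).
exact: (smoothM_mul oU (smoothM_tr oU s_eta) s_kap).
Qed.

Lemma dyad_l (x u v : 'rV[C]_8) : x *m L *m (u^T *m v) = lorentz x u *: v.
Proof. by rewrite mulmxA lorentz_mx mul_scalar_mx. Qed.

Lemma wedge_l x p : x *m L *m wedge p = lorentz x (kap p) *: eta p - lorentz x (eta p) *: kap p.
Proof. by rewrite /wedge mulmxBr !dyad_l. Qed.

Lemma md_dyad c (u v : plane -> 'rV[C]_8) p : U p -> smoothM U u -> smoothM U v ->
  md c (fun q => (u q)^T *m v q) p = (md c u p)^T *m v p + (u p)^T *m md c v p.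
Proof. by move=> Up su sv; rewrite (md_mul _ oU Up (smoothM_tr oU su) sv) md_tr. Qed.

Lemma md_wedge c p : U p -> md c wedge p =
  (md c kap p)^T *m eta p + (kap p)^T *m md c eta p - ((md c eta p)^T *m kap p + (eta p)^T *m md c kap p).
Proof.
move=> Up; have s1 := smoothM_mul oU (smoothM_tr oU s_kap) s_eta.
have s2 := smoothM_mul oU (smoothM_tr oU s_eta) s_kap.
rewrite (md_add _ Up s1 (smoothM_opp oU s2)) (md_opp _ oU Up s2).
by rewrite (md_dyad _ Up s_kap s_eta) (md_dyad _ Up s_eta s_kap).
Qed.

(** Contractions of the bivector with the conjugates of [eta] and [kap]. This form makes them
    visibly linear in [wedge], so they vanish to the same order; [wedge_db_vanish] relies on it. *)
Definition alphav p : 'rV[C]_8 := etab p *m L *m wedge p.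
Definition betav p : 'rV[C]_8 := kapb p *m L *m wedge p.

Lemma s_alphav : smoothM U alphav.
Proof. exact: (smoothM_mul oU (smoothM_mul oU (smoothM_conj oU s_eta) (smoothM_cst _ oU)) s_wedge). Qed.
Lemma s_betav : smoothM U betav.
Proof. exact: (smoothM_mul oU (smoothM_mul oU (smoothM_conj oU s_kap) (smoothM_cst _ oU)) s_wedge). Qed.

Lemma alphavE p : alphav p = lorentz (kap p) (etab p) *: eta p - lorentz (eta p) (etab p) *: kap p.
Proof. by rewrite /alphav wedge_l [lorentz _ (kap p)]lorentzC [lorentz _ (eta p)]lorentzC. Qed.
Lemma betavE p : betav p = lorentz (kap p) (kapb p) *: eta p - lorentz (eta p) (kapb p) *: kap p.
Proof. by rewrite /betav wedge_l [lorentz _ (kap p)]lorentzC [lorentz _ (eta p)]lorentzC. Qed.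

Definition wedge_dbar p := 2 *: ((Y p)^T *m alphav p - (alphav p)^T *m Y p)
  - 2 *: ((dd Y p)^T *m betav p - (betav p)^T *m dd Y p).

(** The normal part of the derivative is [eta ^ eta + kap ^ D_zbar eta], which is zero since
    [D_zbar eta] is a multiple of [kap]. Only the tangential Weingarten terms survive. *)
Lemma wedge_db p : U p -> db wedge p = wedge_dbar p.
Proof.
move=> Up; rewrite md_wedge // kap_db // eta_db // /wedge_dbar alphavE betavE.
exact: wedge_db_aux.
Qed.

Definition coefa p := coefA p (dd kap p).
Definition coefb p := coefB p (dd kap p).
Definition coefc p := coefA p (dd eta p).
Definition coefd p := coefB p (dd eta p).

(** [D_z kap] is orthogonal to [kap] by isotropy and to [eta] because the quartic differential
    vanishes, so [span_max] applies. *)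
Lemma kap_dd_span p : W p -> dd kap p = coefa p *: kap p + coefb p *: eta p.
Proof.
move=> Wp; have Up := WU Wp; apply: (span_max Up (W_indep Wp)).
- by rewrite kap_dd //; apply: nproj_perp.
- have := pd_lorentz_cst oU (- 'i%C) Up s_kap s_kap kap_iso.
  by rewrite [X in _ = - X]lorentzC => /eqP; rewrite -addr_eq0 -mulr2n mulrn_eq0 /= => /eqP.
- exact: hopf4_0.
Qed.

Lemma eta_dd_span p : W p -> dd eta p = coefc p *: kap p + coefd p *: eta p.
Proof.
move=> Wp; have Up := WU Wp; apply: (span_max Up (W_indep Wp)).
- by rewrite eta_dd //; apply: nproj_perp.
- have H q : U q -> lorentz (eta q) (kap q) = 0 by move=> Uq; rewrite lorentzC lkap_eta.
  rewrite (pd_lorentz_cst oU _ Up s_eta s_kap H) lorentzC -/(hopf4 p) hopf4_0 //.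
  exact: oppr0.
- have H q : U q -> lorentz (eta q) (eta q) = 0 by exact: leta_eta.
  have := pd_lorentz_cst oU (- 'i%C) Up s_eta s_eta H.
  by rewrite [X in _ = - X]lorentzC => /eqP; rewrite -addr_eq0 -mulr2n mulrn_eq0 /= => /eqP.
Qed.

Lemma wedge_dd p : W p -> dd wedge p = (coefa p + coefd p) *: wedge p.
Proof.
move=> Wp; rewrite md_wedge; last exact: WU.
rewrite kap_dd_span // eta_dd_span // /wedge.
move: (kap p) (eta p) (coefa p) (coefb p) (coefc p) (coefd p) => k e a b c d.
apply/matrixP => i j; rewrite !mxE !big_ord1 !mxE.
move: (k _ _) (k _ _) (e _ _) (e _ _) => k1 k2 e1 e2; ring.
Qed.

Lemma s_gramw : smoothC U gramw.
Proof.
have sk := s_kap; have se := s_eta; have skb := smoothM_conj oU sk; have seb := smoothM_conj oU se.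
apply: (smoothC_add oU); last apply: (smoothC_opp oU).
  exact: (smoothC_mul oU (smoothC_lorentz oU sk skb) (smoothC_lorentz oU se seb)).
exact: (smoothC_mul oU (smoothC_lorentz oU sk seb) (smoothC_lorentz oU se skb)).
Qed.

(** Evaluates a matrix, seen as a tensor of rank two, on [x] and [y]; with the conjugates of [kap]
    and [eta] it turns the equations for the bivector into scalar ones. *)
Definition tst (x y : 'rV[C]_8) (M : 'M[C]_8) : C := lorentz (x *m L *m M) y.

Lemma tst_dyad x y u v : tst x y (u^T *m v) = lorentz x u * lorentz v y.
Proof. by rewrite /tst dyad_l lorentzZl. Qed.

Lemma tstD x y M N : tst x y (M + N) = tst x y M + tst x y N.
Proof. by rewrite /tst mulmxDr lorentzDl. Qed.

Lemma tstZ x y a M : tst x y (a *: M) = a * tst x y M.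
Proof. by rewrite /tst -scalemxAr lorentzZl. Qed.

Lemma tstN x y M : tst x y (- M) = - tst x y M.
Proof. by rewrite /tst mulmxN lorentzNl. Qed.

Definition tst_lin := (tstD, tstZ, tstN, tst_dyad).

Lemma tst_wedge p : tst (kapb p) (etab p) (wedge p) = gramw p.
Proof. by rewrite /wedge !tst_lin /gramw ![lorentz (kapb p) _]lorentzC [X in _ - X = _]mulrC. Qed.

Lemma tst_wedge_dbar p : U p -> tst (kapb p) (etab p) (wedge_dbar p) = 0.
Proof.
move=> Up; have [kb1 kb2 _ _] := perp_conj Up (kap_perp Up); have [eb1 eb2 _ _] := perp_conj Up (eta_perp Up).
rewrite /wedge_dbar !tst_lin kb1 kb2 [lorentz (Y p) _]lorentzC [lorentz (dd Y p) _]lorentzC eb1 eb2.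
move: (lorentz _ _) (lorentz _ _) (lorentz _ _) (lorentz _ _) => a b c d; ring.
Qed.

Lemma lorentz_conj_db_kap p x : U p -> perp p x -> lorentz x (conj_cmx (db kap p)) = lorentz x (etab p).
Proof.
move=> Up px; rewrite lorentz_conjr [RHS]lorentz_conjr etaE lorentz_nproj //.
exact: perp_conj.
Qed.

Lemma lorentz_conj_db_eta p x : U p -> perp p x ->
  lorentz x (conj_cmx (db eta p)) = - conjc (conjc (schw p) / 2) * lorentz x (kapb p).
Proof.
move=> Up px; rewrite lorentz_conjr -(lorentz_nproj (db eta p) (perp_conj Up px)) kap_willmore //.
by rewrite lorentzZr conjcM conjcN -lorentz_conjr.
Qed.

(** [w] is the squared norm of the bivector. Its derivative falls on [kap ^ eta], where it produces
    the trace [coefa + coefd], or on the conjugate, where it produces the conjugate of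
    [D_zbar (kap ^ eta) = 0]. *)
Lemma gramw_dd p : W p -> pd (- 'i%C) gramw p = (coefa p + coefd p) * gramw p.
Proof.
move=> Wp; have Up := WU Wp.
have sk := s_kap; have se := s_eta; have skb := smoothM_conj oU sk; have seb := smoothM_conj oU se.
have s1 := smoothC_lorentz oU sk skb; have s2 := smoothC_lorentz oU se seb.
have s3 := smoothC_lorentz oU sk seb; have s4 := smoothC_lorentz oU se skb.
rewrite (pd_add _ Up (smoothC_mul oU s1 s2) (smoothC_opp oU (smoothC_mul oU s3 s4))).
have -> : pd (- 'i%C) (fun q => - (lorentz (kap q) (etab q) * lorentz (eta q) (kapb q))) p =
  - pd (- 'i%C) (fun q => lorentz (kap q) (etab q) * lorentz (eta q) (kapb q)) p.
  have := pd_mul (- 'i%C) Up (smoothC_cst (-1) oU) (smoothC_mul oU s3 s4).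
  rewrite pd_cst mul0r add0r mulN1r => <-; congr (pd _ _ p); apply/funext => q; by rewrite mulN1r.
rewrite (pd_mul _ Up s1 s2) (pd_mul _ Up s3 s4).
rewrite (pd_lorentz oU _ Up sk skb) (pd_lorentz oU _ Up se seb) (pd_lorentz oU _ Up sk seb) (pd_lorentz oU _ Up se skb).
rewrite (md_conj _ Up sk) (md_conj _ Up se) conjNi.
have kp := kap_perp Up; have ep := eta_perp Up.
rewrite (lorentz_conj_db_kap Up kp) (lorentz_conj_db_kap Up ep) (lorentz_conj_db_eta Up kp) (lorentz_conj_db_eta Up ep).
have Dk z : lorentz (dd kap p) z = coefa p * lorentz (kap p) z + coefb p * lorentz (eta p) z.
  by rewrite kap_dd_span // lorentzDl !lorentzZl.
have De z : lorentz (dd eta p) z = coefc p * lorentz (kap p) z + coefd p * lorentz (eta p) z.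
  by rewrite eta_dd_span // lorentzDl !lorentzZl.
rewrite !Dk !De /gramw.
move: (lorentz (kap p) (kapb p)) (lorentz (kap p) (etab p)) (lorentz (eta p) (kapb p)) (lorentz (eta p) (etab p)) => A B D E.
move: (coefa p) (coefb p) (coefc p) (coefd p) (conjc _) => a b c d t.
ring.
Qed.

(** The trace [coefa + coefd], by [lamE], written as the logarithmic derivative of [w] so that its
    smoothness is immediate. *)
Definition lam p := pd (- 'i%C) gramw p / gramw p.

Lemma lamE p : W p -> lam p = coefa p + coefd p.
Proof. by move=> Wp; rewrite /lam gramw_dd // mulfK // W_indep. Qed.

Lemma s_lam : smoothC W lam.
Proof.
have sg := smoothC_sub WU s_gramw.
apply: (smoothC_mul oW (smoothC_sub WU (smoothC_pd _ oU s_gramw))).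
exact: (smoothC_inv oW W_indep sg).
Qed.

Lemma tst_dd_aux (kb eb y z k a a' b b' : 'rV[C]_8) (t : C) :
  lorentz kb y = 0 -> lorentz kb z = 0 -> lorentz y eb = 0 -> lorentz z eb = 0 ->
  tst kb eb (2 *: (z^T *m a + y^T *m a' - (a'^T *m y + a^T *m z))
    - 2 *: ((k - t *: y)^T *m b + z^T *m b' - (b'^T *m z + b^T *m (k - t *: y)))) =
  - 2 * (lorentz kb k * lorentz b eb - lorentz kb b * lorentz k eb).
Proof.
move=> h1 h2 h3 h4.
have E1 : lorentz kb (k - t *: y) = lorentz kb k by rewrite lorentzDr lorentzNr lorentzZr h1 mulr0 subr0.
have E2 : lorentz (k - t *: y) eb = lorentz k eb by rewrite lorentzDl lorentzNl lorentzZl h3 mulr0 subr0.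
rewrite !tst_lin E1 E2 h1 h2 h3 h4.
move: (lorentz _ _) (lorentz _ _) (lorentz _ _) (lorentz _ _) => A B D E.
move: (lorentz _ _) (lorentz _ _) => F G; ring.
Qed.

(** Against normal vectors only the term in which [Y_z] becomes [Y_zz], with normal part [kap],
    survives. It is [- 2 kap ^ betav], that is [- 2 <kap, conj kap>] times the bivector. *)
Lemma tst_dd_wedge_dbar p : W p ->
  tst (kapb p) (etab p) (dd wedge_dbar p) = - 2 * lorentz (kap p) (kapb p) * gramw p.
Proof.
move=> Wp; have Up := WU Wp; have sa := s_alphav; have sb := s_betav.
have [kb1 kb2 _ _] := perp_conj Up (kap_perp Up); have [eb1 eb2 _ _] := perp_conj Up (eta_perp Up).
have c2 := smoothC_cst 2 oU.
have s1 := smoothM_mul oU (smoothM_tr oU sY) sa; have s2 := smoothM_mul oU (smoothM_tr oU sa) sY.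
have s3 := smoothM_mul oU (smoothM_tr oU sYz) sb; have s4 := smoothM_mul oU (smoothM_tr oU sb) sYz.
have s12 := smoothM_add oU s1 (smoothM_opp oU s2); have s34 := smoothM_add oU s3 (smoothM_opp oU s4).
have t12 := smoothM_scale oU c2 s12; have t34 := smoothM_scale oU c2 s34.
rewrite (md_add _ Up t12 (smoothM_opp oU t34)) (md_opp _ oU Up t34) (md_scale _ Up c2 s12) (md_scale _ Up c2 s34) pd_cst !scale0r !add0r.
rewrite (md_add _ Up s1 (smoothM_opp oU s2)) (md_opp _ oU Up s2) (md_add _ Up s3 (smoothM_opp oU s4)) (md_opp _ oU Up s4).
rewrite (md_dyad _ Up sY sa) (md_dyad _ Up sa sY) (md_dyad _ Up sYz sb) (md_dyad _ Up sb sYz) Yzz_kap.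
have Ye : lorentz (Y p) (etab p) = 0 by rewrite lorentzC.
have ze : lorentz (dd Y p) (etab p) = 0 by rewrite lorentzC.
rewrite (tst_dd_aux _ _ _ _ _ _ kb1 kb2 Ye ze) betavE /gramw.
move: kb1 kb2 Ye ze => _ _ _ _.
rewrite lorentzDl lorentzNl !lorentzZl lorentzDr lorentzNr !lorentzZr [lorentz (kapb p) (kap p)]lorentzC [lorentz (kapb p) (eta p)]lorentzC.
move: (lorentz (kap p) (kapb p)) (lorentz (kap p) (etab p)) (lorentz (eta p) (kapb p)) (lorentz (eta p) (etab p)) => A B D E.
ring.
Qed.

(* The curvature of the line bundle spanned by [kap ^ eta]. *)
Lemma lam_db p : W p -> pd 'i%C lam p = - 2 * lorentz (kap p) (kapb p).
Proof.
move=> Wp; have Up := WU Wp.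
have E1 : db (dd wedge) p = pd 'i%C lam p *: wedge p + lam p *: wedge_dbar p.
  have H q : W q -> dd wedge q = lam q *: wedge q by move=> Wq; rewrite wedge_dd // lamE.
  by rewrite (md_eq _ oW Wp H) (md_scale _ Wp s_lam (smoothM_sub WU s_wedge)) wedge_db.
have E2 : db (dd wedge) p = dd wedge_dbar p.
  by rewrite (md_comm _ _ oU Up s_wedge); apply: (md_eq _ oU Up) => q Uq; exact: wedge_db.
have := tst_dd_wedge_dbar Wp; rewrite -E2 E1 tstD !tstZ tst_wedge tst_wedge_dbar // mulr0 addr0.
by move=> /(mulIf (W_indep Wp)).
Qed.

Lemma gramw_loglaplacian p : W p ->
  gramw p * pd 'i%C (pd (- 'i%C) gramw) p - pd (- 'i%C) gramw p * pd 'i%C gramw p =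
  - 2 * lorentz (kap p) (kapb p) * gramw p ^+ 2.
Proof.
move=> Wp; have Up := WU Wp.
have H q : W q -> pd (- 'i%C) gramw q = lam q * gramw q by move=> Wq; rewrite lamE // gramw_dd.
rewrite (pd_eq _ oW Wp H) (pd_mul _ Wp s_lam (smoothC_sub WU s_gramw)) lam_db // H //.
move: (lorentz _ _) (gramw p) (lam p) (pd _ _ p) => a b c d; ring.
Qed.

(* The orthogonal projection onto the null plane spanned by [kap] and [eta], acting on row vectors. *)
Definition planeP p : 'M[C]_8 := (gramw p)^-1 *: (L *m (conj_cmx (wedge p))^T *m L *m wedge p).

Lemma s_planeP : smoothM W planeP.
Proof.
have sw := smoothM_sub WU s_wedge; have cL := smoothM_cst L oW.
apply: (smoothM_scale oW (smoothC_inv oW W_indep (smoothC_sub WU s_gramw))).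
apply: (smoothM_mul oW _ sw); apply: (smoothM_mul oW _ cL); apply: (smoothM_mul oW cL).
exact: (smoothM_tr oW (smoothM_conj oW sw)).
Qed.

Lemma wedge_conjE p : (conj_cmx (wedge p))^T = (etab p)^T *m kapb p - (kapb p)^T *m etab p.
Proof.
rewrite /wedge conj_cmxD conj_cmxN !conj_cmxM !conj_cmx_tr linearB /=.
by rewrite !trmx_mul !trmxK.
Qed.

Lemma planeP_l p x : x *m planeP p = coefA p x *: kap p + coefB p x *: eta p.
Proof.
have E : x *m L *m (conj_cmx (wedge p))^T = lorentz x (etab p) *: kapb p - lorentz x (kapb p) *: etab p.
  by rewrite wedge_conjE (mulmxBr (x *m L)) !dyad_l.
rewrite /planeP -scalemxAr !mulmxA E (mulmxBl (_ *: kapb p)) -!scalemxAl (mulmxBl (_ *: (kapb p *m L))) -!scalemxAl.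
rewrite -/(betav p) -/(alphav p) alphavE betavE /coefA /coefB.
move: (kap p) (eta p) (lorentz _ _) (lorentz _ _) (lorentz _ _) (lorentz _ _) (lorentz _ _) (lorentz _ _) (gramw p)^-1 => k e a b c d m n w.
apply/rowP => j; rewrite !mxE; move: (k _ _) (e _ _) => k1 e1; ring.
Qed.


Lemma planeP_kap p : W p -> kap p *m planeP p = kap p.
Proof.
move=> Wp; rewrite planeP_l; have w0 := W_indep Wp.
have Z (a b w : C) : (a * b - b * a) / w = 0 by rewrite [b * a]mulrC subrr mul0r.
have -> : coefA p (kap p) = 1 by exact: (divff w0).
have -> : coefB p (kap p) = 0 by exact: Z.
by rewrite scale1r scale0r addr0.
Qed.

Lemma planeP_eta p : W p -> eta p *m planeP p = eta p.
Proof.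
move=> Wp; rewrite planeP_l; have w0 := W_indep Wp.
have Z (a b w : C) : (a * b - b * a) / w = 0 by rewrite [b * a]mulrC subrr mul0r.
have Z1 (a b c d w : C) : w != 0 -> w = a * b - c * d -> (b * a - c * d) / w = 1.
  by move=> ww e; rewrite [b * a]mulrC -e divff.
have -> : coefB p (eta p) = 1.
  rewrite /coefB [lorentz (eta p) (kapb p) * _]mulrC; exact: (Z1 _ _ _ _ _ w0 erefl).
have -> : coefA p (eta p) = 0 by exact: Z.
by rewrite scale1r scale0r add0r.
Qed.

Lemma planeP_idem p : W p -> planeP p *m planeP p = planeP p.
Proof.
move=> Wp; apply/row_matrixP => i; rewrite row_mul.
have -> : row i (planeP p) = coefA p 'e_i *: kap p + coefB p 'e_i *: eta p by rewrite rowE planeP_l.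
by rewrite mulmxDl -!scalemxAl planeP_kap // planeP_eta.
Qed.

Lemma planeP_perp p x : W p -> perp p (x *m planeP p).
Proof.
move=> /WU Up; rewrite planeP_l; apply: perpD; apply: perpZ; [exact: kap_perp|exact: eta_perp].
Qed.

Lemma planeP_iso p x y : W p -> lorentz (x *m planeP p) (y *m planeP p) = 0.
Proof.
move=> /WU Up; rewrite !planeP_l !(lorentzDl, lorentzZl) !(lorentzDr, lorentzZr).
have Z (a b c d u v w z : C) : u = 0 -> v = 0 -> w = 0 -> z = 0 -> a * (c * u + d * v) + b * (c * w + d * z) = 0.
  by move=> -> -> -> ->; rewrite !mulr0 !addr0 !mulr0 addr0.
apply: Z; [exact: kap_iso|exact: lkap_eta|by rewrite lorentzC lkap_eta|exact: leta_eta].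
Qed.

Lemma lorentz_metric_tr : L^T = L. Proof. exact: tr_diag_mx. Qed.
Lemma lorentz_metric_conj : conj_cmx L = L.
Proof.
apply/matrixP => i j; rewrite !mxE; case: (i == j); rewrite ?mulr1n ?mulr0n ?conjc0 //.
by case: ifP => _; rewrite ?conjcN conjc1.
Qed.

Lemma gramw_conj p : conjc (gramw p) = gramw p.
Proof. exact: gram_conj. Qed.

Lemma planeP_herm p : L *m (conj_cmx (planeP p))^T *m L = planeP p.
Proof.
have LL (M : 'M[C]_8) : M *m L *m L = M by rewrite -mulmxA lorentz_metricK mulmx1.
rewrite /planeP conj_cmxZ conjc_inv gramw_conj !conj_cmxM lorentz_metric_conj !conj_cmx_tr conj_cmxK.
rewrite linearZ /= !trmx_mul !trmxK lorentz_metric_tr -scalemxAr -scalemxAl !mulmxA LL.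
by [].
Qed.

(** The contributions of [dd wedge = lam wedge] and of the factor [1 / w] cancel. What remains is
    the derivative of the conjugate bivector, the conjugate of [wedge_dbar]; contracted with the
    bivector it yields [- w eta] and [- w kap], and this [w] cancels the denominator. No division is
    left. *)
Lemma planeP_dd p : W p -> dd planeP p = 2 *: (L *m (Y p)^T *m eta p) - 2 *: (L *m (db Y p)^T *m kap p).
Proof.
move=> Wp; have Up := WU Wp; have w0 := W_indep Wp.
have sw := smoothM_sub WU s_wedge; have cL := smoothM_cst L oW.
have swc := smoothM_tr oW (smoothM_conj oW sw).
have s1 := smoothM_mul oW cL swc; have s2 := smoothM_mul oW s1 cL; have s3 := smoothM_mul oW s2 sw.
have sg := smoothC_sub WU s_gramw.
rewrite (md_scale _ Wp (smoothC_inv oW W_indep sg) s3) (pd_inv _ oW Wp W_indep sg).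
rewrite (md_mul _ oW Wp s2 sw) (md_mul _ oW Wp s1 cL) (md_mul _ oW Wp cL swc) !md_cst mul0mx add0r mulmx0 addr0.
rewrite md_tr (md_conj _ Wp sw) conjNi wedge_db // wedge_dd // gramw_dd // -lamE //.
rewrite /wedge_dbar wedge_dbar_conj Y_real conj_Yz //.
have [k1 _ k3 _] := kap_perp Up; have [e1 _ e3 _] := eta_perp Up.
have YS : Y p *m L *m wedge p = 0.
  by rewrite wedge_l [lorentz _ (kap p)]lorentzC [lorentz _ (eta p)]lorentzC k1 e1 !scale0r subrr.
have bS : db Y p *m L *m wedge p = 0.
  by rewrite wedge_l [lorentz _ (kap p)]lorentzC [lorentz _ (eta p)]lorentzC k3 e3 !scale0r subrr.
have kbk : lorentz (kapb p) (kap p) = lorentz (kap p) (kapb p) by exact: lorentzC.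
have kbe : lorentz (kapb p) (eta p) = lorentz (eta p) (kapb p) by exact: lorentzC.
have ebk : lorentz (etab p) (kap p) = lorentz (kap p) (etab p) by exact: lorentzC.
have ebe : lorentz (etab p) (eta p) = lorentz (eta p) (etab p) by exact: lorentzC.
have ca : conj_cmx (alphav p) = lorentz (eta p) (kapb p) *: etab p - lorentz (eta p) (etab p) *: kapb p.
  rewrite alphavE conj_cmxD conj_cmxN !conj_cmxZ -!lorentz_conj !conj_cmxK.
  rewrite kbe ebe; reflexivity.
have cb : conj_cmx (betav p) = lorentz (kap p) (kapb p) *: etab p - lorentz (kap p) (etab p) *: kapb p.
  rewrite betavE conj_cmxD conj_cmxN !conj_cmxZ -!lorentz_conj !conj_cmxK.
  rewrite kbk ebk; reflexivity.
have lc (x y z : 'rV[C]_8) (a b : C) : lorentz (a *: x - b *: y) z = a * lorentz x z - b * lorentz y z.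
  rewrite lorentzDl lorentzNl !lorentzZl; reflexivity.
have aS : conj_cmx (alphav p) *m L *m wedge p = - gramw p *: eta p.
  rewrite wedge_l ca !lc kbk kbe ebk ebe; exact: planeP_dd_aux1.
have beS : conj_cmx (betav p) *m L *m wedge p = - gramw p *: kap p.
  rewrite wedge_l cb !lc kbk kbe ebk ebe; exact: planeP_dd_aux2.
rewrite (planeP_dd_aux YS bS aS beS) -scalemxAr.
exact: planeP_dd_aux3.
Qed.

(** Adjoint of [planeP_dd]: the projection is self-adjoint by [planeP_herm], and taking adjoints
    exchanges [z] and [zbar]. *)
Lemma planeP_db p : W p -> db planeP p = 2 *: (L *m (conj_cmx (eta p))^T *m Y p) - 2 *: (L *m (conj_cmx (kap p))^T *m dd Y p).
Proof.
move=> Wp; have Up := WU Wp; have sP := s_planeP; have cL := smoothM_cst L oW.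
have scP := smoothM_conj oW sP; have stP := smoothM_tr oW scP.
have H q : W q -> planeP q = L *m (conj_cmx (planeP q))^T *m L by move=> _; rewrite planeP_herm.
rewrite (md_eq _ oW Wp H) (md_mul _ oW Wp (smoothM_mul oW cL stP) cL) (md_mul _ oW Wp cL stP) !md_cst mul0mx add0r mulmx0 addr0.
rewrite md_tr (md_conj _ Wp sP) conj_i planeP_dd //.
have LL (M : 'M[C]_8) : M *m L *m L = M by rewrite -mulmxA lorentz_metricK mulmx1.
have cc (u v : 'rV[C]_8) : (conj_cmx (L *m u^T *m v))^T = (conj_cmx v)^T *m conj_cmx u *m L.
  by rewrite !conj_cmxM lorentz_metric_conj !conj_cmx_tr !trmx_mul trmxK lorentz_metric_tr mulmxA.
rewrite conj_tr_diff !cc.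
have D (P Q : 'M[C]_8) : L *m (2 *: P - 2 *: Q) *m L = 2 *: (L *m P *m L) - 2 *: (L *m Q *m L).
  by rewrite mulmxBr -!scalemxAr !mulmxBl -!scalemxAl.
rewrite D !mulmxA !LL Y_real conj_Yb //.
Qed.

(** The null plane and its conjugate are Hermitian orthogonal and fill the normal space of rank 4;
    the identity is checked against [null_frame]. *)
Lemma planeP_compl p x : W p -> perp p x -> x *m planeP p + x *m conj_cmx (planeP p) = x.
Proof.
move=> Wp px; have Up := WU Wp; have w0 := W_indep Wp.
apply/eqP; rewrite eq_sym -subr_eq0; apply/eqP.
have xc : x *m conj_cmx (planeP p) = conj_cmx (conj_cmx x *m planeP p) by rewrite conj_cmxM conj_cmxK.
rewrite xc; set u := x *m planeP p; set v := conj_cmx x *m planeP p.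
have pu : perp p u by exact: planeP_perp.
have pv : perp p (conj_cmx v) := perp_conj Up (planeP_perp _ Wp).
have [x1 x2 x3 x4] := (perpP _ _).1 px.
have [u1 u2 u3 u4] := (perpP _ _).1 pu.
have [v1 v2 v3 v4] := (perpP _ _).1 pv.
have Z (a b c : C) : a = 0 -> b = 0 -> c = 0 -> a - (b + c) = 0.
  by move=> -> -> ->; rewrite addr0 subrr.
have Zl (a b c : C) : b = a -> c = 0 -> a - (b + c) = 0 by move=> -> ->; rewrite addr0 subrr.
have Zr (a b c : C) : b = 0 -> c = a -> a - (b + c) = 0 by move=> -> ->; rewrite add0r subrr.
have ul (z : 'rV[C]_8) : lorentz u z = coefA p x * lorentz (kap p) z + coefB p x * lorentz (eta p) z.
  by rewrite /u planeP_l lorentzDl !lorentzZl.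
have vl (z : 'rV[C]_8) : lorentz v z = coefA p (conj_cmx x) * lorentz (kap p) z + coefB p (conj_cmx x) * lorentz (eta p) z.
  by rewrite /v planeP_l lorentzDl !lorentzZl.
have ZZ (a b c d : C) : c = 0 -> d = 0 -> a * c + b * d = 0.
  by move=> -> ->; rewrite !mulr0 addr0.
have ek : lorentz (eta p) (kap p) = 0 by rewrite lorentzC; exact: lkap_eta.
have kk := kap_iso Up; have ee := leta_eta Up; have ke := lkap_eta Up.
apply: (nondegenerate8 (null_frame_free Up w0)) => i.
rewrite lorentzDl lorentzNl lorentzDl.
case: i => [[|[|[|[|[|[|[|[|//]]]]]]]] ilt]; rewrite /null_frame /=.
- exact: Z x1 u1 v1.
- exact: Z x2 u2 v2.
- exact: Z x3 u3 v3.
- exact: Z x4 u4 v4.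
- apply: Zr; first by rewrite ul; exact: ZZ.
  by rewrite lorentz_conjl vl coefA_B_kapb // lorentz_conj conjcK.
- apply: Zr; first by rewrite ul; exact: ZZ.
  by rewrite lorentz_conjl vl coefA_B_etab // lorentz_conj conjcK.
- apply: Zl; first by rewrite ul coefA_B_kapb.
  by rewrite lorentz_conj vl ZZ // conjc0.
- apply: Zl; first by rewrite ul coefA_B_etab.
  by rewrite lorentz_conj vl ZZ // conjc0.
Qed.

End ConformalLift.

(** * Parallel null planes *)

Section ComplexRemovable.
Variable R : realType.
Local Notation plane := (plane R).
Local Notation eu := (eu R).
Local Notation ev := (ev R).
Local Notation C := R[i].
Local Notation Re := complex.Re.
Local Notation Im := complex.Im.
Implicit Types (U V : set plane) (f g : plane -> C) (p q : plane).

Lemma pd_Dc_eu f q : pd (- 'i%C) f q + pd 'i%C f q = Dc eu f q.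
Proof. rewrite !pd.unlock; move: (Dc _ f q) (Dc _ f q) => a b; by field. Qed.

Lemma pd_Dc_ev f q : 'i%C * (pd (- 'i%C) f q - pd 'i%C f q) = Dc ev f q.
Proof.
rewrite !pd.unlock; move: (Dc _ f q) (Dc _ f q) => b a.
have ii : 'i%C * 'i%C = -1 :> C by rewrite -expr2 sqr_i.
have -> : 2^-1 * (a + - 'i%C * b) - 2^-1 * (a + 'i%C * b) = - ('i%C * b) by field.
by rewrite mulrN mulrA ii mulN1r opprK.
Qed.

Lemma punctured_open U p : open U -> open (U `&` [set q | q != p]).
Proof.
move=> oU; apply: openI => //; rewrite openE => q /= qp; apply/plane_ballP.
exists `|q - p|; first by rewrite normr_gt0 subr_eq0.
by move=> z zq; apply/eqP => zp; rewrite zp distrC ltxx in zq.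
Qed.

Lemma open_pos U (f : plane -> R) : open U -> (forall q, U q -> {for q, continuous f}) ->
  open (U `&` [set q | 0 < f q]).
Proof.
move=> oU cf; rewrite openE => q [Uq gq]; apply: filterI; first exact: open_nbhs_nbhs.
have [d d0 Hd] := (plane_ballP _ _).1 (cont_near (cf q Uq) gq).
apply/plane_ballP; exists d; first exact: d0.
by move=> z /Hd /=; rewrite ltr_norml ltrBrDl subrr => /andP[].
Qed.

Lemma removableC U f a b p : open U -> U p -> smoothC (U `&` [set q | q != p]) f ->
  smoothC U a -> smoothC U b ->
  (forall q, U q -> q != p -> pd (- 'i%C) f q = a q /\ pd 'i%C f q = b q) ->
  exists c : C, let g := fun q => if q == p then c else f q in
    smoothC U g /\ forall q, U q -> pd (- 'i%C) g q = a q /\ pd 'i%C g q = b q.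
Proof.
move=> oU Up sf sa sb H.
pose A q := a q + b q; pose B q := 'i%C * (a q - b q).
have [sA1 sA2] : smoothC U A by exact: smoothC_add.
have [sB1 sB2] : smoothC U B.
  exact: (smoothC_mul oU (smoothC_cst _ oU) (smoothC_add oU sa (smoothC_opp oU sb))).
have oP := punctured_open (p := p) oU.
have EA q : U q -> q != p -> Dc eu f q = A q.
  by move=> Uq qp; rewrite -pd_Dc_eu; have [-> ->] := H q Uq qp.
have EB q : U q -> q != p -> Dc ev f q = B q.
  by move=> Uq qp; rewrite -pd_Dc_ev; have [-> ->] := H q Uq qp.
have d1 q : U q -> q != p -> is_derive q eu (fun z => Re (f z)) (Re (A q)).
  move=> Uq qp; rewrite -EA //; have [[x1 _] _] := smoothC_derC sf (conj Uq qp).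
  exact: derivableP.
have d2 q : U q -> q != p -> is_derive q ev (fun z => Re (f z)) (Re (B q)).
  move=> Uq qp; rewrite -EB //; have [_ [x1 _]] := smoothC_derC sf (conj Uq qp).
  exact: derivableP.
have d3 q : U q -> q != p -> is_derive q eu (fun z => Im (f z)) (Im (A q)).
  move=> Uq qp; rewrite -EA //; have [[_ x1] _] := smoothC_derC sf (conj Uq qp).
  exact: derivableP.
have d4 q : U q -> q != p -> is_derive q ev (fun z => Im (f z)) (Im (B q)).
  move=> Uq qp; rewrite -EB //; have [_ [_ x1]] := smoothC_derC sf (conj Uq qp).
  exact: derivableP.
have [c1 [s1 e1]] := removable oU Up d1 d2 sA1 sB1.
have [c2 [s2 e2]] := removable oU Up d3 d4 sA2 sB2.
exists (c1 +i* c2) => g.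
have gR : (fun q => Re (g q)) = (fun q => if q == p then c1 else Re (f q)).
  by apply/funext => q; rewrite /g; case: ifP.
have gI : (fun q => Im (g q)) = (fun q => if q == p then c2 else Im (f q)).
  by apply/funext => q; rewrite /g; case: ifP.
split; first by split; rewrite ?gR ?gI.
move=> q Uq; have [[_ x1] [_ x2]] := e1 q Uq; have [[_ x3] [_ x4]] := e2 q Uq.
have Eu : Dc eu g q = A q by rewrite /Dc gR gI x1 x3; case: (A q).
have Ev : Dc ev g q = B q by rewrite /Dc gR gI x2 x4; case: (B q).
have ii : 'i%C * 'i%C = -1 :> C by rewrite -expr2 sqr_i.
split; rewrite pd.unlock Eu Ev /A /B.
  have -> : - 'i%C * ('i%C * (a q - b q)) = a q - b q by rewrite mulNr mulrA ii mulN1r opprK.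
  by move: (a q) (b q) => x y; field.
rewrite mulrA ii mulN1r; by move: (a q) (b q) => x y; field.
Qed.

Lemma removableM U m n (F A B : plane -> 'M[C]_(m, n)) p : open U -> U p ->
  smoothM (U `&` [set q | q != p]) F -> smoothM U A -> smoothM U B ->
  (forall q, U q -> q != p -> md (- 'i%C) F q = A q /\ md 'i%C F q = B q) ->
  exists G : plane -> 'M[C]_(m, n), [/\ smoothM U G, forall q, q != p -> G q = F q &
    forall q, U q -> md (- 'i%C) G q = A q /\ md 'i%C G q = B q].
Proof.
move=> oU Up sF sA sB H.
have K (ij : 'I_m * 'I_n) : exists c : C, let g := fun q => if q == p then c else F q ij.1 ij.2 in
    smoothC U g /\ forall q, U q -> pd (- 'i%C) g q = A q ij.1 ij.2 /\ pd 'i%C g q = B q ij.1 ij.2.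
  apply: (removableC oU Up (sF ij.1 ij.2) (sA ij.1 ij.2) (sB ij.1 ij.2)) => q Uq qp.
  by have [<- <-] := H q Uq qp; rewrite !mdE.
have [c Hc] := choice K.
exists (fun q => if q == p then \matrix_(i, j) c (i, j) else F q).
have E i j : (fun q => (if q == p then \matrix_(i, j) c (i, j) else F q) i j) =
   (fun q => if q == p then c (i, j) else F q i j).
  by apply/funext => q; case: ifP => // _; rewrite mxE.
split.
- by move=> i j; rewrite E; have [s _] := Hc (i, j); exact: s.
- by move=> q /negbTE ->.
- move=> q Uq; split; apply/matrixP => i j; rewrite mdE E; have [_ /(_ q Uq)[e1 e2]] := Hc (i, j).
    exact: e1.
  exact: e2.
Qed.

Lemma cont_eq0 U (f : plane -> R) p : open U -> U p -> {for p, continuous f} ->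
  (forall q, U q -> q != p -> f q = 0) -> f p = 0.
Proof.
move=> oU Up cf H; apply/eqP; apply: contraT => fp.
have e0 : 0 < `|f p| by rewrite normr_gt0.
have nU : \forall q \near p, U q by exact: open_nbhs_nbhs.
have [d d0 Hd] := (plane_ballP _ _).1 (filterI nU (cont_near cf e0)).
have nq : `|(d / 2) *: eu + p - p| < d.
  by rewrite addrK normZ_eu gtr0_norm ?divr_gt0 // ltr_pdivrMr // ltr_pMr // ltr1n.
have [Uq] := Hd _ nq; rewrite H //; first by rewrite sub0r normrN ltxx.
by rewrite -subr_eq0 -normr_gt0 addrK normZ_eu normr_gt0 gt_eqF // divr_gt0.
Qed.

Lemma smoothM_eq0 U m n (F : plane -> 'M[C]_(m, n)) p : open U -> U p -> smoothM U F ->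
  (forall q, U q -> q != p -> F q = 0) -> F p = 0.
Proof.
move=> oU Up sF H; apply/matrixP => i j; rewrite mxE.
have [c1 c2] := smoothC_cont (sF i j) Up.
apply/eqP; rewrite eq_complex /=; apply/andP; split; apply/eqP.
  by apply: (cont_eq0 oU Up c1) => q Uq qp; rewrite H // mxE.
by apply: (cont_eq0 oU Up c2) => q Uq qp; rewrite H // mxE.
Qed.

End ComplexRemovable.

(** * Extension of the projection across an isolated zero, and its sections *)

Section PlaneField.
Variable R : realType.
Local Notation plane := (plane R).
Local Notation C := R[i].
Local Notation dd := (md (- 'i%C)).
Local Notation db := (md 'i%C).
Local Notation L := (lorentz_metric C).
Variables (U : set plane) (Y : plane -> 'rV[C]_8).
Hypothesis HY : conformal_lift U Y.
Hypothesis HW : isotropic_willmore U Y.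

Local Notation Yzb := (liftW Y).
Local Notation kap := (lift_kap Y).
Local Notation nproj := (lift_proj Y).
Local Notation eta := (lift_eta Y).
Local Notation perp := (perp Y).
#[local] Opaque lorentz conj_cmx.

Let oU : open U. Proof. by case: HY. Qed.
Let sY : smoothM U Y. Proof. by case: HY. Qed.

Definition projF q : 'M[C]_8 := \matrix_i nproj q 'e_i.

Lemma nproj_mx q x : nproj q x = x *m projF q.
Proof.
rewrite lift_proj.unlock /=; congr (x *m _).
apply/row_matrixP => i; rewrite rowK lift_proj.unlock /=; exact: rowE.
Qed.

(** What survives of [planeP] at a zero of [w]. No clause divides by [w] or asks [kap] and [eta] to
    be independent, so each one is an identity between smooth functions and passes to the limit. *)
Record plane_field (V : set plane) (P : plane -> 'M[C]_8) : Prop := PlaneField {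
  pf_open : open V;
  pf_sub : V `<=` U;
  pf_smooth : smoothM V P;
  pf_idem : forall q, V q -> P q *m P q = P q;
  pf_perp : forall q x, V q -> perp q (x *m P q);
  pf_iso : forall q x y, V q -> lorentz (x *m P q) (y *m P q) = 0;
  pf_herm : forall q, V q -> L *m (conj_cmx (P q))^T *m L = P q;
  pf_kap : forall q, V q -> kap q *m P q = kap q;
  pf_eta : forall q, V q -> eta q *m P q = eta q;
  pf_compl : forall q x, V q -> perp q x -> x *m P q + x *m conj_cmx (P q) = x;
  pf_dd : forall q, V q -> dd P q = 2 *: (L *m (Y q)^T *m eta q) - 2 *: (L *m (db Y q)^T *m kap q);
  pf_db : forall q, V q -> db P q =
    2 *: (L *m (conj_cmx (eta q))^T *m Y q) - 2 *: (L *m (conj_cmx (kap q))^T *m dd Y q) }.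

Lemma extend_eq V m n (F G : plane -> 'M[C]_(m, n)) p : open V -> smoothM V F -> smoothM V G ->
  (forall q, V q -> q != p -> F q = G q) -> forall q, V q -> F q = G q.
Proof.
move=> oV sF sG H q; have [-> Vp|qp Vq] := eqVneq q p; last exact: H.
apply/eqP; rewrite -subr_eq0; apply/eqP.
apply: (@smoothM_eq0 _ V _ _ (fun z => F z - G z) p oV Vp).
  exact: (smoothM_add oV sF (smoothM_opp oV sG)).
by move=> z Vz zp; rewrite H // subrr.
Qed.

Lemma extend_eq0 V (f : plane -> C) p : open V -> smoothC V f ->
  (forall q, V q -> q != p -> f q = 0) -> forall q, V q -> f q = 0.
Proof.
move=> oV sf H q Vq.
have sF : smoothM V (fun z => (f z)%:M : 'M[C]_1).
  move=> i j; apply: (smoothC_eq oV _ sf) => z _; by rewrite mxE !ord1 eqxx mulr1n.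
have := extend_eq oV sF (smoothM_cst 0 oV) (p := p) _ Vq => /(_ _)/matrixP/(_ 0 0).
rewrite !mxE eqxx mulr1n; apply=> z Vz zp; by rewrite H // raddf0.
Qed.

Lemma planeP_field (V : set plane) (p : plane) : open V -> V `<=` U -> V p ->
  (forall q, U q -> hopf4 Y q = 0) ->
  (forall q, V q -> q != p -> gramw Y q != 0) -> exists P, plane_field V P.
Proof.
move=> oV VU Vp H40 Hw.
have oW := punctured_open (p := p) oV; set W : set plane := V `&` _ in oW.
have WU : W `<=` U by move=> q [/VU].
have Wi q : W q -> gramw Y q != 0 by case=> Vq qp; exact: Hw.
have sk := smoothM_sub VU (s_kap HY); have se := smoothM_sub VU (s_eta HY).
have sYV := smoothM_sub VU sY; have sYz := smoothM_sub VU (sYz HY); have sYb := smoothM_sub VU (sYb HY).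
have sYzb := smoothM_sub VU (sYzb HY).
have cL := smoothM_cst L oV; have c2 := smoothC_cst (2 : C) oV.
have dy (u v : plane -> 'rV[C]_8) : smoothM V u -> smoothM V v -> smoothM V (fun q => 2 *: (L *m (u q)^T *m v q)).
  move=> su sv; exact: (smoothM_scale oV c2 (smoothM_mul oV (smoothM_mul oV cL (smoothM_tr oV su)) sv)).
have sA := smoothM_add oV (dy _ _ sYV se) (smoothM_opp oV (dy _ _ sYb sk)).
have sB := smoothM_add oV (dy _ _ (smoothM_conj oV se) sYV) (smoothM_opp oV (dy _ _ (smoothM_conj oV sk) sYz)).
have EW q : V q -> q != p -> W q by [].
have [q Vq qp|P [sP PE Pd]] := removableM oV Vp (s_planeP HY oW WU Wi) sA sB.
  have Wq := EW q Vq qp.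
  split; [exact: (planeP_dd HY HW H40 oW WU Wi Wq)|exact: (planeP_db HY HW H40 oW WU Wi Wq)].
have scP := smoothM_conj oV sP.
have EX m n (F G : plane -> 'M[C]_(m, n)) := @extend_eq V m n F G p oV.
have sc m n (A : 'M[C]_(m, n)) : smoothM V (fun=> A) by exact: smoothM_cst.
have K (u : plane -> 'rV[C]_8) : smoothM V u -> (forall q x, U q -> perp q x -> lorentz x (u q) = 0) ->
    forall q x, V q -> lorentz (x *m P q) (u q) = 0.
  move=> su Hu q x Vq.
  have sx := smoothC_lorentz oV (smoothM_mul oV (sc _ _ x) sP) su.
  apply: (extend_eq0 (p := p) oV sx) (Vq) => z Vz zp; rewrite PE //.
  apply: Hu; [exact: VU|exact: (planeP_perp HY _ _ (EW z Vz zp))].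
exists P; split => //.
- apply: (EX _ _ _ _ (smoothM_mul oV sP sP) sP) => q Vq qp.
  rewrite PE //; exact: (planeP_idem Wi (EW q Vq qp)).
- move=> q x Vq; split.
  + by apply: (K _ sYV _ q x Vq) => z u Uz [].
  + by apply: (K _ sYz _ q x Vq) => z u Uz [].
  + by apply: (K _ sYb _ q x Vq) => z u Uz [].
  + by apply: (K _ sYzb _ q x Vq) => z u Uz [].
- move=> q x y Vq.
  have sx := smoothC_lorentz oV (smoothM_mul oV (sc _ _ x) sP) (smoothM_mul oV (sc _ _ y) sP).
  apply: (extend_eq0 (p := p) oV sx) (Vq) => z Vz zp; rewrite PE //.
  exact: (planeP_iso HY HW WU _ _ (EW z Vz zp)).
- have s1 := smoothM_mul oV (smoothM_mul oV cL (smoothM_tr oV scP)) cL.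
  apply: (EX _ _ _ _ s1 sP) => q Vq qp; rewrite PE //; exact: planeP_herm.
- apply: (EX _ _ _ _ (smoothM_mul oV sk sP) sk) => q Vq qp; rewrite PE //.
  exact: (planeP_kap Wi (EW q Vq qp)).
- apply: (EX _ _ _ _ (smoothM_mul oV se sP) se) => q Vq qp; rewrite PE //.
  exact: (planeP_eta Wi (EW q Vq qp)).
- move=> q x Vq px.
  (* [x] is normal at [q] only; its projections at the nearby points form a smooth normal field
     through it, to which [planeP_compl] applies. *)
  have sn := smoothM_sub VU (s_nproj HY (smoothM_cst x oU)).
  have s1 := smoothM_add oV (smoothM_mul oV sn sP) (smoothM_mul oV sn scP).
  have := EX _ _ _ _ s1 sn _ q Vq => /=; rewrite (nproj_id px); apply=> z Vz zp.
  rewrite PE //; apply: (planeP_compl HY HW WU Wi (EW z Vz zp)).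
  exact: (nproj_perp HY (VU _ Vz)).
- by move=> q Vq; exact: (Pd q Vq).1.
- by move=> q Vq; exact: (Pd q Vq).2.
Qed.

Definition vframe q : 'M[C]_(4, 8) := \matrix_(i < 4) [:: Y q; dd Y q; db Y q; Yzb q]`_i.

Lemma vframe_row (c : 'rV[C]_4) q : c *m vframe q =
  c 0 0 *: Y q + c 0 1 *: dd Y q + c 0 2%:R *: db Y q + c 0 3%:R *: Yzb q.
Proof.
rewrite mulmx_sum_row !big_ord_recl big_ord0 addr0 !rowK /= !addrA.
by do 3?congr (_ + _); congr (c 0 _ *: _); apply/val_inj.
Qed.

Lemma vframe_free q : U q -> row_free (vframe q).
Proof.
move=> Uq; apply: inj_row_free => c; rewrite vframe_row => c0.
have H x : lorentz (c 0 0 *: Y q + c 0 1 *: dd Y q + c 0 2%:R *: db Y q + c 0 3%:R *: Yzb q) x = 0.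
  by rewrite c0 lorentz0l.
have E x : c 0 0 * lorentz (Y q) x + c 0 1 * lorentz (dd Y q) x + c 0 2%:R * lorentz (db Y q) x
   + c 0 3%:R * lorentz (Yzb q) x = 0.
  by rewrite -(H x) !lorentzDl !lorentzZl.
have [n1 n2 n3 _] : [/\ lorentz (Y q) (Y q) = 0, lorentz (dd Y q) (dd Y q) = 0,
   lorentz (dd Y q) (db Y q) = 2^-1 & True] by case: HY => _ _ _ /(_ q Uq)[].
have E0 := E (Y q); have E1 := E (dd Y q); have E2 := E (db Y q); have E3 := E (Yzb q).
rewrite n1 [lorentz (dd Y q) (Y q)]lorentzC (lYYz HY Uq) [lorentz (db Y q) (Y q)]lorentzC (lYYb HY Uq)
  [lorentz (Yzb q) (Y q)]lorentzC (lYYzb HY Uq) in E0.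
rewrite (lYYz HY Uq) n2 [lorentz (db Y q) (dd Y q)]lorentzC n3 [lorentz (Yzb q) (dd Y q)]lorentzC (lYzYzb HY Uq) in E1.
rewrite (lYYb HY Uq) n3 (lYbYb HY Uq) [lorentz (Yzb q) (db Y q)]lorentzC (lYbYzb HY Uq) in E2.
rewrite (lYYzb HY Uq) (lYzYzb HY Uq) (lYbYzb HY Uq) in E3.
move: E0 E1 E2 E3; move: (lorentz _ _) => l; clear.
have K (x y : C) : x * y = 0 -> y != 0 -> x = 0 by move=> /eqP; rewrite mulf_eq0 => /orP[/eqP//|/eqP->]; rewrite eqxx.
have h0 : (2^-1 : C) != 0 by rewrite invr_eq0 pnatr_eq0.
have h1 : (- 2^-1 : C) != 0 by rewrite oppr_eq0.
rewrite !mulr0 !addr0 !add0r => /K/(_ h1) c3 /K/(_ h0) c2 /K/(_ h0) c1.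
rewrite c3 mul0r addr0 => /K/(_ h1) c0.
apply/rowP => -[[|[|[|[|//]]]] ilt]; rewrite mxE.
- by rewrite -[RHS]c0; congr (c _ _); apply/val_inj.
- by rewrite -[RHS]c1; congr (c _ _); apply/val_inj.
- by rewrite -[RHS]c2; congr (c _ _); apply/val_inj.
- by rewrite -[RHS]c3; congr (c _ _); apply/val_inj.
Qed.

Lemma perp_vframe q x : perp q x <-> x *m L *m (vframe q)^T = 0.
Proof.
split=> [[h1 h2 h3 h4]|H].
  by apply/rowP => -[[|[|[|[|//]]]] ilt]; rewrite lorentz_row rowK mxE.
have K (i : 'I_4) : lorentz x ([:: Y q; dd Y q; db Y q; Yzb q]`_i) = 0.
  by rewrite -(rowK (fun i : 'I_4 => [:: Y q; dd Y q; db Y q; Yzb q]`_i) i) -lorentz_row H mxE.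
by split; [exact: (K 0)|exact: (K 1)|exact: (K 2%:R)|exact: (K 3%:R)].
Qed.

Lemma perp_kermx q x : perp q x <-> (x <= kermx (L *m (vframe q)^T))%MS.
Proof. by rewrite perp_vframe -mulmxA; split=> [H|/sub_kermxP //]; apply/sub_kermxP. Qed.

Lemma projF_kermx q : U q -> (projF q == kermx (L *m (vframe q)^T))%MS.
Proof.
move=> Uq; apply/andP; split; apply/row_subP => i.
  by rewrite -perp_kermx rowK; exact: (nproj_perp HY).
have /perp_kermx/nproj_id E := row_sub i (kermx (L *m (vframe q)^T)).
by rewrite -E nproj_mx submxMl.
Qed.

Lemma rank_projF q : U q -> \rank (projF q) = 4.
Proof.
move=> Uq; rewrite (eqmx_rank (projF_kermx Uq)) mxrank_ker.
have Lu : L \in unitmx by apply: (proj1 (mulmx1_unit (lorentz_metricK R))).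
have -> : \rank (L *m (vframe q)^T) = \rank (vframe q)^T.
  by rewrite (eqmxMfull (vframe q)^T _) // row_full_unit.
by rewrite mxrank_tr (eqP (vframe_free Uq)).
Qed.

Section Field.
Variables (V : set plane) (P : plane -> 'M[C]_8).
Hypothesis pf : plane_field V P.

(** [P] and its conjugate have equal rank, their ranges span the normal space of dimension 4, and a
    common vector [x] satisfies [x + x = x], hence is zero. *)
Lemma pf_rank q : V q -> \rank (P q) = 2.
Proof.
move=> Vq; have Uq := pf_sub pf Vq.
have rc : \rank (conj_cmx (P q)) = \rank (P q) by exact: mxrank_map.
have le1 : (projF q <= P q + conj_cmx (P q))%MS.
  apply/row_subP => i; rewrite rowK -(pf_compl pf Vq (nproj_perp HY Uq 'e_i)).
  by rewrite addmx_sub_adds // submxMl.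
have pc i : perp q (row i (conj_cmx (P q))).
  have -> : row i (conj_cmx (P q)) = conj_cmx ('e_i *m P q) by rewrite -rowE; apply/rowP => j; rewrite !mxE.
  exact: (perp_conj HY Uq (pf_perp pf _ Vq)).
have le2 : (P q + conj_cmx (P q) <= projF q)%MS.
  rewrite addsmx_sub; apply/andP; split; apply/row_subP => i.
    by rewrite rowE -(nproj_id (pf_perp pf 'e_i Vq)) nproj_mx submxMl.
  by rewrite -(nproj_id (pc i)) nproj_mx submxMl.
have cap0 : (P q :&: conj_cmx (P q))%MS = 0.
  apply/eqP; rewrite -submx0; apply/row_subP => i.
  have := row_sub i (P q :&: conj_cmx (P q))%MS; rewrite sub_capmx => /andP[/submxP[a ea] /submxP[b eb]].
  set x := row i _ in ea eb *.
  have Ex : x *m P q = x by rewrite {1}ea -mulmxA (pf_idem pf Vq) -ea.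
  have cI : conj_cmx (P q) *m conj_cmx (P q) = conj_cmx (P q) by rewrite -conj_cmxM (pf_idem pf Vq).
  have Ey : x *m conj_cmx (P q) = x by rewrite {1}eb -mulmxA cI -eb.
  have px : perp q x by rewrite -Ex; exact: (pf_perp pf).
  have := pf_compl pf Vq px; rewrite Ex Ey => /eqP; rewrite -subr_eq0 addrK => /eqP ->; exact: sub0mx.
have := mxrank_sum_cap (P q) (conj_cmx (P q)); rewrite cap0 mxrank0 addn0 rc.
have -> : \rank (P q + conj_cmx (P q)) = 4.
  rewrite -(rank_projF Uq); apply: eqmx_rank; apply/andP; split; [exact: le2|exact: le1].
by move=> /esym/eqP; rewrite addnn -[4]/(2.*2) (inj_eq double_inj) => /eqP.
Qed.

Lemma mul_dyads (x a b y z : 'rV[C]_8) : x *m (2 *: (L *m a^T *m y) - 2 *: (L *m b^T *m z)) =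
  (2 * lorentz x a) *: y - (2 * lorentz x b) *: z.
Proof. by rewrite mulmxBr -!scalemxAr !mulmxA !lorentz_mx !mul_scalar_mx !scalerA. Qed.

(** By [pf_dd] the derivative factors through the products of [x] with [Y] and [Y_zbar].
    Consequently the [z]-derivative of a section [F = F P] stays in the plane without projecting. *)
Lemma pf_mul_dd q x : V q -> perp q x -> x *m dd P q = 0.
Proof.
move=> Vq [h1 _ h3 _]; rewrite (pf_dd pf Vq) mul_dyads h1 h3.
by rewrite mulr0 !scale0r subrr.
Qed.

Lemma pf_mul_db q x : V q -> x *m db P q =
  (2 * lorentz x (conj_cmx (eta q))) *: Y q - (2 * lorentz x (conj_cmx (kap q))) *: dd Y q.
Proof.
move=> Vq; rewrite (pf_db pf Vq); exact: mul_dyads.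
Qed.

Variable F : plane -> 'rV[C]_8.
Variable W : set plane.
Hypothesis oW : open W.
Hypothesis WV : W `<=` V.
Hypothesis sF : smoothM W F.
Hypothesis FP : forall q, W q -> F q *m P q = F q.

Lemma section_perp q : W q -> perp q (F q).
Proof. by move=> Wq; rewrite -FP //; apply: (pf_perp pf); exact: WV. Qed.

Lemma section_dd q : W q -> dd F q *m P q = dd F q.
Proof.
move=> Wq; have sP := smoothM_sub WV (pf_smooth pf).
have E : forall z, W z -> F z = F z *m P z by move=> z /FP.
rewrite [RHS](md_eq _ oW Wq E) (md_mul _ oW Wq sF sP).
by rewrite (pf_mul_dd (WV Wq) (section_perp Wq)) addr0.
Qed.

Lemma section_nproj_dd q : W q -> nproj q (dd F q) *m P q = nproj q (dd F q).
Proof.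
move=> Wq; have p1 : perp q (dd F q) by rewrite -section_dd //; apply: (pf_perp pf); exact: WV.
by rewrite (nproj_id p1) section_dd.
Qed.

(** The term [F (db P)] is a combination of [Y] and [Y_z], which the normal projection removes. *)
Lemma section_nproj_db q : W q -> nproj q (db F q) *m P q = nproj q (db F q).
Proof.
move=> Wq; have sP := smoothM_sub WV (pf_smooth pf); have Vq := WV Wq; have Uq := pf_sub pf Vq.
have E : forall z, W z -> F z = F z *m P z by move=> z /FP.
rewrite [in nproj q _](md_eq _ oW Wq E) (md_mul _ oW Wq sF sP) (pf_mul_db _ Vq).
have Z (a b : C) x : nproj q (x + (a *: Y q - b *: dd Y q)) = nproj q x.
  rewrite nprojD nprojD -scaleNr !nprojZ (nproj_Y HY Uq) (nproj_Yz HY Uq) !scaler0 !addr0; reflexivity.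
rewrite Z (nproj_id (pf_perp pf _ Vq)) -mulmxA (pf_idem pf Vq); reflexivity.
Qed.

End Field.

Section UnitSection.
Variable W : set plane.
Hypothesis (oW : open W) (WU : W `<=` U).

Lemma positive_norm q x : U q -> perp q x -> x != 0 -> 0 < lorentz x (conj_cmx x).
Proof. by move=> Uq [h1 _ _ h4] x0; case: HY => _ _ _ /(_ q Uq)[_ _ _]; exact. Qed.

Lemma unit_section F p : smoothM W F -> (forall q, W q -> perp q (F q)) -> W p -> F p != 0 ->
  exists (W' : set plane) (a : plane -> C), [/\ open W', W' p, W' `<=` W, smoothC W' a &
    forall q, W' q -> lorentz (a q *: F q) (conj_cmx (a q *: F q)) = 1].
Proof.
move=> sF pF Wp F0; pose g q := lorentz (F q) (conj_cmx (F q)).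
have sg : smoothC W g := smoothC_lorentz oW sF (smoothM_conj oW sF).
pose W' := W `&` [set q | 0 < complex.Re (g q)].
have oW' : open W' := open_pos oW (fun q Wq => (smoothC_cont sg Wq).1).
have W'W : W' `<=` W by move=> q [].
have [sg1 _] := smoothC_sub W'W sg.
have r0 q : W' q -> Num.sqrt (complex.Re (g q)) != 0 by move=> [_ h]; rewrite gt_eqF // sqrtr_gt0.
have sa : smooth_on W' (fun q => (Num.sqrt (complex.Re (g q)))^-1).
  by move=> k; apply: (Ck_inv oW' r0); apply: (Ck_sqrt oW' _ (sg1 k)) => q [].
exists W', (fun q => ((Num.sqrt (complex.Re (g q)))^-1)%:C); split => //.
- split => //; have := positive_norm (WU Wp) (pF p Wp) F0.
  by rewrite ltcE => /andP[_].
- exact: smoothC_real.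
- move=> q Wq; have [W1 g1] := Wq; have Fq : F q != 0.
    apply: contraTneq g1 => F00; by rewrite /g F00 lorentz0l ltxx.
  have := positive_norm (WU W1) (pF q W1) Fq; rewrite -/(g q) ltcE /= => /andP[/eqP gi _].
  rewrite conj_cmxZ lorentzZl lorentzZr -/(g q); move: (r0 q Wq) (g1 : 0 < complex.Re (g q)) gi; case: (g q) => x y /= h x0 ->.
  rewrite oppr0 /=; apply/eqP; rewrite eq_complex /= !(mulr0, mul0r, subr0, addr0) eqxx andbT.
  have := sqr_sqrtr (ltW x0); move: h; move: (Num.sqrt x) => r r1 <-; apply/eqP; by field.
Qed.

End UnitSection.

Section Frame.
Variables (V : set plane) (P : plane -> 'M[C]_8).
Hypothesis pf : plane_field V P.

Lemma unitary_frame p : V p -> exists (W : set plane) (E : 'I_2 -> plane -> 'rV[C]_8),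
  [/\ open W, W p, W `<=` V, forall i, smoothM W (E i) & forall q, W q ->
     (forall i, E i q *m P q = E i q) /\ (forall i j, lorentz (E i q) (conj_cmx (E j q)) = (i == j)%:R)].
Proof.
move=> Vp; have oV := pf_open pf; have VU := pf_sub pf.
(* A basis of the plane at [p], kept constant and projected to the nearby planes, gives two local
   sections for Gram-Schmidt. *)
have : exists A : 'M[C]_(\rank (P p), 8), row_free A /\ A *m P p = A.
  exists (row_base (P p)); split; first exact: row_base_free.
  have /submxP[B ->] : (row_base (P p) <= P p)%MS by rewrite eq_row_base.
  by rewrite -mulmxA (pf_idem pf Vp).
rewrite (pf_rank pf Vp) => -[A [fA AP]].
have sF i : smoothM V (fun q => row i A *m P q) by exact: (smoothM_mul oV (smoothM_cst _ oV) (pf_smooth pf)).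
have FP i q : V q -> row i A *m P q *m P q = row i A *m P q by move=> Vq; rewrite -mulmxA (pf_idem pf Vq).
have pF i q : V q -> perp q (row i A *m P q) by exact: (pf_perp pf).
have EA i : row i A *m P p = row i A by rewrite -row_mul AP.
have A0 : row 0 A *m P p != 0.
  rewrite EA rowE; apply/negP => /eqP/(congr1 (fun x => x == 0)); rewrite (mulmx_free_eq0 _ fA) eqxx.
  by move=> /eqP/rowP/(_ 0)/eqP; rewrite !mxE eqxx oner_eq0.
have [W1 [a1 [oW1 W1p W1V sa1 u1]]] := unit_section oV VU (sF 0) (pF 0) Vp A0.
pose E1 q := a1 q *: (row 0 A *m P q).
have sE1 : smoothM W1 E1 by exact: (smoothM_scale oW1 sa1 (smoothM_sub W1V (sF 0))).
have EP1 q : W1 q -> E1 q *m P q = E1 q by move=> /W1V Vq; rewrite -scalemxAl FP.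
pose c q := lorentz (row 1 A *m P q) (conj_cmx (E1 q)).
pose F2 q := row 1 A *m P q - c q *: E1 q.
have sF1 := smoothM_sub W1V (sF 1).
have sc : smoothC W1 c := smoothC_lorentz oW1 sF1 (smoothM_conj oW1 sE1).
have sF2 : smoothM W1 F2.
  exact: (smoothM_add oW1 sF1 (smoothM_opp oW1 (smoothM_scale oW1 sc sE1))).
have F2P q : W1 q -> F2 q *m P q = F2 q.
  by move=> W1q; rewrite mulmxBl -scalemxAl (EP1 _ W1q) (FP _ _ (W1V _ W1q)).
have pF2 q : W1 q -> perp q (F2 q) by move=> W1q; rewrite -F2P //; apply: (pf_perp pf); exact: W1V.
have A1 : F2 p != 0.
  (* Coordinates of [F2 p] in the rows of [A]; the last entry 1 shows that it is not zero. *)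
  pose u : 'rV[C]_2 := \row_j (if j == 0 then - (c p * a1 p) else 1).
  have -> : F2 p = u *m A.
    rewrite /F2 /E1 !EA mulmx_sum_row !big_ord_recl big_ord0 addr0 !mxE /= scalerA scaleNr addrC.
    by congr (_ + _); rewrite scale1r; congr (row _ A); apply/val_inj.
  rewrite (mulmx_free_eq0 _ fA); apply/negP => /eqP/rowP/(_ 1)/eqP; by rewrite !mxE /= oner_eq0.
have W1U : W1 `<=` U by move=> q /W1V/VU.
have [W2 [a2 [oW2 W2p W2W sa2 u2]]] := unit_section oW1 W1U sF2 pF2 W1p A1.
pose E2 q := a2 q *: F2 q.
have sE2 : smoothM W2 E2 by exact: (smoothM_scale oW2 sa2 (smoothM_sub W2W sF2)).
have e21 q : W2 q -> lorentz (E2 q) (conj_cmx (E1 q)) = 0.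
  by move=> /W2W/u1 h; rewrite lorentzZl lorentzDl lorentzNl lorentzZl h mulr1 subrr mulr0.
exists W2, (fun i => if i == 0 then E1 else E2); split => //.
- by move=> q /W2W/W1V.
- move=> i; case: ifP => _ //; exact: (smoothM_sub W2W).
move=> q W2q; have W1q := W2W q W2q; split.
  by move=> i; case: ifP => _; [exact: EP1|rewrite -scalemxAl F2P].
move=> i j; case: (i =P 0) => [->|i0]; case: (j =P 0) => [->|j0].
- by rewrite eqxx; exact: u1.
- rewrite eq_sym (introF eqP j0) lorentz_conjr lorentzC e21 ?conjc0 //.
- by rewrite (introF eqP i0) e21.
- have -> : i = j.
    have K (k : 'I_2) : k <> 0 -> k = 1.
      by case: k => [[|[|//]]] klt k0; [case: k0; apply/val_inj|apply/val_inj].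
    by rewrite (K i i0) (K j j0).
  by rewrite eqxx; exact: u2.
Qed.

(** Unitarity gives the frame matrix an explicit right inverse, so its rank is 2, that of the plane
    that contains its rows. *)
Lemma frame_span (E : 'I_2 -> 'rV[C]_8) q (x : 'rV[C]_8) : V q ->
  (forall i, E i *m P q = E i) -> (forall i j, lorentz (E i) (conj_cmx (E j)) = (i == j)%:R) ->
  x *m P q = x -> (x <= \matrix_(i < 2) E i)%MS.
Proof.
move=> Vq EP EE xP; set M := (X in (_ <= X)%MS).
have MP : (M <= P q)%MS by apply/row_subP => i; rewrite rowK -EP submxMl.
have rM : \rank M = 2.
  apply/eqP; apply/row_freeP; exists (L *m (conj_cmx M)^T).
  apply/matrixP => i j; rewrite mulmxA !mxE -EE.
  transitivity ((row i M *m L *m (conj_cmx M)^T) 0 j).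
    by rewrite -row_mul -row_mul [RHS]mxE mxE.
  by rewrite lorentz_row rowK; congr lorentz; apply/rowP => k; rewrite !mxE.
have := mxrank_leqif_eq MP; rewrite rM (pf_rank pf Vq) => -[_]; rewrite eqxx => /esym/andP[_ PM].
by apply: submx_trans PM; rewrite -xP submxMl.
Qed.

End Frame.

Section Isotropy.
Variables (V : set plane) (P : plane -> 'M[C]_8).
Hypothesis pf : plane_field V P.

Let oV : open V. Proof. exact: (pf_open pf). Qed.
Let VU : V `<=` U. Proof. exact: (pf_sub pf). Qed.

(** The span of [Y], [Y_z] and the plane is stable under [d/dz]: [Y_zz] is [kap] minus a multiple of
    [Y], [kap] lies in the plane, and derivatives of sections stay in it by [section_dd]. *)
Lemma iter_dd_span m : exists (a b : plane -> C) (xi : plane -> 'rV[C]_8),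
  [/\ smoothC V a, smoothC V b, smoothM V xi, forall q, V q -> xi q *m P q = xi q &
   forall q, V q -> iter m.+1 (@dz R 8) Y q = a q *: Y q + b q *: dd Y q + xi q].
Proof.
have sYV := smoothM_sub VU sY; have sYz := smoothM_sub VU (sYz HY).
elim: m => [|m [a [b [xi [sa sb sx xP E]]]]].
  exists (fun=> 0), (fun=> 1), (fun=> 0); split.
  - exact: smoothC_cst.
  - exact: smoothC_cst.
  - exact: smoothM_cst.
  - by move=> q _; rewrite mul0mx.
  - by move=> q _; rewrite scale0r scale1r add0r addr0 /= dzE.
have sk := smoothM_sub VU (s_kap HY); have ss := smoothC_sub VU (s_schw HY).
have sbs := smoothC_mul oV sb (smoothC_mul oV ss (smoothC_cst 2^-1 oV)).
exists (fun q => pd (- 'i%C) a q - b q * (lift_schw Y q / 2)), (fun q => a q + pd (- 'i%C) b q),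
  (fun q => b q *: kap q + dd xi q); split.
- exact: (smoothC_add oV (smoothC_pd _ oV sa) (smoothC_opp oV sbs)).
- exact: (smoothC_add oV sa (smoothC_pd _ oV sb)).
- exact: (smoothM_add oV (smoothM_scale oV sb sk) (smoothM_md _ oV sx)).
- move=> q Vq; rewrite mulmxDl -scalemxAl (pf_kap pf Vq).
  by rewrite (section_dd pf oV (fun _ h => h) sx xP Vq).
- move=> q Vq; rewrite iterS dzE (md_eq _ oV Vq E).
  have s1 := smoothM_scale oV sa sYV; have s2 := smoothM_scale oV sb sYz.
  rewrite (md_add _ Vq (smoothM_add oV s1 s2) sx) (md_add _ Vq s1 s2) (md_scale _ Vq sa sYV) (md_scale _ Vq sb sYz).
  rewrite (Yzz_kap Y q).
  move: (dd Y q) (Y q) (kap q) (dd xi q) (pd _ _ q) (pd _ _ q) (a q) (b q) (lift_schw Y q / 2) => v y k x a' b' a0 b0 s.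
  apply/rowP => j; rewrite !mxE; move: (v _ _) (y _ _) (k _ _) (x _ _) => ? ? ? ?; ring.
Qed.

Lemma iter_dd_isotropic m n q : (0 < m)%N -> (0 < n)%N -> V q ->
  lorentz (iter m (@dz R 8) Y q) (iter n (@dz R 8) Y q) = 0.
Proof.
case: m => [//|m]; case: n => [//|n] _ _ Vq; have Uq := VU Vq.
have [a [b [x [_ _ _ xP ->]]]] := iter_dd_span m; last exact: Vq.
have [a' [b' [x' [_ _ _ xP' ->]]]] := iter_dd_span n; last exact: Vq.
have [p1 p2 p3 p4] := pf_perp pf (x q) Vq; have [q1 q2 q3 q4] := pf_perp pf (x' q) Vq.
have xx := pf_iso pf (x q) (x' q) Vq.
rewrite (xP q Vq) in p1 p2 p3 p4 xx; rewrite (xP' q Vq) in q1 q2 q3 q4 xx.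
have [n1 n2 _ _] : [/\ lorentz (Y q) (Y q) = 0, lorentz (dd Y q) (dd Y q) = 0, True & True].
  by case: HY => _ _ _ /(_ q Uq)[].
rewrite !lorentzDl !lorentzZl !lorentzDr !lorentzZr n1 n2 (lYYz HY Uq) [lorentz (dd Y q) (Y q)]lorentzC (lYYz HY Uq).
rewrite p1 p2 xx [lorentz (Y q) _]lorentzC q1 [lorentz (dd Y q) _]lorentzC q2.
by rewrite !mulr0 !addr0 !mulr0 !addr0.
Qed.

End Isotropy.

End PlaneField.

(** * Positivity of the Gram determinant *)

Section GramDeterminant.
Variable R : realType.
Local Notation plane := (plane R).
Local Notation C := R[i].
Variables (U : set plane) (Y : plane -> 'rV[C]_8).
Hypothesis HY : conformal_lift U Y.
#[local] Opaque lorentz conj_cmx.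
Local Notation kap := (lift_kap Y).
Local Notation eta := (lift_eta Y).
Local Notation a p := (lorentz (kap p) (conj_cmx (kap p))).
Local Notation b p := (lorentz (eta p) (conj_cmx (kap p))).

(** The vector on the right is the Gram-Schmidt remainder of [eta] against [kap], with denominators
    cleared. Positivity of the normal bundle then gives [w >= 0], with equality only for dependent
    vectors. *)
Lemma gramw_norm p : a p * gramw Y p =
  lorentz ((- b p) *: kap p + a p *: eta p) (conj_cmx ((- b p) *: kap p + a p *: eta p)).
Proof.
have cb : lorentz (kap p) (conj_cmx (eta p)) = conjc (b p) by rewrite lorentz_conjr lorentzC.
have ca : conjc (a p) = a p by rewrite -lorentz_conj conj_cmxK lorentzC.
rewrite conj_cmxD !conj_cmxZ lorentzDl !lorentzZl !lorentzDr !lorentzZr cb conjcN ca /gramw cb.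
by move: (lorentz _ _) (lorentz _ _) (conjc _) (lorentz _ _) => x y z t; ring.
Qed.

Lemma kap_norm_gt0 p : U p -> kap p != 0 -> 0 < a p.
Proof. by move=> Up k0; exact: (positive_norm HY Up (kap_perp HY Up) k0). Qed.

Let perp_x p : U p -> perp Y p ((- b p) *: kap p + a p *: eta p).
Proof. by move=> Up; apply: perpD; apply: perpZ; [exact: (kap_perp HY)|exact: (eta_perp HY)]. Qed.

Lemma gramw_eq0 p : U p -> gramw Y p = 0 -> kap p = 0 \/ exists c, eta p = c *: kap p.
Proof.
move=> Up w0; have [k0|k0] := eqVneq (kap p) 0; [by left|right].
have a0 := kap_norm_gt0 Up k0; have := gramw_norm p; rewrite w0 mulr0.
have [x0 _|x0 xx] := eqVneq ((- b p) *: kap p + a p *: eta p) 0; last first.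
  by have := positive_norm HY Up (perp_x Up) x0; rewrite -xx ltxx.
exists ((a p)^-1 * b p); apply: (scalerI (lt0r_neq0 a0)).
rewrite !scalerA mulrA divff ?lt0r_neq0 // mul1r; apply/eqP; rewrite -subr_eq0 addrC -scaleNr; apply/eqP.
exact: x0.
Qed.

Lemma gramw_ge0 p : U p -> 0 <= gramw Y p.
Proof.
move=> Up; have [k0|k0] := eqVneq (kap p) 0.
  have c0 : conj_cmx (0 : 'rV[C]_8) = 0 by rewrite -(scale0r (0 : 'rV[C]_8)) conj_cmxZ conjc0 !scale0r.
  by rewrite /gramw k0 c0 !lorentz0l !lorentz0r !mul0r subrr.
have a0 := kap_norm_gt0 Up k0; rewrite -(pmulr_rge0 _ a0) gramw_norm.
set x := _ + _; have [->|x0] := eqVneq x 0; first by rewrite lorentz0l.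
exact: (ltW (positive_norm HY Up (perp_x Up) x0)).
Qed.

Lemma wedge_eq0 p : U p -> gramw Y p = 0 -> wedge Y p = 0.
Proof.
move=> Up /(gramw_eq0 Up)[k0|[c e]]; rewrite /wedge.
  by rewrite k0 trmx0 mul0mx mulmx0 subrr.
by rewrite e [(c *: _)^T]linearZ /= -scalemxAl -scalemxAr subrr.
Qed.

End GramDeterminant.

(** * Lifts of immersions and changes of coordinate *)

Section LiftOfImmersion.
Variable R : realType.
Local Notation plane := (plane R).
Local Notation C := R[i].
Local Notation dd := (md (- 'i%C)).
Local Notation db := (md 'i%C).
Local Notation L := (lorentz_metric C).
#[local] Opaque derive derivable Defs.eu Defs.ev.

Lemma crowD_cplx n v (G : plane -> 'rV[R]_n) p : crowD v (fun q => cplx (G q)) p = cplx (rowD v G p).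
Proof.
apply/rowP => j; rewrite !mxE.
have -> : (fun q => complex.Re (cplx (G q) 0 j)) = (fun q => G q 0 j) by apply/funext => q; rewrite mxE.
have -> : (fun q => complex.Im (cplx (G q) 0 j)) = (fun=> 0) by apply/funext => q; rewrite mxE.
by rewrite derive_cst.
Qed.

Lemma lift0_rshift n (j : 'I_n) : lift ord0 j = rshift 1 j :> 'I_(1 + n).
Proof. by apply/val_inj. Qed.

Lemma row_mx_0 n (a : 'rV[R]_1) (u : 'rV[R]_n) : row_mx a u 0 (ord0 : 'I_(1 + n)) = a 0 0.
Proof. by rewrite -(row_mxEl a u 0 0); congr (row_mx a u 0 _); apply/val_inj. Qed.

Lemma rowD_row_mx n v (G : plane -> 'rV[R]_n) p :
  rowD v (fun q => row_mx (1 : 'rV[R]_1) (G q)) p = row_mx 0 (rowD v G p).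
Proof.
apply/rowP => j; rewrite mxE; case: (unliftP ord0 j) => [k|] ->.
  rewrite lift0_rshift row_mxEr mxE; congr ('D_v _ p); apply/funext => q.
  by rewrite row_mxEr.
rewrite row_mx_0 mxE -[RHS](derive_cst (1 : R) p v); congr ('D_v _ p); apply/funext => q.
by rewrite row_mx_0 mxE.
Qed.

Lemma lorentz_cplx (a b : 'rV[R]_1) (u v : 'rV[R]_7) :
  lorentz (cplx (row_mx a u)) (cplx (row_mx b v)) = (- (a 0 0 * b 0 0) + dot u v)%:C.
Proof.
have cE (w : 'rV[R]_8) j : cplx w 0 j = (w 0 j)%:C by rewrite mxE.
rewrite lorentzE big_ord_recl eqxx !cE row_mx_0 row_mx_0 mulN1r mulNr rmorphD rmorphN rmorphM /=; congr (_ + _).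
rewrite /dot mxE rmorph_sum; apply: eq_bigr => j _ /=.
by rewrite !cE mul1r lift0_rshift (row_mxEr a u) (row_mxEr b v) mxE rmorphM.
Qed.

Lemma lorentz_dz (x y : 'rV[C]_8) : lorentz (2^-1 *: (x - 'i%C *: y)) (2^-1 *: (x - 'i%C *: y)) =
  2^-1 * 2^-1 * (lorentz x x - lorentz y y) - 2^-1 * 'i%C * lorentz x y.
Proof.
have ii : 'i%C * 'i%C = -1 :> C by rewrite -expr2 sqr_i.
rewrite lorentzZl lorentzZr lorentzDl lorentzNl lorentzZl !lorentzDr !lorentzNr !lorentzZr [lorentz y x]lorentzC.
move: (lorentz _ _) (lorentz _ _) (lorentz _ _) => a b c; move: ii; move: 'i%C => i ii.
have -> : c - i * b - i * (b - i * a) = c + i * i * a - 2 * (i * b) by ring.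
by rewrite ii; field.
Qed.

Lemma lorentz_dz_dzbar (x y : 'rV[C]_8) : lorentz (2^-1 *: (x - 'i%C *: y)) (2^-1 *: (x + 'i%C *: y)) =
  2^-1 * 2^-1 * (lorentz x x + lorentz y y).
Proof.
have ii : 'i%C * 'i%C = -1 :> C by rewrite -expr2 sqr_i.
rewrite lorentzZl lorentzZr lorentzDl lorentzNl lorentzZl !lorentzDr !lorentzZr [lorentz y x]lorentzC.
move: (lorentz _ _) (lorentz _ _) (lorentz _ _) => a b c; move: ii; move: 'i%C => i ii.
have -> : c + i * b - i * (b + i * a) = c - i * i * a by ring.
by rewrite ii; field.
Qed.

Lemma dot_dz_dzbar n (u v : 'rV[R]_n) :
  dot (2^-1 *: (cplx u - 'i%C *: cplx v)) (2^-1 *: (cplx u + 'i%C *: cplx v)) =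
  (2^-1 * 2^-1 * (dot u u + dot v v))%:C.
Proof.
have ii : 'i%C * 'i%C = -1 :> C by rewrite -expr2 sqr_i.
rewrite /dot !mxE -big_split mulr_sumr rmorph_sum; apply: eq_bigr => j _ /=.
rewrite !mxE !rmorphM rmorphD !rmorphM /= fmorphV rmorph_nat.
move: (u _ _)%:C (v _ _)%:C ii; move: 'i%C => i a b ii.
have -> : 2^-1 * (a - i * b) * (2^-1 * (a + i * b)) = 2^-1 * 2^-1 * (a * a - i * i * (b * b)) by ring.
by rewrite ii mulN1r opprK.
Qed.

Lemma conj_cplx m n (A : 'M[R]_(m, n)) : conj_cmx (cplx A) = cplx A.
Proof. by apply/matrixP => i j; rewrite !mxE /= oppr0. Qed.

Variables (U : set plane) (f : plane -> 'rV[R]_7).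
Hypothesis oU : open U.
Hypothesis sf : smooth_row_on U f.
Hypothesis f1 : forall p, U p -> unit_sphere (f p).
Hypothesis cf : conformal_immersion_on U f.

Let X p : 'rV[C]_8 := cplx (row_mx (1 : 'rV[R]_1) (f p)).
Let E p := dot (rowD (eu R) f p) (rowD (eu R) f p).
Let Xv v p : 'rV[C]_8 := cplx (row_mx (0 : 'rV[R]_1) (rowD v f p)).

Let ddX p : dd X p = 2^-1 *: (Xv (eu R) p - 'i%C *: Xv (ev R) p).
Proof. by rewrite -dzE /dz !crowD_cplx !rowD_row_mx. Qed.

Let dbX p : db X p = 2^-1 *: (Xv (eu R) p + 'i%C *: Xv (ev R) p).
Proof. by rewrite -dzbarE /dzbar !crowD_cplx !rowD_row_mx. Qed.

Let lXv v w p : lorentz (Xv v p) (Xv w p) = (dot (rowD v f p) (rowD w f p))%:C.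
Proof. by rewrite lorentz_cplx !mxE mulr0 oppr0 add0r. Qed.

Let ii : 'i%C * 'i%C = -1 :> C. Proof. by rewrite -expr2 sqr_i. Qed.

Let lddX p : U p -> lorentz (dd X p) (dd X p) = 0.
Proof.
move=> /cf[e0 e1 _]; rewrite ddX.
have := lXv (eu R) (eu R) p; have := lXv (ev R) (ev R) p; have := lXv (eu R) (ev R) p; rewrite e0 e1.
move: (Xv (eu R) p) (Xv (ev R) p) (dot _ _) => x y d h1 h2 h3.
by rewrite lorentz_dz h1 h2 h3 subrr !mulr0 subrr.
Qed.

Let lddbX p : U p -> lorentz (dd X p) (db X p) = 2^-1 * (E p)%:C.
Proof.
move=> /cf[e0 e1 _]; rewrite ddX dbX.
have := lXv (eu R) (eu R) p; have := lXv (ev R) (ev R) p; rewrite -e1 -/(E p).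
move: (Xv (eu R) p) (Xv (ev R) p) (E p)%:C => x y d h1 h2.
by rewrite lorentz_dz_dzbar h1 h2; field.
Qed.

Let sX : smoothM U X.
Proof.
move=> i j; rewrite ord1.
have [k ->|->] := unliftP ord0 j.
  have := smoothC_real oU (sf k); apply: (smoothC_eq oU) => q _.
  by rewrite mxE lift0_rshift row_mxEr.
by apply: (smoothC_eq oU _ (smoothC_cst 1 oU)) => q _; rewrite mxE row_mx_0 mxE.
Qed.

Let E_pos p : U p -> 0 < E p. Proof. by case/cf => _ _; rewrite /E => ->. Qed.

Let sE : smooth_on U E.
Proof.
have sD : smoothC U (fun p => 2 * lorentz (dd X p) (db X p)).
  exact: (smoothC_mul oU (smoothC_cst 2 oU) (smoothC_lorentz oU (smoothM_md _ oU sX) (smoothM_md _ oU sX))).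
have [s1 _] : smoothC U (fun p => (E p)%:C).
  apply: (smoothC_eq oU _ sD) => p Up; rewrite lddbX // mulrA.
  have -> : 2 * 2^-1 = 1 :> C by rewrite divff // pnatr_eq0.
  exact: mul1r.
exact: s1.
Qed.

Let a p : C := ((Num.sqrt (E p))^-1)%:C.

Let sa : smoothC U a.
Proof.
apply: smoothC_real => // k; apply: (Ck_inv oU).
  by move=> p Up; rewrite gt_eqF // sqrtr_gt0 E_pos.
by apply: (Ck_sqrt oU E_pos); exact: sE.
Qed.

Let aE p : U p -> a p * a p * (E p)%:C = 1.
Proof.
move=> Up; rewrite /a -!rmorphM /= -invfM -expr2 sqr_sqrtr ?ltW ?E_pos //.
by rewrite mulVf // gt_eqF // E_pos.
Qed.

Let a_neq0 p : U p -> a p != 0.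
Proof. by move=> Up; apply/eqP => a0; have := aE Up; rewrite a0 !mul0r => /esym/eqP; rewrite oner_eq0. Qed.

(** For a conformal map [2 <f_z, f_zbar>] is [E], the squared norm of [f_u], so the factor
    [exp (- omega)] is [1 / sqrt E]. *)
Lemma lift_YE p : U p -> lift_Y f p = a p *: X p.
Proof.
move=> Up; have Ep := E_pos Up; have [_ e1 _] := cf Up.
rewrite /lift_Y /real_lift.
have -> : expR (- omega f p) = (Num.sqrt (E p))^-1.
  rewrite expRN; congr (_^-1).
  have -> : omega f p = ln (E p) / 2.
    congr (ln _ / 2).
    rewrite /dz /dzbar !crowD_cplx dot_dz_dzbar -e1 -/(E p).
    rewrite -(rmorph_nat (real_complex R) 2) -rmorphM /=; by field.
  apply/eqP; rewrite -(@eqrXn2 _ 2) ?expR_ge0 ?sqrtr_ge0 //.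
  have -> : expR (ln (E p) / 2) ^+ 2 = E p by rewrite -expRM_natl mulrC divfK ?lnK.
  by rewrite sqr_sqrtr ?ltW.
by apply/rowP => j; rewrite !mxE rmorphM.
Qed.

Let Y := lift_Y f.

Let sY : smoothM U Y.
Proof. exact: (smoothM_eq oU (fun q Uq => esym (lift_YE Uq)) (smoothM_scale oU sa sX)). Qed.

Let lXX p : U p -> lorentz (X p) (X p) = 0.
Proof. by move=> /f1 h; rewrite lorentz_cplx h !mxE mulr1 addrC subrr. Qed.

Let lXX_md c p : U p -> lorentz (X p) (md c X p) = 0.
Proof.
move=> Up; have := pd_lorentz_cst oU c Up sX sX lXX; rewrite lorentzC => /eqP.
by rewrite -addr_eq0 -mulr2n mulrn_eq0 /= => /eqP.
Qed.

Let mdY c p : U p -> md c Y p = pd c a p *: X p + a p *: md c X p.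
Proof. by move=> Up; rewrite (md_eq _ oU Up lift_YE) (md_scale _ Up sa sX). Qed.

Let lmdY c d p : U p -> lorentz (md c Y p) (md d Y p) = a p * a p * lorentz (md c X p) (md d X p).
Proof.
move=> Up; rewrite !mdY // !lorentzDl !lorentzZl !lorentzDr !lorentzZr lXX // lXX_md //.
rewrite [lorentz (md c X p) (X p)]lorentzC lXX_md //.
by rewrite !(mulr0, add0r, addr0) mulrA.
Qed.

Let lYY p : U p -> lorentz (Y p) (Y p) = 0.
Proof. by move=> Up; rewrite /Y lift_YE // lorentzZl lorentzZr lXX // !mulr0. Qed.

Let lYmd c p : U p -> lorentz (Y p) (md c Y p) = 0.
Proof.
move=> Up; have := pd_lorentz_cst oU c Up sY sY lYY; rewrite lorentzC => /eqP.
by rewrite -addr_eq0 -mulr2n mulrn_eq0 /= => /eqP.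
Qed.

Let lYzYb p : U p -> lorentz (dd Y p) (db Y p) = 2^-1.
Proof. by move=> Up; rewrite lmdY // lddbX // mulrCA aE // mulr1. Qed.

Let lYW p : U p -> lorentz (Y p) (liftW Y p) = - 2^-1.
Proof.
move=> Up; rewrite liftW.unlock -(lYzYb Up) [lorentz (dd Y p) _]lorentzC.
by rewrite (pd_lorentz_cst oU _ Up sY (smoothM_md _ oU sY) (fun q Uq => lYmd _ Uq)) opprK.
Qed.

Lemma lorentz_euclid (x : 'rV[C]_8) : x 0 0 = 0 -> 0 <= lorentz x (conj_cmx x) /\
  (lorentz x (conj_cmx x) = 0 -> x = 0).
Proof.
move=> x0.
have -> : lorentz x (conj_cmx x) = (\sum_j (complex.Re (x 0 j) ^+ 2 + complex.Im (x 0 j) ^+ 2))%:C.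
  rewrite lorentzE rmorph_sum; apply: eq_bigr => j _ /=.
  rewrite mxE; case: (j =P 0) => [->|_]; first by rewrite x0 /= mulr0 mul0r expr0n addr0.
  rewrite mul1r; case: (x 0 j) => u v /=; apply/eqP; rewrite eq_complex /=; apply/andP; split; apply/eqP; ring.
split; first by rewrite ler0c; apply: sumr_ge0 => j _; rewrite addr_ge0 // sqr_ge0.
move=> /(congr1 (@complex.Re R)) /= /eqP; rewrite psumr_eq0; last by move=> j _; rewrite addr_ge0 // sqr_ge0.
move=> /allP H; apply/rowP => j; rewrite mxE; apply/eqP; rewrite -nsq_eq0; apply: H.
exact: mem_index_enum.
Qed.

Lemma conformal_lift_Y : conformal_lift U Y.
Proof.
split => //; first by move=> p; exact: conj_cplx.
move=> p Up; split; [exact: lYY| by rewrite lmdY // lddX // mulr0|exact: lYzYb|].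
move=> x xY xW x0.
have aX : a p * lorentz x (X p) = 0 by rewrite -lorentzZr -lift_YE.
have xX : lorentz x (X p) = 0.
  by apply/eqP; move/eqP: aX; rewrite mulf_eq0 (negbTE (a_neq0 Up)).
have X0 : X p 0 0 = 1 by rewrite mxE row_mx_0 mxE.
(* Subtracting a multiple of the null vector [X], to which [x] is orthogonal, kills the time
   coordinate without changing the norm, which becomes Euclidean. If it were zero, [x] would be a
   multiple of [X], which is not orthogonal to [Y_(z zbar)]. *)
pose u := x - x 0 0 *: X p.
have mE (y z : 'rV[C]_8) (c : C) : (y - c *: z) 0 0 = y 0 0 - c * z 0 0 by rewrite !mxE.
have u0 : u 0 0 = 0 by rewrite /u mE X0 mulr1 subrr.
have Xc : conj_cmx (X p) = X p by exact: conj_cplx.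
have xX' : lorentz (X p) (conj_cmx x) = 0 by rewrite lorentz_conjr Xc lorentzC xX conjc0.
have Eu : lorentz u (conj_cmx u) = lorentz x (conj_cmx x).
  rewrite /u conj_cmxD conj_cmxN conj_cmxZ Xc !lorentzDl !lorentzNl !lorentzZl !lorentzDr !lorentzNr !lorentzZr.
  by rewrite xX xX' lXX // !(mulr0, oppr0, addr0).
have [ge eq0] := lorentz_euclid u0; rewrite -Eu lt_neqAle ge andbT eq_sym; apply/eqP => /eq0 /eqP.
rewrite subr_eq0 => /eqP; move: (x 0 0) => c xE; move: x0; rewrite xE scaler_eq0 negb_or => /andP[/negP c0 _].
move: xW; rewrite xE lorentzZl => /eqP; rewrite mulf_eq0 => /orP[//|/eqP XW].
have := lYW Up; rewrite /Y lift_YE // -/Y lorentzZl XW mulr0 => /esym/eqP.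
by rewrite oppr_eq0 invr_eq0 pnatr_eq0.
Qed.

End LiftOfImmersion.

(** * The normal bundle and connection of a lift in terms of [lift_proj] *)

Section NormalBundle.
Variable R : realType.
Local Notation plane := (plane R).
Local Notation C := R[i].
Local Notation dd := (md (- 'i%C)).
Local Notation db := (md 'i%C).
Local Notation L := (lorentz_metric C).
Variables (U : set plane) (f : plane -> 'rV[R]_7).
Local Notation Y := (lift_Y f).
Hypothesis HY : conformal_lift U Y.

Local Notation perp := (perp Y).
Local Notation nproj := (lift_proj Y).
Local Notation kap := (lift_kap Y).
Local Notation eta := (lift_eta Y).
#[local] Opaque lorentz conj_cmx.

Let oU : open U. Proof. by case: HY. Qed.

Lemma cplx_re_row n (x : 'rV[C]_n) : cplx (re_row x) = 2^-1 *: (x + conj_cmx x).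
Proof.
apply/rowP => j; rewrite !mxE; case: (x 0 j) => a b /=; apply/eqP.
have -> : (2^-1 : C) = (2^-1)%:C by rewrite fmorphV rmorph_nat.
by rewrite eq_complex /=; apply/andP; split; apply/eqP; field.
Qed.

Lemma cplx_im_row n (x : 'rV[C]_n) : cplx (im_row x) = - (2^-1 * 'i%C) *: (x - conj_cmx x).
Proof.
apply/rowP => j; rewrite !mxE; case: (x 0 j) => a b /=; apply/eqP.
have -> : (2^-1 : C) = (2^-1)%:C by rewrite fmorphV rmorph_nat.
by rewrite eq_complex /=; apply/andP; split; apply/eqP; field.
Qed.

Lemma re_im_row n (x : 'rV[C]_n) : x = cplx (re_row x) + 'i%C *: cplx (im_row x) /\
  conj_cmx x = cplx (re_row x) - 'i%C *: cplx (im_row x).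
Proof.
split; apply/rowP => j; rewrite !mxE; case: (x 0 j) => a b /=; apply/eqP;
  by rewrite eq_complex /=; apply/andP; split; apply/eqP; ring.
Qed.

Lemma V_frameE p : V_frame f p = \matrix_(i < 4)
  [:: Y p; cplx (re_row (dd Y p)); cplx (im_row (dd Y p)); liftW Y p]`_i.
Proof. by rewrite /V_frame liftW.unlock dzbarE dzE. Qed.

Lemma V_frame_sub p : U p -> (V_frame f p <= vframe Y p)%MS.
Proof.
move=> Up; rewrite V_frameE.
have K (i : 'I_4) : ([:: Y p; dd Y p; db Y p; liftW Y p]`_i <= vframe Y p)%MS.
  by rewrite -(rowK (fun i : 'I_4 => [:: Y p; dd Y p; db Y p; liftW Y p]`_i) i) row_sub.
have kY := K 0; have kz := K 1; have kb := K 2%:R; have kw := K 3%:R.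
apply/row_subP => i; rewrite rowK; case: i => [[|[|[|[|//]]]] ilt] /=.
- exact: kY.
- by rewrite cplx_re_row (conj_Yz HY Up) scalemx_sub // addmx_sub.
- rewrite cplx_im_row (conj_Yz HY Up) scalemx_sub // addmx_sub // eqmx_opp; exact: kb.
- exact: kw.
Qed.

Lemma vframe_sub p : U p -> (vframe Y p <= V_frame f p)%MS.
Proof.
move=> Up; rewrite V_frameE; set M := (X in (_ <= X)%MS).
have K (i : 'I_4) : ([:: Y p; cplx (re_row (dd Y p)); cplx (im_row (dd Y p)); liftW Y p]`_i <= M)%MS.
  by rewrite -(rowK (fun i : 'I_4 => [:: Y p; cplx (re_row (dd Y p)); cplx (im_row (dd Y p)); liftW Y p]`_i) i) row_sub.
have kY := K 0; have kz := K 1; have kb := K 2%:R; have kw := K 3%:R.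
have [e1 e2] := re_im_row (dd Y p); rewrite (conj_Yz HY Up) in e2.
apply/row_subP => i; rewrite rowK; case: i => [[|[|[|[|//]]]] ilt] /=.
- exact: kY.
- rewrite e1 addmx_sub // scalemx_sub //.
- rewrite e2 addmx_sub // eqmx_opp scalemx_sub //.
- exact: kw.
Qed.

Lemma V_perpP p (x : 'rV[C]_8) : U p -> (x <= V_perp f p)%MS <-> perp p x.
Proof.
move=> Up; rewrite perp_kermx; split => /sub_kermxP H; apply/sub_kermxP.
  have /submxP[D ->] := vframe_sub Up.
  by rewrite trmx_mul mulmxA mulmxA -(mulmxA x) H mul0mx.
have /submxP[D ->] := V_frame_sub Up.
by rewrite trmx_mul mulmxA mulmxA -(mulmxA x) H mul0mx.
Qed.

Lemma nproj_sub p x : U p -> (x - nproj p x <= V_frame f p)%MS.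
Proof.
move=> Up; apply: submx_trans (vframe_sub Up).
have K (i : 'I_4) : ([:: Y p; dd Y p; db Y p; liftW Y p]`_i <= vframe Y p)%MS.
  by rewrite -(rowK (fun i : 'I_4 => [:: Y p; dd Y p; db Y p; liftW Y p]`_i) i) row_sub.
have kY := K 0; have kz := K 1; have kb := K 2%:R; have kw := K 3%:R.
have kN : (liftN Y p <= vframe Y p)%MS by rewrite liftN.unlock addmx_sub ?scalemx_sub.
have -> : x - nproj p x = - (lorentz x (liftN Y p) *: Y p) - lorentz x (Y p) *: liftN Y p
  + (2 * lorentz x (db Y p)) *: dd Y p + (2 * lorentz x (dd Y p)) *: db Y p.
  rewrite nprojE; move: (lorentz _ _) (lorentz _ _) (2 * lorentz _ _) (2 * lorentz _ _) => a b c d.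
  move: (liftN _ _) (Y p) (dd Y p) (db Y p) => n y v w.
  apply/rowP => j; rewrite !mxE; ring.
by rewrite !addmx_sub ?eqmx_opp ?scalemx_sub.
Qed.

Lemma nproj_vframe p (c : 'rV[C]_4) : U p -> nproj p (c *m vframe Y p) = 0.
Proof.
move=> Up; rewrite vframe_row !nprojD !nprojZ (nproj_Y HY Up) (nproj_Yz HY Up) (nproj_Yb HY Up).
have -> : nproj p (liftW Y p) = 0.
  have l1 : lorentz (liftW Y p) (Y p) = - 2^-1 by rewrite lorentzC (lYYzb HY Up).
  have l2 : lorentz (liftW Y p) (db Y p) = 0 by rewrite lorentzC (lYbYzb HY Up).
  have l3 : lorentz (liftW Y p) (dd Y p) = 0 by rewrite lorentzC (lYzYzb HY Up).
  rewrite nprojE (lYzbN HY Up) l1 l2 l3 liftN.unlock.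
  move: (lorentz (liftW Y p) (liftW Y p)) (liftW Y p) (Y p) (dd Y p) (db Y p) => a w y v u.
  by apply/rowP => j; rewrite !mxE; move: (w _ _) (y _ _) => w' y'; field.
by rewrite !scaler0 !addr0.
Qed.

Lemma V_perp_cap p : U p -> (V_perp f p :&: <<V_frame f p>> = 0)%MS.
Proof.
move=> Up; apply/eqP; rewrite -submx0; apply/row_subP => i.
have := row_sub i (V_perp f p :&: <<V_frame f p>>)%MS; rewrite sub_capmx => /andP[].
move: (row i _) => x /(V_perpP _ Up)/nproj_id <-; rewrite genmxE => h.
have /submxP[c E] := submx_trans h (V_frame_sub Up).
have xx : nproj p (nproj p x) = nproj p x by rewrite (nproj_id (nproj_perp HY Up x)).
by rewrite -xx E nproj_vframe // sub0mx.
Qed.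

(** [x - nproj p x] is tangent and [nproj p x] is normal, and the two bundles meet in zero, so this
    is the decomposition that [proj_mx] computes. *)
Lemma normal_partE p x : U p -> normal_part f p x = nproj p x.
Proof.
move=> Up; rewrite /normal_part -[x in LHS](subrK (nproj p x)) mulmxDl.
have cap := V_perp_cap Up.
rewrite (proj_mx_0 cap) ?add0r; last by rewrite genmxE; exact: nproj_sub.
by rewrite (proj_mx_id cap) //; apply/(V_perpP _ Up); exact: (nproj_perp HY Up).
Qed.

(** The pair exists and is unique, pairing with [N] determining the Schwarzian; hence the choice
    operator returns it and not its default. *)
Lemma hopf_schwarzianE p : U p -> hopf_schwarzian f p = (kap p, lift_schw Y p).
Proof.
move=> Up; apply: xget_unique => /=.
  split; first by apply/(V_perpP _ Up); exact: (kap_perp HY Up).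
  by rewrite !dzE (Yzz_kap Y p) addrC scaleNr.
move=> [k s] /= [/(V_perpP _ Up)/(perpP _ _ _)[_ _ _ kN]]; rewrite !dzE => E.
have es : s = lift_schw Y p.
  rewrite lift_schw.unlock E lorentzDl lorentzZl (lYN HY Up) kN; by field.
by congr (_, _) => //; rewrite lift_kap.unlock E -es scaleNr addrAC addNr add0r.
Qed.

Lemma kappaE p : U p -> kappa f p = kap p.
Proof. by move=> Up; rewrite /kappa hopf_schwarzianE. Qed.

Lemma schwarzianE p : U p -> schwarzian f p = lift_schw Y p.
Proof. by move=> Up; rewrite /schwarzian hopf_schwarzianE. Qed.

Lemma DzE xi p : U p -> Dz f xi p = nproj p (dd xi p).
Proof. by move=> Up; rewrite /Dz normal_partE // dzE. Qed.

Lemma DzbarE xi p : U p -> Dzbar f xi p = nproj p (db xi p).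
Proof. by move=> Up; rewrite /Dzbar normal_partE // dzbarE. Qed.

Lemma Dz_kappaE p : U p -> Dz f (kappa f) p = nproj p (dd kap p).
Proof. by move=> Up; rewrite DzE // (md_eq _ oU Up kappaE). Qed.

Lemma Dzbar_kappaE p : U p -> Dzbar f (kappa f) p = eta p.
Proof. by move=> Up; rewrite DzbarE // (md_eq _ oU Up kappaE) lift_eta.unlock. Qed.

Lemma isotropic_willmoreE : willmore_on f U -> isotropic_hopf_on f U -> isotropic_willmore U Y.
Proof.
move=> fW fI p Up; split; first by rewrite -kappaE //; exact: fI.
have := fW p Up; rewrite DzbarE // (md_eq _ oU Up Dzbar_kappaE) kappaE // schwarzianE //.
by move=> /eqP; rewrite addr_eq0 scaleNr => /eqP.
Qed.

Lemma row_free_gramw p : U p -> row_free (col_mx (kappa f p) (Dzbar f (kappa f) p)) -> gramw Y p != 0.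
Proof.
move=> Up; rewrite Dzbar_kappaE // kappaE // => fr; apply/eqP => w0.
have free (c d : C) : c *: kap p + d *: eta p = 0 -> c = 0 /\ d = 0.
  move=> cd; have := mulmx_free_eq0 (row_mx c%:M d%:M) fr; rewrite mul_row_col !mul_scalar_mx cd eqxx.
  move=> /esym/eqP; rewrite -row_mx0 => /eq_row_mx[/matrixP/(_ 0 0) + /matrixP/(_ 0 0)].
  by rewrite !mxE eqxx !mulr1n => -> ->.
have [k0|[c e]] := gramw_eq0 HY Up w0.
  by have [] := free 1 0; [rewrite k0 scaler0 scale0r addr0|move/eqP; rewrite oner_eq0].
by have [] := free (- c) 1; [rewrite e scaleNr scale1r addNr|move=> _ /eqP; rewrite oner_eq0].
Qed.

Section WithField.
Hypothesis HW : isotropic_willmore U Y.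
Variables (V : set plane) (P : plane -> 'M[C]_8).
Hypothesis pf : plane_field U Y V P.

(** The unitary frame spans the range of [P]. The statements on the conjugate frame follow by
    conjugation, which exchanges [D_z] and [D_zbar], and the splitting of the normal bundle is
    [pf_compl]. *)
Lemma isotropic_frame p : V p -> exists (W : set plane) (E : 'I_2 -> plane -> 'rV[C]_8),
  [/\ open W, W p, W `<=` V & isotropic_frame_on f W E].
Proof.
move=> Vp; have [W [E [oW Wp WV sE HE]]] := unitary_frame HY pf Vp.
have VU := pf_sub pf.
exists W, E; split => //; split; first by move=> i; apply/smooth_crowE.
move=> q Wq; have Vq := WV q Wq; have Uq := VU q Vq; have [EP EE] := HE q Wq.
have EW i z : W z -> E i z *m P z = E i z by move=> /HE[].
have sp (x : 'rV[C]_8) : x *m P q = x -> (x <= span2 E q)%MS.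
  exact: (frame_span HY pf (E := fun i => E i q) Vq EP EE).
have spc (x : 'rV[C]_8) : x *m P q = x -> (conj_cmx x <= span2 (fun i q => conj_cmx (E i q)) q)%MS.
  move=> /sp/submxP[D ->]; rewrite conj_cmxM.
  have -> : conj_cmx (span2 E q) = span2 (fun i q => conj_cmx (E i q)) q.
    by apply/matrixP => i j; rewrite !mxE.
  exact: submxMl.
have pE i : perp q (E i q) by rewrite -EP; exact: (pf_perp pf).
have oV := pf_open pf.
have sk := smoothM_sub VU (s_kap HY).
have VV : V `<=` V by [].
have kP z : V z -> kap z *m P z = kap z by exact: (pf_kap pf).
have dE i : nproj q (dd (E i) q) *m P q = nproj q (dd (E i) q).
  exact: (section_nproj_dd pf oW WV (sE i) (EW i) Wq).
have bE i : nproj q (db (E i) q) *m P q = nproj q (db (E i) q).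
  exact: (section_nproj_db HY pf oW WV (sE i) (EW i) Wq).
have lEb i : lorentz (E i q) (E i q) = 0 by rewrite -EP; exact: (pf_iso pf).
split.
- by move=> i; apply/(V_perpP _ Uq).
- split.
  + by rewrite kappaE //; apply: sp; exact: kP.
  + rewrite Dz_kappaE //; apply: sp; exact: (section_nproj_dd pf oV VV sk kP Vq).
  + by rewrite Dzbar_kappaE //; apply: sp; exact: (pf_eta pf).
- split; last exact: EE.
  by move=> i j; rewrite -(EP i) -(EP j); exact: (pf_iso pf).
- by move=> i; rewrite DzE // DzbarE //; split; apply: sp.
split.
  apply/eqmxP/andP; split.
    apply/row_subP => i; have /(V_perpP _ Uq) px := row_sub i (V_perp f q).
    rewrite -addsmxE -(pf_compl pf Vq px); apply: addmx_sub_adds.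
      by apply: sp; rewrite -mulmxA (pf_idem pf Vq).
    rewrite -[X in (X *m _ <= _)%MS]conj_cmxK -conj_cmxM; apply: spc.
    by rewrite -mulmxA (pf_idem pf Vq).
  rewrite -addsmxE addsmx_sub; apply/andP; split; apply/row_subP => i; rewrite rowK; apply/(V_perpP _ Uq) => //.
  exact: (perp_conj HY Uq).
move=> i; rewrite DzE // DzbarE //.
rewrite (md_conj _ Wq (sE i)) conjNi (md_conj _ Wq (sE i)) conj_i !(nproj_conj HY Uq).
by split; apply: spc.
Qed.

Lemma totally_isotropic_field : totally_isotropic_on f V.
Proof. move=> m n p m0 n0 Vp; exact: (iter_dd_isotropic HY pf). Qed.

End WithField.

End NormalBundle.

(** * Transformation under a holomorphic change of coordinate *)

Section HolomorphicChange.
Variable R : realType.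
Local Notation plane := (plane R).
Local Notation C := R[i].
Local Notation dd := (md (- 'i%C)).
Local Notation db := (md 'i%C).
#[local] Opaque lorentz conj_cmx derive derivable Defs.eu Defs.ev.

Variables (U1 U2 : set plane) (g h : plane -> R).
Hypothesis (oU1 : open U1) (oU2 : open U2).
Hypothesis (sg : smooth_on U2 g) (sh : smooth_on U2 h).
Hypothesis T_in : forall q, U2 q -> U1 (g q, h q).
Let zeta q : C := g q +i* h q.
Hypothesis zeta_hol : forall q, U2 q -> pd 'i%C zeta q = 0.

Local Notation T := (fun q => (g q, h q)).
(** The complex derivative [t] of the coordinate change [g + i h]. *)
Definition holder (q : plane) : C := pd (- 'i%C) (fun q => g q +i* h q) q.
Local Notation t := holder.

Let szeta : smoothC U2 zeta. Proof. by split. Qed.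

Lemma s_holder : smoothC U2 t. Proof. exact: (smoothC_pd _ oU2 szeta). Qed.

Lemma holder_hol q : U2 q -> pd 'i%C t q = 0.
Proof.
move=> Uq; rewrite /holder (pd_comm _ _ oU2 Uq szeta) -[RHS](pd_cst (- 'i%C) 0 q).
by apply: (pd_eq _ oU2 Uq) => z /zeta_hol.
Qed.

Lemma cauchy_riemann q : U2 q -> [/\ 'D_(eu R) g q = complex.Re (t q), 'D_(eu R) h q = complex.Im (t q),
  'D_(ev R) g q = - complex.Im (t q) & 'D_(ev R) h q = complex.Re (t q)].
Proof.
move=> Uq; have := pd_Dc_eu zeta q; have := pd_Dc_ev zeta q.
rewrite zeta_hol // addr0 subr0 -/(t q) -/(zeta) /Dc /=.
case: (t q) => a b /= e1 e2; have := congr1 (@complex.Re R) e1; have := congr1 (@complex.Im R) e1.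
have := congr1 (@complex.Re R) e2; have := congr1 (@complex.Im R) e2 => /= <- <- <- <-.
by split=> //; ring.
Qed.

Lemma pd_comp (F : plane -> C) q : U2 q -> smoothC U1 F ->
  pd (- 'i%C) (fun z => F (T z)) q = t q * pd (- 'i%C) F (T q) /\
  pd 'i%C (fun z => F (T z)) q = conjc (t q) * pd 'i%C F (T q).
Proof.
move=> Uq [F1 F2]; have [e1 e2 e3 e4] := cauchy_riemann Uq.
have K v : Dc v (fun z => F (T z)) q = ('D_v g q)%:C * Dc (eu R) F (T q) + ('D_v h q)%:C * Dc (ev R) F (T q).
  have [_ d1] := chain_rule v oU1 oU2 Uq (T_in Uq) (F1 1%N) (sg 1%N) (sh 1%N).
  have [_ d2] := chain_rule v oU1 oU2 Uq (T_in Uq) (F2 1%N) (sg 1%N) (sh 1%N).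
  rewrite /Dc d1 d2; move: ('D_v g q) ('D_v h q) ('D_(eu R) _ _) ('D_(ev R) _ _) ('D_(eu R) _ _) ('D_(ev R) _ _) => a b c d e f.
  by apply/eqP; rewrite eq_complex /=; apply/andP; split; apply/eqP; ring.
rewrite !pd.unlock !K e1 e2 e3 e4; move: (Dc (eu R) _ _) (Dc (ev R) _ _) => x y.
move: (t q) => [a b] /=.
have -> : a +i* b = a%:C + 'i%C * b%:C.
  by apply/eqP; rewrite eq_complex /=; apply/andP; split; apply/eqP; ring.
have -> : (a +i* - b) = a%:C - 'i%C * b%:C :> C.
  by apply/eqP; rewrite eq_complex /=; apply/andP; split; apply/eqP; ring.
have ii : 'i%C * 'i%C = -1 :> C by rewrite -expr2 sqr_i.
rewrite rmorphN /=; move: a%:C b%:C ii; move: 'i%C => i a' b' ii.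
have E1 : (a' + i * b') * (x + - i * y) = a' * x - i * a' * y + i * b' * x - i * i * (b' * y) by ring.
have E2 : (a' - i * b') * (x + i * y) = a' * x + i * a' * y - i * b' * x - i * i * (b' * y) by ring.
split.
  rewrite [RHS]mulrCA E1 ii; congr (_ * _); ring.
rewrite [RHS]mulrCA E2 ii; congr (_ * _); ring.
Qed.

Lemma smoothC_comp (F : plane -> C) : smoothC U1 F -> smoothC U2 (fun q => F (T q)).
Proof.
move=> [F1 F2]; split=> k; [exact: (Ck_comp oU1 oU2 T_in (F1 k) (sg k) (sh k))|].
exact: (Ck_comp oU1 oU2 T_in (F2 k) (sg k) (sh k)).
Qed.

Lemma smoothM_comp m n (F : plane -> 'M[C]_(m, n)) : smoothM U1 F -> smoothM U2 (fun q => F (T q)).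
Proof. by move=> sF i j; exact: (smoothC_comp (sF i j)). Qed.

Lemma md_comp m n (F : plane -> 'M[C]_(m, n)) q : U2 q -> smoothM U1 F ->
  dd (fun z => F (T z)) q = t q *: dd F (T q) /\ db (fun z => F (T z)) q = conjc (t q) *: db F (T q).
Proof.
move=> Uq sF; split; apply/matrixP => i j; rewrite !mxE !mdE; have [e1 e2] := pd_comp Uq (sF i j).
  exact: e1.
exact: e2.
Qed.

Lemma kap_unique U Y p k (a : C) : conformal_lift U Y -> U p -> perp Y p k ->
  dd (dd Y) p = k + a *: Y p -> k = lift_kap Y p.
Proof.
move=> HY Up /(perpP _ _ _)[_ _ _ kN] E.
have ea : a = - (lift_schw Y p / 2).
  rewrite lift_schw.unlock E lorentzDl lorentzZl (lYN HY Up) kN; by field.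
by rewrite lift_kap.unlock E ea scaleNr addrNK.
Qed.

Variables (Y1 Y2 : plane -> 'rV[C]_8) (mu : plane -> C).
Hypothesis (HY1 : conformal_lift U1 Y1) (HY2 : conformal_lift U2 Y2).
Hypothesis smu : smoothC U2 mu.
Hypothesis Y2E : forall q, U2 q -> Y2 q = mu q *: Y1 (T q).

Let sY1 : smoothM U1 Y1. Proof. by case: HY1. Qed.
Let sYz1 := sYz HY1.
Let st := s_holder.
Let stb : smoothC U2 (fun q => conjc (t q)) := smoothC_conj oU2 s_holder.
Let smt : smoothC U2 (fun q => mu q * t q) := smoothC_mul oU2 smu s_holder.

Let ddY2 q : U2 q -> dd Y2 q = pd (- 'i%C) mu q *: Y1 (T q) + (mu q * t q) *: dd Y1 (T q).
Proof.
move=> Uq; rewrite (md_eq _ oU2 Uq Y2E) (md_scale _ Uq smu (smoothM_comp sY1)).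
by have [-> _] := md_comp Uq sY1; rewrite scalerA.
Qed.

Let dbY2 q : U2 q -> db Y2 q = pd 'i%C mu q *: Y1 (T q) + (mu q * conjc (t q)) *: db Y1 (T q).
Proof.
move=> Uq; rewrite (md_eq _ oU2 Uq Y2E) (md_scale _ Uq smu (smoothM_comp sY1)).
by have [_ ->] := md_comp Uq sY1; rewrite scalerA.
Qed.

(** Both lifts are normalized by [<Y_z, Y_zbar> = 1/2], and the derivative of the factor [mu] does
    not contribute since [Y1] is null and orthogonal to its first derivatives. *)
Lemma mu_norm q : U2 q -> mu q * mu q * (t q * conjc (t q)) = 1.
Proof.
move=> Uq; have U1q := T_in Uq.
have [_ _ n1 _] : [/\ True, True, lorentz (dd Y1 (T q)) (db Y1 (T q)) = 2^-1 & True] by case: HY1 => _ _ _ /(_ _ U1q)[].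
have [_ _ n2 _] : [/\ True, True, lorentz (dd Y2 q) (db Y2 q) = 2^-1 & True] by case: HY2 => _ _ _ /(_ _ Uq)[].
have n3 : lorentz (Y1 (T q)) (Y1 (T q)) = 0 by case: HY1 => _ _ _ /(_ _ U1q)[].
have n4 := lYYz HY1 U1q; have n5 := lYYb HY1 U1q.
move: n2; rewrite ddY2 // dbY2 // lorentzDl !lorentzZl !lorentzDr !lorentzZr n3 n5 [lorentz (dd _ _) (Y1 _)]lorentzC n4 n1.
move: (mu q) (t q) (conjc _) => m t' tb E.
have : 2 * (m * m * (t' * tb) * 2^-1) = 1.
  transitivity (2 * 2^-1 : C); last by rewrite divff // pnatr_eq0.
  congr (2 * _); rewrite -[RHS]E; ring.
move=> <-; by field.
Qed.

Let mu0 q : U2 q -> mu q != 0.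
Proof. by move=> /mu_norm H; apply/eqP => m0; move: H; rewrite m0 !mul0r => /esym/eqP; rewrite oner_eq0. Qed.

Let t0 q : U2 q -> t q != 0.
Proof. by move=> /mu_norm H; apply/eqP => m0; move: H; rewrite m0 mul0r mulr0 => /esym/eqP; rewrite oner_eq0. Qed.

Let tb0 q : U2 q -> conjc (t q) != 0.
Proof. by move=> /mu_norm H; apply/eqP => m0; move: H; rewrite m0 !mulr0 => /esym/eqP; rewrite oner_eq0. Qed.

Let tb_dd q : U2 q -> pd (- 'i%C) (fun z => conjc (t z)) q = 0.
Proof. by move=> Uq; rewrite (pd_conj _ Uq s_holder) conjNi holder_hol // conjc0. Qed.

(** The [z]-derivative of [mu_norm], in which the conjugate of [t] is constant. It is exactly the
    coefficient of [dd Y1] in the second derivative of [Y2], and its vanishing makes [kap] transform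
    as a tensor. *)
Lemma mu_dd q : U2 q -> 2 * (pd (- 'i%C) mu q * t q) + mu q * pd (- 'i%C) t q = 0.
Proof.
move=> Uq; have := pd_eq (- 'i%C) oU2 Uq mu_norm; rewrite pd_cst.
have s1 := smoothC_mul oU2 smu smu; have s2 := smoothC_mul oU2 st stb.
rewrite (pd_mul _ Uq s1 s2) (pd_mul _ Uq smu smu) (pd_mul _ Uq st stb) tb_dd //.
move: (mu0 Uq) (tb0 Uq); move: (mu q) (t q) (conjc _) (pd _ _ _) (pd _ _ _) => m t' tb m' t'' h1 h2 E.
apply: (mulfI h1); apply: (mulfI h2); rewrite !mulr0 -E; ring.
Qed.

Let ddddY2 q : U2 q -> dd (dd Y2) q = (mu q * t q * t q) *: dd (dd Y1) (T q) + pd (- 'i%C) (pd (- 'i%C) mu) q *: Y1 (T q).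
Proof.
move=> Uq; rewrite (md_eq _ oU2 Uq ddY2).
have s1 := smoothM_scale oU2 (smoothC_pd (- 'i%C) oU2 smu) (smoothM_comp sY1).
have s2 := smoothM_scale oU2 smt (smoothM_comp sYz1).
rewrite (md_add _ Uq s1 s2) (md_scale _ Uq (smoothC_pd (- 'i%C) oU2 smu) (smoothM_comp sY1)).
rewrite (md_scale _ Uq smt (smoothM_comp sYz1)) (pd_mul _ Uq smu st).
have [-> _] := md_comp Uq sY1; have [-> _] := md_comp Uq sYz1.
have := mu_dd Uq; move: (pd _ (pd _ _) q) (pd _ mu q) (pd _ t q) (mu q) (t q) => m2 m1 t1 m t' E.
move: (Y1 _) (dd Y1 _) (dd (dd Y1) _) => y v w.
rewrite !scalerA -addrA [X in _ + X]addrA -scalerDl.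
have -> : m1 * t' + (m1 * t' + m * t1) = 0 by rewrite -E; ring.
by rewrite scale0r add0r addrC.
Qed.

Lemma perp_comp q x : U2 q -> perp Y1 (T q) x -> perp Y2 q x.
Proof.
move=> Uq [h1 h2 h3 h4]; split.
- by rewrite Y2E // lorentzZr h1 mulr0.
- by rewrite ddY2 // lorentzDr !lorentzZr h1 h2 !mulr0 addr0.
- by rewrite dbY2 // lorentzDr !lorentzZr h1 h3 !mulr0 addr0.
rewrite YzbE (md_eq _ oU2 Uq ddY2).
have s1 := smoothM_scale oU2 (smoothC_pd (- 'i%C) oU2 smu) (smoothM_comp sY1).
have s2 := smoothM_scale oU2 smt (smoothM_comp sYz1).
rewrite (md_add _ Uq s1 s2) (md_scale _ Uq (smoothC_pd (- 'i%C) oU2 smu) (smoothM_comp sY1)).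
rewrite (md_scale _ Uq smt (smoothM_comp sYz1)).
have [_ ->] := md_comp Uq sY1; have [_ ->] := md_comp Uq sYz1.
rewrite YzbE in h4.
by rewrite !lorentzDr !lorentzZr h1 h2 h3 h4 !mulr0 !addr0.
Qed.

Let rho q := mu q * t q * t q.
Let srho : smoothC U2 rho := smoothC_mul oU2 smt s_holder.

Lemma kap_comp q : U2 q -> lift_kap Y2 q = rho q *: lift_kap Y1 (T q).
Proof.
move=> Uq; symmetry; set a := pd (- 'i%C) (pd (- 'i%C) mu) q - rho q * (lift_schw Y1 (T q) / 2).
apply: (@kap_unique _ _ _ _ (a / mu q) HY2 Uq).
  by apply: perp_comp => //; apply: perpZ; apply: (kap_perp HY1); exact: T_in.
rewrite ddddY2 // Y2E // scalerA divfK ?mu0 // Yzz_kap -/(rho q) /a.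
move: (lift_kap _ _) (Y1 _) => k y; apply/rowP => j; rewrite !mxE; ring.
Qed.

Let sk1 := s_kap HY1.

(** The factor [rho] is not holomorphic, whence a multiple of [kap] besides the tensorial term; it
    drops out of [hopf4] and of the Gram determinant. *)
Lemma eta_comp q : U2 q -> lift_eta Y2 q = pd 'i%C rho q *: lift_kap Y1 (T q) + (rho q * conjc (t q)) *: lift_eta Y1 (T q).
Proof.
move=> Uq; have U1q := T_in Uq; rewrite etaE (md_eq _ oU2 Uq kap_comp).
rewrite (md_scale _ Uq srho (smoothM_comp sk1)).
have [_ ->] := md_comp Uq sk1.
have := weingartenb HY1 U1q sk1 (fun q Uq => kap_perp HY1 Uq).
rewrite -etaE => ->.
have pk : perp Y2 q (lift_kap Y1 (T q)) by apply: perp_comp => //; exact: (kap_perp HY1).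
have pe : perp Y2 q (lift_eta Y1 (T q)) by apply: perp_comp => //; exact: (eta_perp HY1).
have nY : lift_proj Y2 q (Y1 (T q)) = 0.
  have -> : Y1 (T q) = (mu q)^-1 *: Y2 q by rewrite Y2E // scalerA mulVf ?mu0 // scale1r.
  by rewrite nprojZ (nproj_Y HY2 Uq) scaler0.
have nYz : lift_proj Y2 q (dd Y1 (T q)) = 0.
  have : lift_proj Y2 q (dd Y2 q) = 0 by exact: (nproj_Yz HY2 Uq).
  rewrite ddY2 // nprojD !nprojZ nY scaler0 add0r => /eqP.
  by rewrite scaler_eq0 mulf_eq0 (negbTE (mu0 Uq)) (negbTE (t0 Uq)) => /eqP.
rewrite -scaleNr !(nprojD, nprojZ) nY nYz !scaler0 !addr0 (nproj_id pk) (nproj_id pe) scalerA.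
reflexivity.
Qed.

Hypothesis HW1 : isotropic_willmore U1 Y1.

(** All products with [kap] vanish by isotropy. The remaining factor is [rho t] times [rho] times
    the conjugate of [t], which is [t^4] by [mu_norm]. *)
Lemma hopf4_comp q : U2 q -> hopf4 Y2 q = t q ^+ 4 * hopf4 Y1 (T q).
Proof.
move=> Uq; have U1q := T_in Uq; rewrite /hopf4 eta_comp // (md_eq _ oU2 Uq kap_comp).
rewrite (md_scale _ Uq srho (smoothM_comp sk1)); have [-> _] := md_comp Uq sk1.
have kk : forall z, U1 z -> lorentz (lift_kap Y1 z) (lift_kap Y1 z) = 0 by move=> z /HW1[].
have dk : lorentz (dd (lift_kap Y1) (T q)) (lift_kap Y1 (T q)) = 0.
  have := pd_lorentz_cst oU1 (- 'i%C) U1q sk1 sk1 kk; rewrite [X in _ = - X]lorentzC => /eqP.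
  by rewrite -addr_eq0 -mulr2n mulrn_eq0 /= => /eqP.
rewrite !lorentzDl !lorentzDr !lorentzZl !lorentzZr (kk _ U1q) (lkap_eta HY1 HW1 U1q) dk !mulr0 !add0r.
have := mu_norm Uq; rewrite /rho; move: (lorentz _ _) (mu q) (t q) (conjc _) => H m t' tb E.
have -> : m * t' * t' * (t' * (m * t' * t' * tb * H)) = m * m * (t' * tb) * (t' ^+ 4 * H) by ring.
by rewrite E mul1r.
Qed.

(** Adding a multiple of [kap] to [eta] leaves the Gram determinant unchanged, and the scalings
    multiply it by the nonzero squared moduli of [rho] and [rho conj t]. *)
Lemma gramw_comp q : U2 q -> gramw Y1 (T q) != 0 <-> gramw Y2 q != 0.
Proof.
move=> Uq; have r0 : rho q != 0 by rewrite !mulf_neq0 ?mu0 ?t0.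
have -> : gramw Y2 q = (rho q * conjc (rho q)) * (rho q * conjc (t q) * conjc (rho q * conjc (t q))) * gramw Y1 (T q).
  rewrite /gramw eta_comp // kap_comp // conj_cmxD !conj_cmxZ !lorentzDl !lorentzZl !lorentzDr !lorentzZr.
  move: (lorentz _ _) (lorentz _ _) (lorentz _ _) (lorentz _ _) => a b c d.
  move: (rho q) (conjc _) (pd _ _ _) (conjc _) (conjc _) (conjc _) => r rb s sb u ub; ring.
have c0 (x : C) : x != 0 -> conjc x != 0 by rewrite conjc_eq0.
have rt : rho q * conjc (t q) != 0 by exact: (mulf_neq0 r0 (tb0 Uq)).
have K0 := mulf_neq0 (mulf_neq0 r0 (c0 _ r0)) (mulf_neq0 rt (c0 _ rt)).
by rewrite mulf_eq0 (negbTE K0).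
Qed.

End HolomorphicChange.

(** * Coordinates in dimension three *)

Section Det3.
Variable R : realType.

Local Notation o0 := (ord0 : 'I_3).
Local Notation o1 := (lift ord0 ord0 : 'I_3).
Local Notation o2 := (lift ord0 (lift ord0 ord0) : 'I_3).

Lemma det3 (A : 'M[R]_3) : \det A =
  A o0 o0 * (A o1 o1 * A o2 o2 - A o1 o2 * A o2 o1) - A o0 o1 * (A o1 o0 * A o2 o2 - A o1 o2 * A o2 o0)
  + A o0 o2 * (A o1 o0 * A o2 o1 - A o1 o1 * A o2 o0).
Proof.
pose a m n := A (inord m) (inord n).
have E i j : A i j = a (val i) (val j) by rewrite /a !inord_val.
rewrite (expand_det_row _ ord0) !big_ord_recl big_ord0 /cofactor.
rewrite !(expand_det_row _ ord0) !big_ord_recl !big_ord0 /cofactor !det_mx11 !mxE /= !E /bump /=; ring.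
Qed.

Lemma det_col3 (x y z : 'rV[R]_3) : \det (col_mx x (col_mx y z) : 'M[R]_3) =
  x 0 o0 * (y 0 o1 * z 0 o2 - y 0 o2 * z 0 o1) - x 0 o1 * (y 0 o0 * z 0 o2 - y 0 o2 * z 0 o0)
  + x 0 o2 * (y 0 o0 * z 0 o1 - y 0 o1 * z 0 o0).
Proof.
have E0 j : (col_mx x (col_mx y z) : 'M[R]_3) o0 j = x 0 j.
  by rewrite -(col_mxEu x (col_mx y z) 0 j); congr (col_mx _ _ _ _); exact: val_inj.
have E1 j : (col_mx x (col_mx y z) : 'M[R]_3) o1 j = y 0 j.
  rewrite -(col_mxEu y z 0 j) -(col_mxEd x (col_mx y z)); congr (col_mx _ _ _ _); exact: val_inj.
have E2 j : (col_mx x (col_mx y z) : 'M[R]_3) o2 j = z 0 j.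
  rewrite -(col_mxEd y z 0 j) -(col_mxEd x (col_mx y z)); congr (col_mx _ _ _ _); exact: val_inj.
by rewrite det3 !(E0, E1, E2).
Qed.

Lemma dot3 (x y : 'rV[R]_3) : dot x y = x 0 o0 * y 0 o0 + x 0 o1 * y 0 o1 + x 0 o2 * y 0 o2.
Proof. by rewrite /dot mxE !big_ord_recl big_ord0 addr0 !mxE addrA. Qed.

Lemma eq_row3 (x y : 'rV[R]_3) : x 0 o0 = y 0 o0 -> x 0 o1 = y 0 o1 -> x 0 o2 = y 0 o2 -> x = y.
Proof.
move=> h0 h1 h2; apply/rowP => -[[|[|[|//]]] ilt].
- by have -> : Ordinal ilt = o0 by exact: val_inj.
- by have -> : Ordinal ilt = o1 by exact: val_inj.
- by have -> : Ordinal ilt = o2 by exact: val_inj.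
Qed.

End Det3.

(** * Stereographic charts *)

Section Stereographic.
Variable R : realType.
Local Notation plane := (plane R).
Local Notation C := R[i].
Local Notation o0 := (ord0 : 'I_3).
Local Notation o1 := (lift ord0 ord0 : 'I_3).
Local Notation o2 := (lift ord0 (lift ord0 ord0) : 'I_3).
#[local] Opaque derive derivable Defs.eu Defs.ev.

Definition row3 (a b c : R) : 'rV[R]_3 := \row_j [:: a; b; c]`_j.

Lemma row3E a b c : [/\ row3 a b c 0 o0 = a, row3 a b c 0 o1 = b & row3 a b c 0 o2 = c].
Proof. by rewrite !mxE. Qed.

Definition smul (q : plane) : R := (1 + q.1 * q.1 + q.2 * q.2)^-1.

Lemma smul_den (q : plane) : 0 < 1 + q.1 * q.1 + q.2 * q.2.
Proof. by rewrite -addrA ltr_pwDl // addr_ge0 // -expr2 sqr_ge0. Qed.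

Lemma smulK q : smul q * (1 + q.1 * q.1 + q.2 * q.2) = 1.
Proof. by rewrite mulVf // gt_eqF // smul_den. Qed.

Lemma smul_gt0 q : 0 < smul q. Proof. by rewrite invr_gt0 smul_den. Qed.

(* Inverse stereographic projection from the pole [(0, 0, - eps)], oriented for [eps = 1] and [eps = -1] alike. *)
Definition stereo (eps : R) (q : plane) : 'rV[R]_3 :=
  row3 (2 * q.1 * smul q) (eps * (2 * q.2 * smul q)) (eps * (2 * smul q - 1)).

Lemma is_derive_fst (p v : plane) : is_derive p v (fun q : plane => q.1) v.1.
Proof.
have : is_derive p v (lin2 1 0) (lin2 1 0 v) := is_derive_of_lin p v (@lin2_continuous R 1 0).
have -> : (lin2 1 0 : plane -> R) = (fun q : plane => q.1).
  by apply/funext => q; rewrite /lin2 mulr1 mulr0 addr0.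
exact: id.
Qed.

Lemma is_derive_snd (p v : plane) : is_derive p v (fun q : plane => q.2) v.2.
Proof.
have : is_derive p v (lin2 0 1) (lin2 0 1 v) := is_derive_of_lin p v (@lin2_continuous R 0 1).
have -> : (lin2 0 1 : plane -> R) = (fun q : plane => q.2).
  by apply/funext => q; rewrite /lin2 mulr1 mulr0 add0r.
exact: id.
Qed.

Lemma is_derive_mul (f g : plane -> R) p v df dg : is_derive p v f df -> is_derive p v g dg ->
  is_derive p v (fun q => f q * g q) (f p * dg + g p * df).
Proof. by move=> Hf Hg; exact: (is_deriveM Hf Hg). Qed.

Lemma is_derive_add (f g : plane -> R) p v df dg : is_derive p v f df -> is_derive p v g dg ->
  is_derive p v (fun q => f q + g q) (df + dg).
Proof. by move=> Hf Hg; exact: (is_deriveD Hf Hg). Qed.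

Lemma is_derive_val (f : plane -> R) p v a b : is_derive p v f a -> a = b -> is_derive p v f b.
Proof. by move=> h <-. Qed.

Lemma is_derive_smul (p v : plane) : is_derive p v smul (- (smul p * smul p * (2 * (p.1 * v.1 + p.2 * v.2)))).
Proof.
have h1 := is_derive_fst p v; have h2 := is_derive_snd p v.
have hc := is_derive_cst (1 : R) p v.
have d := is_derive_add (is_derive_add hc (is_derive_mul h1 h1)) (is_derive_mul h2 h2).
apply: (is_derive_val (is_derive_inv _ d)); first by rewrite gt_eqF // smul_den.
by rewrite /smul; congr (- (_ * _)); ring.
Qed.

Lemma rowD_stereo eps (p v : plane) dm : dm = - (smul p * smul p * (2 * (p.1 * v.1 + p.2 * v.2))) ->
  rowD v (stereo eps) p =
  row3 (2 * (p.1 * dm + smul p * v.1)) (eps * (2 * (p.2 * dm + smul p * v.2))) (eps * (2 * dm)).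
Proof.
have h1 := is_derive_fst p v; have h2 := is_derive_snd p v; have hm := is_derive_smul p v.
have hc (a : R) := is_derive_cst a p v.
move=> dmE; rewrite -dmE in hm; apply: eq_row3; rewrite mxE.
- have -> : (fun q => stereo eps q 0 o0) = (fun q => 2 * q.1 * smul q) by apply/funext => q; rewrite mxE.
  have [_ ->] := is_derive_mul (is_derive_mul (hc 2) h1) hm; rewrite mxE /=; ring.
- have -> : (fun q => stereo eps q 0 o1) = (fun q => eps * (2 * q.2 * smul q)) by apply/funext => q; rewrite mxE.
  have [_ ->] := is_derive_mul (hc eps) (is_derive_mul (is_derive_mul (hc 2) h2) hm); rewrite mxE /=; ring.
- have -> : (fun q => stereo eps q 0 o2) = (fun q => eps * (2 * smul q + -1)) by apply/funext => q; rewrite mxE.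
  have [_ ->] := is_derive_mul (hc eps) (is_derive_add (is_derive_mul (hc 2) hm) (hc (-1))); rewrite mxE /=; ring.
Qed.

Let eu1 : (eu R).1 = 1. Proof. by []. Qed.
Let eu2 : (eu R).2 = 0. Proof. by []. Qed.
Let ev1 : (ev R).1 = 0. Proof. by []. Qed.
Let ev2 : (ev R).2 = 1. Proof. by []. Qed.

Variable eps : R.
Hypothesis eps2 : eps * eps = 1.

Let edot a b c a' b' c' : dot (row3 a (eps * b) (eps * c)) (row3 a' (eps * b') (eps * c')) = a * a' + b * b' + c * c'.
Proof.
rewrite dot3; have [-> -> ->] := row3E a (eps * b) (eps * c); have [-> -> ->] := row3E a' (eps * b') (eps * c').
by rewrite [eps * b * _]mulrACA [eps * c * _]mulrACA eps2 !mul1r.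
Qed.

Lemma stereo_unit q : unit_sphere (stereo eps q).
Proof.
rewrite /unit_sphere /= /stereo edot; have := smulK q; move: (smul q) (q.1) (q.2) => m u v E.
have -> : 2 * u * m * (2 * u * m) + 2 * v * m * (2 * v * m) + (2 * m - 1) * (2 * m - 1)
  = 4 * m * (m * (1 + u * u + v * v)) - 4 * m + 1 by ring.
by rewrite E mulr1 subrr add0r.
Qed.

Lemma stereo_conformal q :
  [/\ dot (rowD (eu R) (stereo eps) q) (rowD (ev R) (stereo eps) q) = 0,
      dot (rowD (eu R) (stereo eps) q) (rowD (eu R) (stereo eps) q) = 4 * smul q * smul q,
      dot (rowD (ev R) (stereo eps) q) (rowD (ev R) (stereo eps) q) = 4 * smul q * smul q &
      \det (col_mx (stereo eps q) (col_mx (rowD (eu R) (stereo eps) q) (rowD (ev R) (stereo eps) q)) : 'M[R]_3)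
        = 4 * smul q * smul q].
Proof.
rewrite (rowD_stereo eps (dm := - (smul q * smul q * (2 * q.1)))); last by rewrite eu1 eu2 mulr1 mulr0 addr0.
rewrite (rowD_stereo eps (dm := - (smul q * smul q * (2 * q.2)))); last by rewrite ev1 ev2 mulr1 mulr0 add0r.
rewrite eu1 eu2 ev1 ev2 !edot det_col3 /stereo.
rewrite !mulr0 !mulr1 !addr0.
have [-> -> ->] := row3E (2 * q.1 * smul q) (eps * (2 * q.2 * smul q)) (eps * (2 * smul q - 1)).
set mu := - (_ * _ * (2 * q.1)); set mv := - (_ * _ * (2 * q.2)).
have [-> -> ->] := row3E (2 * (q.1 * mu + smul q)) (eps * (2 * (q.2 * mu))) (eps * (2 * mu)).
have [-> -> ->] := row3E (2 * (q.1 * mv)) (eps * (2 * (q.2 * mv + smul q))) (eps * (2 * mv)).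
rewrite /mu /mv {mu mv}; have := smulK q; move: (smul q) (q.1) (q.2) => m u v E; split.
- transitivity (- (16 * u * v * m * m * m) + 16 * u * v * m * m * m * (m * (1 + u * u + v * v))); first by ring.
  rewrite E; ring.
- transitivity (4 * m * m - 16 * u * u * m * m * m + 16 * u * u * m * m * m * (m * (1 + u * u + v * v))); first by ring.
  rewrite E; ring.
- transitivity (4 * m * m - 16 * v * v * m * m * m + 16 * v * v * m * m * m * (m * (1 + u * u + v * v))); first by ring.
  rewrite E; ring.
- transitivity (eps * eps * (8 * m * m * (m * (1 + u * u + v * v)) - 4 * m * m)); first by ring.
  rewrite E eps2; ring.
Qed.

Lemma smul_smooth : smooth_on setT smul.
Proof.
move=> k; apply: (Ck_inv openT); first by move=> p _; rewrite gt_eqF // smul_den.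
have c1 := Ck_fst k (@openT plane); have c2 := Ck_snd k (@openT plane).
exact: (Ck_add openT (Ck_add openT (Ck_cst k 1 openT) (Ck_mul openT c1 c1)) (Ck_mul openT c2 c2)).
Qed.

Lemma stereo_local_coordinate : local_coordinate setT (stereo eps).
Proof.
split.
- exact: openT.
- move=> j k; have c1 := Ck_fst k (@openT plane); have c2 := Ck_snd k (@openT plane).
  have cc a := Ck_cst k a (@openT plane); have cm := smul_smooth k.
  have m1 := Ck_mul openT (Ck_mul openT (cc 2) c1) cm.
  have m2 := Ck_mul openT (cc eps) (Ck_mul openT (Ck_mul openT (cc 2) c2) cm).
  have m3 := Ck_mul openT (cc eps) (Ck_add openT (Ck_mul openT (cc 2) cm) (cc (-1))).
  have E3 (x : 'I_3) : [\/ x = o0, x = o1 | x = o2].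
    case: x => [[|[|[|//]]] ilt]; [apply: Or31|apply: Or32|apply: Or33]; exact: val_inj.
  by case: (E3 j) => ->; [apply: (Ck_on_eq openT _ m1)|apply: (Ck_on_eq openT _ m2)|apply: (Ck_on_eq openT _ m3)] => q _; rewrite mxE.
- split; first by move=> p _; exact: stereo_unit.
  move=> p q _ _ E.
  have K z : stereo eps z 0 o0 = 2 * z.1 * smul z /\ stereo eps z 0 o1 = eps * (2 * z.2 * smul z) /\
    stereo eps z 0 o2 = eps * (2 * smul z - 1) by rewrite !mxE.
  have ei (a b : R) : eps * a = eps * b -> a = b.
    by move=> h; rewrite -[a]mul1r -eps2 -mulrA h mulrA eps2 mul1r.
  have [a1 [a2 a3]] := K p; have [b1 [b2 b3]] := K q; rewrite E in a1 a2 a3.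
  rewrite a3 in b3; rewrite a2 in b2; rewrite a1 in b1.
  have em : smul p = smul q by move/ei: b3 => h; lra.
  move/ei: b2; rewrite em => h2; rewrite em in b1.
  have m0 : smul q != 0 by rewrite gt_eqF // smul_gt0.
  have two0 : (2 : R) != 0 by rewrite pnatr_eq0.
  by apply: injective_projections; apply: (mulfI two0); apply: (mulIf m0).
- move=> p _; have [h1 h2 h3 _] := stereo_conformal p; split; [exact: h1|exact: (etrans h2 (esym h3))|].
  have m0 := smul_gt0 p; have P : 0 < 4 * smul p * smul p by rewrite !mulr_gt0.
  rewrite -h2 in P; exact: P.
- move=> p _; have [_ _ _ h] := stereo_conformal p.
  have m0 := smul_gt0 p; have P : 0 < 4 * smul p * smul p by rewrite !mulr_gt0.
  rewrite -h in P; exact: P.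
Qed.

End Stereographic.

(** With [J = a d - b c] and [S = a^2 + b^2], Lagrange's identity gives [J^2 = S^2], and positivity
    of [J] selects [J = S]. Then [(a - d)^2 + (b + c)^2 = 2 S - 2 J = 0]. *)
Lemma conformal_cauchy_riemann (R : realType) (a b c d : R) : a * c + b * d = 0 ->
  a * a + b * b = c * c + d * d -> 0 < a * d - b * c -> c = - b /\ d = a.
Proof.
move=> h1 h2; set J := a * d - b * c => J0; pose S := a * a + b * b.
have S0 : 0 <= S by rewrite /S -!expr2 addr_ge0 ?sqr_ge0.
have JS : J = S.
  have : (J - S) * (J + S) = 0.
    have -> : (J - S) * (J + S) = (a * a + b * b) * (c * c + d * d) - (a * c + b * d) * (a * c + b * d) - S * S.
      by rewrite /J; ring.
    by rewrite -h2 h1 -/S mulr0 subr0 subrr.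
  move=> /eqP; rewrite mulf_eq0 [J + S == 0]gt_eqF ?orbF ?subr_eq0; first by move/eqP.
  by rewrite ltr_pwDl.
have : (a - d) ^+ 2 + (b + c) ^+ 2 == 0.
  have -> : (a - d) ^+ 2 + (b + c) ^+ 2 = S + (c * c + d * d) - (J + J) by rewrite /S /J; ring.
  by rewrite -h2 -/S JS subrr.
rewrite paddr_eq0 ?sqr_ge0 // !sqrf_eq0 => /andP[/eqP e1 /eqP e2]; split; lra.
Qed.

(** [a], [b], [c], [d] are the entries of the Jacobian of a transition between two conformal charts;
    the determinants with [x] compare their orientations. *)
Lemma conformal_frame_change (R : realType) (x A B Fu Fv : 'rV[R]_3) (a b c d K : R) :
  Fu = a *: A + b *: B -> Fv = c *: A + d *: B -> dot A B = 0 -> dot A A = K -> dot B B = K ->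
  \det (col_mx x (col_mx A B) : 'M[R]_3) = K -> 0 < K ->
  dot Fu Fv = 0 -> dot Fu Fu = dot Fv Fv -> 0 < \det (col_mx x (col_mx Fu Fv) : 'M[R]_3) ->
  [/\ c = - b, d = a & dot Fu Fu = K * (a ^+ 2 + b ^+ 2)].
Proof.
move=> -> -> AB AA BB dt K0 c1 c2 c3.
have dl (p q r s : R) : dot (p *: A + q *: B) (r *: A + s *: B) = p * r * dot A A + (p * s + q * r) * dot A B + q * s * dot B B.
  by rewrite !dot3 !mxE; ring.
have e1 : a * c + b * d = 0.
  by apply: (mulfI (lt0r_neq0 K0)); rewrite mulr0 -[RHS]c1 dl AB AA BB; ring.
have e2 : a * a + b * b = c * c + d * d.
  apply: (mulfI (lt0r_neq0 K0)); transitivity (dot (a *: A + b *: B) (a *: A + b *: B)).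
    by rewrite dl AB AA BB; ring.
  by rewrite c2 dl AB AA BB; ring.
have e3 : 0 < a * d - b * c.
  rewrite -(pmulr_rgt0 _ K0); move: c3.
  have -> : \det (col_mx x (col_mx (a *: A + b *: B) (c *: A + d *: B)) : 'M[R]_3) = K * (a * d - b * c).
    by rewrite -dt !det_col3 !mxE; ring.
  exact: id.
have [-> ->] := conformal_cauchy_riemann e1 e2 e3; split=> //.
by rewrite dl AB AA BB; ring.
Qed.

(** * Transition from an arbitrary chart to a stereographic one *)

Section Transition.
Variable R : realType.
Local Notation plane := (plane R).
Local Notation C := R[i].
Local Notation o0 := (ord0 : 'I_3).
Local Notation o1 := (lift ord0 ord0 : 'I_3).
Local Notation o2 := (lift ord0 (lift ord0 ord0) : 'I_3).
#[local] Opaque derive derivable Defs.eu Defs.ev.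

Variables (eps : R) (U : set plane) (phi : plane -> 'rV[R]_3).
Hypothesis eps2 : eps * eps = 1.
Hypothesis Hphi : local_coordinate U phi.

(** [trans_u] and [trans_v] are the stereographic projection from the pole [(0, 0, - eps)], which
    inverts [stereo eps]; on the unit sphere this denominator vanishes only at that pole. *)
Definition trans_den q := 1 + eps * phi q 0 o2.
Definition trans_u q := phi q 0 o0 / trans_den q.
Definition trans_v q := eps * phi q 0 o1 / trans_den q.
Definition trans_dom : set plane := U `&` [set q | 0 < trans_den q].
Local Notation T := (fun q => (trans_u q, trans_v q)).
Local Notation Ud := trans_dom.

Let oU : open U. Proof. by case: Hphi. Qed.
Let sphi j : smooth_on U (fun q => phi q 0 j). Proof. by case: Hphi => _ s _ _ _ k; exact: s. Qed.

Let s_den : smooth_on U trans_den.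
Proof. by move=> k; apply: (Ck_add oU (Ck_cst k 1 oU) (Ck_mul oU (Ck_cst k eps oU) (sphi o2 k))). Qed.

Lemma trans_dom_sub : Ud `<=` U. Proof. by move=> q []. Qed.

Lemma trans_dom_open : open Ud.
Proof. exact: (open_pos oU (fun q Uq => Ck_on_cont (s_den 0%N) Uq)). Qed.

Let oUd := trans_dom_open.

Let iden : smooth_on Ud (fun q => (trans_den q)^-1).
Proof.
move=> k; apply: (Ck_inv oUd); first by move=> q [_ h]; rewrite gt_eqF.
exact: (Ck_on_sub trans_dom_sub (s_den k)).
Qed.

Lemma trans_u_smooth : smooth_on Ud trans_u.
Proof. by move=> k; exact: (Ck_mul oUd (Ck_on_sub trans_dom_sub (sphi o0 k)) (iden k)). Qed.

Lemma trans_v_smooth : smooth_on Ud trans_v.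
Proof.
by move=> k; exact: (Ck_mul oUd (Ck_mul oUd (Ck_cst k eps oUd) (Ck_on_sub trans_dom_sub (sphi o1 k))) (iden k)).
Qed.

Lemma smul_trans q : Ud q -> smul (T q) = trans_den q / 2.
Proof.
move=> [Uq d0]; have : dot (phi q) (phi q) = 1 by case: Hphi => _ _ [H _] _ _; exact: H.
rewrite dot3 /smul /trans_u /trans_v /=; move: (d0 : 0 < trans_den q); rewrite /trans_den.
move: (phi q 0 o0) (phi q 0 o1) (phi q 0 o2) => x y z w0 E.
have w0' : 1 + eps * z != 0 by rewrite gt_eqF.
rewrite -[RHS]invrK; congr (_^-1); rewrite invf_div.
have e1 : x * x + y * y = (1 + eps * z) * (1 - eps * z).
  by rewrite mulrBr mulr1 mulrDl mul1r mulrACA eps2 mul1r; lra.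
transitivity (1 + (x * x + eps * eps * (y * y)) / ((1 + eps * z) * (1 + eps * z))); first by field.
rewrite eps2 mul1r e1; by field.
Qed.

Lemma stereo_trans q : Ud q -> phi q = stereo eps (T q).
Proof.
move=> Uq; have [_ d0] := Uq; have d1 : trans_den q != 0 by rewrite gt_eqF.
rewrite /stereo smul_trans //; apply: eq_row3; rewrite mxE /=.
- rewrite /trans_u; by field.
- transitivity (eps * eps * phi q 0 o1); first by rewrite eps2 mul1r.
  rewrite /trans_v; by field.
- transitivity (eps * eps * phi q 0 o2); first by rewrite eps2 mul1r.
  rewrite /trans_den; by field.
Qed.

Lemma rowD_trans v q : Ud q -> rowD v phi q =
  'D_v trans_u q *: rowD (eu R) (stereo eps) (T q) + 'D_v trans_v q *: rowD (ev R) (stereo eps) (T q).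
Proof.
have rE w F z j : rowD w F z 0 j = 'D_w (fun q => F q 0 j) z by rewrite mxE.
have cE (a b : R) (A B : 'rV[R]_3) j : (a *: A + b *: B) 0 j = a * A 0 j + b * B 0 j by rewrite !mxE.
move=> Uq; apply/rowP => j; rewrite cE !rE.
have [_ s _ _ _] := stereo_local_coordinate eps2.
rewrite (eq_on_derive v oUd Uq (g := fun q => stereo eps (T q) 0 j)); last by move=> z /stereo_trans ->.
have [_ ->] := chain_rule v openT oUd Uq I (s j 1%N) (trans_u_smooth 1%N) (trans_v_smooth 1%N).
by rewrite [X in X + _]mulrC [X in _ + X]mulrC.
Qed.

Lemma trans_cr q : Ud q -> [/\ 'D_(ev R) trans_u q = - 'D_(eu R) trans_v q, 'D_(ev R) trans_v q = 'D_(eu R) trans_u q &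
  dot (rowD (eu R) phi q) (rowD (eu R) phi q) =
  (trans_den q) ^+ 2 * ('D_(eu R) trans_u q ^+ 2 + 'D_(eu R) trans_v q ^+ 2)].
Proof.
move=> Uq; have U1 := trans_dom_sub Uq.
have [c1 c2 c3] : [/\ dot (rowD (eu R) phi q) (rowD (ev R) phi q) = 0,
   dot (rowD (eu R) phi q) (rowD (eu R) phi q) = dot (rowD (ev R) phi q) (rowD (ev R) phi q) &
   0 < \det (col_mx (phi q) (col_mx (rowD (eu R) phi q) (rowD (ev R) phi q)) : 'M[R]_3)].
  case: Hphi => _ _ _ H1 H2; have [h1 h2 _] := H1 q U1; split; [exact: h1|exact: h2|exact: (H2 q U1)].
have [h1 h2 h3 h4] := stereo_conformal eps2 (T q).
rewrite -(stereo_trans Uq) in h4.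
have m0 := smul_gt0 (T q).
have K0 : 0 < 4 * smul (T q) * smul (T q) := mulr_gt0 (mulr_gt0 (ltr0n _ 4) m0) m0.
have [e1 e2 e3] := conformal_frame_change (rowD_trans (eu R) Uq) (rowD_trans (ev R) Uq) h1 h2 h3 h4 K0 c1 c2 c3.
split; [exact: e1|exact: e2|rewrite e3 (smul_trans Uq)].
by move: ('D_(eu R) _ q) ('D_(eu R) _ q) (trans_den q) => ? ? ?; field.
Qed.

Lemma trans_holomorphic q : Ud q -> pd 'i%C (fun q => trans_u q +i* trans_v q) q = 0.
Proof.
move=> Uq; have [e1 e2 _] := trans_cr Uq; rewrite pd.unlock /Dc /= e1 e2.
move: ('D_(eu R) _ _) ('D_(eu R) _ _) => b a.
have -> : a +i* b + 'i%C * (- b +i* a) = 0.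
  by apply/eqP; rewrite eq_complex /=; apply/andP; split; apply/eqP; ring.
by rewrite mulr0.
Qed.

End Transition.

(** * Maximum principles and isolated zeros *)

Section MaximumPrinciple.
Variable R : realType.
Local Notation plane := (plane R).
Local Notation C := R[i].
Local Notation Re := complex.Re.
Local Notation Im := complex.Im.
Local Notation pz := (pd (- 'i%C)).
Local Notation pb := (pd 'i%C).
Local Notation eu := (eu R).
Local Notation ev := (ev R).
Implicit Types (U W : set plane) (f g F : plane -> C) (p q : plane).
#[local] Opaque derive derivable Defs.eu Defs.ev.

Lemma box_max (f : plane -> R) (c : plane) (r : R) : 0 <= r ->
  (forall q, `|q - c| <= r -> {for q, continuous f}) ->
  exists2 m, `|m - c| <= r & forall q, `|q - c| <= r -> f q <= f m.
Proof.
move=> r0 cf; pose A := (`[c.1 - r, c.1 + r]%classic `*` `[c.2 - r, c.2 + r]%classic : set plane).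
have AE q : A q <-> `|q - c| <= r.
  by rewrite plane_normE ge_max !ler_distl /A /= !in_itv /=; split=> [[-> ->]|/andP].
have cA : compact A by apply: compact_setX; exact: segment_compact.
have A0 : A !=set0 by exists c; apply/AE; rewrite subrr normr0.
have cw : {within A, continuous f}.
  by apply: continuous_in_subspaceT => q; rewrite inE => /AE /cf.
have [m + H] := compact_EVT_max A0 cA cw; rewrite inE => /AE mr.
by exists m => // q /AE qA; apply: H; rewrite inE.
Qed.

Definition lapL f p : C := f p * pb (pz f) p - pz f p * pb f p.

Lemma lapL_eq U f g p : open U -> U p -> (forall q, U q -> f q = g q) -> lapL f p = lapL g p.
Proof.
move=> oU Up fg; rewrite /lapL (fg p Up) !(pd_eq _ oU Up fg).
by rewrite (pd_eq _ oU Up (fun q Uq => pd_eq _ oU Uq fg)).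
Qed.

(* The operator [lapL f = f ^ 2 (log f)_(z zbar)] is a logarithmic derivation. *)
Lemma lapL_mul U f g p : open U -> U p -> smoothC U f -> smoothC U g ->
  lapL (fun q => f q * g q) p = f p ^+ 2 * lapL g p + g p ^+ 2 * lapL f p.
Proof.
move=> oU Up sf sg; have sfz := smoothC_pd (- 'i%C) oU sf; have sgz := smoothC_pd (- 'i%C) oU sg.
rewrite /lapL !(pd_mul _ Up sf sg) (pd_eq _ oU Up (fun q Uq => pd_mul (- 'i%C) Uq sf sg)).
rewrite (pd_add _ Up (smoothC_mul oU sfz sg) (smoothC_mul oU sf sgz)) (pd_mul _ Up sfz sg) (pd_mul _ Up sf sgz).
move: (f p) (g p) (pz f p) (pb f p) (pz g p) (pb g p) (pb (pz f) p) (pb (pz g) p) => a b c d e x y z; ring.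
Qed.

Lemma lapL_cst (c : C) p : lapL (fun=> c) p = 0.
Proof.
rewrite /lapL (_ : pz (fun=> c) = fun=> 0); last by apply/funext => q; rewrite pd_cst.
by rewrite pd_cst mulr0 mul0r subrr.
Qed.

Lemma lapL_exp U f n p : open U -> U p -> smoothC U f ->
  lapL (fun q => f q ^+ n.+1) p = n.+1%:R * (f p ^+ n) ^+ 2 * lapL f p.
Proof.
move=> oU Up sf; elim: n => [|n IH].
  rewrite expr0 expr1n !mul1r; congr lapL.
rewrite (lapL_eq (g := fun q => f q * f q ^+ n.+1) oU Up); last by move=> q _; rewrite exprS.
rewrite (lapL_mul oU Up sf (smoothC_exp _ oU sf)) IH [n.+2%:R]mulrS !exprS.
by move: (f p) (f p ^+ n) (lapL f p) n.+1%:R => a b c d; ring.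
Qed.

Lemma lapL_inv U f p : open U -> U p -> smoothC U f -> (forall q, U q -> f q != 0) -> lapL f p = 0 ->
  lapL (fun q => (f q)^-1) p = 0.
Proof.
move=> oU Up sf f0 L0; have := lapL_mul oU Up sf (smoothC_inv oU f0 sf).
rewrite (lapL_eq (g := fun=> 1) oU Up); last by move=> q /f0 /divff.
rewrite lapL_cst L0 mulr0 addr0 => /esym/eqP; rewrite mulf_eq0 sqrf_eq0 (negbTE (f0 _ Up)) => /eqP; exact: id.
Qed.

(** The logarithm of the squared modulus of a holomorphic function is harmonic; stated with [lapL]
    this includes the zeros of [f]. *)
Lemma lapL_hol U f p : open U -> U p -> smoothC U f -> (forall q, U q -> pb f q = 0) ->
  lapL (fun q => f q * conjc (f q)) p = 0.
Proof.
move=> oU Up sf f0; have sc := smoothC_conj oU sf.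
have L0 : lapL f p = 0.
  rewrite /lapL (pd_comm _ _ oU Up sf) (pd_eq (g := fun=> 0) _ oU Up f0) pd_cst f0 // mulr0 mulr0 subrr; reflexivity.
have z0 q : U q -> pz (fun z => conjc (f z)) q = 0.
  by move=> Uq; rewrite (pd_conj _ Uq sf) conjcN conj_i opprK f0 // conjc0.
have L1 : lapL (fun q => conjc (f q)) p = 0.
  rewrite /lapL (pd_eq (g := fun=> 0) _ oU Up z0) pd_cst z0 // mulr0 mul0r subrr; reflexivity.
by rewrite (lapL_mul oU Up sf sc) L0 L1 !mulr0 addr0.
Qed.

Lemma Re_pb f p : Re (pb f p) = 2^-1 * ('D_eu (fun q => Re (f q)) p - 'D_ev (fun q => Im (f q)) p).
Proof.
rewrite pd.unlock /Dc; move: ('D_eu _ p) ('D_eu _ p) ('D_ev _ p) ('D_ev _ p) => a b c d.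
have -> : (2^-1 : C) = (2^-1)%:C by rewrite fmorphV rmorph_nat.
rewrite Re_mul /=; ring.
Qed.

(** At a local maximum the first derivatives vanish, so [lapL] reduces to [F] times a quarter of its
    Laplacian, a nonnegative number times a nonpositive one. *)
Lemma lapL_max U F p : open U -> U p -> smoothC U F -> (forall q, U q -> Im (F q) = 0) ->
  (\forall q \near p, Re (F q) <= Re (F p)) -> 0 <= Re (F p) -> Re (lapL F p) <= 0.
Proof.
move=> oU Up sF F0 mx Fp; have [sR sI] := sF.
have [_ [dR [cu cv]]] : Ck_on 2 U (fun q => Re (F q)) := sR 2%N.
have [cu0 [duu [cuu _]]] := cu; have [cv0 [dvv [_ cvv]]] := cv.
have du q : U q -> derivable (fun q => Re (F q)) q eu /\ derivable ('D_eu (fun q => Re (F q))) q eu.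
  by move=> Uq; split; [exact: (dR q Uq).1|exact: (duu q Uq).1].
have dv q : U q -> derivable (fun q => Re (F q)) q ev /\ derivable ('D_ev (fun q => Re (F q))) q ev.
  by move=> Uq; split; [exact: (dR q Uq).2|exact: (dvv q Uq).2].
have u1 : 'D_eu (fun q => Re (F q)) p = 0.
  exact: (local_max_deriv0 oU Up (fun q Uq => (du q Uq).1) (cu0 p Up) mx).
have v1 : 'D_ev (fun q => Re (F q)) p = 0.
  exact: (local_max_deriv0 oU Up (fun q Uq => (dv q Uq).1) (cv0 p Up) mx).
have u2 := local_max_deriv2 oU Up du (cu0 p Up) (cuu.1 p Up) mx.
have v2 := local_max_deriv2 oU Up dv (cv0 p Up) (cvv.1 p Up) mx.
have I0 v q : U q -> 'D_v (fun q => Im (F q)) q = 0.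
  by move=> Uq; rewrite (eq_on_derive v oU Uq F0) derive_cst.
have z0 : pz F p = 0.
  by rewrite pd.unlock /Dc u1 v1 !I0 // mulr0 addr0 mulr0.
rewrite /lapL z0 mul0r subr0 Re_mul F0 // mul0r subr0.
apply: mulr_ge0_le0 => //.
have Ez q : U q -> pz F q = (2^-1 * 'D_eu (fun q => Re (F q)) q) +i* (- (2^-1 * 'D_ev (fun q => Re (F q)) q)).
  move=> Uq; rewrite pd.unlock /Dc !I0 //; move: ('D_eu _ q) ('D_ev _ q) => a b.
  have -> : (2^-1 : C) = (2^-1)%:C by rewrite fmorphV rmorph_nat.
  move: (2^-1 : R) => k; by apply/eqP; rewrite eq_complex /=; apply/andP; split; apply/eqP; ring.
have scale (a : R) (k : plane -> R) v : derivable k p v -> 'D_v (fun q => a * k q) p = a * 'D_v k p.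
  by move=> dk; have [_ ->] := is_derive_mul (is_derive_cst a p v) (derivableP dk); rewrite mulr0 addr0.
have scaleN (a : R) (k : plane -> R) v : derivable k p v -> 'D_v (fun q => - (a * k q)) p = - (a * 'D_v k p).
  by move=> dk; rewrite -mulNr -scale //; congr ('D_v _ p); apply/funext => q; rewrite mulNr.
rewrite Re_pb.
have ER q : U q -> Re (pz F q) = 2^-1 * 'D_eu (fun q => Re (F q)) q by move=> Uq; rewrite Ez.
have EI q : U q -> Im (pz F q) = - (2^-1 * 'D_ev (fun q => Re (F q)) q) by move=> Uq; rewrite Ez.
rewrite (eq_on_derive eu oU Up ER) (eq_on_derive ev oU Up EI).
rewrite (scale _ _ _ (du p Up).2) (scaleN _ _ _ (dv p Up).2).
move: u2 v2; move: ('D_eu _ p) ('D_ev _ p) => a b; clear; lra.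
Qed.


Let eu1 : (Defs.eu R).1 = 1. Proof. by []. Qed.
Let eu2 : (Defs.eu R).2 = 0. Proof. by []. Qed.
Let ev1 : (Defs.ev R).1 = 0. Proof. by []. Qed.
Let ev2 : (Defs.ev R).2 = 1. Proof. by []. Qed.

Definition zc (q : plane) : C := q.1 +i* q.2.

Lemma s_zc U : open U -> smoothC U zc.
Proof. by move=> oU; split=> k; [exact: Ck_fst|exact: Ck_snd]. Qed.

Lemma pz_zc p : pz zc p = 1.
Proof.
rewrite pd.unlock /Dc.
have [_ ->] := is_derive_fst p eu; have [_ ->] := is_derive_snd p eu.
have [_ ->] := is_derive_fst p ev; have [_ ->] := is_derive_snd p ev.
have -> : (2^-1 : C) = (2^-1)%:C by rewrite fmorphV rmorph_nat.
by apply/eqP; rewrite eq_complex; apply/andP; split; apply/eqP; rewrite /= ?eu1 ?eu2 ?ev1 ?ev2; field.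
Qed.

Lemma pb_zc p : pb zc p = 0.
Proof.
rewrite pd.unlock /Dc.
have [_ ->] := is_derive_fst p eu; have [_ ->] := is_derive_snd p eu.
have [_ ->] := is_derive_fst p ev; have [_ ->] := is_derive_snd p ev.
rewrite [X in _ * X = _](_ : _ = 0) ?mulr0 //.
by apply/eqP; rewrite eq_complex; apply/andP; split; apply/eqP; rewrite /= ?eu1 ?eu2 ?ev1 ?ev2; ring.
Qed.

Section Centred.
Variable a : C.
Local Notation zt := (fun q => zc q - a).

Lemma s_zt U : open U -> smoothC U zt.
Proof. by move=> oU; apply: (smoothC_add oU (s_zc oU) (smoothC_cst _ oU)). Qed.

Lemma pd_zt p : pz zt p = 1 /\ pb zt p = 0.
Proof.
have sc := smoothC_cst (- a) (@openT plane); have sz := s_zc (@openT plane).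
by rewrite !(pd_add _ I sz sc) !pd_cst pz_zc pb_zc !addr0.
Qed.

Lemma pd_ztc p : pz (fun q => conjc (zt q)) p = 0 /\ pb (fun q => conjc (zt q)) p = 1.
Proof.
have sz := s_zt (@openT plane); have [e1 e2] := pd_zt p.
by rewrite !(pd_conj _ I sz) conjNi conj_i e1 e2 conjc0 conjc1.
Qed.

(** Used with [c = 0], where [log |z - a|^2] is harmonic off [a], and with [c = 1], where the weight
    [1 + |z|^2] gets the positive value 1. *)
Lemma lapL_r2 c p : lapL (fun q => c + zt q * conjc (zt q)) p = c.
Proof.
have oT := @openT plane; have sz := s_zt oT; have sb := smoothC_conj oT sz; have sc := smoothC_cst c oT.
have s2 := smoothC_mul oT sz sb.
have Ez q : pz (fun q => c + zt q * conjc (zt q)) q = conjc (zt q).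
  have [e1 e2] := pd_zt q; have [e3 e4] := pd_ztc q.
  by rewrite (pd_add _ I sc s2) (pd_mul _ I sz sb) pd_cst e1 e3 mulr0 mul1r add0r addr0.
have Eb q : pb (fun q => c + zt q * conjc (zt q)) q = zt q.
  have [e1 e2] := pd_zt q; have [e3 e4] := pd_ztc q.
  by rewrite (pd_add _ I sc s2) (pd_mul _ I sz sb) pd_cst e2 e4 mulr1 mul0r !add0r.
rewrite /lapL Ez Eb (_ : pz _ = fun q => conjc (zt q)); last by apply/funext => q; rewrite Ez.
have [_ ->] := pd_ztc p; rewrite mulr1 [conjc _ * _]mulrC addrK; reflexivity.
Qed.

End Centred.

Definition dist2 (p q : plane) : R := (q.1 - p.1) ^+ 2 + (q.2 - p.2) ^+ 2.

Lemma dist2E p q : (zc q - zc p) * conjc (zc q - zc p) = (dist2 p q)%:C.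
Proof. by apply/eqP; rewrite eq_complex /dist2 /=; apply/andP; split; apply/eqP; ring. Qed.

Lemma dist2_ge0 p q : 0 <= dist2 p q. Proof. by rewrite addr_ge0 ?sqr_ge0. Qed.

Lemma dist2_le p q : dist2 p q <= 2 * `|q - p| ^+ 2.
Proof.
have K (x y : R) : `|x| <= y -> x ^+ 2 <= y ^+ 2.
  by move=> xy; rewrite -(real_normK (num_real x)) ler_sqr ?nnegrE // (le_trans (normr_ge0 x)).
by rewrite mulr_natl mulr2n lerD // K // plane_normE le_max lexx ?orbT.
Qed.

Lemma dist2_ge p q : `|q - p| ^+ 2 <= dist2 p q.
Proof.
rewrite plane_normE /dist2; case: (leP `|(q - p).1| `|(q - p).2|) => _; rewrite real_normK ?num_real //=.
  by rewrite lerDr sqr_ge0.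
by rewrite lerDl sqr_ge0.
Qed.

Lemma dist2_eq0 p q : (dist2 p q == 0) = (q == p).
Proof.
rewrite paddr_eq0 ?sqr_ge0 // !sqrf_eq0 !subr_eq0.
by apply/andP/eqP => [[/eqP e1 /eqP e2]|->]; [exact: injective_projections|].
Qed.

(* A nonnegative function with [(log w)_(z zbar) = - K], [K] continuous, that vanishes to infinite order at
   a point vanishes: [w (1 + |z|^2)^n / |z - p|^2k] satisfies the maximum principle for some [n] that does
   not depend on [k]. *)
Lemma flat_zero (w : plane -> C) (K : plane -> R) p : smoothC setT w ->
  (forall q, Im (w q) = 0) -> (forall q, 0 <= Re (w q)) -> (forall q, {for q, continuous K}) ->
  (forall q, w q != 0 -> lapL w q = - (K q)%:C * w q ^+ 2) ->
  (forall k, exists A : R, exists2 d : R, 0 < d & forall q, `|q - p| < d -> Re (w q) <= A * `|q - p| ^+ k) ->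
  forall q, w q = 0.
Proof.
move=> sw w0 wge cK HL Hflat z1; apply/eqP; apply: contraT => wz1.
have wz1R : 0 < Re (w z1).
  rewrite lt_neqAle wge andbT; apply: contraNneq wz1 => e; rewrite eq_complex w0 -e /=; by rewrite !eqxx.
have oT := @openT plane.
(* Large enough that the squared Euclidean distance of [z1] to [p] is at most half of [rho^2]; this
   margin yields the factor [2^(k+1)] that decides at the end. *)
pose rho := 2 * (`|z1 - p| + 1).
have n0 : 0 <= `|z1 - p| by [].
have rho0 : 0 < rho by rewrite mulr_gt0 // ltr_wpDl.
have z1rho : `|z1 - p| < rho by rewrite /rho; lra.
have z1r2 : 2 * dist2 p z1 <= rho ^+ 2.
  apply: (le_trans (ler_wpM2l _ (dist2_le p z1))) => //; rewrite /rho; move: (`|z1 - p|) n0 => x x0; nra.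
pose b (q : plane) : R := 1 + dist2 (0, 0) q.
have b1 q : 1 <= b q by rewrite lerDl dist2_ge0.
have b0 q : 0 < b q by exact: lt_le_trans (b1 q).
have bE q : (b q)%:C = 1 + (zc q - zc (0, 0)) * conjc (zc q - zc (0, 0)) by rewrite dist2E rmorphD rmorph1.
have sz c := s_zt c oT.
have sB : smoothC setT (fun q => (b q)%:C).
  apply: (smoothC_eq oT (fun q _ => esym (bE q))).
  exact: (smoothC_add oT (smoothC_cst 1 oT) (smoothC_mul oT (sz _) (smoothC_conj oT (sz _)))).
have sD : smoothC setT (fun q => (dist2 p q)%:C).
  exact: (smoothC_eq oT (fun q _ => dist2E p q) (smoothC_mul oT (sz _) (smoothC_conj oT (sz _)))).
have cb q : {for q, continuous b} := (smoothC_cont sB (I : setT q)).1.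
have cw q : {for q, continuous (fun q => Re (w q))} := (smoothC_cont sw (I : setT q)).1.
have cM (f g : plane -> R) q : {for q, continuous f} -> {for q, continuous g} -> {for q, continuous (fun q => f q * g q)}.
  by move=> cf cg; exact: (cvgM cf cg).
have cX (f : plane -> R) n q : {for q, continuous f} -> {for q, continuous (fun q => f q ^+ n)}.
  move=> cf; elim: n => [|n IH]; first exact: cvg_cst.
  have -> : (fun q => f q ^+ n.+1) = (fun q => f q * f q ^+ n) by apply/funext => z; rewrite exprS.
  exact: cM.
have [mK _ HK] := @box_max (fun q => K q * b q ^+ 2) p rho (ltW rho0) (fun q _ => cM _ _ q (cK q) (cX _ 2%N q (cb q))).
(* The weight [b^n] contributes [n / b^2] to [(log)_(z zbar)], so [n] is taken larger than [K b^2]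
   on the whole box. It is chosen before [k]. *)
pose n' := Num.truncn (K mK * b mK ^+ 2); pose n := n'.+1.
have Hn q : `|q - p| <= rho -> K q * b q ^+ 2 < n%:R.
  by move=> /HK h; apply: (le_lt_trans h); exact: truncnS_gt.
pose wb q := Re (w q) * b q ^+ n.
have cwb q : {for q, continuous wb} by apply: cM => //; exact: cX.
have wbge q : 0 <= wb q by rewrite mulr_ge0 // exprn_ge0 // ltW.
have [mM _ HM] := @box_max wb p rho (ltW rho0) (fun q _ => cwb q).
pose M := wb mM.
have z1p : z1 != p.
  apply/eqP => e; have [A [d d0 Hd]] := Hflat 1%N; have := Hd p; rewrite subrr normr0 expr1 mulr0 => /(_ d0).
  by rewrite -e leNgt wz1R.
have flat_bound k : wb z1 / dist2 p z1 ^+ k.+1 <= M / (rho ^+ 2) ^+ k.+1.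
  rewrite leNgt; apply/negP => bad.
  pose G q := wb q / dist2 p q ^+ k.+1.
  (* Division by zero gives 0, which is also the limit of [G] at [p] by flatness. *)
  have Gp : G p = 0.
    have e : dist2 p p = 0 by apply/eqP; rewrite dist2_eq0.
    by rewrite /G e expr0n invr0 mulr0.
  have Gge q : 0 <= G q by rewrite divr_ge0 // exprn_ge0 // dist2_ge0.
  have cd q : {for q, continuous (dist2 p)} := (smoothC_cont sD (I : setT q)).1.
  have cG q : {for q, continuous G}.
    have [->|qp] := eqVneq q p; last first.
      apply: cM => //; apply: cvgV; last exact: cX.
      by rewrite expf_neq0 // dist2_eq0.
    (* One power more than the denominator [dist2^(k+1)] absorbs, so that [G] is bounded by a
       multiple of the distance and is continuous at [p]. *)
    have [A [d1 d10 H1]] := Hflat (k.+1 * 2).+1.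
    have [d2 d20 H2] := (plane_ballP _ _).1 (cont_near (cX _ n p (cb p)) (@ltr01 R)).
    pose B := `|A| * (b p ^+ n + 1).
    have B0 : 0 <= B by rewrite mulr_ge0 // addr_ge0 // exprn_ge0 // ltW.
    have Gb q' : `|q' - p| < d1 -> `|q' - p| < d2 -> G q' <= B * `|q' - p|.
      move=> h1 h2; have [->|q'p] := eqVneq q' p; first by rewrite Gp subrr normr0 mulr0.
      have D0 : 0 < dist2 p q' by rewrite lt_neqAle dist2_ge0 andbT eq_sym dist2_eq0.
      rewrite /G ler_pdivrMr ?exprn_gt0 //.
      have w1 : Re (w q') <= `|A| * `|q' - p| * dist2 p q' ^+ k.+1.
        apply: (le_trans (H1 _ h1)); rewrite exprS exprM -!mulrA exprAC.
        have x0 : 0 <= `|q' - p| by [].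
        have y0 : 0 <= `|q' - p| ^+ 2 by rewrite exprn_ge0.
        apply: (@le_trans _ _ (`|A| * (`|q' - p| * (`|q' - p| ^+ 2) ^+ k.+1))).
          by apply: ler_wpM2r; [rewrite mulr_ge0 // exprn_ge0|exact: ler_norm].
        apply: ler_wpM2l => //; apply: ler_wpM2l => //.
        by apply: lerXn2r; rewrite ?nnegrE ?dist2_ge0 //; exact: dist2_ge.
      have b2 : b q' ^+ n <= b p ^+ n + 1.
        by have := H2 _ h2; rewrite ltr_norml => /andP[_ /ltW]; rewrite lerBlDl.
      have bq0 : 0 <= b q' ^+ n by rewrite exprn_ge0 // ltW.
      apply: (le_trans (ler_wpM2r bq0 w1)).
      rewrite /B; move: b2 bq0 (exprn_ge0 k.+1 (dist2_ge0 p q')) (normr_ge0 A) (normr_ge0 (q' - p)).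
      move: (_ ^+ k.+1) (b q' ^+ n) (_ + 1) `|A| `|q' - p| => D y x a r yx y0 D0' a0 r0.
      have -> : a * r * D * y = a * r * D * y by [].
      have -> : a * x * r * D = a * r * D * x by ring.
      by apply: ler_wpM2l => //; rewrite !mulr_ge0.
    apply/cvgrPdist_lt => e e0; apply/plane_ballP.
    exists (Num.min (Num.min d1 d2) (e / (B + 1))).
      by rewrite !lt_min d10 d20 divr_gt0 // ltr_wpDl.
    move=> q'; rewrite !lt_min => /andP[/andP[h1 h2]].
    rewrite ltr_pdivlMr ?ltr_wpDl // => h3; rewrite Gp sub0r normrN ger0_norm //.
    apply: (le_lt_trans (Gb q' h1 h2)); apply: le_lt_trans h3.
    by rewrite mulrC ler_wpM2l // lerDl.
  have [m mrho Hm] := @box_max G p rho (ltW rho0) (fun q _ => cG q).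
  have c0 : 0 <= M / (rho ^+ 2) ^+ k.+1 by apply: divr_ge0; [exact: wbge|apply: exprn_ge0; apply: ltW; exact: exprn_gt0].
  have Gm : M / (rho ^+ 2) ^+ k.+1 < G m by apply: lt_le_trans bad (Hm _ (ltW z1rho)).
  have Gm0 : 0 < G m by exact: le_lt_trans Gm.
  have mp : m != p by apply: contraTneq Gm0 => ->; rewrite Gp ltxx.
  have dm0 : 0 < dist2 p m by rewrite lt_neqAle dist2_ge0 andbT eq_sym dist2_eq0.
  have mint : `|m - p| < rho.
    (* On the boundary of the box the distance is at least [rho], where [G] does not exceed
       [M / rho^(2(k+1))]; a larger maximum is interior. *)
    rewrite lt_neqAle mrho andbT; apply/eqP => e; move: Gm; rewrite ltNge => /negP; apply.
    have r2 : (rho ^+ 2) ^+ k.+1 <= dist2 p m ^+ k.+1.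
      apply: lerXn2r; [by rewrite nnegrE exprn_ge0 // ltW|by rewrite nnegrE dist2_ge0|by rewrite -e; exact: dist2_ge].
    have r20 : 0 < (rho ^+ 2) ^+ k.+1 by rewrite !exprn_gt0.
    apply: ler_pM; [exact: wbge|by rewrite invr_ge0 exprn_ge0 // dist2_ge0|exact: HM|].
    by rewrite lef_pV2 // posrE exprn_gt0.
  pose F (q : plane) : C := w q * (b q)%:C ^+ n * ((dist2 p q)%:C ^+ k.+1)^-1.
  pose V := setT `&` [set q | q != p] : set plane.
  have oV : open V := punctured_open oT.
  have dV q : V q -> (dist2 p q)%:C ^+ k.+1 != 0 :> C.
    by move=> [_ qp]; rewrite expf_neq0 // fmorph_eq0 dist2_eq0.
  have VT : V `<=` setT by [].
  have swV := smoothC_sub VT sw; have sBV := smoothC_sub VT sB; have sDV := smoothC_sub VT sD.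
  have sBn := smoothC_exp n oV sBV; have sDk := smoothC_exp k.+1 oV sDV.
  have siD := smoothC_inv oV dV sDk; have swB := smoothC_mul oV swV sBn.
  have sF : smoothC V F by exact: (smoothC_mul oV swB siD).
  have wE q : w q = (Re (w q))%:C by apply/eqP; rewrite eq_complex w0 /= !eqxx.
  have FE q : F q = (G q)%:C by rewrite /F wE -!rmorphXn -rmorphM -fmorphV -rmorphM.
  have Vm : V m by split.
  have near_m : \forall q \near m, Re (F q) <= Re (F m).
    apply/plane_ballP; exists (rho - `|m - p|); first by rewrite subr_gt0.
    move=> q; rewrite ltrBrDr => qm; rewrite !FE; apply: Hm; apply/ltW; apply: le_lt_trans qm.
    by rewrite -[q - p](subrKA m) ler_normD.
  have FI q : Im (F q) = 0 by rewrite FE.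
  have FRm : 0 <= Re (F m) by rewrite FE; exact: ltW.
  have := lapL_max oV Vm sF (fun q _ => FI q) near_m FRm; apply/negP.
  have LD : lapL (fun q => ((dist2 p q)%:C ^+ k.+1)^-1) m = 0.
    apply: (lapL_inv oV Vm sDk dV); rewrite (lapL_exp _ oV Vm sDV).
    have -> : lapL (fun q => (dist2 p q)%:C) m = 0.
      rewrite -(lapL_r2 (zc p) 0 m); congr lapL; apply/funext => q; by rewrite add0r dist2E.
    by rewrite mulr0.
  have LB : lapL (fun q => (b q)%:C ^+ n) m = n%:R * ((b m)%:C ^+ n') ^+ 2.
    rewrite (lapL_exp _ oV Vm sBV).
    have -> : lapL (fun q => (b q)%:C) m = 1.
      by rewrite -(lapL_r2 (zc (0, 0)) 1 m); congr lapL; apply/funext => q; rewrite bE.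
    by rewrite mulr1.
  have wm0 : w m != 0 by apply: contraTneq Gm0 => e; rewrite /G /wb e mul0r mul0r ltxx.
  have LF : lapL F m = ((dist2 p m ^+ k.+1)^-1 ^+ 2 * Re (w m) ^+ 2 * (b m ^+ n') ^+ 2 * (n%:R - K m * b m ^+ 2))%:C.
    rewrite (lapL_mul oV Vm swB siD) (lapL_mul oV Vm swV sBn) LD LB (HL _ wm0) mulr0 add0r wE.
    rewrite !(rmorphM, rmorphXn, rmorphB, fmorphV, rmorph_nat) /=.
    move: (Re (w m))%:C (b m)%:C ((dist2 p m)%:C ^+ k.+1)^-1 (K m)%:C => x y z t; rewrite /n.
    rewrite ![y ^+ n'.+1]exprS; move: (y ^+ n') n'.+1%:R => u N; ring.
  rewrite LF /= -ltNge; apply: mulr_gt0; last by rewrite subr_gt0; exact: Hn.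
  have wm1 : 0 < Re (w m) by rewrite lt_neqAle wge andbT eq_sym; apply: contraNneq wm0 => e; rewrite wE e.
  by rewrite !mulr_gt0 ?exprn_gt0 ?invr_gt0 ?exprn_gt0.
(* [flat_bound] implies [2^(k+1) wb z1 <= M]; this [k] gives [M < (k + 1) wb z1], and
   [k + 1 < 2^(k+1)]. *)
pose k := Num.truncn (M / wb z1).
have wb0 : 0 < wb z1 by rewrite mulr_gt0 // exprn_gt0.
have kM : M < wb z1 * k.+1%:R by rewrite mulrC -ltr_pdivrMr //; exact: truncnS_gt.
have := flat_bound k; have D0 : 0 < dist2 p z1 by rewrite lt_neqAle dist2_ge0 andbT eq_sym dist2_eq0.
have r20 : 0 < rho ^+ 2 by rewrite exprn_gt0.
rewrite ler_pdivrMr ?exprn_gt0 // mulrAC ler_pdivlMr ?exprn_gt0 // => E.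
have : wb z1 * (2 ^+ k.+1 * dist2 p z1 ^+ k.+1) <= M * dist2 p z1 ^+ k.+1.
  apply: le_trans E; apply: ler_wpM2l; first exact: ltW.
  by rewrite -exprMn; apply: lerXn2r; rewrite ?nnegrE ?mulr_ge0 // ltW.
rewrite mulrA ler_pM2r ?exprn_gt0 // leNgt => /negP[]; apply: (lt_trans kM).
by rewrite ltr_pM2l // -natrX ltr_nat ltn_expl.
Qed.

(** * Order of vanishing in terms of Wirtinger derivatives *)

Fixpoint cvan k f p : Prop :=
  if k is k'.+1 then f p = 0 /\ cvan k' (pz f) p /\ cvan k' (pb f) p else True.

Section Vanishing.
Variables (U : set plane) (p : plane).
Hypothesis (oU : open U) (Up : U p).

Lemma cvan_eq k f g : (forall q, U q -> f q = g q) -> cvan k f p -> cvan k g p.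
Proof.
elim: k f g => [//|k IH] f g fg [f0 [fz fb]]; split; first by rewrite -fg.
by split; [apply: IH fz|apply: IH fb] => q Uq; exact: (pd_eq _ oU Uq fg).
Qed.

Lemma cvanW k f : cvan k.+1 f p -> cvan k f p.
Proof.
by elim: k f => [//|k IH] f [f0 [fz fb]]; split => //; split; exact: IH.
Qed.

Lemma cvan_cst0 k : cvan k (fun=> 0) p.
Proof.
elim: k => [//|k IH]; split=> //.
have E c : pd c (fun=> 0) = fun=> 0 :> C by apply/funext => q; rewrite pd_cst.
by rewrite !E.
Qed.

Lemma cvan_add k f g : smoothC U f -> smoothC U g -> cvan k f p -> cvan k g p -> cvan k (fun q => f q + g q) p.
Proof.
elim: k f g => [//|k IH] f g sf sg [f0 [fz fb]] [g0 [gz gb]]; split; first by rewrite f0 g0 addr0.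
have E c q (Uq : U q) := esym (pd_add c Uq sf sg).
split.
  by apply: (cvan_eq (E (- 'i%C))); exact: (IH _ _ (smoothC_pd _ oU sf) (smoothC_pd _ oU sg) fz gz).
by apply: (cvan_eq (E 'i%C)); exact: (IH _ _ (smoothC_pd _ oU sf) (smoothC_pd _ oU sg) fb gb).
Qed.

Lemma cvan_mul k f g : smoothC U f -> smoothC U g -> cvan k f p -> cvan k (fun q => g q * f q) p.
Proof.
elim: k f g => [//|k IH] f g sf sg vf; have [f0 [fz fb]] := vf; split; first by rewrite f0 mulr0.
have E c q (Uq : U q) := esym (pd_mul c Uq sg sf).
have H c : cvan k (pd c f) p -> cvan k (fun q => pd c g q * f q + g q * pd c f q) p.
  move=> fc; have sfc := smoothC_pd c oU sf; have sgc := smoothC_pd c oU sg.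
  apply: cvan_add; [exact: (smoothC_mul oU sgc sf)|exact: (smoothC_mul oU sg sfc)|apply: IH => //; exact: cvanW|exact: IH].
by split; [exact: (cvan_eq (E (- 'i%C)) (H _ fz))|exact: (cvan_eq (E 'i%C) (H _ fb))].
Qed.

Lemma cvan_sum k (I : Type) (r : seq I) (F : I -> plane -> C) : (forall i, smoothC U (F i)) ->
  (forall i, cvan k (F i) p) -> cvan k (fun q => \sum_(i <- r) F i q) p.
Proof.
move=> sF vF; elim: r => [|x r IH].
  by apply: (cvan_eq _ (cvan_cst0 k)) => q _; rewrite big_nil.
apply: (cvan_eq _ (cvan_add (sF x) (smoothC_sum r oU sF) (vF x) IH)) => q _; by rewrite big_cons.
Qed.

Lemma cvan_vanish k f : smoothC U f -> cvan k f p -> vanish k (fun q => Re (f q)) p /\ vanish k (fun q => Im (f q)) p.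
Proof.
elim: k f => [//|k IH] f sf [f0 [fz fb]].
have sz := smoothC_pd (- 'i%C) oU sf; have sb := smoothC_pd 'i%C oU sf.
have [su sv] := smoothC_Dc oU sf.
have vu : cvan k (Dc eu f) p.
  by apply: (cvan_eq _ (cvan_add sz sb fz fb)) => q _; rewrite pd_Dc_eu.
have sbN := smoothC_mul oU (smoothC_cst (-1) oU) sb.
have vv : cvan k (Dc ev f) p.
  have := cvan_mul (smoothC_add oU sz sbN) (smoothC_cst 'i%C oU) (cvan_add sz sbN fz (cvan_mul sb (smoothC_cst (-1) oU) fb)).
  by apply: cvan_eq => q _; rewrite mulN1r pd_Dc_ev.
have [u1 u2] := IH _ su vu; have [v1 v2] := IH _ sv vv.
by split; (split; first by rewrite f0); split; [exact: u1|exact: v1|exact: u2|exact: v2].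
Qed.

Lemma cvan_bound k f : smoothC U f -> cvan k f p -> exists A : R, exists d : R, [/\ 0 <= A, 0 < d &
  forall q, `|q - p| < d -> `|Re (f q)| <= A * `|q - p| ^+ k /\ `|Im (f q)| <= A * `|q - p| ^+ k].
Proof.
move=> sf vf; have [v1 v2] := cvan_vanish sf vf; have [s1 s2] := sf.
have [A1 [d1 [A10 d10 H1]]] := vanish_bound oU Up (s1 k.+1) v1.
have [A2 [d2 [A20 d20 H2]]] := vanish_bound oU Up (s2 k.+1) v2.
exists (A1 + A2), (Num.min d1 d2); split; [exact: addr_ge0|by rewrite lt_min d10|].
move=> q; rewrite lt_min => /andP[/H1 h1 /H2 h2]; split.
  by apply: (le_trans h1); rewrite ler_wpM2r ?exprn_ge0 // lerDl.
by apply: (le_trans h2); rewrite ler_wpM2r ?exprn_ge0 // lerDr.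
Qed.

(** If the [zbar]-derivative vanishes to order [k], every derivative of order [k] that contains a
    [zbar] is already zero; only the pure [z]-derivative can obstruct the next order. *)
Lemma cvan_step k f : smoothC U f -> cvan k f p -> cvan k (pb f) p -> iter k pz f p = 0 -> cvan k.+1 f p.
Proof.
elim: k f => [|k IH] f sf vf vb it0; first by split.
have [f0 [fz fb]] := vf; split=> //; split; last exact: vb.
apply: IH => //; [exact: (smoothC_pd _ oU sf)| |by rewrite iterSr in it0].
have [_ [vbz _]] := vb.
by apply: (cvan_eq _ vbz) => q Uq; rewrite (pd_comm _ _ oU Uq sf).
Qed.

(** The factorial makes each [z]-derivative the preceding monomial and the [k]-th one equal to 1. *)
Definition zmon k q : C := (zc q - zc p) ^+ k / k`!%:R.

Lemma s_zmon k : smoothC U (zmon k).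
Proof. by apply: (smoothC_mul oU (smoothC_exp _ oU (s_zt _ oU)) (smoothC_cst _ oU)). Qed.

Lemma pd_zmon k q : U q -> pz (zmon k.+1) q = zmon k q /\ pb (zmon k.+1) q = 0.
Proof.
move=> Uq; have [e1 e2] := pd_zt (zc p) q.
have sz := s_zt (zc p) oU.
have P c n : pd c (fun z => (zc z - zc p) ^+ n.+1) q = n.+1%:R * (zc q - zc p) ^+ n * pd c (fun z => zc z - zc p) q.
  elim: n => [|n IH]; first by rewrite expr0 !mul1r.
  rewrite (pd_eq (g := fun z => (zc z - zc p) * (zc z - zc p) ^+ n.+1) _ oU Uq); last by move=> z _; rewrite exprS.
  rewrite (pd_mul _ Uq sz (smoothC_exp _ oU sz)) IH [n.+2%:R]mulrS !exprS.
  by move: (zc q - _) (_ ^+ n) (pd _ _ _) n.+1%:R => x y u v; ring.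
rewrite /zmon !(pd_mul _ Uq (smoothC_exp k.+1 oU sz) (smoothC_cst _ oU)) !pd_cst !P e1 e2.
rewrite !mulr0 mul0r !addr0 mulr1; split => //.
rewrite factS natrM invfM; have n0 : k.+1%:R != 0 :> C by rewrite pnatr_eq0.
by move: n0; move: (_ ^+ k) (_%:R^-1) k.+1%:R => x y u u0; field.
Qed.

Lemma cvan_zmon k : cvan k (zmon k) p.
Proof.
elim: k => [//|k IH]; split; first by rewrite /zmon subrr expr0n mul0r.
split; first by apply: (cvan_eq _ IH) => q /(pd_zmon k)[->].
by apply: (cvan_eq _ (cvan_cst0 k)) => q /(pd_zmon k)[_ ->].
Qed.

Lemma iter_pz_eq k f g : (forall q, U q -> f q = g q) -> forall q, U q -> iter k pz f q = iter k pz g q.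
Proof. by elim: k => [//|k IH] fg q Uq /=; apply: (pd_eq _ oU Uq); exact: IH. Qed.

Lemma iter_pz_zmon k f (c : C) : smoothC U f -> iter k pz (fun q => f q + c * zmon k q) p = iter k pz f p + c.
Proof.
elim: k f => [|k IH] f sf /=; first by rewrite /zmon expr0 invr1 !mulr1.
rewrite -!iterS !iterSr -(IH _ (smoothC_pd _ oU sf)).
apply: (iter_pz_eq _ _ Up) => q Uq; have sc := smoothC_cst c oU; have sz := s_zmon k.+1.
by rewrite (pd_add _ Uq sf (smoothC_mul oU sc sz)) (pd_mul _ Uq sc sz) pd_cst mul0r add0r; have [-> _] := pd_zmon k Uq.
Qed.

(* [f = c (z - p)^k / k! + O(|z - p|^(k+1))] with [c != 0]. *)
Lemma isolated_zero k f : smoothC U f -> cvan k f p -> cvan k (pb f) p -> iter k pz f p != 0 ->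
  exists2 d : R, 0 < d & forall q, q != p -> `|q - p| < d -> f q != 0.
Proof.
move=> sf vf vb c0; set c := iter k pz f p in c0.
have sN := smoothC_cst (- c) oU; have sz := s_zmon k; have sNz := smoothC_mul oU sN sz.
(* Removing the leading term leaves a function that vanishes to order [k + 1] by [cvan_step]. *)
pose g q := f q + - c * zmon k q.
have sg : smoothC U g by exact: (smoothC_add oU sf sNz).
have vg : cvan k.+1 g p.
  apply: cvan_step => //; [exact: (cvan_add sf sNz vf (cvan_mul sz sN (cvan_zmon k)))| |].
    have E q : U q -> pb f q + - c * pb (zmon k) q = pb g q.
      by move=> Uq; rewrite (pd_add _ Uq sf sNz) (pd_mul _ Uq sN sz) pd_cst mul0r add0r.
    apply: (cvan_eq E); have szb := smoothC_pd 'i%C oU sz.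
    apply: (cvan_add (smoothC_pd _ oU sf) (smoothC_mul oU sN szb) vb); apply: cvan_mul => //.
    case: k {vf vb c0 c sN sz sNz g sg E} szb => [//|k] _.
    by apply: (cvan_eq _ (cvan_cst0 _)) => q /(pd_zmon k)[_ ->].
  by rewrite iter_pz_zmon // subrr.
have [A [d [A0 d0 H]]] := cvan_bound sg vg.
pose m : R := Re (c / k`!%:R) ^+ 2 + Im (c / k`!%:R) ^+ 2.
have m0 : 0 < m.
  by rewrite lt_neqAle eq_sym nsq_eq0 addr_ge0 ?sqr_ge0 // andbT mulf_neq0 // invr_eq0 pnatr_eq0 -lt0n fact_gt0.
(* At a zero of [f] at distance [r], the leading term equals the remainder up to sign, so
   [m r^(2k) <= 2 A^2 r^(2k+2)]. For [r < 1] and [r (2 A^2 + 1) < m] this fails. *)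
exists (Num.min d (Num.min 1 (m / (2 * A ^+ 2 + 1)))).
  by rewrite !lt_min d0 ltr01 divr_gt0 // ltr_wpDl // mulr_ge0 // sqr_ge0.
move=> q qp; rewrite !lt_min => /and3P[/H[h1 h2] q1 qm]; apply/eqP => fq.
have gq : g q = - (c / k`!%:R * (zc q - zc p) ^+ k).
  by rewrite /g fq add0r /zmon mulNr; congr (- _); rewrite mulrA mulrAC.
pose N (x : C) : R := Re x ^+ 2 + Im x ^+ 2.
have NM x y : N (x * y) = N x * N y by rewrite /N Re_mul Im_mul; ring.
have NX x n : N (x ^+ n) = N x ^+ n.
  elim: n => [|n IH]; first by rewrite /N /= expr0n expr1n addr0.
  by rewrite exprS NM IH -exprS.
have NN x : N (- x) = N x by rewrite /N Re_opp Im_opp !sqrrN.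
have E : N (g q) = m * dist2 p q ^+ k by rewrite gq NN NM NX.
have r0 : 0 < `|q - p| by rewrite normr_gt0 subr_eq0.
have G : N (g q) <= 2 * (A * `|q - p| ^+ k.+1) ^+ 2.
  have B0 : 0 <= A * `|q - p| ^+ k.+1 by rewrite mulr_ge0 // exprn_ge0.
  have K (x : R) : `|x| <= A * `|q - p| ^+ k.+1 -> x ^+ 2 <= (A * `|q - p| ^+ k.+1) ^+ 2.
    by move=> xy; rewrite -(real_normK (num_real x)) ler_sqr ?nnegrE.
  by rewrite mulr_natl mulr2n; apply: lerD; apply: K.
have D : m * (`|q - p| ^+ 2) ^+ k <= m * dist2 p q ^+ k.
  apply: ler_wpM2l; first exact: ltW.
  by apply: lerXn2r; [by rewrite nnegrE exprn_ge0|by rewrite nnegrE dist2_ge0|exact: dist2_ge].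
rewrite E in G; have := le_trans D G.
have -> : 2 * (A * `|q - p| ^+ k.+1) ^+ 2 = 2 * A ^+ 2 * `|q - p| ^+ 2 * (`|q - p| ^+ 2) ^+ k.
  by rewrite [_ ^+ k.+1]exprS [X in _ = _ * X]exprAC !exprMn !mulrA.
rewrite ler_pM2r ?exprn_gt0 ?exprn_gt0 // leNgt => /negP; apply.
rewrite ltr_pdivlMr in qm; last by rewrite ltr_wpDl // mulr_ge0 // sqr_ge0.
apply: le_lt_trans qm; move: (A ^+ 2) (sqr_ge0 A) q1 r0; move: `|q - p| => r a a0 r1 r0.
have -> : 2 * a * r ^+ 2 = r * (2 * a * r) by ring.
rewrite ler_pM2l //; have : a * r <= a by rewrite ler_piMr // ltW.
by rewrite -mulrA; move: (a * r) => b ba; lra.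
Qed.

End Vanishing.

End MaximumPrinciple.

(** * Zeros of the bivector [kap ^ eta] *)

Section IsolatedZeros.
Variable R : realType.
Local Notation plane := (plane R).
Local Notation C := R[i].
Local Notation dd := (md (- 'i%C)).
Local Notation db := (md 'i%C).
Local Notation pz := (pd (- 'i%C)).
Local Notation pb := (pd 'i%C).
#[local] Opaque lorentz conj_cmx.

Section MatrixVanishing.
Variables (U : set plane) (p : plane).
Hypothesis (oU : open U) (Up : U p).

Definition cvanM k m n (F : plane -> 'M[C]_(m, n)) := forall i j, cvan k (fun q => F q i j) p.

Lemma cvanM_mul k m n l (F : plane -> 'M[C]_(m, n)) (G : plane -> 'M[C]_(n, l)) :
  smoothM U F -> smoothM U G -> cvanM k F \/ cvanM k G -> cvanM k (fun q => F q *m G q).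
Proof.
move=> sF sG H i j; apply: (cvan_eq oU Up (f := fun q => \sum_t F q i t * G q t j)) => [q _|]; first by rewrite mxE.
apply: (cvan_sum oU Up) => t; first exact: (smoothC_mul oU (sF i t) (sG t j)).
case: H => H; last exact: (cvan_mul oU Up (sG t j) (sF i t) (H t j)).
apply: (cvan_eq oU Up (f := fun q => G q t j * F q i t)) => [q _|]; first by rewrite mulrC.
exact: (cvan_mul oU Up (sF i t) (sG t j) (H i t)).
Qed.

Lemma cvanM_tr k m n (F : plane -> 'M[C]_(m, n)) : cvanM k F -> cvanM k (fun q => (F q)^T).
Proof. by move=> H i j; apply: (cvan_eq oU Up _ (H j i)) => q _; rewrite mxE. Qed.

Lemma cvanM_add k m n (F G : plane -> 'M[C]_(m, n)) : smoothM U F -> smoothM U G ->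
  cvanM k F -> cvanM k G -> cvanM k (fun q => F q + G q).
Proof.
move=> sF sG HF HG i j; apply: (cvan_eq oU Up _ (cvan_add oU Up (sF i j) (sG i j) (HF i j) (HG i j))) => q _.
by rewrite mxE.
Qed.

Lemma cvanM_scale k (c : C) m n (F : plane -> 'M[C]_(m, n)) : smoothM U F -> cvanM k F -> cvanM k (fun q => c *: F q).
Proof.
move=> sF HF i j; apply: (cvan_eq oU Up _ (cvan_mul oU Up (sF i j) (smoothC_cst c oU) (HF i j))) => q _.
by rewrite mxE.
Qed.

End MatrixVanishing.

Variables (Y : plane -> 'rV[C]_8).
Hypothesis HY : conformal_lift setT Y.
Hypothesis HW : isotropic_willmore setT Y.
Hypothesis H40 : forall q, hopf4 Y q = 0.
Local Notation L := (lorentz_metric C).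
Local Notation kap := (lift_kap Y).
Local Notation eta := (lift_eta Y).

Let oT : open [set: plane]. Proof. exact: openT. Qed.
Let sS : smoothM setT (wedge Y) := s_wedge HY.
Let cL : smoothM setT (fun=> L). Proof. exact: smoothM_cst. Qed.
Let skb : smoothM setT (fun q => conj_cmx (kap q)). Proof. exact: (smoothM_conj oT (s_kap HY)). Qed.
Let seb : smoothM setT (fun q => conj_cmx (eta q)). Proof. exact: (smoothM_conj oT (s_eta HY)). Qed.

(** By [wedge_db] the [zbar]-derivative is a linear expression in the bivector with smooth
    coefficients, through the contractions [alphav] and [betav]. *)
Lemma wedge_db_vanish p k : cvanM p k (wedge Y) -> cvanM p k (db (wedge Y)).
Proof.
move=> HS.
have HD : cvanM p k (wedge_dbar Y); last first.
  by move=> i j; apply: (cvan_eq oT I _ (HD i j)) => q _; rewrite (wedge_db HY HW).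
have [_ sY _ _] := HY; have sYz := sYz HY.
have sa := s_alphav HY; have sb := s_betav HY.
have Ha : cvanM p k (alphav Y).
  exact: (cvanM_mul oT I (smoothM_mul oT seb cL) sS (or_intror HS)).
have Hb : cvanM p k (betav Y).
  exact: (cvanM_mul oT I (smoothM_mul oT skb cL) sS (or_intror HS)).
have D (u v : plane -> 'rV[C]_8) : smoothM setT u -> smoothM setT v -> cvanM p k v ->
    smoothM setT (fun q => 2 *: ((u q)^T *m v q - (v q)^T *m u q)) /\
    cvanM p k (fun q => 2 *: ((u q)^T *m v q - (v q)^T *m u q)).
  move=> su sv Hv; have su' := smoothM_tr oT su; have sv' := smoothM_tr oT sv.
  have s1 := smoothM_mul oT su' sv; have s2 := smoothM_mul oT sv' su; have s2' := smoothM_opp oT s2.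
  have s3 := smoothM_add oT s1 s2'.
  split; first exact: (smoothM_scale oT (smoothC_cst 2 oT) s3).
  apply: (cvanM_scale oT I 2 s3); apply: (cvanM_add oT I s1 s2').
    exact: (cvanM_mul oT I su' sv (or_intror Hv)).
  have H2 := cvanM_mul oT I sv' su (or_introl (cvanM_tr oT I Hv)).
  by move=> i j; apply: (cvan_eq oT I _ (cvanM_scale oT I (-1) s2 H2 i j)) => q _; rewrite scaleN1r.
have [s1 v1] := D _ _ sY sa Ha; have [s2 v2] := D _ _ sYz sb Hb.
have v2' : cvanM p k (fun q => - (2 *: ((dd Y q)^T *m betav Y q - (betav Y q)^T *m dd Y q))).
  by move=> i j; apply: (cvan_eq oT I _ (cvanM_scale oT I (-1) s2 v2 i j)) => q _; rewrite scaleN1r.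
exact: (cvanM_add oT I s1 (smoothM_opp oT s2) v1 v2').
Qed.

Lemma gramw_vanish p k : cvanM p k (wedge Y) -> cvan k (gramw Y) p.
Proof.
move=> HS.
have s1 := smoothM_mul oT skb cL; have s2 := smoothM_mul oT s1 sS; have s3 := smoothM_mul oT s2 cL.
have v2 := cvanM_mul oT I s1 sS (or_intror HS).
have v3 := cvanM_mul oT I s2 cL (or_introl v2).
have v4 := cvanM_mul oT I s3 (smoothM_tr oT seb) (or_introl v3).
by apply: (cvan_eq oT I _ (v4 0 0)) => q _; rewrite -tst_wedge.
Qed.

Let gramw_real q : complex.Im (gramw Y q) = 0 /\ 0 <= complex.Re (gramw Y q).
Proof. by have := gramw_ge0 HY (I : setT q); rewrite lecE /= => /andP[/eqP -> ->]. Qed.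

(** [w] is a smooth contraction of the bivector and vanishes at least to its order. At a zero of
    infinite order [flat_zero], with [K = 2 <kap, conj kap>], would make [w] vanish on the whole
    plane. *)
Lemma wedge_finite_order p : (exists q, gramw Y q != 0) -> exists k, ~ cvanM p k (wedge Y).
Proof.
move=> [z wz]; apply: contrapT => H; have {}H k : cvanM p k (wedge Y) by apply: contrapT => h; apply: H; exists k.
have sw := s_gramw HY; have sl := smoothC_lorentz oT (s_kap HY) skb.
pose K q : R := 2 * complex.Re (lorentz (kap q) (conj_cmx (kap q))).
have cK q : {for q, continuous K}.
  exact: (cvgM (cvg_cst _) (smoothC_cont sl (I : setT q)).1).
move/eqP: wz; apply; apply: (flat_zero (K := K) (p := p) sw) => //.
- by move=> q; have [] := gramw_real q.
- by move=> q; have [] := gramw_real q.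
- move=> q wq; pose W : set plane := [set q | gramw Y q != 0].
  have oW : open W.
    rewrite openE => q0 wq0; have [cR cI] := smoothC_cont sw (I : setT q0).
    have [i0 _] := gramw_real q0.
    have r0 : 0 < `|complex.Re (gramw Y q0)|.
      by rewrite normr_gt0; apply: contra wq0 => /eqP r0; rewrite eq_complex i0 r0 /= !eqxx.
    apply: filterS (cont_near cR r0) => q1 h; apply/eqP => w1; move: h.
    by rewrite w1 sub0r normrN ltxx.
  have := gramw_loglaplacian HY HW (fun q _ => H40 q) oW (fun _ _ => I) (fun _ h => h) (wq : W q).
  rewrite /lapL /K => ->; congr (_ * _); rewrite rmorphM /= rmorph_nat mulNr; congr (- (2 * _)).
  have : conjc (lorentz (kap q) (conj_cmx (kap q))) = lorentz (kap q) (conj_cmx (kap q)).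
    by rewrite -lorentz_conj conj_cmxK lorentzC.
  case: (lorentz _ _) => a b /eqP; rewrite eq_complex /= eqxx /= => /eqP b0.
  by apply/eqP; rewrite eq_complex /= eqxx; apply/eqP; move: b0; lra.
- move=> k; have [A [d [_ d0 Hb]]] := cvan_bound oT I sw (gramw_vanish (H k)).
  by exists A, d => // q /Hb[h _]; exact: le_trans (ler_norm _) h.
Qed.

(** Some entry of the bivector has the exact order [k] of the whole, and its [zbar]-derivative
    vanishes to order [k], so its zero is isolated. By [wedge_eq0] a zero of [w] would be a zero of
    every entry. *)
Lemma gramw_isolated p : (exists q, gramw Y q != 0) ->
  exists2 d : R, 0 < d & forall q, q != p -> `|q - p| < d -> gramw Y q != 0.
Proof.
move=> /(wedge_finite_order p) Hk.
have [k [Vk Nk]] : exists k, cvanM p k (wedge Y) /\ ~ cvanM p k.+1 (wedge Y).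
  apply: contrapT => H; case: Hk => k; apply; elim: k => [|k IH]; first by [].
  by apply: contrapT => Nk; apply: H; exists k.
have [i [j Nij]] : exists i j, ~ cvan k.+1 (fun q => wedge Y q i j) p.
  apply: contrapT => H; apply: Nk => i j; apply: contrapT => h; apply: H; by exists i, j.
have vb : cvan k (pb (fun q => wedge Y q i j)) p.
  by apply: (cvan_eq oT I _ (wedge_db_vanish Vk i j)) => q _; rewrite mdE.
have it0 : iter k pz (fun q => wedge Y q i j) p != 0.
  by apply/eqP => h; apply: Nij; exact: (cvan_step oT I (sS i j) (Vk i j) vb h).
have [d d0 Hd] := isolated_zero oT I (sS i j) (Vk i j) vb it0.
exists d => // q qp qd; apply/eqP => w0; move/eqP: (Hd q qp qd); apply.
by rewrite (wedge_eq0 HY I w0) mxE.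
Qed.

End IsolatedZeros.

(** * Willmore spheres *)

Section Surface.
Variable R : realType.
Local Notation plane := (plane R).
Local Notation C := R[i].
Local Notation dd := (md (- 'i%C)).
Local Notation db := (md 'i%C).
#[local] Opaque lorentz conj_cmx derive derivable Defs.eu Defs.ev.

Lemma conformal_lift_sub (U W : set plane) Y : open W -> W `<=` U -> conformal_lift U Y -> conformal_lift W Y.
Proof.
move=> oW WU [_ sY rY H]; split=> //; first exact: (smoothM_sub WU).
by move=> p /WU; exact: H.
Qed.

Lemma lift_Y0 (f : plane -> 'rV[R]_7) p : lift_Y f p 0 0 = (expR (- omega f p))%:C.
Proof. by rewrite /lift_Y /real_lift 2!mxE (row_mx_0 1 (f p)) mxE mulr1. Qed.

Lemma lift_Y_cone (f : plane -> 'rV[R]_7) p : lift_Y f p = lift_Y f p 0 0 *: cplx (row_mx (1 : 'rV[R]_1) (f p)).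
Proof. by rewrite lift_Y0; apply/rowP => j; rewrite !mxE rmorphM. Qed.

Lemma lift_Y0_neq0 (f : plane -> 'rV[R]_7) p : lift_Y f p 0 0 != 0.
Proof. by rewrite lift_Y0 fmorph_eq0 gt_eqF // expR_gt0. Qed.

Variable y : 'rV[R]_3 -> 'rV[R]_7.
Hypothesis y_immersion : conformally_immersed_sphere y.
Hypothesis y_willmore : willmore y.
Hypothesis y_isotropic : isotropic_hopf y.
Local Notation YC phi := (lift_Y (y \o phi)).

Lemma chart_conformal U phi : local_coordinate U phi -> conformal_lift U (YC phi).
Proof.
move=> H; have [y1 y2] := y_immersion; have [sf cf] := y2 _ _ H; have [oU _ [u1 _] _ _] := H.
by apply: (conformal_lift_Y oU sf _ cf) => p Up; apply: y1; exact: u1.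
Qed.

Lemma chart_willmore U phi : local_coordinate U phi -> isotropic_willmore U (YC phi).
Proof. by move=> H; exact: (isotropic_willmoreE (chart_conformal H) (y_willmore H) (y_isotropic H)). Qed.

Section Compare.
Variables (eps : R) (U : set plane) (phi : plane -> 'rV[R]_3).
Hypothesis (eps2 : eps * eps = 1) (Hphi : local_coordinate U phi).
Local Notation Ud := (trans_dom eps U phi).
Local Notation g := (trans_u eps phi).
Local Notation h := (trans_v eps phi).
Local Notation Y1 := (YC (stereo eps)).

Let oUd : open Ud := trans_dom_open Hphi.
Let sg : smooth_on Ud g := trans_u_smooth eps Hphi.
Let sh : smooth_on Ud h := trans_v_smooth eps Hphi.
Let HY1 := chart_conformal (stereo_local_coordinate eps2).
Let HY2 : conformal_lift Ud (YC phi) := conformal_lift_sub oUd (@trans_dom_sub _ eps U phi) (chart_conformal Hphi).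
Let T_in q : Ud q -> [set: plane] (g q, h q). Proof. by []. Qed.
Let hol q : Ud q -> pd 'i%C (fun q => g q +i* h q) q = 0. Proof. exact: (trans_holomorphic eps2 Hphi). Qed.

(** Both lifts are multiples of [(1, y)], so the ratio of their time coordinates is the factor
    between them. *)
Let mu (q : plane) : C := YC phi q 0 0 / Y1 (g q, h q) 0 0.

Let smu : smoothC Ud mu.
Proof.
have [_ s2 _ _] := HY2; have [_ s1 _ _] := HY1.
have sc := smoothC_comp openT oUd sg sh T_in (s1 0 0).
by apply: (smoothC_mul oUd (s2 0 0)); apply: (smoothC_inv oUd _ sc) => q _; exact: lift_Y0_neq0.
Qed.

Let Y2E q : Ud q -> YC phi q = mu q *: Y1 (g q, h q).
Proof.
move=> Uq; rewrite [LHS]lift_Y_cone [X in _ = _ *: X]lift_Y_cone /mu scalerA divfK ?lift_Y0_neq0 //=.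
by rewrite -(stereo_trans eps2 Hphi Uq).
Qed.

Lemma compare_hopf4 q : Ud q -> hopf4 (YC phi) q = holder g h q ^+ 4 * hopf4 Y1 (g q, h q).
Proof.
exact: (hopf4_comp openT oUd sg sh T_in hol HY1 HY2 smu Y2E (chart_willmore (stereo_local_coordinate eps2))).
Qed.

Lemma compare_gramw q : Ud q -> gramw Y1 (g q, h q) != 0 <-> gramw (YC phi) q != 0.
Proof. exact: (gramw_comp openT oUd sg sh T_in hol HY1 HY2 smu Y2E). Qed.

End Compare.

Local Notation o2 := (lift ord0 (lift ord0 ord0) : 'I_3).

(** A point of the sphere is different from at least one of the two poles. *)
Lemma trans_cover U (phi : plane -> 'rV[R]_3) q : U q -> exists2 eps, eps * eps = 1 & trans_dom eps U phi q.
Proof.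
move=> Uq; have [h|h] := ltP 0 (1 + phi q 0 o2).
  by exists 1; rewrite ?mul1r //; split=> //=; rewrite /trans_den mul1r.
by exists (-1); rewrite ?mulrNN ?mul1r //; split=> //=; rewrite /trans_den mulN1r; lra.
Qed.

Let N (x : C) : R := complex.Re x ^+ 2 + complex.Im x ^+ 2.
Let NM x z : N (x * z) = N x * N z. Proof. by rewrite /N Re_mul Im_mul; ring. Qed.
Let NX x n : N (x ^+ n) = N x ^+ n.
Proof.
elim: n => [|n IH]; first by rewrite /N /= expr0n expr1n addr0.
by rewrite exprS NM IH -exprS.
Qed.
Let NC x : x * conjc x = (N x)%:C.
Proof. by case: x => a b; apply/eqP; rewrite eq_complex /N /=; apply/andP; split; apply/eqP; ring. Qed.
Let Nge x : 0 <= N x. Proof. by rewrite addr_ge0 ?sqr_ge0. Qed.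

Lemma smulE (q : plane) : smul q = (1 + dist2 (0, 0) q)^-1.
Proof. by rewrite /smul /dist2 !subr0 addrA !expr2. Qed.

Lemma trans_den_stereo (eps : R) q : eps * eps = 1 -> trans_den (- eps) (stereo eps) q = 2 * (1 - smul q).
Proof.
move=> e2; rewrite /trans_den; have [_ _ ->] := row3E (2 * q.1 * smul q) (eps * (2 * q.2 * smul q)) (eps * (2 * smul q - 1)).
by rewrite mulNr mulrA e2 mul1r; ring.
Qed.

(** * Vanishing of the quartic differential on the sphere *)

Section FarAway.
Variable eps : R.
Hypothesis e2 : eps * eps = 1.
Let ne2 : - eps * - eps = 1. Proof. by rewrite mulrNN. Qed.
Let HA := stereo_local_coordinate e2.

Lemma trans_stereo_dom q : q != (0, 0) -> trans_dom (- eps) setT (stereo eps) q.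
Proof.
move=> q0; split=> //=; rewrite trans_den_stereo // mulr_gt0 // subr_gt0 smulE invf_lt1.
  by rewrite ltrDl lt_neqAle dist2_ge0 andbT eq_sym dist2_eq0.
by rewrite ltr_pwDl // dist2_ge0.
Qed.

(* The Jacobian of the change of chart [z |-> 1 / z] decays like [|z|^-2]. *)
Lemma trans_stereo_far q : 1 <= dist2 (0, 0) q ->
  [/\ trans_dom (- eps) setT (stereo eps) q,
   `|(trans_u (- eps) (stereo eps) q, trans_v (- eps) (stereo eps) q) - (0, 0)| <= 1 &
   N (holder (trans_u (- eps) (stereo eps)) (trans_v (- eps) (stereo eps)) q) <= (2 * smul q) ^+ 2].
Proof.
move=> q1; have Uq : trans_dom (- eps) setT (stereo eps) q.
  apply: trans_stereo_dom; apply: contraTneq q1 => ->.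
  by rewrite -ltNge /dist2 subrr expr0n addr0.
have m0 := smul_gt0 q; have m1 : smul q <= 2^-1.
  by rewrite smulE lef_pV2 ?posrE // ?ltr_pwDl // ?dist2_ge0 //; lra.
have := smul_trans ne2 HA Uq; rewrite trans_den_stereo //.
set T := (_, _) => mT.
have dT : dist2 (0, 0) T <= 1.
  have : 1 + dist2 (0, 0) T = (1 - smul q)^-1.
    by rewrite -[LHS]invrK -smulE mT; congr (_^-1); field.
  move=> e; have : (1 - smul q)^-1 <= 2.
    by rewrite -[X in _ <= X]invrK lef_pV2 ?posrE ?invr_gt0 //; lra.
  by rewrite -e; lra.
split=> //.
  have := le_trans (dist2_ge (0, 0) T) dT; rewrite -[X in _ <= X](expr1n _ 2) ler_sqr ?nnegrE //.
have [c1 c2 _ _] := cauchy_riemann (trans_holomorphic ne2 HA) Uq.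
have [_ _ c3] := trans_cr ne2 HA Uq; have [_ c4 _ _] := stereo_conformal e2 q.
have c5 := etrans (esym c4) c3; rewrite trans_den_stereo // c1 c2 in c5.
have := Nge (holder (trans_u (- eps) (stereo eps)) (trans_v (- eps) (stereo eps)) q).
move: c5; rewrite -/(N _); move: (N _) (smul q) m0 m1 => n m m0 m1 c5 n0.
have : 1 <= (2 * (1 - m)) ^+ 2 by rewrite -[X in X <= _](expr1n _ 2) ler_sqr ?nnegrE; lra.
have -> : (2 * m) ^+ 2 = 4 * m * m by ring.
rewrite c5 => h; by rewrite -[X in X <= _]mul1r ler_wpM2r.
Qed.

(** Far out [hA = t^4 hB], with [hB] bounded near the other pole, and [|t|] decays like [|z|^-2], so
    [Q = |hA|^2 (1 + |z|^2)] tends to 0 and has a maximum if it is not zero. Since [lapL] kills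
    [|hA|^2] and is 1 on the weight, [lapL Q] equals [|hA|^4 > 0] there. *)
Lemma hopf4_stereo q : hopf4 (YC (stereo eps)) q = 0.
Proof.
have HYA := chart_conformal HA; have HWA := chart_willmore HA.
have HB := stereo_local_coordinate ne2; have HYB := chart_conformal HB.
pose hA := hopf4 (YC (stereo eps)); pose hB := hopf4 (YC (stereo (- eps))).
have sA : smoothC setT hA := s_hopf4 HYA; have sB : smoothC setT hB := s_hopf4 HYB.
have oT := @openT plane.
have cN (k : plane -> C) p : smoothC setT k -> {for p, continuous (fun p => N (k p))}.
  move=> sk; have [c1 c2] := smoothC_cont sk (I : setT p).
  exact: (cvgD (cvgM c1 c1) (cvgM c2 c2)).
have [mB _ HmB] := @box_max _ (fun p => N (hB p)) (0, 0) 1 ler01 (fun p _ => cN _ p sB).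
pose B := N (hB mB).
apply/eqP; apply: contraT => hq; pose b (p : plane) : R := 1 + dist2 (0, 0) p.
have b0 p : 0 < b p by rewrite ltr_pwDl // dist2_ge0.
have bE p : (b p)%:C = 1 + (zc p - zc (0, 0)) * conjc (zc p - zc (0, 0)) by rewrite dist2E rmorphD rmorph1.
pose Q p := N (hA p) * b p.
have Qq : 0 < Q q by rewrite mulr_gt0 // lt_neqAle Nge andbT eq_sym nsq_eq0.
have sz := s_zt (zc (0, 0)) oT.
have sb : smoothC setT (fun p => (b p)%:C).
  apply: (smoothC_eq oT (fun p _ => esym (bE p))).
  exact: (smoothC_add oT (smoothC_cst 1 oT) (smoothC_mul oT sz (smoothC_conj oT sz))).
have cQ p : {for p, continuous Q} by exact: (cvgM (cN _ p sA) (smoothC_cont sb (I : setT p)).1).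
have Bge : 0 <= B by exact: Nge.
(* Beyond this radius [Q] is at most [256 B smul], where [256 = (2^2)^4] comes from the bound on
   [|t|^2] raised to the fourth power. As [1 / smul] exceeds [rho^2 >= rho], the value is below
   [Q q]. *)
pose rho := 1 + `|q| + 256 * B / Q q.
have e0 : 0 <= 256 * B / Q q by apply: divr_ge0; [apply: mulr_ge0; [exact: ler0n|exact: Bge]|exact: ltW].
have n0 : 0 <= `|q| by [].
have rho1 : 1 <= rho by rewrite /rho; lra.
have rho0 : 0 <= rho by lra.
have [m _ Hm] := @box_max _ Q (0, 0) rho rho0 (fun p _ => cQ p).
have qrho : `|q - (0, 0)| <= rho by rewrite (_ : q - (0, 0) = q); [rewrite /rho; lra|exact: subr0].
have far p : rho < `|p - (0, 0)| -> Q p < Q q.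
  move=> pr; have d1 : rho ^+ 2 <= dist2 (0, 0) p.
    apply: le_trans (dist2_ge _ _); rewrite ler_sqr ?nnegrE //; exact: ltW.
  have r2 : rho <= rho ^+ 2 by rewrite expr2 ler_peMl.
  have [Up T1 tN] := trans_stereo_far (le_trans rho1 (le_trans r2 d1)).
  have m0 := smul_gt0 p; have bm : b p = (smul p)^-1 by rewrite smulE invrK.
  have QB : Q p <= ((2 * smul p) ^+ 2) ^+ 4 * B * b p.
    rewrite ler_wpM2r ?(ltW (b0 _)) // /hA (compare_hopf4 ne2 HA Up) NM NX.
    apply: ler_pM; [exact: (exprn_ge0 4 (Nge _))|exact: Nge|apply: lerXn2r; [exact: Nge|exact: sqr_ge0|exact: tN]|exact: (HmB _ T1)].
  have m1 : smul p <= 1 by rewrite smulE invf_le1 ?b0 // lerDl dist2_ge0.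
  apply: (le_lt_trans QB).
  have -> : ((2 * smul p) ^+ 2) ^+ 4 * B * b p = 256 * B * smul p * smul p ^+ 6.
    rewrite bm; by field; rewrite gt_eqF.
  apply: (@le_lt_trans _ _ (256 * B * smul p)).
    apply: ler_piMr; [exact: (mulr_ge0 (mulr_ge0 (ler0n _ _) Bge) (ltW m0))|exact: (exprn_ile1 6 (ltW m0) m1)].
  rewrite smulE -/(b p) ltr_pdivrMr // -ltr_pdivrMl // [_^-1 * _]mulrC.
  have h : 256 * B / Q q <= rho by rewrite /rho; lra.
  apply: (le_lt_trans h); apply: (le_lt_trans r2); apply: (le_lt_trans d1).
  by rewrite /b ltrDr.
have Hmax p : Q p <= Q m.
  have [h|h] := leP `|p - (0, 0)| rho; first exact: Hm.
  by apply: le_trans (ltW (far p h)) (Hm _ qrho).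
have Qm : 0 < Q m := lt_le_trans Qq (Hmax q).
pose F p : C := hA p * conjc (hA p) * (b p)%:C.
have FE p : F p = (Q p)%:C by rewrite /F NC -rmorphM.
have sAA := smoothC_mul oT sA (smoothC_conj oT sA).
have sF : smoothC setT F := smoothC_mul oT sAA sb.
have FI p : complex.Im (F p) = 0 by rewrite FE.
have nm : \forall p \near m, complex.Re (F p) <= complex.Re (F m).
  by apply/plane_ballP; exists 1 => // p _; rewrite !FE; exact: Hmax.
have Fm : 0 <= complex.Re (F m) by rewrite FE; exact: ltW.
have le0 := lapL_max oT I sF (fun p _ => FI p) nm Fm.
suff : 0 < complex.Re (lapL F m) by rewrite ltNge le0.
rewrite (lapL_mul oT I sAA sb) (lapL_hol oT I sA (fun p _ => hopf4_holomorphic HYA HWA I)) mulr0 addr0 NC.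
have -> : lapL (fun p => (b p)%:C) m = 1.
  by rewrite -(lapL_r2 (zc (0, 0)) 1 m); congr lapL; apply/funext => p; rewrite bE.
have Nm : 0 < N (hA m).
  by rewrite lt_neqAle Nge andbT eq_sym; apply: contraTneq Qm => e; rewrite /Q e mul0r ltxx.
by rewrite mulr1 -rmorphXn; exact: (exprn_gt0 2 Nm).
Qed.

End FarAway.

Lemma hopf4_0 U phi q : local_coordinate U phi -> U q -> hopf4 (YC phi) q = 0.
Proof.
move=> H Uq; have [eps e2 Ud] := trans_cover phi Uq.
by rewrite (compare_hopf4 e2 H Ud) hopf4_stereo // mulr0.
Qed.

Hypothesis y_not_s_willmore : ~ s_willmore y.

(** A failure of the S-Willmore condition occurs in some chart and is visible in one of the two
    stereographic charts; the remaining task is to reach the other one. *)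
Lemma gramw_neq0 (eps : R) : eps * eps = 1 -> exists q, gramw (YC (stereo eps)) q != 0.
Proof.
move=> e2.
have [U [phi [q [H [Uq wq]]]]] : exists U phi q, local_coordinate U phi /\ U q /\ gramw (YC phi) q != 0.
  apply: contrapT => Hn; apply: y_not_s_willmore; split=> // U phi H q Uq; apply/negP => fr.
  by apply: Hn; exists U, phi, q; split=> //; split=> //; exact: (row_free_gramw (chart_conformal H) Uq fr).
have [eps' e2' Ud] := trans_cover phi Uq.
have wT := (compare_gramw e2' H Ud).2 wq.
set P := (_, _) in wT.
have [<-|ne] := eqVneq eps' eps; first by exists P.
have en : eps = - eps'.
  have : (eps - eps') * (eps + eps') = 0 by rewrite mulrDl !mulrDr mulNr e2 mulNr e2'; ring.
  move=> /eqP; rewrite mulf_eq0 subr_eq0 [eps == _]eq_sym (negbTE ne) /= addr_eq0 => /eqP; exact: id.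
have H' := stereo_local_coordinate e2'.
(* The point found may be the origin, which is the pole missing from the other chart. Isolated zeros
   give a nearby point of the overlap with [w] nonzero. *)
have [d d0 Hd] := gramw_isolated (chart_conformal H') (chart_willmore H') (hopf4_stereo e2') (0, 0) (ex_intro _ P wT).
pose q1 := (d / 2) *: (eu R) : plane.
have nq1 : `|q1| = d / 2 by rewrite normZ_eu gtr0_norm // divr_gt0.
have q10 : q1 != (0, 0) by rewrite -normr_eq0 nq1 gt_eqF // divr_gt0.
have q1d : `|q1 - (0, 0)| < d by rewrite (_ : q1 - (0, 0) = q1); [rewrite nq1; lra|exact: subr0].
have w1 := Hd q1 q10 q1d; have Uq1 := trans_stereo_dom e2' q10; rewrite -en in Uq1.
by exists (trans_u eps (stereo eps') q1, trans_v eps (stereo eps') q1); exact: (compare_gramw e2 H' Uq1).2.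
Qed.

(** Near [p] the determinant [w] can vanish only at [p]: this is known in the stereographic chart,
    which is a whole plane, and the transition map carries it to the given chart. *)
Lemma local_plane_field U phi p : local_coordinate U phi -> U p ->
  exists V P, V p /\ plane_field U (YC phi) V P.
Proof.
move=> H Up; have [eps e2 Udp] := trans_cover phi Up.
have HA := stereo_local_coordinate e2.
pose T q := (trans_u eps phi q, trans_v eps phi q) : plane.
have [d d0 Hd] := gramw_isolated (chart_conformal HA) (chart_willmore HA) (hopf4_stereo e2) (T p) (gramw_neq0 e2).
pose V := trans_dom eps U phi `&` [set q | `|T q - T p| < d] : set plane.
have oV : open V.
  rewrite openE => q [Uq Tq]; apply: filterI; first exact: (open_nbhs_nbhs (conj (trans_dom_open H) Uq)).
  have e0 : 0 < d - `|T q - T p| by rewrite subr_gt0.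
  have cu := Ck_on_cont (trans_u_smooth eps H 0%N) Uq; have cv := Ck_on_cont (trans_v_smooth eps H 0%N) Uq.
  apply: filterS (filterI (cont_near cu e0) (cont_near cv e0)) => z [z1 z2].
  have zq : `|T z - T q| < d - `|T q - T p| by rewrite plane_normE gt_max; apply/andP; split.
  rewrite /= -[T z - T p](subrKA (T q)); apply: (le_lt_trans (ler_normD _ _)).
  by rewrite -ltrBrDr.
have VU : V `<=` U by move=> q [/trans_dom_sub].
have Vp : V p by split=> //=; rewrite subrr normr0.
(* Injectivity of the coordinate ensures that [T q] is different from [T p]. *)
have Hw q : V q -> q != p -> gramw (YC phi) q != 0.
  move=> [Uq Tq] qp; apply: (compare_gramw e2 H Uq).1; apply: (Hd (T q) _ Tq).
  apply: contra qp => /eqP TT; apply/eqP; have [_ _ [_ inj] _ _] := H.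
  apply: inj; [exact: trans_dom_sub Uq|exact: Up|].
  exact: (etrans (stereo_trans e2 H Uq) (etrans (congr1 (stereo eps) TT) (esym (stereo_trans e2 H Udp)))).
have [P pf] := planeP_field (chart_conformal H) (chart_willmore H) oV VU Vp (fun q Uq => hopf4_0 H Uq) Hw.
by exists V, P.
Qed.

Lemma surface_totally_isotropic : totally_isotropic y.
Proof.
move=> U phi H m n p m0 n0 Up; have [V [P [Vp pf]]] := local_plane_field H Up.
exact: (totally_isotropic_field (chart_conformal H) pf m0 n0 Vp).
Qed.

Lemma surface_isotropic_frames : has_local_isotropic_frames y.
Proof.
move=> U phi H p Up; have [V [P [Vp pf]]] := local_plane_field H Up.
have [W [E [oW Wp WV fr]]] := isotropic_frame (chart_conformal H) pf Vp.
exists W, E; split=> //; exact: (subset_trans WV (pf_sub pf)).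
Qed.

(* [v] is orthogonal to [Y], [Y_z], its conjugate, [N], [kap], [eta] and their conjugates, a frame of [C^8]. *)
Lemma constant_normal Y (v : 'rV[C]_8) p : conformal_lift setT Y -> isotropic_willmore setT Y ->
  gramw Y p != 0 -> conj_cmx v = v -> (forall q, lorentz (Y q) v = 0) -> v = 0.
Proof.
move=> HY HW w0 vr Yv; have [_ sY _ _] := HY; have oT := @openT plane.
have K c (F : plane -> 'rV[C]_8) : smoothM setT F -> (forall q, lorentz (F q) v = 0) -> forall q, lorentz (md c F q) v = 0.
  move=> sF Fv q; rewrite (pd_lorentz_cst oT c I sF (smoothM_cst v oT) (fun q _ => Fv q)) md_cst lorentz0r oppr0; reflexivity.
have vz := K (- 'i%C) Y sY Yv; have vb := K 'i%C Y sY Yv.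
have vW := K 'i%C _ (sYz HY) vz; have vzz := K (- 'i%C) _ (sYz HY) vz.
have vk q : lorentz (lift_kap Y q) v = 0.
  by rewrite kapE lorentzDl lorentzZl vzz Yv mulr0 addr0.
have pv q : perp Y q v.
  split; rewrite lorentzC; [exact: Yv|exact: vz|exact: vb|by rewrite YzbE; exact: vW].
have vkb := K 'i%C _ (s_kap HY) vk.
have ve q : lorentz (lift_eta Y q) v = 0.
  by rewrite etaE lorentzC (lorentz_nproj _ (pv q)) lorentzC vkb.
have [h1 h2 h3 h4] := (perpP _ _ _).1 (pv p).
apply: (nondegenerate8 (null_frame_free HY HW (I : setT p) w0)) => i.
case: i => [[|[|[|[|[|[|[|[|//]]]]]]]] ilt]; rewrite /null_frame /=.
- exact: h1.
- exact: h2.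
- exact: h3.
- exact: h4.
- by rewrite lorentzC vk.
- by rewrite lorentzC ve.
- by rewrite lorentz_conjr vr lorentzC vk conjc0.
- by rewrite lorentz_conjr vr lorentzC ve conjc0.
Qed.

Lemma surface_full : full y.
Proof.
move=> [k [c [r [W [k7 r0 WW _ Hy]]]]].
(* A subsphere with fewer than 7 spanning directions lies in a hyperplane [<a, x> = b]; [a] is a
   vector orthogonal to the rows of [W]. *)
have [a a0 aW] : exists2 a : 'rV[R]_7, a != 0 & a *m W^T = 0.
  have : kermx W^T != 0.
    rewrite -mxrank_eq0 mxrank_ker mxrank_tr -lt0n subn_gt0.
    exact: leq_ltn_trans (rank_leq_row W) k7.
  by move=> /rowV0Pn[a /sub_kermxP aW a0]; exists a.
pose b : R := dot a c.
have ay x : unit_sphere x -> dot a (y x) = b.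
  move=> /Hy[v _ <-]; rewrite /b /dot linearD linearZ /= trmx_mul mulmxDr -scalemxAr mulmxA aW mul0mx scaler0 addr0.
  reflexivity.
have e2 : (1 : R) * 1 = 1 by rewrite mul1r.
have H := stereo_local_coordinate e2; have [p wp] := gramw_neq0 e2.
(* The Lorentzian product of [(1, y)] with [(b, a)] is [- b + <a, y>], so the hyperplane becomes a
   constant vector orthogonal to the lift. *)
pose v : 'rV[C]_8 := cplx (row_mx b%:M a).
have v0 : v = 0.
  apply: (constant_normal (chart_conformal H) (chart_willmore H) wp); first exact: conj_cplx.
  move=> q; rewrite lift_Y_cone lorentzZl lorentz_cplx !mxE !eqxx mul1r mulr1n.
  have -> : dot ((y \o stereo 1) q) a = b.
    rewrite -(ay (stereo 1 q)); last exact: (stereo_unit e2).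
    by rewrite /dot !mxE; apply: eq_bigr => j _; rewrite !mxE mulrC.
  by rewrite addNr mulr0.
move/eqP: a0; apply; apply/rowP => j.
have /rowP/(_ (rshift 1 j)) := v0; rewrite mxE (row_mxEr b%:M a) !mxE => /(congr1 (@complex.Re R)); exact: id.
Qed.

End Surface.

Theorem theorem2p1 (R : realType) (y : 'rV[R]_3 -> 'rV[R]_7)
    (y_immersion : conformally_immersed_sphere y)
    (y_willmore : willmore y)
    (y_isotropic : isotropic_hopf y)
    (y_not_s_willmore : ~ s_willmore y) :
  totally_isotropic y /\ full y /\ has_local_isotropic_frames y.
Proof.
split; first exact: surface_totally_isotropic.
by split; [exact: surface_full|exact: surface_isotropic_frames].
Qed.
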